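(* Let $\Lambda=\bigwedge_\infty$. (1) The sets $$\overline{S^2K}(1)|_0=\{(\mathbf 0,(a_0^+,a_0^-,A^+,A^-,M^+,M^-))\},\qquad \overline{S^2K}(1)|_\infty=\{((A^+,A^-,M^+,M^-),(1,1,\mathbf 0))\}$$ (subsets of $\overline{S^2K}(1)$) are groups under the sewing operation ${}_1\infty_0$. The group $\overline{S^2K}(1)|_0$ is isomorphic to the group $((\Lambda^0)^\times)^2/\langle\pm1\rangle\times(\Lambda^\infty)^2$ with operation $\circ$; the subset $\{(\mathbf 0,(1,1,A^+,A^-,M^+,M^-))\}$ is a subgroup isomorphic to the subgroup $(\Lambda^\infty)^2$ under $\circ$. The group $\overline{S^2K}(1)|_\infty$ is isomorphic to $(\Lambda^\infty)^2$ with operation $\circ_\infty$. In addition, under these isomorphisms, there are subgroups of $\{(\mathbf 0,(1,1,A^+,A^-,M^+,M^-))\}$ and of $\overline{S^2K}(1)|_\infty$ corresponding to the following subgroups of $((\Lambda^\infty)^2,\circ)$ and of $((\Lambda^\infty)^2,\circ_\infty)$, with $A^\pm$ ranging over all sequences in $\Lambda^0$ and $M^\pm$ over all sequences in $\Lambda^1$: the sets of all $(A^+,\mathbf0,\mathbf0,\mathbf0)$; $(\mathbf0,A^-,\mathbf0,\mathbf0)$; $(A^+,A^-,\mathbf0,\mathbf0)$; $(\mathbf0,\mathbf0,M^+,\mathbf0)$; $(\mathbf0,\mathbf0,\mathbf0,M^-)$; $(A^+,\mathbf0,M^+,\mathbf0)$; $(A^+,\mathbf0,\mathbf0,M^-)$;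 $(\mathbf0,A^-,M^+,\mathbf0)$; $(\mathbf0,A^-,\mathbf0,M^-)$; $(A^+,A^-,M^+,\mathbf0)$; $(A^+,A^-,\mathbf0,M^-)$. (2) The subset $S^2K(1)|_0=((\Lambda^0)^\times)^2/\langle\pm1\rangle\times\mathcal H$ is a subgroup of $\overline{S^2K}(1)|_0=((\Lambda^0)^\times)^2/\langle\pm1\rangle\times(\Lambda^\infty)^2$, isomorphic to the group of local $N=2$ superconformal transformations vanishing at $0$. The subset $S^2K(1)|_\infty=\mathcal H$ is a subgroup of $\overline{S^2K}(1)|_\infty=(\Lambda^\infty)^2$, isomorphic to the group of local $N=2$ superconformal transformations vanishing at $\infty$. (3) If $(A^+,A^-,M^+,M^-)\in(\Lambda^\infty)^2$, $a_0^\pm\in(\Lambda^0)^\times$ and $t\in\Lambda^0$, then $t\mapsto(\mathbf0,((a_0^+)^t,1,\mathbf0))$, $t\mapsto(\mathbf0,(1,(a_0^-)^t,\mathbf0))$ and $t\mapsto(\mathbf0,(1,1,t(A^+,A^-,M^+,M^-)))$ give homomorphisms from the additive group $\Lambda^0$ to $\overline{S^2K}(1)|_0$, and $t\mapsto(t(A^+,A^-,M^+,M^-),(1,1,\mathbf0))$ gives a homomorphism from $\Lambda^0$ to $\overline{S^2K}(1)|_\infty$. (4) Let $t_1,t_2\in\Lambda^0$ and $\mathbf A=(A^+,A^-,M^+,M^-)\in(\Lambda^\infty)^2$ with $t_1\mathbf A,t_2\mathbf A\in\mathcal H$. Then $(t_1+t_2)\mathbf A\in\mathcal H$ and $$(\mathbf0,(1,1,(t_1+t_2)\mathbf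 A))=(\mathbf0,(1,1,t_1\mathbf A))\;{}_1\infty_0\;(\mathbf0,(1,1,t_2\mathbf A)),$$ $$((t_1+t_2)\mathbf A,(1,1,\mathbf0))=(t_1\mathbf A,(1,1,\mathbf0))\;{}_1\infty_0\;(t_2\mathbf A,(1,1,\mathbf0)).$$ In particular, for $\mathbf A\in\mathcal H$, the sets $\{(\mathbf0,(1,1,t\mathbf A)) : t\in\Lambda^0,\ t\mathbf A\in\mathcal H\}$ and $\{(t\mathbf A,(1,1,\mathbf0)) : t\in\Lambda^0,\ t\mathbf A\in\mathcal H\}$ are subgroups of $S^2K(1)|_0$ and $S^2K(1)|_\infty$, respectively.
   Context: $\Lambda=\bigwedge_\infty$ is the Grassmann algebra over $\mathbb C$ on generators $\zeta_1,\zeta_2,\dots$, with even and odd parts $\Lambda^0,\Lambda^1$; $a=a_B+a_S$ is the decomposition into body $a_B\in\mathbb C$ and soul; $(\Lambda^0)^\times=\{a\in\Lambda^0:a_B\ne0\}$. $(\Lambda^\infty)^2$ is the set of $(A^+,A^-,M^+,M^-)$ with $A^\pm=\{A^\pm_j\}_{j\in\mathbb Z_+}$ sequences in $\Lambda^0$ and $M^\pm=\{M^\pm_{j-1/2}\}_{j\in\mathbb Z_+}$ sequences in $\Lambda^1$; $t(A^+,A^-,M^+,M^-)$ multiplies every entry by $t$; $\mathbf0$ denotes zero sequences. In $((\Lambda^0)^\times)^2/\langle\pm1\rangle$ one identifies $(a,b)$ with $(-a,-b)$. Powers: $(a_0^\pm)^t=\exp(t\log a_0^\pm)$ for a choice of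 $\log a_0^\pm$. With $x$ even and $\varphi^\pm$ odd formal variables, for $j\in\mathbb Z$ put $L_j=-\bigl(x^{j+1}\frac{\partial}{\partial x}+\frac{j+1}2x^j(\varphi^+\frac{\partial}{\partial\varphi^+}+\varphi^-\frac{\partial}{\partial\varphi^-})\bigr)$, $J_j=-x^j(\varphi^+\frac{\partial}{\partial\varphi^+}-\varphi^-\frac{\partial}{\partial\varphi^-})$, $G^\pm_{j-\frac12}=-\bigl(x^j(\frac{\partial}{\partial\varphi^\pm}-\varphi^\mp\frac{\partial}{\partial x})\pm jx^{j-1}\varphi^+\varphi^-\frac{\partial}{\partial\varphi^\pm}\bigr)$. Let $\tilde E(A^+,A^-,M^+,M^-)=\exp\bigl(-\sum_{j\ge1}(A_j^+L_j+A_j^-J_j+M^+_{j-\frac12}G^+_{j-\frac12}+M^-_{j-\frac12}G^-_{j-\frac12})\bigr)\cdot(x,\varphi^+,\varphi^-)=:(\tilde x,\tilde\varphi^+,\tilde\varphi^-)$ and $\hat E(a_0^+,a_0^-,A^+,A^-,M^+,M^-)=((a_0^+)^2\tilde x,a_0^+a_0^-\tilde\varphi^+,a_0^+(a_0^-)^{-1}\tilde\varphi^-)$. A triple $(\tilde x,\tilde\varphi^+,\tilde\varphi^-)$ ($\tilde x$ even, $\tilde\varphi^\pm$ odd) is $N=2$ superconformal if, with $D^\pm=\frac{\partial}{\partial\varphi^\pm}+\varphi^\mp\frac{\partial}{\partial x}$, one has $D^+\tilde\varphi^-=D^-\tilde\varphi^+=0$, $D^\pm\tilde x=\tilde\varphi^\mp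 D^\pm\tilde\varphi^\pm$ and $D^\pm\tilde\varphi^\pm\not\equiv0$. $\hat E$ is a bijection from $((\Lambda^0)^\times)^2/\langle\pm1\rangle\times(\Lambda^\infty)^2$ to the formal superconformal power series over $\Lambda$ vanishing at zero with $\frac{\partial}{\partial\varphi^\pm}\tilde\varphi^\pm|_{0}$ invertible, and $\tilde E$ a bijection from $(\Lambda^\infty)^2$ to those with these coefficients equal to $1$. Operations: for $\alpha,\beta\in((\Lambda^0)^\times)^2/\langle\pm1\rangle\times(\Lambda^\infty)^2$, $\alpha\circ\beta=\hat E^{-1}(\hat E(\beta)\circ\hat E(\alpha))$ (right side: composition of series, $\hat E(\alpha)$ applied first); $(\Lambda^\infty)^2$ is the subgroup with first two entries $(1,1)$. Let $I(x,\varphi^+,\varphi^-)=(1/x,i\varphi^+/x,i\varphi^-/x)$. For $\mathbf A=(A^+,A^-,M^+,M^-)$, $\mathbf B=(B^+,B^-,N^+,N^-)$ let $H,\overline H$ be the series with $H\circ I^{-1}=\tilde E(A^+,-A^-,-iM^+,-iM^-)$, $\overline H\circ I^{-1}=\tilde E(B^+,-B^-,-iN^+,-iN^-)$; then $\mathbf A\circ_\infty\mathbf B=(C^+,C^-,P^+,P^-)$ where $(C^+,-C^-,-iP^+,-iP^-)=\tilde E^{-1}(H\circ I^{-1}\circ\overline H\circ I^{-1})$. $\overline{S^2K}(1)=(\Lambda^\infty)^2\times\bigl(((\Lambda^0)^\times)^2/\langle\pm1\rangle\times(\Lambda^\infty)^2\bigr)$ is the set of generalized $N=2$ super-Riemann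 spheres with one incoming and one outgoing tube (first factor: data at infinity; second: data at zero). Sewing: $(\mathbf0,\alpha)\;{}_1\infty_0\;(\mathbf0,\beta)=(\mathbf0,\alpha\circ\beta)$ and $(\mathbf B,(1,1,\mathbf0))\;{}_1\infty_0\;(\mathbf A,(1,1,\mathbf0))=(\mathbf A\circ_\infty\mathbf B,(1,1,\mathbf0))$. $\mathcal H$ is the set of $\mathbf A\in(\Lambda^\infty)^2$ such that $\tilde E(\mathbf A)$ is an absolutely convergent power series in some neighborhood of $0$ (neighborhoods in $\Lambda^0\oplus(\Lambda^1)^2$ for the topology whose open sets are preimages of open sets of $\mathbb C$ under $(z,\theta^+,\theta^-)\mapsto z_B$). $S^2K(1)|_0$, $S^2K(1)|_\infty$ are the elements of $\overline{S^2K}(1)|_0$, $\overline{S^2K}(1)|_\infty$ whose $(\Lambda^\infty)^2$-component lies in $\mathcal H$. The group of local $N=2$ superconformal transformations vanishing at $0$ consists of germs at $0$ of convergent superconformal power series vanishing at $0$ with invertible even coefficients of $\varphi^\pm$, under composition; the group of those vanishing at $\infty$ consists of the germs at $\infty$ of convergent superconformal series $H$ such that $H\circ I^{-1}$ vanishes at $0$ with even coefficients of $\varphi^\pm$ equal to $1$, under $(H,\overline H)\mapsto H\circ I^{-1}\circ\overline H$.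
   Formalization: S²K(1)|_∞ is taken as the A for which H∘I⁻¹ = Ẽ(A⁺,−A⁻,−iM⁺,−iM⁻) converges near 0, not A∈ℋ, since ℋ is not closed under ∘_∞; in (4) the subgroup of S²K(1)|_∞ is stated for this set, and {tA : tA∈ℋ} as a subgroup of the full group at infinity. *)

(* Defs.v *)
From HB Require Import structures.
From mathcomp Require Import all_boot all_order all_algebra finmap generic_quotient.
From mathcomp Require Import boolp classical_sets functions cardinality fsbigop.
From mathcomp Require Import reals ereal topology normedtype sequences esum exp trigo.
From mathcomp Require Import complex ring.
Set Implicit Arguments.
Unset Strict Implicit.
Unset Printing Implicit Defensive.
Import numFieldNormedType.Exports.
Import Order.TTheory GRing.Theory Num.Theory.
Local Open Scope ring_scope.
Local Open Scope classical_set_scope.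
Local Open Scope quotient_scope.

Section FsetSums.
Local Open Scope fset_scope.

(* The sign of the shuffle of I and J:
   zeta_I zeta_J = (-1) ^ crossings I J zeta_(I `|` J) for disjoint I and J. *)
Definition crossings (I J : {fset nat}) : nat :=
  \sum_(i <- I) \sum_(j <- J) (j < i)%N.

Lemma fsetUDid (J M : {fset nat}) : J `<=` M -> J `|` (M `\` J) = M.
Proof.
move=> JM; apply/fsetP => x; rewrite in_fsetU in_fsetD.
by have [/(fsubsetP JM) ->|] := boolP (x \in J).
Qed.

Lemma perm_fsetD (J M : {fset nat}) : J `<=` M ->
  perm_eq M (J ++ M `\` J).
Proof.
move=> JM; apply: uniq_perm.
- exact: fset_uniq.
- rewrite cat_uniq !fset_uniq andbT /=; apply/hasPn => x.
  by rewrite in_fsetD => /andP[].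
- move=> x; rewrite mem_cat in_fsetD.
  by have [/(fsubsetP JM) ->|] := boolP (x \in J).
Qed.

Lemma crossingsDl (J M K : {fset nat}) : J `<=` M ->
  crossings M K = (crossings J K + crossings (M `\` J) K)%N.
Proof. by move=> JM; rewrite /crossings (perm_big _ (perm_fsetD JM)) big_cat. Qed.

Lemma crossingsDr (J M K : {fset nat}) : J `<=` M ->
  crossings K M = (crossings K J + crossings K (M `\` J))%N.
Proof.
move=> JM; rewrite /crossings -big_split /=; apply: eq_bigr => i _.
by rewrite (perm_big _ (perm_fsetD JM)) big_cat.
Qed.

Lemma crossings0l J : crossings fset0 J = 0%N.
Proof. by rewrite /crossings big_seq_fset0. Qed.

Lemma crossings0r J : crossings J fset0 = 0%N.
Proof. by rewrite /crossings big1 // => i _; rewrite big_seq_fset0. Qed.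

Lemma fpowerset_flatten (V : zmodType) (I : {fset nat})
    (G : {fset nat} -> {fset nat} -> {fset nat} -> V) :
  \sum_(M <- fpowerset I) \sum_(J <- fpowerset M) G J (M `\` J) (I `\` M) =
  \sum_(J <- fpowerset I) \sum_(L <- fpowerset (I `\` J)) G J L (I `\` J `\` L).
Proof.
transitivity (\sum_(M <- fpowerset I) \sum_(J <- fpowerset I | J `<=` M)
    G J (M `\` J) (I `\` M)).
  rewrite big_seq [RHS]big_seq; apply: eq_bigr => M; rewrite fpowersetE => MI.
  rewrite -[RHS]big_filter; apply: perm_big; apply: uniq_perm.
  - exact: fset_uniq.
  - by rewrite filter_uniq // fset_uniq.
  - move=> J; rewrite mem_filter !fpowersetE.
    by have [JM|//] := boolP (J `<=` M); rewrite (fsubset_trans JM MI).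
rewrite (exchange_big_dep xpredT) //=.
rewrite big_seq [RHS]big_seq; apply: eq_bigr => J; rewrite fpowersetE => JI.
rewrite -big_filter.
transitivity (\sum_(L <- [seq M `\` J | M <- [seq M <- fpowerset I | J `<=` M]])
    G J L (I `\` J `\` L)).
  rewrite big_map big_seq [RHS]big_seq; apply: eq_bigr => M.
  rewrite mem_filter fpowersetE => /andP[JM MI]; congr (G _ _ _).
  by rewrite fsetDDl fsetUDid.
apply: perm_big; apply: uniq_perm; last 1 first.
- move=> L; rewrite fpowersetCE; apply/mapP/andP.
    move=> [M]; rewrite mem_filter fpowersetE => /andP[JM MI] ->.
    split; first exact: fsubset_trans (fsubsetDl _ _) MI.
    by rewrite -fsetI_eq0 fsetIC fsetIDA fsetIC -fsetIDA fsetDv fsetI0.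
  move=> [LI dLJ]; exists (J `|` L).
    by rewrite mem_filter fpowersetE fsubsetUl fsubUset JI LI.
  by rewrite fsetDUl fsetDv fset0U (fsetDidPl _ _ dLJ).
- rewrite map_inj_in_uniq ?filter_uniq ?fset_uniq // => M N.
  rewrite !mem_filter => /andP[JM _] /andP[JN _] E.
  by rewrite -(fsetUDid JM) -(fsetUDid JN) E.
- exact: fset_uniq.
Qed.

End FsetSums.

Section GrassmannFunctions.
Variable R : realType.

(* Arbitrary (possibly infinite) combinations sum_I a_I zeta_I. *)
Definition ghat := {fset nat} -> R[i].
HB.instance Definition _ := GRing.Zmodule.copy ghat ({fset nat} -> R[i]).
HB.instance Definition _ := GRing.Lmodule.copy ghat ({fset nat} -> R[i]).

Implicit Types a b c : ghat.

Definition ghat_one : ghat := fun I => (I == fset0)%:R.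

Definition ghat_mul a b : ghat := fun I =>
  \sum_(J <- fpowerset I)
    (-1) ^+ crossings J (I `\` J)%fset * a J * b (I `\` J)%fset.

Lemma ghat_mulA : associative ghat_mul.
Proof.
move=> a b c; apply/funext => I; apply/esym; rewrite /ghat_mul.
pose G J K L := (-1) ^+ (crossings J K + crossings J L + crossings K L)
  * a J * b K * c L.
transitivity (\sum_(M <- fpowerset I) \sum_(J <- fpowerset M)
    G J (M `\` J)%fset (I `\` M)%fset).
  rewrite big_seq [RHS]big_seq; apply: eq_bigr => M; rewrite fpowersetE => MI.
  rewrite mulr_sumr mulr_suml big_seq [RHS]big_seq; apply: eq_bigr => J.
  rewrite fpowersetE => JM; rewrite /G (crossingsDl _ JM) !exprD.
  move: (_ ^+ _) (_ ^+ _) (_ ^+ _) (a J) (b _) (c _) => s t u x y z; ring.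
rewrite fpowerset_flatten.
rewrite big_seq [RHS]big_seq; apply: eq_bigr => J; rewrite fpowersetE => JI.
rewrite mulr_sumr big_seq [RHS]big_seq; apply: eq_bigr => K.
rewrite fpowersetE => KI; rewrite /G (crossingsDr J KI) !exprD.
move: (_ ^+ _) (_ ^+ _) (_ ^+ _) (a J) (b K) (c _) => s t u x y z.
by rewrite -!mulrA; do 2 congr (_ * _); rewrite mulrCA.
Qed.

Lemma ghat_mul1l : left_id ghat_one ghat_mul.
Proof.
move=> a; apply/funext => I; rewrite /ghat_mul (big_fsetD1 fset0) /=; last first.
  by rewrite fpowersetE fsub0set.
rewrite fsetD0 crossings0l expr0 mul1r /ghat_one eqxx mul1r.
rewrite big_seq big1 ?addr0 // => J; rewrite in_fsetD1 => /andP[/negPf -> _].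
by rewrite mulr0 mul0r.
Qed.

Lemma ghat_mul1r : right_id ghat_one ghat_mul.
Proof.
move=> a; apply/funext => I; rewrite /ghat_mul (big_fsetD1 I) /=; last first.
  by rewrite fpowersetE.
rewrite fsetDv crossings0r expr0 mul1r /ghat_one eqxx mulr1.
rewrite big_seq big1 ?addr0 // => J; rewrite in_fsetD1 fpowersetE.
move=> /andP[JI sJI]; rewrite /ghat_one fsetD_eq0.
have [IJ|_] := boolP (I `<=` J)%fset; last by rewrite mulr0.
by case/eqP: JI; apply/eqP; rewrite eqEfsubset sJI.
Qed.

Lemma ghat_mulDl : left_distributive ghat_mul +%R.
Proof.
move=> a b c; apply/funext => I; rewrite -[RHS]/(ghat_mul a c I + ghat_mul b c I).
by rewrite /ghat_mul -big_split /=; apply: eq_bigr => J _; rewrite mulrDr mulrDl.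
Qed.

Lemma ghat_mulDr : right_distributive ghat_mul +%R.
Proof.
move=> a b c; apply/funext => I; rewrite -[RHS]/(ghat_mul a b I + ghat_mul a c I).
by rewrite /ghat_mul -big_split /=; apply: eq_bigr => J _; rewrite -mulrDr.
Qed.

Lemma ghat_one_neq0 : ghat_one != 0.
Proof.
apply/eqP => /(congr1 (fun f : ghat => f fset0)) /eqP.
by rewrite /ghat_one eqxx oner_eq0.
Qed.

HB.instance Definition _ := GRing.Zmodule_isNzRing.Build ghat
  ghat_mulA ghat_mul1l ghat_mul1r ghat_mulDl ghat_mulDr ghat_one_neq0.

Lemma ghat_scalerAl (k : R[i]) a b : k *: (a * b) = (k *: a) * b.
Proof.
apply/funext => I; rewrite -[LHS]/(k * ghat_mul a b I) /ghat_mul mulr_sumr.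
apply: eq_bigr => J _; rewrite !mulrA; congr (_ * _).
by rewrite mulrAC mulrC mulrA.
Qed.

HB.instance Definition _ := GRing.Lmodule_isLalgebra.Build R[i] ghat ghat_scalerAl.

Lemma ghatME a b I : (a * b) I = \sum_(J <- fpowerset I)
    (-1) ^+ crossings J (I `\` J)%fset * a J * b (I `\` J)%fset.
Proof. by []. Qed.

End GrassmannFunctions.

Section Grassmann.
Variable R : realType.

Definition fin_supp : {pred ghat R} :=
  fun a => `[< finite_set [set I | a I != 0] >].

Lemma fin_supp_subring : subring_closed fin_supp.
Proof.
split=> [|a b|a b].
- apply/asboolP; apply: (@sub_finite_set _ _ [set fset0]); last exact: finite_set1.
  move=> I /=; rewrite -[(1 : ghat R) I]/((I == fset0)%:R).
  by rewrite pnatr_eq0 eqb0 negbK => /eqP.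
- move=> /asboolP fa /asboolP fb; apply/asboolP.
  apply: (@sub_finite_set _ _ ([set I | a I != 0] `|` [set I | b I != 0])).
    move=> I /=; rewrite -[(a - b) I]/(a I - b I).
    have [->|] := eqVneq (a I) 0; last by left.
    by rewrite sub0r oppr_eq0; right.
  by rewrite finite_setU.
- move=> /asboolP fa /asboolP fb; apply/asboolP.
  apply: (sub_finite_set _ (finite_image2 (@fsetU nat) fa fb)).
  move=> I /=; apply: contra_neqP => h; rewrite ghatME big_seq big1 // => J.
  rewrite fpowersetE => JI.
  have [->|aJ] := eqVneq (a J) 0; first by rewrite mulr0 mul0r.
  have [->|bJ] := eqVneq (b (I `\` J)%fset) 0; first by rewrite mulr0.
  by exfalso; apply: h; exists J => //; exists (I `\` J)%fset => //; exact: fsetUDid.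
Qed.

Lemma fin_supp_scale : GRing.scaler_closed fin_supp.
Proof.
move=> k a /asboolP fa; apply/asboolP; apply: (sub_finite_set _ fa) => I /=.
by apply: contra_neq => a0; rewrite -[LHS]/(k * a I) a0 mulr0.
Qed.

HB.instance Definition _ :=
  GRing.isSubringClosed.Build (ghat R) fin_supp fin_supp_subring.
HB.instance Definition _ :=
  GRing.isScaleClosed.Build R[i] (ghat R) fin_supp fin_supp_scale.

(* The Grassmann algebra on zeta_0, zeta_1, ...; [a I] is the coefficient of
   the product of the zeta_i, i in I, taken in increasing order. *)
Record Lam := MkLam { lam_val : ghat R; _ : lam_val \in fin_supp }.
HB.instance Definition _ := [isSub for lam_val].
HB.instance Definition _ := [Choice of Lam by <:].
HB.instance Definition _ := [SubChoice_isSubNzRing of Lam by <:].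
HB.instance Definition _ := [SubZmodule_isSubLmodule of Lam by <:].
HB.instance Definition _ := [SubNzRing_SubLmodule_isSubLalgebra of Lam by <:].

Definition lam_coef (a : Lam) (I : {fset nat}) : R[i] := lam_val a I.
Coercion lam_coef : Lam >-> Funclass.

Definition has_parity (p : bool) (a : Lam) : Prop :=
  forall I : {fset nat}, odd #|` I| != p -> a I = 0.

Lemma lamME (a b : Lam) I : (a * b) I = \sum_(J <- fpowerset I)
    (-1) ^+ crossings J (I `\` J)%fset * a J * b (I `\` J)%fset.
Proof. by []. Qed.

Lemma has_parityM p q (a b : Lam) :
  has_parity p a -> has_parity q b -> has_parity (p (+) q) (a * b).
Proof.
move=> pa qb I hI; rewrite lamME.
rewrite big_seq big1 // => J; rewrite fpowersetE => JI.
have [oJ|/pa ->] := eqVneq (odd #|` J|) p; last by rewrite mulr0 mul0r.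
rewrite (qb (I `\` J)%fset) ?mulr0 //; apply: contraNneq hI => oK.
by rewrite -oJ -oK -oddD cardfsDS // subnKC // fsubset_leq_card.
Qed.

Lemma has_parityB p (a b : Lam) :
  has_parity p a -> has_parity p b -> has_parity p (a - b).
Proof.
by move=> pa pb I hI; rewrite -[LHS]/(a I - b I) pa // pb // subr0.
Qed.

Lemma has_parityZ p k (a : Lam) : has_parity p a -> has_parity p (k *: a).
Proof. by move=> pa I hI; rewrite -[LHS]/(k * a I) pa // mulr0. Qed.

Lemma has_parity1 : has_parity false 1.
Proof.
move=> I hI; rewrite -[LHS]/((I == fset0)%:R : R[i]).
by have [I0|//] := eqVneq I fset0; rewrite I0 cardfs0 in hI.
Qed.

Lemma has_parity0 p : has_parity p 0. Proof. by []. Qed.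

Definition even_pred : {pred Lam} := fun a => `[< has_parity false a >].
Definition odd_pred : {pred Lam} := fun a => `[< has_parity true a >].

Lemma even_subring : subring_closed even_pred.
Proof.
split=> [|a b /asboolP pa /asboolP pb|a b /asboolP pa /asboolP pb]; apply/asboolP.
- exact: has_parity1.
- exact: has_parityB.
- exact: (has_parityM pa pb).
Qed.

Lemma even_scale : GRing.scaler_closed even_pred.
Proof. by move=> k a /asboolP pa; apply/asboolP; exact: has_parityZ. Qed.

Lemma odd_zmod : zmod_closed odd_pred.
Proof.
split=> [|a b /asboolP pa /asboolP pb]; apply/asboolP; first exact: has_parity0.
exact: has_parityB.
Qed.

Lemma odd_scale : GRing.scaler_closed odd_pred.
Proof. by move=> k a /asboolP pa; apply/asboolP; exact: has_parityZ. Qed.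

HB.instance Definition _ := GRing.isSubringClosed.Build Lam even_pred even_subring.
HB.instance Definition _ := GRing.isScaleClosed.Build R[i] Lam even_pred even_scale.
HB.instance Definition _ := GRing.isZmodClosed.Build Lam odd_pred odd_zmod.
HB.instance Definition _ := GRing.isScaleClosed.Build R[i] Lam odd_pred odd_scale.

Record Lam0 := MkLam0 { lam0_val :> Lam; _ : lam0_val \in even_pred }.
HB.instance Definition _ := [isSub for lam0_val].
HB.instance Definition _ := [Choice of Lam0 by <:].
HB.instance Definition _ := [SubChoice_isSubNzRing of Lam0 by <:].
HB.instance Definition _ := [SubZmodule_isSubLmodule of Lam0 by <:].
HB.instance Definition _ := [SubNzRing_SubLmodule_isSubLalgebra of Lam0 by <:].

Record Lam1 := MkLam1 { lam1_val :> Lam; _ : lam1_val \in odd_pred }.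
HB.instance Definition _ := [isSub for lam1_val].
HB.instance Definition _ := [Choice of Lam1 by <:].
HB.instance Definition _ := [SubChoice_isSubZmodule of Lam1 by <:].
HB.instance Definition _ := [SubZmodule_isSubLmodule of Lam1 by <:].

Lemma mul01_subproof (t : Lam0) (m : Lam1) : (t : Lam) * m \in odd_pred.
Proof.
have t0 : has_parity false t by apply/asboolP; exact: (valP t).
have m1 : has_parity true m by apply/asboolP; exact: (valP m).
by apply/asboolP; exact: (has_parityM t0 m1).
Qed.

Definition mul01 (t : Lam0) (m : Lam1) : Lam1 := MkLam1 (mul01_subproof t m).

Definition body (a : Lam) : R[i] := a fset0.

Lemma lam_sign_subproof (a : Lam) :
  ((fun I => (-1) ^+ #|` I| * a I) : ghat R) \in fin_supp.
Proof.
apply/asboolP; have /asboolP fa := valP a.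
apply: (sub_finite_set _ fa) => I /=.
by apply: contra_neq => a0; rewrite -[a I]/(lam_val a I) a0 mulr0.
Qed.

(* a_even + a_odd |-> a_even - a_odd *)
Definition lam_sign (a : Lam) : Lam := MkLam (lam_sign_subproof a).

Lemma lam_signK : involutive lam_sign.
Proof.
move=> a; apply/val_inj/funext => I /=.
by rewrite /lam_coef /= mulrA -exprD addnn -mul2n exprM sqrrN expr1n expr1n mul1r.
Qed.

Lemma lam_signB : {morph lam_sign : a b / a - b}.
Proof. by move=> a b; apply/val_inj/funext => I; exact: mulrBr. Qed.

Lemma lam_signM : {morph lam_sign : a b / a * b}.
Proof.
move=> a b; apply/val_inj/funext => I /=.
rewrite -[LHS]/((-1) ^+ #|` I| * (a * b) I).
rewrite -[RHS]/((lam_sign a * lam_sign b) I) !lamME mulr_sumr.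
rewrite big_seq [RHS]big_seq; apply: eq_bigr => J; rewrite fpowersetE => JI.
rewrite /lam_coef /=.
have -> : #|` I| = (#|` J| + #|` (I `\` J)%fset|)%N.
  by rewrite cardfsDS // subnKC // fsubset_leq_card.
rewrite exprD; move: (_ ^+ _) (_ ^+ _) (_ ^+ _) => s t u.
by rewrite /lam_coef; move: (lam_val a J) (lam_val b _) => x y; ring.
Qed.

Lemma lam_sign1 : lam_sign 1 = 1.
Proof.
apply/val_inj/funext => I.
rewrite -[LHS]/((-1) ^+ #|` I| * (I == fset0)%:R) -[RHS]/((I == fset0)%:R : R[i]).
have [->|_] := eqVneq I fset0; first by rewrite cardfs0 expr0 mul1r.
exact: mulr0.
Qed.

Lemma lam_sign0 : lam_sign 0 = 0.
Proof. by apply/val_inj/funext => I; exact: mulr0. Qed.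

Lemma lam_signD : {morph lam_sign : a b / a + b}.
Proof.
by move=> a b; rewrite -{1}[b]opprK -[- b]add0r !lam_signB lam_sign0 sub0r opprK.
Qed.

End Grassmann.

Section ClassicalUnits.
Variable T : nzRingType.

Definition classical_unit : {pred T} := fun a => `[< exists b, b * a = 1 /\ a * b = 1 >].
Definition classical_inv (a : T) : T := xget a [set b | b * a = 1 /\ a * b = 1].

Lemma classical_invP a : a \in classical_unit ->
  classical_inv a * a = 1 /\ a * classical_inv a = 1.
Proof. by move=> /asboolP h; exact: (xgetPex a h). Qed.

Lemma classical_mulVr : {in classical_unit, left_inverse 1 classical_inv *%R}.
Proof. by move=> a /classical_invP[]. Qed.

Lemma classical_mulrV : {in classical_unit, right_inverse 1 classical_inv *%R}.
Proof. by move=> a /classical_invP[]. Qed.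

Lemma classical_unitP a b : b * a = 1 /\ a * b = 1 -> a \in classical_unit.
Proof. by move=> h; apply/asboolP; exists b. Qed.

Lemma classical_inv_out : {in [predC classical_unit], classical_inv =1 id}.
Proof.
move=> a /asboolP h; rewrite /classical_inv; case: xgetP => // b _ hb.
by case: h; exists b.
Qed.

End ClassicalUnits.

HB.instance Definition _ (R : realType) := GRing.NzRing_hasMulInverse.Build (Lam R)
  (@classical_mulVr (Lam R)) (@classical_mulrV (Lam R))
  (@classical_unitP (Lam R)) (@classical_inv_out (Lam R)).
HB.instance Definition _ (R : realType) := GRing.NzRing_hasMulInverse.Build (Lam0 R)
  (@classical_mulVr (Lam0 R)) (@classical_mulrV (Lam0 R))
  (@classical_unitP (Lam0 R)) (@classical_inv_out (Lam0 R)).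

Section Series.
Variable R : realType.
Local Notation L := (Lam R).

(* [SExt a b c d] is a + b phi+ + c phi- + d phi+ phi-, where the phi's
   anticommute with each other and with the odd elements of Lam. *)
Record sext := SExt { c0 : L; cp : L; cm : L; cpm : L }.

HB.instance Definition _ := gen_eqMixin sext.
HB.instance Definition _ := gen_choiceMixin sext.

Definition sext_zero := SExt 0 0 0 0.
Definition sext_opp e := SExt (- c0 e) (- cp e) (- cm e) (- cpm e).
Definition sext_add e f :=
  SExt (c0 e + c0 f) (cp e + cp f) (cm e + cm f) (cpm e + cpm f).

Lemma sext_addA : associative sext_add.
Proof. by move=> e f g; rewrite /sext_add /= !addrA. Qed.
Lemma sext_addC : commutative sext_add.
Proof. by move=> e f; congr SExt; rewrite addrC. Qed.
Lemma sext_add0 : left_id sext_zero sext_add.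
Proof. by move=> [a b c d]; rewrite /sext_add /= !add0r. Qed.
Lemma sext_addN : left_inverse sext_zero sext_opp sext_add.
Proof. by move=> e; rewrite /sext_add /= !addNr. Qed.

HB.instance Definition _ :=
  GRing.isZmodule.Build sext sext_addA sext_addC sext_add0 sext_addN.

Local Notation s := (@lam_sign R).

Definition sext_one := SExt 1 0 0 0.
Definition sext_mul e f := SExt
  (c0 e * c0 f)
  (c0 e * cp f + cp e * s (c0 f))
  (c0 e * cm f + cm e * s (c0 f))
  (c0 e * cpm f + cp e * s (cm f) - cm e * s (cp f) + cpm e * c0 f).

Lemma sext_mulA : associative sext_mul.
Proof.
move=> e f g; rewrite /sext_mul /=; congr SExt.
- exact: mulrA.
- by rewrite !mulrDr !mulrDl !lam_signM !mulrA addrA.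
- by rewrite !mulrDr !mulrDl !lam_signM !mulrA addrA.
- rewrite !(lam_signD, lam_signM, lam_signK) !(mulrDr, mulrDl, mulrN, mulNr, mulrA).
  rewrite !(opprD, addrA); by rewrite [RHS](ACl (1*2*4*6*3*7*5*8*9)).
Qed.

Lemma sext_mul1l : left_id sext_one sext_mul.
Proof. by move=> [a b c d]; rewrite /sext_mul /= !mul0r !mul1r subr0 !addr0. Qed.

Lemma sext_mul1r : right_id sext_one sext_mul.
Proof.
move=> [a b c d].
by rewrite /sext_mul /= lam_sign1 lam_sign0 !mulr0 !mulr1 subr0 !add0r.
Qed.

Lemma sext_mulDl : left_distributive sext_mul +%R.
Proof.
move=> e f g; congr SExt; rewrite /= !mulrDl //.
- by rewrite addrACA.
- by rewrite addrACA.
- by rewrite !(opprD, addrA) [RHS](ACl (1*5*2*6*3*7*4*8)).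
Qed.

Lemma sext_mulDr : right_distributive sext_mul +%R.
Proof.
move=> e f g; congr SExt; rewrite /= ?lam_signD !mulrDr //.
- by rewrite addrACA.
- by rewrite addrACA.
- by rewrite !(opprD, addrA) [RHS](ACl (1*5*2*6*3*7*4*8)).
Qed.

Lemma sext_one_neq0 : sext_one != 0.
Proof. by apply/eqP => -[] /eqP; rewrite oner_eq0. Qed.

HB.instance Definition _ := GRing.Zmodule_isNzRing.Build sext
  sext_mulA sext_mul1l sext_mul1r sext_mulDl sext_mulDr sext_one_neq0.

(* Lam[[x]][phi+, phi-], with [f n] the coefficient of x ^ n. *)
Definition sser := nat -> sext.
HB.instance Definition _ := GRing.Zmodule.copy sser (nat -> sext).

Implicit Types f g h : sser.

Definition sser_one : sser := fun n => (n == 0%N)%:R.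
Definition sser_mul f g : sser := fun n => \sum_(i < n.+1) f i * g (n - i)%N.

Lemma sser_mul_poly f g n m : (m <= n)%N ->
  sser_mul f g m = ((\poly_(i < n.+1) f i) * \poly_(i < n.+1) g i)`_m.
Proof.
move=> mn; rewrite coefM; apply: eq_bigr => i _; rewrite !coef_poly.
have im : (i <= m)%N by rewrite -ltnS.
by rewrite !ltnS (leq_trans im mn) (leq_trans (leq_subr _ _) mn).
Qed.

Lemma sser_mulA : associative sser_mul.
Proof.
move=> f g h; apply/funext => n.
transitivity ((\poly_(i < n.+1) f i * (\poly_(i < n.+1) g i * \poly_(i < n.+1) h i))`_n).
  rewrite coefM; apply: eq_bigr => i _.
  by rewrite coef_poly ltn_ord (sser_mul_poly _ _ (leq_subr i n)).
rewrite mulrA coefM; apply: eq_bigr => i _.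
by rewrite coef_poly ltnS leq_subr -sser_mul_poly // -ltnS.
Qed.

Lemma sser_mul1l : left_id sser_one sser_mul.
Proof.
move=> f; apply/funext => n; rewrite /sser_mul big_ord_recl /= /sser_one subn0 mul1r.
by rewrite big1 ?addr0 // => i _; rewrite mul0r.
Qed.

Lemma sser_mul1r : right_id sser_one sser_mul.
Proof.
move=> f; apply/funext => n; rewrite /sser_mul big_ord_recr /= /sser_one subnn mulr1.
rewrite big1 ?add0r // => i _; rewrite subn_eq0 leqNgt ltn_ord /=.
by rewrite mulr0.
Qed.

Lemma sser_mulDl : left_distributive sser_mul +%R.
Proof.
move=> f g h; apply/funext => n.
rewrite -[RHS]/(sser_mul f h n + sser_mul g h n) /sser_mul -big_split /=.
by apply: eq_bigr => i _; rewrite -mulrDl.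
Qed.

Lemma sser_mulDr : right_distributive sser_mul +%R.
Proof.
move=> f g h; apply/funext => n.
rewrite -[RHS]/(sser_mul f g n + sser_mul f h n) /sser_mul -big_split /=.
by apply: eq_bigr => i _; rewrite -mulrDr.
Qed.

Lemma sser_one_neq0 : sser_one != 0.
Proof.
apply/eqP => /(congr1 (fun f : sser => f 0%N)) /eqP.
by rewrite /sser_one oner_eq0.
Qed.

HB.instance Definition _ := GRing.Zmodule_isNzRing.Build sser
  sser_mulA sser_mul1l sser_mul1r sser_mulDl sser_mulDr sser_one_neq0.

End Series.

Section Superconformal.
Variable R : realType.
Local Notation C := (R[i]).
Local Notation L := (Lam R).
Local Notation L0 := (Lam0 R).
Local Notation L1 := (Lam1 R).
Local Notation S := (sser R).
Local Notation sg := (@lam_sign R).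

Definition constS (a : L) : S := fun n => if n == 0%N then SExt a 0 0 0 else 0.
Definition varx : S := fun n => (n == 1%N)%:R.
Definition phip : S := fun n => if n == 0%N then SExt 0 1 0 0 else 0.
Definition phim : S := fun n => if n == 0%N then SExt 0 0 1 0 else 0.

Definition dx (f : S) : S := fun n => f n.+1 *+ n.+1.
(* Left derivatives: passing them over a coefficient produces its sign. *)
Definition dphip (f : S) : S := fun n => SExt (sg (cp (f n))) 0 (sg (cpm (f n))) 0.
Definition dphim (f : S) : S := fun n => SExt (sg (cm (f n))) (- sg (cpm (f n))) 0 0.

(* Lop j, Jop j, Gpop j, Gmop j are L_j, J_j, G^+_(j-1/2), G^-_(j-1/2), j >= 1 *)
Definition Lop (j : nat) (f : S) : S :=
  - (varx ^+ j.+1 * dx f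
     + constS (j.+1%:R / 2)%:A * varx ^+ j * (phip * dphip f + phim * dphim f)).
Definition Jop (j : nat) (f : S) : S :=
  - (varx ^+ j * (phip * dphip f - phim * dphim f)).
Definition Gpop (j : nat) (f : S) : S :=
  - (varx ^+ j * (dphip f - phim * dx f)
     + varx ^+ j.-1 *+ j * phip * phim * dphip f).
Definition Gmop (j : nat) (f : S) : S :=
  - (varx ^+ j * (dphim f - phip * dx f)
     - varx ^+ j.-1 *+ j * phip * phim * dphim f).

(* Coefficientwise sum of a formally summable family: \sum_(_ \in _) is the
   sum over the support when that is finite, and 0 otherwise. *)
Definition ssum (u : nat -> S) : S := fun n => \sum_(k \in [set: nat]) u k n.

(* (A^+, A^-, M^+, M^-); the entry at k is A_(k+1), resp. M_(k+1/2). *)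
Definition data := ((nat -> L0) * (nat -> L0) * (nat -> L1) * (nat -> L1))%type.

Definition vfield (A : data) (f : S) : S :=
  let: (Ap, Am, Mp, Mm) := A in
  ssum (fun k => constS (Ap k) * Lop k.+1 f + constS (Am k) * Jop k.+1 f
               + constS (Mp k) * Gpop k.+1 f + constS (Mm k) * Gmop k.+1 f).

Definition exp_vfield (A : data) (f : S) : S :=
  ssum (fun k => constS (k`!%:R^-1)%:A * iter k (fun g => - vfield A g) f).

Definition triple := (S * S * S)%type.

Definition Etilde (A : data) : triple :=
  (exp_vfield A varx, exp_vfield A phip, exp_vfield A phim).

(* f (X, P, M); the family is formally summable when X vanishes at zero. *)
Definition scomp (f : S) (F : triple) : S :=
  let: (X, P, M) := F in
  ssum (fun n => constS (c0 (f n)) * X ^+ n + constS (cp (f n)) * X ^+ n * P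
               + constS (cm (f n)) * X ^+ n * M + constS (cpm (f n)) * X ^+ n * P * M).
(* F \circ G, with G applied first *)
Definition tcomp (F G : triple) : triple :=
  (scomp F.1.1 G, scomp F.1.2 G, scomp F.2 G).

Definition series_parity (p : bool) (f : S) : Prop := forall n,
  [/\ has_parity p (c0 (f n)), has_parity (~~ p) (cp (f n)),
      has_parity (~~ p) (cm (f n)) & has_parity p (cpm (f n))].

(* The derivation [d] with respect to x is a parameter because series at
   infinity are written in the variable 1/x. *)
Definition superconformal (d : S -> S) (F : triple) : Prop :=
  let: (X, P, M) := F in
  let Dp f := dphip f + phim * d f in
  let Dm f := dphim f + phip * d f in
  [/\ series_parity false X, series_parity true P & series_parity true M] /\
  [/\ Dp M = 0, Dm P = 0, Dp X = M * Dp P & Dm X = P * Dm M] /\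
  (Dp P != 0 /\ Dm M != 0).

Definition at0 (f : S) : L := c0 (f 0%N).
Definition vanishes0 (F : triple) : Prop :=
  [/\ at0 F.1.1 = 0, at0 F.1.2 = 0 & at0 F.2 = 0].
Definition unit_coefs (F : triple) : Prop :=
  at0 (dphip F.1.2) \is a GRing.unit /\ at0 (dphim F.2) \is a GRing.unit.
Definition one_coefs (F : triple) : Prop :=
  at0 (dphip F.1.2) = 1 /\ at0 (dphim F.2) = 1.

Record units2 := Units2 { units2_val : L0 * L0;
  _ : (body units2_val.1 != 0) && (body units2_val.2 != 0) }.
HB.instance Definition _ := [isSub for units2_val].
HB.instance Definition _ := [Choice of units2 by <:].

Lemma units2_one_subproof :
  (body (1 : L0, 1 : L0).1 != 0) && (body (1 : L0, 1 : L0).2 != 0).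
Proof.
have -> : body (1 : L0, 1 : L0).1 = 1.
  by rewrite -[LHS]/((fset0 == fset0 :> {fset nat})%:R) eqxx.
by rewrite oner_eq0.
Qed.
Definition units2_one : units2 := Units2 units2_one_subproof.

Definition same_up_to_sign (u v : units2) : bool :=
  (val u == val v) || (val u == - val v).

Lemma same_up_to_sign_refl : reflexive same_up_to_sign.
Proof. by move=> u; rewrite /same_up_to_sign eqxx. Qed.
Lemma same_up_to_sign_sym : symmetric same_up_to_sign.
Proof.
by move=> u v; rewrite /same_up_to_sign eq_sym; congr (_ || _); rewrite -eqr_oppLR eq_sym.
Qed.
Lemma same_up_to_sign_trans : transitive same_up_to_sign.
Proof.
move=> v u w /orP[] /eqP uv /orP[] /eqP vw; rewrite /same_up_to_sign uv vw;
  by rewrite ?opprK eqxx ?orbT.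
Qed.
Canonical same_up_to_sign_equiv := EquivRel same_up_to_sign
  same_up_to_sign_refl same_up_to_sign_sym same_up_to_sign_trans.

Definition uquot := {eq_quot same_up_to_sign}.

(* The class of (a, b), for a and b with nonzero body. *)
Definition uclass (a b : L0) : uquot := \pi_uquot (insubd units2_one (a, b)).
Definition uone : uquot := uclass 1 1.

Definition pdata := (uquot * data)%type.

Definition Ehat (al : pdata) : triple :=
  let: (ap, am) := val (repr al.1) in
  let: (X, P, M) := Etilde al.2 in
  (constS (ap ^+ 2) * X, constS (ap * am) * P, constS (ap * am^-1) * M).

Definition Ehat_inv (F : triple) : pdata := xget (uone, 0) [set al | Ehat al = F].
Definition Etilde_inv (F : triple) : data := xget 0 [set A | Etilde A = F].

Definition circ (al be : pdata) : pdata := Ehat_inv (tcomp (Ehat be) (Ehat al)).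

Definition twist (A : data) : data :=
  let: (Ap, Am, Mp, Mm) := A in (Ap, - Am, - 'i *: Mp, - 'i *: Mm).

(* With H o I^-1 = Etilde (twist A) and H' o I^-1 = Etilde (twist B), the
   right-hand side is Etilde^-1 (H o I^-1 o H' o I^-1). *)
Definition circoo (A B : data) : data :=
  xget 0 [set D | twist D = Etilde_inv (tcomp (Etilde (twist A)) (Etilde (twist B)))].

(* data at infinity, data at zero *)
Definition SK1 := (data * pdata)%type.

Inductive sew : SK1 -> SK1 -> SK1 -> Prop :=
| sew_zero al be : sew (0, al) (0, be) (0, circ al be)
| sew_infty A B : sew (B, (uone, 0)) (A, (uone, 0)) (circoo A B, (uone, 0)).

Definition with_one (X : set data) : set pdata := [set al | al.1 = uone /\ X al.2].
Definition at_zero (P : set pdata) : set SK1 := [set x | x.1 = 0 /\ P x.2].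
Definition at_infty (X : set data) : set SK1 := [set x | X x.1 /\ x.2 = (uone, 0)].

(* b tells which of A^+, A^-, M^+, M^- are unconstrained; the others are 0 *)
Definition vanishing_family (b : bool * bool * bool * bool) : set data :=
  let: (ap, am, mp, mm) := b in
  [set A | [/\ ap || (A.1.1.1 == 0), am || (A.1.1.2 == 0),
               mp || (A.1.2 == 0) & mm || (A.2 == 0)]].
Definition families : seq (bool * bool * bool * bool) :=
  [:: (true,  false, false, false);
      (false, true,  false, false);
      (true,  true,  false, false);
      (false, false, true,  false);
      (false, false, false, true);
      (true,  false, true,  false);
      (true,  false, false, true);
      (false, true,  true,  false);
      (false, true,  false, true);
      (true,  true,  true,  false);
      (true,  true,  false, true)].

Definition dscale (t : L0) (A : data) : data :=
  let: (Ap, Am, Mp, Mm) := A in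
  (fun k => t * Ap k, fun k => t * Am k, fun k => mul01 t (Mp k), fun k => mul01 t (Mm k)).

Definition cexp (z : C) : C :=
  ((expR (complex.Re z))%:C * (cos (complex.Im z) +i* sin (complex.Im z)))%C.
(* The soul is nilpotent, so the sum is finite. *)
Definition expL (a : L0) : L0 :=
  cexp (body a) *: \sum_(k \in [set: nat]) (k`!%:R^-1 : C) *: (a - (body a)%:A) ^+ k.

Definition spoint := (L0 * L1 * L1)%type.

Definition sext_coef (e : sext R) (s t : bool) : L :=
  match s, t with
  | false, false => c0 e | true, false => cp e
  | false, true => cm e  | true, true => cpm e
  end.

Definition sterm (f : S) (p : spoint) (k : nat * bool * bool) : L :=
  let: (n, s, t) := k in let: (z, thp, thm) := p in
  sext_coef (f n) s t * (z : L) ^+ n * (thp : L) ^+ s * (thm : L) ^+ t.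

(* Absolute convergence in Lam is that of each coefficient with respect to the
   monomials in the zeta's; the sum v is required to lie in Lam. *)
Definition has_sum (f : S) (p : spoint) (v : L) : Prop :=
  forall I : {fset nat},
    summable [set: nat * bool * bool] (fun k => (complex.Re `|sterm f p k I|)%:E) /\
    (fun N => \sum_(n < N) \sum_(s : bool) \sum_(t : bool)
       (sterm f p (val n, s, t) I : C^o)) @ \oo --> (v I : C^o).

Definition has_sum3 (F : triple) (p q : spoint) : Prop :=
  [/\ has_sum F.1.1 p q.1.1, has_sum F.1.2 p q.1.2 & has_sum F.2 p q.2].

Definition pbody (p : spoint) : C^o := body p.1.1.

(* Open sets of points are the preimages of open sets of C under pbody. *)
Definition near0 (P : set spoint) : Prop :=
  exists U : set C^o, [/\ open U, U 0 & forall p, U (pbody p) -> P p].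
Definition nearoo (P : set spoint) : Prop :=
  exists r : R, forall p, r < complex.Re `|pbody p| -> P p.

Definition Hconv : set data :=
  [set A | near0 [set p | exists q, has_sum3 (Etilde A) p q]].

(* The A whose series at infinity H, H o I^-1 = Etilde (twist A), converges.
   This is not Hconv: the vector field map behind [twist] is not an
   automorphism, and Hconv is not closed under [circoo]. *)
Definition Hconv_infty : set data := [set A | Hconv (twist A)].

Definition germ (near : set spoint -> Prop) (F : spoint -> spoint) : set (spoint -> spoint) :=
  [set G | near [set p | G p = F p]].

Definition local0 (F : spoint -> spoint) : Prop :=
  exists H : triple, [/\ superconformal dx H, vanishes0 H, unit_coefs H &
    near0 [set p | has_sum3 H p (F p)]].

Definition germs0 : set (set (spoint -> spoint)) :=
  [set X | exists2 F, local0 F & X = germ near0 F].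
Definition germs0_mul (X Y Z : set (spoint -> spoint)) : Prop :=
  exists F G, [/\ X F, Y G & Z = germ near0 (F \o G)].

(* A series at infinity such that H o I^-1 is a power series is a power series
   in y = 1/x and phi+, phi-; it is represented by an element of [triple] in
   the variable y.  Then d/dx = - y^2 d/dy and I = (y, i phi+ y, i phi- y). *)
Definition dx_infty (f : S) : S := - (varx ^+ 2 * dx f).
Definition I_infty : triple :=
  (varx, constS ('i%:A) * phip * varx, constS ('i%:A) * phim * varx).

Definition inv_x (p : spoint) : spoint := let: (z, thp, thm) := p in (z^-1, thp, thm).
Definition I_inv (p : spoint) : spoint :=
  let: (z, thp, thm) := p in
  (z^-1, mul01 (- 'i *: z^-1) thp, mul01 (- 'i *: z^-1) thm).

(* H o I^-1 = K *)
Definition localoo (F : spoint -> spoint) : Prop :=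
  exists H K : triple, [/\ H = tcomp K I_infty, superconformal dx_infty H,
    vanishes0 K, one_coefs K & nearoo [set p | has_sum3 H (inv_x p) (F p)]].

Definition germsoo : set (set (spoint -> spoint)) :=
  [set X | exists2 F, localoo F & X = germ nearoo F].
Definition germsoo_mul (X Y Z : set (spoint -> spoint)) : Prop :=
  exists F G, [/\ X F, Y G & Z = germ nearoo (F \o I_inv \o G)].

End Superconformal.

(* Operations are ternary relations [op x y z], read "x y is defined and equals
   z", because sewing and the product of germs are not total functions. *)
Definition group_on (T : Type) (D : set T) (op : T -> T -> T -> Prop) : Prop :=
  [/\ forall x y, D x -> D y -> exists2 z, D z & forall w, op x y w <-> w = z,
      forall x y z xy yz w, D x -> D y -> D z ->
        op x y xy -> op xy z w -> op y z yz -> op x yz w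
    & exists2 e, D e & forall x, D x -> [/\ op e x x, op x e x
        & exists2 y, D y & op x y e /\ op y x e]].

Definition subgroup_on (T : Type) (D' D : set T) (op : T -> T -> T -> Prop) : Prop :=
  [/\ group_on D op, D' `<=` D & group_on D' op].

Definition iso_on (T1 T2 : Type) (D1 : set T1) (op1 : T1 -> T1 -> T1 -> Prop)
    (D2 : set T2) (op2 : T2 -> T2 -> T2 -> Prop) (f : T1 -> T2) : Prop :=
  set_bij D1 D2 f /\
  forall x y z, D1 x -> D1 y -> op1 x y z -> op2 (f x) (f y) (f z).

Definition isomorphic_on (T1 T2 : Type) (D1 : set T1) (op1 : T1 -> T1 -> T1 -> Prop)
    (D2 : set T2) (op2 : T2 -> T2 -> T2 -> Prop) : Prop :=
  [/\ group_on D1 op1, group_on D2 op2 & exists f, iso_on D1 op1 D2 op2 f].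

Definition hom_from_additive (V : zmodType) (T : Type) (h : V -> T)
    (D : set T) (op : T -> T -> T -> Prop) : Prop :=
  (forall t, D (h t)) /\ forall s t, op (h s) (h t) (h (s + t)).

Definition graph2 (T : Type) (f : T -> T -> T) : T -> T -> T -> Prop :=
  fun x y z => z = f x y.

(* Main.v *)
(** Substitution turns series into operators: E~(A) is the image of (x, phi+, phi-) under e^w, where
    w = -(sum of the A_j L_j + ...) is an even derivation of Lam[[x]][phi+, phi-] that raises the weight
    in which x counts 2 and phi+, phi- count 1, and f(E~(A)) = e^w f.  Composing series amounts to
    composing operators in the opposite order, so the group axioms and e^(sw) e^(tw) = e^((s+t)w) are
    inherited by the data as soon as every superconformal series is an E^(al).  That holds because such
    a series is determined by four coefficient sequences, on which A acts by a unipotent map.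

    A family of data with prescribed zeros consists of the A whose w stabilises a space of pairs of
    series defined by the vanishing of coefficients.  As e^(nw) is a polynomial in n modulo high
    weights, w stabilises such a space exactly when e^w does, whence the subgroups of part (1).

    Convergence is measured by the seminorms sum_(J <= I) |a_J| e^#|J|, which are submultiplicative;
    the radius available for x does not depend on I because e may be taken small.  The inverse series
    converges by a contraction argument.  That its values lie in Lam, where only finitely many zeta's
    occur, is more delicate: the coefficients of a convergent series multiplied by a given monomial in
    the zeta's have a common finite support, for otherwise countably many nonzero power series would
    have zeros filling an interval; hence the inverse at p can be computed modulo all zeta's outside a
    large finite set.

    At infinity, H = K o I with I = (y, i phi+ y, i phi- y), and the superconformal derivations
    satisfy D_oo (f o I) = (i y +- i y^2 phi+ phi-) (D f) o I, which reduces everything to zero. *)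

Require Import Defs.
From HB Require Import structures.
From mathcomp Require Import all_boot all_order all_algebra finmap generic_quotient.
From mathcomp Require Import boolp classical_sets functions cardinality fsbigop.
From mathcomp Require Import reals ereal topology normedtype sequences esum exp trigo.
From mathcomp Require Import complex ring lra zify lebesgue_measure.
Set Implicit Arguments.
Unset Strict Implicit.
Unset Printing Implicit Defensive.
Import numFieldNormedType.Exports.
Import Order.TTheory GRing.Theory Num.Theory.
Local Open Scope ring_scope.
Local Open Scope classical_set_scope.
Local Open Scope quotient_scope.

(** * The Grassmann algebra *)

(** The weights 2 for x and 1 for phi+, phi- are chosen so that all substitutions preserve them
    while each L_j, J_j, G_(j-1/2) with j >= 1 strictly raises them: modulo any given weight, every
    infinite sum on the formal side is finite. From E^ only q = a_0^+ a_0^- and r = a_0^+ / a_0^-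
    are visible; recovering a_0^+ takes a square root of q r among the even elements. The stabilised
    spaces consist of pairs because A^- = 0 compares two series: it says that phi+ and phi- are
    scaled alike. Germs at zero, and sewing at infinity, multiply in the order opposite to that of
    the data, so the isomorphisms concerned pass through inversion. Infinitely many generators
    matter: fresh zeta's put in place of phi+ and phi- separate the four coefficients of a series,
    which turns statements about values into statements about scalar series. A germ at infinity says
    nothing about points whose image under I would have body 0. Series are therefore recovered from
    a punctured neighbourhood of zero, and at points with nilpotent even coordinate the sums are
    finite. *)

Section Grassmann.
Variable R : realType.
Local Notation L := (Lam R).
Local Notation sg := (@lam_sign R).
Implicit Types a b : L.

Lemma lamP a b : (forall I, a I = b I) -> a = b.
Proof. by move=> h; apply/val_inj/funext => I; exact: h. Qed.

Lemma lamDE a b I : (a + b) I = a I + b I. Proof. by []. Qed.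
Lemma lamNE a I : (- a) I = - a I. Proof. by []. Qed.
Lemma lamZE (k : R[i]) a I : (k *: a) I = k * a I. Proof. by []. Qed.
Lemma lam0E I : (0 : L) I = 0. Proof. by []. Qed.
Lemma lam1E I : (1 : L) I = (I == fset0)%:R. Proof. by []. Qed.
Lemma lam_signE a I : sg a I = (-1) ^+ #|` I| * a I. Proof. by []. Qed.

Lemma lam_sumE (T : Type) (r : seq T) P (F : T -> L) I :
  (\sum_(i <- r | P i) F i) I = \sum_(i <- r | P i) F i I.
Proof. exact: (big_morph (fun a : L => a I) (fun a b => lamDE a b I) (lam0E I)). Qed.

Lemma lam_signN a : sg (- a) = - sg a.
Proof. by apply: lamP => I; rewrite lam_signE !lamNE lam_signE mulrN. Qed.

Lemma lam_signZ (k : R[i]) a : sg (k *: a) = k *: sg a.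
Proof. by apply: lamP => I; rewrite lam_signE !lamZE lam_signE mulrCA. Qed.

Lemma lam_signMn a n : sg (a *+ n) = sg a *+ n.
Proof. by elim: n => [|n ih]; rewrite ?lam_sign0 // !mulrSr lam_signD ih. Qed.

(** Parity becomes an eigenvalue condition for [sg], the form in which all sign computations are
    done. Conversely, a coefficient of the wrong parity equals its own opposite, hence is 0 in
    characteristic 0. *)
Lemma has_parityP p a : has_parity p a <-> sg a = (-1) ^+ p *: a.
Proof.
split=> [h|h I hI].
  apply: lamP => I; rewrite lam_signE lamZE.
  have [<-|/h ->] := eqVneq (odd #|` I|) p; last by rewrite !mulr0.
  by rewrite signr_odd.
have /(congr1 (fun a : L => a I)) := h; rewrite lam_signE lamZE => /eqP.
rewrite -signr_odd -subr_eq0 -mulrBl mulf_eq0 => /orP[|/eqP //].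
have h2 : (1 + 1 : R[i]) == 0 = false by rewrite -mulr2n pnatr_eq0.
by move: hI; case: (odd _); case: p {h} => //= _; rewrite ?expr0 ?expr1 ?opprK
  ?h2 // -oppr_eq0 opprB opprK h2.
Qed.

(** For i in J and k in K, necessarily distinct, exactly one of the two orders is a crossing. The
    parity of this count is the sign for exchanging zeta_J and zeta_K. *)
Lemma crossings_sym (J K : {fset nat}) : [disjoint J & K]%fset ->
  (crossings J K + crossings K J = #|` J| * #|` K|)%N.
Proof.
move=> /fdisjointP dJK; rewrite /crossings [X in (_ + X)%N]exchange_big -big_split /=.
transitivity (\sum_(i <- J) #|` K|)%N; last first.
  by rewrite big_const_seq count_predT iter_addn_0 mulnC.
rewrite big_seq [RHS]big_seq; apply: eq_bigr => i iJ.
rewrite -big_split /= -[RHS]muln1 mulnC -[#|` K|](count_predT) -[RHS]addn0 -iter_addn -big_const_seq.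
rewrite big_seq [RHS]big_seq; apply: eq_bigr => k kK.
by case: (ltngtP k i) => // ki; have := dJK _ iJ; rewrite -ki kK.
Qed.

Lemma fpowersetC_sum (V : nmodType) (I : {fset nat}) (G : {fset nat} -> V) :
  \sum_(J <- fpowerset I) G J = \sum_(J <- fpowerset I) G (I `\` J)%fset.
Proof.
transitivity (\sum_(J <- [seq (I `\` J)%fset | J <- fpowerset I]) G J); last by rewrite big_map.
apply: perm_big; apply: uniq_perm; first exact: fset_uniq.
  rewrite map_inj_in_uniq ?fset_uniq // => M N; rewrite !fpowersetE => MI NI E.
  by rewrite -(fsetDK MI) -(fsetDK NI) E.
move=> J; apply/idP/mapP => [|[K]]; rewrite fpowersetE.
  by move=> JI; exists (I `\` J)%fset; rewrite ?fpowersetE ?fsubsetDl // fsetDK.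
by move=> KI ->; rewrite fpowersetE fsubsetDl.
Qed.

(** Only [a] has to be homogeneous: moving an odd [a] over an arbitrary [b] changes the sign of the
    odd part of [b], which is the effect of [sg]. *)
Lemma lam_supercomm p a b : has_parity p a -> a * b = iter p sg b * a.
Proof.
move=> pa; apply: lamP => I; rewrite !lamME [RHS]fpowersetC_sum.
rewrite big_seq [RHS]big_seq; apply: eq_bigr => J; rewrite fpowersetE => JI.
rewrite fsetDK //.
have [oJ|/pa ->] := eqVneq (odd #|` J|) p; last by rewrite !mulr0 mul0r.
have -> : iter p sg b (I `\` J)%fset = (-1) ^+ (p * #|` (I `\` J)%fset|) * b (I `\` J)%fset.
  by case: p {pa oJ} => /=; rewrite ?lam_signE ?mul1n // mul0n mul1r.
rewrite mulrA -exprD -[RHS]mulrA [b _ * _]mulrC mulrA; congr (_ * _ * _).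
rewrite -signr_odd -[RHS]signr_odd; congr (_ ^+ (nat_of_bool _)).
have dJ : [disjoint J & (I `\` J)]%fset.
  by apply/fdisjointP => x xJ; rewrite in_fsetD xJ.
have := congr1 odd (crossings_sym dJ).
rewrite !oddD !oddM oJ; case: p {pa oJ} => /=; rewrite ?mul1n ?mul0n ?addbF ?add0n.
all: by case: (odd (crossings J _)); case: (odd (crossings _ J)) => //=; case: (odd _).
Qed.

Lemma lam_even_comm a b : sg a = a -> a * b = b * a.
Proof.
by move=> h; apply: (@lam_supercomm false); apply/has_parityP; rewrite scale1r.
Qed.

Lemma lam_odd_comm a b : sg a = - a -> a * b = sg b * a.
Proof.
by move=> h; apply: (@lam_supercomm true); apply/has_parityP; rewrite h scaleN1r.
Qed.

Lemma has_parity_even a : has_parity false a <-> sg a = a.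
Proof. by rewrite has_parityP expr0 scale1r. Qed.

Lemma has_parity_odd a : has_parity true a <-> sg a = - a.
Proof. by rewrite has_parityP expr1 scaleN1r. Qed.

Lemma lam_sign0_even (a : Lam0 R) : sg a = a.
Proof. by apply/has_parity_even; apply/asboolP; exact: (valP a). Qed.

Lemma lam_sign1_odd (a : Lam1 R) : sg a = - (a : L).
Proof. by apply/has_parity_odd; apply/asboolP; exact: (valP a). Qed.

Lemma lam0_commC (a : Lam0 R) b : (a : L) * b = b * a.
Proof. exact: lam_even_comm (lam_sign0_even a). Qed.

Lemma lam0C : commutative (@GRing.mul (Lam0 R)).
Proof. by move=> a b; apply/val_inj; exact: lam0_commC. Qed.

(** Membership in the finite-dimensional subalgebra generated by the zeta_i with i in [U]. *)
Definition supported (U : {fset nat}) a := forall I, ~~ (I `<=` U)%fset -> a I = 0.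

Lemma supportedW (U V : {fset nat}) a : (U `<=` V)%fset -> supported U a -> supported V a.
Proof. by move=> UV h I IV; apply: h; apply: contraNN IV => IU; exact: fsubset_trans UV. Qed.

Lemma supported_ex a : exists U, supported U a.
Proof.
have /asboolP fa := valP a; exists (\bigcup_(I <- fset_set [set I | lam_val a I != 0]) I)%fset.
move=> I; apply: contraNeq => aI; apply: (@bigfcup_sup _ _ _ I xpredT id) => //.
by rewrite in_fset_set // inE.
Qed.

Lemma supportedM U a b : supported U a -> supported U b -> supported U (a * b).
Proof.
move=> ha hb I IU; rewrite lamME big_seq big1 // => J; rewrite fpowersetE => JI.
have [JU|/ha ->] := boolP (J `<=` U)%fset; last by rewrite mulr0 mul0r.
rewrite hb ?mulr0 //; apply: contraNN IU => KU.
by rewrite -(fsetUDid JI) fsubUset JU.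
Qed.

Lemma supported1 U : supported U 1.
Proof. by move=> I; rewrite lam1E; case: eqVneq => // ->; rewrite fsub0set. Qed.

Lemma body1 : body (1 : L) = 1. Proof. by rewrite /body lam1E eqxx. Qed.

Lemma bodyM a b : body (a * b) = body a * body b.
Proof.
rewrite /body lamME fpowerset0 big_seq_fset1 fsetD0 crossings0l.
by rewrite expr0 mul1r.
Qed.

(** Without a term of degree 0, [a ^+ n] starts in degree n, while no monomial on the finite support
    [U] of [a] has degree above |U|. *)
Lemma soul_nilpotent a : body a = 0 -> exists n, a ^+ n = 0.
Proof.
move=> a0; have [U hU] := supported_ex a; exists #|` U|.+1.
have supX n : supported U (a ^+ n).
  by elim: n => [|n ih]; [exact: supported1|rewrite exprS; exact: supportedM].
have degX n I : (#|` I| < n)%N -> (a ^+ n) I = 0.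
  elim: n I => // n ih I hI; rewrite exprS lamME big_seq big1 // => J.
  rewrite fpowersetE => JI; have [->|J0] := eqVneq J fset0.
    by rewrite -[a fset0]/(body a) a0 mulr0 mul0r.
  rewrite ih ?mulr0 // cardfsDS //.
  have J1 : (0 < #|` J|)%N by rewrite cardfs_gt0.
  by have := fsubset_leq_card JI; lia.
apply: lamP => I; have [IU|/supX ->//] := boolP (I `<=` U)%fset.
by apply: degX; rewrite ltnS; exact: fsubset_leq_card.
Qed.

Lemma lam_scalerAr (k : R[i]) a b : a * (k *: b) = k *: (a * b).
Proof.
have e : sg (k%:A : L) = k%:A by rewrite lam_signZ lam_sign1.
by rewrite -[b in LHS]mul1r scalerAl mulrA -(lam_even_comm _ e) -mulrA -scalerAl mul1r.
Qed.

(** After division by the body, [a] is 1 minus a nilpotent element, which the finite geometric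
    series [c] inverts. *)
Lemma lam_unitP a : (a \is a GRing.unit) = (body a != 0).
Proof.
apply/idP/idP => [ua|a0].
  apply/eqP => a0; have := body1; rewrite -(mulrV ua) bodyM a0 mul0r => /esym /eqP.
  by rewrite oner_eq0.
pose b := (body a)^-1 *: a.
have [n hn] : exists n, (1 - b) ^+ n = 0.
  apply: soul_nilpotent; rewrite /body lamDE lamNE -!/(body _) body1.
  by rewrite -[body b]/((body a)^-1 * body a) mulVf // subrr.
have h := subrX1 (1 - b) n; have h' := subrX1 (1 - b) n.
pose c := \sum_(i < n) (1 - b) ^+ i.
have bc : b * c = 1.
  by move: h; rewrite hn sub0r [X in X * _]addrAC subrr sub0r mulNr => /oppr_inj.
have cb : c * b = 1.
  have cc : GRing.comm b c.
    apply/commr_sum => i _; apply/commrX/commrB; [exact: commr1|exact: commr_refl].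
  by rewrite -cc.
apply/unitrP; exists ((body a)^-1 *: c); split.
- by rewrite -scalerAl -lam_scalerAr.
- by rewrite lam_scalerAr scalerAl.
Qed.
Lemma lam_sign_inv a : a \is a GRing.unit -> sg a^-1 = (sg a)^-1.
Proof.
move=> ua; apply: (mulrI (_ : sg a \is a GRing.unit)) => //.
  by rewrite lam_unitP /body lam_signE cardfs0 expr0 mul1r -/(body a) -lam_unitP.
by rewrite -lam_signM !divrr // ?lam_sign1 // lam_unitP /body lam_signE cardfs0
  expr0 mul1r -/(body a) -lam_unitP.
Qed.

Lemma lam0_unit (a : Lam0 R) : body a != 0 -> a \is a GRing.unit.
Proof.
move=> a0; have ua : (a : L) \is a GRing.unit by rewrite lam_unitP.
have ev : (a : L)^-1 \in @even_pred R.
  by apply/asboolP/has_parity_even; rewrite lam_sign_inv // lam_sign0_even.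
apply/unitrP; exists (MkLam0 ev).
by split; apply/val_inj; [exact: mulVr|exact: mulrV].
Qed.

Lemma lam0_unitP (a : Lam0 R) : (a \is a GRing.unit) = (body a != 0).
Proof.
apply/idP/idP => [/unitrP[b [ba ab]]|]; last exact: lam0_unit.
rewrite -lam_unitP; apply/unitrP; exists (b : L).
by split; [rewrite -[LHS]/(val (b * a)) ba|rewrite -[LHS]/(val (a * b)) ab].
Qed.

End Grassmann.

HB.instance Definition _ (R : realType) :=
  GRing.PzRing_hasCommutativeMul.Build (Lam0 R) (@lam0C R).

(** * Square roots of even elements *)

Section Sqrt.
Variable R : realType.
Implicit Types a b : Lam0 R.

Lemma lam0_valX a n : ((a ^+ n : Lam0 R) : Lam R) = (a : Lam R) ^+ n.
Proof. by elim: n => [|n ih] //; rewrite !exprS -ih. Qed.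

(* Newton iteration squares the error a - b ^ 2, which is nilpotent. *)
Lemma lam0_sqrt a : body a != 0 -> exists b, b ^+ 2 = a.
Proof.
move=> a0.
suff H n b : body b != 0 -> (a - b ^+ 2) ^+ n = 0 -> exists b, b ^+ 2 = a.
  pose b : Lam0 R := (sqrtC (body a))%:A.
  have bb : body b = sqrtC (body a).
    by rewrite -[LHS]/(sqrtC (body a) * body (1 : Lam R)) body1 mulr1.
  have [n hn] : exists n, (a - b ^+ 2 : Lam R) ^+ n = 0.
    apply: soul_nilpotent.
    rewrite -[LHS]/(body a - body ((b : Lam R) * b)) bodyM bb -expr2 sqrtCK.
    by rewrite subrr.
  apply: (H n b); first by rewrite bb sqrtC_eq0.
  by apply/val_inj; exact: etrans (lam0_valX _ _) hn.
elim/ltn_ind: n b => n ih b b0 hn.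
have [n1|n1] := leqP n 1.
  exists b; have := congr1 (fun x => x * (a - b ^+ 2) ^+ (1 - n)) hn.
  by rewrite -exprD subnKC // mul0r expr1 => /eqP; rewrite subr_eq0 => /eqP.
have ub : b \is a GRing.unit by rewrite lam0_unitP.
have u2 : (2 : Lam0 R) \is a GRing.unit.
  rewrite lam0_unitP -[body _]/(body (1 : Lam R) + body (1 : Lam R)).
  by rewrite body1 -mulr2n pnatr_eq0.
pose e := a - b ^+ 2; pose b' := b + e / (2 * b).
have e' : a - b' ^+ 2 = - (e / (2 * b)) ^+ 2.
  have -> : a = e + b ^+ 2 by rewrite subrK.
  have k : e = (e / (2 * b)) * (2 * b) by rewrite mulrVK // unitrM u2.
  by rewrite /b' {1}k; move: (e / _) => q; ring.
have eb : body e = 0.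
  have : body (e ^+ n : Lam0 R) = 0 by rewrite hn.
  have bX m : body (e ^+ m : Lam0 R) = body e ^+ m.
    by elim: m => [|m im]; [exact: body1|rewrite !exprS -im -bodyM].
  by rewrite bX => /eqP; rewrite expf_eq0 => /andP[_ /eqP].
(* The new error is a multiple of e^2, so its power [uphalf n] contains e^n = 0; since n > 1,
   [uphalf n] is smaller than n. *)
apply: (ih (uphalf n) _ b').
- by lia.
- rewrite -[body _]/(body b + body ((e : Lam R) * (2 * b)^-1 : Lam R)).
  by rewrite bodyM eb mul0r addr0.
- rewrite e' exprNn -exprM [(e / _) ^+ _]exprMn.
  have -> : (2 * uphalf n = n + (2 * uphalf n - n))%N by lia.
  by rewrite [e ^+ _]exprD hn !mul0r mulr0.
Qed.

End Sqrt.

(** * The superalgebra Lam[phi+, phi-]: parity, weights, odd derivations *)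

Section SextModule.
Variable R : realType.
Local Notation L := (Lam R).
Local Notation sg := (@lam_sign R).
Implicit Types e f : sext R.

Definition sext_scale (k : R[i]) e := SExt (k *: c0 e) (k *: cp e) (k *: cm e) (k *: cpm e).

Lemma sext_scaleA k l e : sext_scale k (sext_scale l e) = sext_scale (k * l) e.
Proof. by rewrite /sext_scale /= !scalerA. Qed.
Lemma sext_scale1 : left_id 1 sext_scale.
Proof. by case=> a b c d; rewrite /sext_scale /= !scale1r. Qed.
Lemma sext_scaleDr : right_distributive sext_scale +%R.
Proof. by move=> k e f; congr SExt; rewrite /= scalerDr. Qed.
Lemma sext_scaleDl e : {morph sext_scale^~ e : a b / a + b}.
Proof. by move=> k l; congr SExt; rewrite /= scalerDl. Qed.

HB.instance Definition _ := GRing.Zmodule_isLmodule.Build R[i] (sext R)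
  sext_scaleA sext_scale1 sext_scaleDr sext_scaleDl.
HB.instance Definition _ := GRing.Lmodule.copy (sser R) (nat -> sext R).

Lemma sextP e f : c0 e = c0 f -> cp e = cp f -> cm e = cm f -> cpm e = cpm f -> e = f.
Proof. by case: e f => [a b c d] [a' b' c' d'] /= -> -> -> ->. Qed.

Lemma c0_sum (T : Type) (r : seq T) P (F : T -> sext R) :
  c0 (\sum_(i <- r | P i) F i) = \sum_(i <- r | P i) c0 (F i).
Proof. exact: (big_morph (@c0 R)). Qed.
Lemma cp_sum (T : Type) (r : seq T) P (F : T -> sext R) :
  cp (\sum_(i <- r | P i) F i) = \sum_(i <- r | P i) cp (F i).
Proof. exact: (big_morph (@cp R)). Qed.
Lemma cm_sum (T : Type) (r : seq T) P (F : T -> sext R) :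
  cm (\sum_(i <- r | P i) F i) = \sum_(i <- r | P i) cm (F i).
Proof. exact: (big_morph (@cm R)). Qed.
Lemma cpm_sum (T : Type) (r : seq T) P (F : T -> sext R) :
  cpm (\sum_(i <- r | P i) F i) = \sum_(i <- r | P i) cpm (F i).
Proof. exact: (big_morph (@cpm R)). Qed.

(** The parity automorphism of Lam[phi+, phi-]. As phi+ and phi- are odd themselves, their
    coefficients receive an additional minus sign. *)
Definition sext_sign e := SExt (sg (c0 e)) (- sg (cp e)) (- sg (cm e)) (sg (cpm e)).

Lemma sext_signK : involutive sext_sign.
Proof. by move=> e; apply: sextP; rewrite /= ?lam_signN ?lam_signK ?opprK. Qed.

Lemma sext_signD : {morph sext_sign : e f / e + f}.
Proof. by move=> e f; apply: sextP; rewrite /= !lam_signD ?opprD. Qed.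

Lemma sext_signZ k : {morph sext_sign : e / k *: e}.
Proof. by move=> e; apply: sextP; rewrite /= !lam_signZ ?scalerN. Qed.

Lemma sext_signM : {morph sext_sign : e f / e * f}.
Proof.
move=> e f; apply: sextP; rewrite /= ?(lam_signB, lam_signD, lam_signM, lam_signK, lam_signN);
  by rewrite ?opprD ?(mulrN, mulNr, opprK).
Qed.

Lemma sext_even_comm e f : sext_sign e = e -> e * f = f * e.
Proof.
case: e f => [a b c d] [a' b' c' d'] [ea eb ec ed].
have ob : sg b = - b by rewrite -{2}eb opprK.
have oc : sg c = - c by rewrite -{2}ec opprK.
apply: sextP; rewrite /= ?ea ?ob ?oc ?mulrN ?opprK.
- exact: lam_even_comm.
- by rewrite (lam_even_comm _ ea) (lam_odd_comm _ ob) lam_signK addrC.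
- by rewrite (lam_even_comm _ ea) (lam_odd_comm _ oc) lam_signK addrC.
- rewrite (lam_even_comm _ ea) (lam_even_comm _ ed) (lam_odd_comm _ ob).
  rewrite (lam_odd_comm _ oc) !lam_signK; set x := d' * a; set y := c' * b.
  by set z := b' * c; set t := a' * d; rewrite [RHS](ACl (4*3*2*1)) /= addrAC.
Qed.

Lemma sext_odd_comm e f : sext_sign e = - e -> e * f = sext_sign f * e.
Proof.
case: e f => [a b c d] [a' b' c' d'] h.
have ea : sg a = - a := congr1 (@c0 R) h.
have eb : sg b = b := oppr_inj (congr1 (@cp R) h).
have ec : sg c = c := oppr_inj (congr1 (@cm R) h).
have ed : sg d = - d := congr1 (@cpm R) h.
apply: sextP; rewrite /= ?ea ?eb ?ec ?(mulrN, mulNr, opprK).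
- exact: lam_odd_comm.
- by rewrite (lam_odd_comm _ ea) (lam_even_comm _ eb) addrC.
- by rewrite (lam_odd_comm _ ea) (lam_even_comm _ ec) addrC.
- rewrite (lam_odd_comm _ ea) (lam_odd_comm _ ed) (lam_even_comm _ eb).
  rewrite (lam_even_comm _ ec).
  by rewrite ?lam_signK [RHS](ACl (4*3*2*1)).
Qed.

(* phi+ and phi- have weight 1. *)
Definition sext_wt k e := [/\ ((0 < k)%N -> c0 e = 0), ((1 < k)%N -> cp e = 0),
  ((1 < k)%N -> cm e = 0) & ((2 < k)%N -> cpm e = 0)].

Lemma sext_wtW k l e : (l <= k)%N -> sext_wt k e -> sext_wt l e.
Proof. by move=> lk [h1 h2 h3 h4]; split=> h; [apply: h1|apply: h2|apply: h3|apply: h4]; lia. Qed.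

Lemma sext_wt_eq0 k e : (2 < k)%N -> sext_wt k e -> e = 0.
Proof. by move=> k2 [h1 h2 h3 h4]; apply: sextP; rewrite ?h1 ?h2 ?h3 ?h4 //; lia. Qed.

Lemma sext_wtD k e f : sext_wt k e -> sext_wt k f -> sext_wt k (e + f).
Proof.
move=> [h1 h2 h3 h4] [k1 k2 k3 k4]; split=> hk /=;
  by rewrite ?h1 ?h2 ?h3 ?h4 ?k1 ?k2 ?k3 ?k4 ?addr0.
Qed.

Lemma sext_wtN k e : sext_wt k e -> sext_wt k (- e).
Proof.
by move=> [h1 h2 h3 h4]; split=> hk /=; rewrite ?h1 ?h2 ?h3 ?h4 ?oppr0.
Qed.

Lemma sext_wtZ k c e : sext_wt k e -> sext_wt k (c *: e).
Proof.
by move=> [h1 h2 h3 h4]; split=> hk /=; rewrite ?h1 ?h2 ?h3 ?h4 ?scaler0.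
Qed.

Lemma sext_wt_sign k e : sext_wt k e -> sext_wt k (sext_sign e).
Proof.
by move=> [h1 h2 h3 h4]; split=> hk /=; rewrite ?h1 ?h2 ?h3 ?h4 ?lam_sign0 ?oppr0.
Qed.

Lemma sext_wt_sum k (T : Type) (r : seq T) (P : pred T) (F : T -> sext R) :
  (forall i, P i -> sext_wt k (F i)) -> sext_wt k (\sum_(i <- r | P i) F i).
Proof. by move=> h; elim/big_ind: _ => //; exact: sext_wtD. Qed.

Lemma sext_wtM k l e f : sext_wt k e -> sext_wt l f -> sext_wt (k + l) (e * f).
Proof.
move=> [h1 h2 h3 h4] [k1 k2 k3 k4].
have M (a b : L) (p q : bool) : (p -> a = 0) -> (q -> b = 0) -> p || q -> a * b = 0.
  by move=> ha hb /orP[/ha ->|/hb ->]; rewrite ?mul0r ?mulr0.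
have S (a : L) (p : bool) : (p -> a = 0) -> p -> sg a = 0.
  by move=> ha /ha ->; rewrite lam_sign0.
split=> hk /=.
- by rewrite (M _ _ _ _ h1 k1) //; lia.
- by rewrite (M _ _ _ _ h1 k2) ?(M _ _ _ _ h2 (S _ _ k1)) ?addr0 //; lia.
- by rewrite (M _ _ _ _ h1 k3) ?(M _ _ _ _ h3 (S _ _ k1)) ?addr0 //; lia.
- rewrite (M _ _ _ _ h1 k4) ?(M _ _ _ _ h2 (S _ _ k3)) ?(M _ _ _ _ h3 (S _ _ k2))
    ?(M _ _ _ _ h4 k1) ?subr0 ?addr0 //; lia.
Qed.

Definition sext_dp e : sext R := SExt (sg (cp e)) 0 (sg (cpm e)) 0.
Definition sext_dm e : sext R := SExt (sg (cm e)) (- sg (cpm e)) 0 0.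

Lemma sext_dpM e f : sext_dp (e * f) = sext_dp e * f + sext_sign e * sext_dp f.
Proof.
apply: sextP => /=; rewrite ?(lam_signB, lam_signD, lam_signM, lam_signK, lam_signN, lam_sign0);
  rewrite ?(mulr0, mul0r, mulNr, mulrN, addr0, subr0, oppr0, sub0r, opprK).
- by rewrite addrC.
- by rewrite subrr.
- by rewrite !addrA [RHS](ACl (3*1*4*2)).
- by rewrite addrACA subrr addNr addr0.
Qed.

Lemma sext_dmM e f : sext_dm (e * f) = sext_dm e * f + sext_sign e * sext_dm f.
Proof.
apply: sextP => /=; rewrite ?(lam_signB, lam_signD, lam_signM, lam_signK, lam_signN, lam_sign0);
  rewrite ?(mulr0, mul0r, mulNr, mulrN, addr0, subr0, oppr0, sub0r, opprK, opprD, opprB).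
- by rewrite addrC.
- by rewrite !addrA [RHS](ACl (3*4*1*2)).
- by rewrite subrr.
- by rewrite addrACA subrr addNr addr0.
Qed.

End SextModule.

(** * Series in x, phi+, phi- and their weights *)

Section Sser.
Variable R : realType.
Local Notation L := (Lam R).
Local Notation sg := (@lam_sign R).
Local Notation S := (sser R).
Implicit Types f g h : S.

Definition sser_sign f : S := fun n => sext_sign (f n).
Local Notation sgS := sser_sign.

Lemma sserP f g : (forall n, f n = g n) -> f = g.
Proof. by move=> h; apply/funext. Qed.

Lemma sserDE f g n : (f + g) n = f n + g n. Proof. by []. Qed.
Lemma sserNE f n : (- f) n = - f n. Proof. by []. Qed.
Lemma sserBE f g n : (f - g) n = f n - g n. Proof. by []. Qed.
Lemma sserME f g n : (f * g) n = \sum_(i < n.+1) f i * g (n - i)%N. Proof. by []. Qed.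
Lemma sser1E n : (1 : S) n = (n == 0%N)%:R. Proof. by []. Qed.
Lemma sser_sumE (T : Type) (r : seq T) P (F : T -> S) n :
  (\sum_(i <- r | P i) F i) n = \sum_(i <- r | P i) F i n.
Proof. exact: (big_morph (fun f : S => f n) (fun f g => sserDE f g n)). Qed.

Lemma sser_signD : {morph sgS : f g / f + g}.
Proof. by move=> f g; apply: sserP => n; exact: sext_signD. Qed.
Lemma sser_signZ k : {morph sgS : f / k *: f}.
Proof. by move=> f; apply: sserP => n; exact: sext_signZ. Qed.
Lemma sser_signK : involutive sgS.
Proof. by move=> f; apply: sserP => n; exact: sext_signK. Qed.
Lemma sser_sign0 : sgS 0 = 0.
Proof. by apply: (addrI (sgS 0)); rewrite -sser_signD !addr0. Qed.
Lemma sser_signN : {morph sgS : f / - f}.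
Proof. by move=> f; apply: (addrI (sgS f)); rewrite -sser_signD !subrr sser_sign0. Qed.

Lemma sext_sign_sum (T : Type) (r : seq T) P (F : T -> sext R) :
  sext_sign (\sum_(i <- r | P i) F i) = \sum_(i <- r | P i) sext_sign (F i).
Proof.
apply: (big_morph _ (@sext_signD R)).
by apply: sextP; rewrite /= ?lam_sign0 ?oppr0.
Qed.

Lemma sser_signM : {morph sgS : f g / f * g}.
Proof.
move=> f g; apply: sserP => n; rewrite /sgS !sserME sext_sign_sum.
by apply: eq_bigr => i _; rewrite sext_signM.
Qed.

Lemma sser_even_comm f g : sgS f = f -> f * g = g * f.
Proof.
move=> ef; apply: sserP => n; rewrite !sserME (reindex_inj rev_ord_inj) /=.
apply: eq_bigr => i _; rewrite subSS; have ni : (n - (n - i) = i)%N by have := ltn_ord i; lia.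
rewrite ni; apply: sext_even_comm; exact: (congr1 (fun f : S => f (n - i)%N) ef).
Qed.

Lemma sser_odd_comm f g : sgS f = - f -> f * g = sgS g * f.
Proof.
move=> ef; apply: sserP => n; rewrite !sserME (reindex_inj rev_ord_inj) /=.
apply: eq_bigr => i _; rewrite subSS; have ni : (n - (n - i) = i)%N by have := ltn_ord i; lia.
rewrite ni; apply: sext_odd_comm; exact: (congr1 (fun f : S => f (n - i)%N) ef).
Qed.

Lemma sserM_local f f' g n : (forall i, (i <= n)%N -> f i = f' i) -> (f * g) n = (f' * g) n.
Proof.
by move=> h; rewrite !sserME; apply: eq_bigr => i _; rewrite h // -ltnS.
Qed.

Lemma constSE (a : L) f n : (constS a * f) n = SExt a 0 0 0 * f n.
Proof.
rewrite sserME big_ord_recl subn0 big1 ?addr0 // => i _.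
by rewrite mul0r.
Qed.

Lemma constS_mul_comp (a : L) (e : sext R) :
  SExt a 0 0 0 * e = SExt (a * c0 e) (a * cp e) (a * cm e) (a * cpm e).
Proof. by apply: sextP; rewrite /= ?mul0r ?addr0 ?subr0. Qed.

Lemma constSD (a b : L) : constS (a + b) = constS a + constS b.
Proof. by apply: sserP => -[|n]; rewrite sserDE /constS //=; apply: sextP; rewrite /= ?addr0. Qed.
Lemma constS0 : constS (0 : L) = 0.
Proof. by apply: sserP => -[|n]. Qed.
Lemma constSM (a b : L) : constS (a * b) = constS a * constS b.
Proof.
apply: sserP => n; rewrite constSE constS_mul_comp /constS; case: n => [|n] /=;
  by apply: sextP; rewrite /= ?mulr0.
Qed.
Lemma constS1 : constS (1 : L) = 1. Proof. by apply: sserP => -[|n]. Qed.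
Lemma constSN (a : L) : constS (- a) = - constS a.
Proof. by apply: (addrI (constS a)); rewrite -constSD !subrr constS0. Qed.
Lemma constSZ (k : R[i]) f : constS k%:A * f = k *: f.
Proof.
by apply: sserP => n; rewrite constSE constS_mul_comp; apply: sextP;
  rewrite /= -scalerAl mul1r.
Qed.
Lemma sser_sign_const (a : L) : sgS (constS a) = constS (sg a).
Proof. by apply: sserP => -[|n]; apply: sextP; rewrite /= ?lam_sign0 ?oppr0. Qed.

Lemma sser_scaleAl (k : R[i]) f g : k *: (f * g) = (k *: f) * g.
Proof. by rewrite -!constSZ mulrA. Qed.
Lemma sser_scaleAr (k : R[i]) f g : k *: (f * g) = f * (k *: g).
Proof.
have e : sgS (constS (k%:A : L)) = constS k%:A by rewrite sser_sign_const lam_signZ lam_sign1.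
by rewrite -!constSZ !mulrA (sser_even_comm f e).
Qed.

Lemma sser_sign_varx : sgS (varx R) = varx R.
Proof. by apply: sserP => n; rewrite /sgS /varx; case: eqP => _; apply: sextP; rewrite /= ?lam_sign1 ?lam_sign0 ?oppr0. Qed.
Lemma sser_sign_phip : sgS (phip R) = - phip R.
Proof. by apply: sserP => -[|n]; apply: sextP; rewrite /= ?lam_sign1 ?lam_sign0 ?oppr0. Qed.
Lemma sser_sign_phim : sgS (phim R) = - phim R.
Proof. by apply: sserP => -[|n]; apply: sextP; rewrite /= ?lam_sign1 ?lam_sign0 ?oppr0. Qed.

Lemma varxXE k n : (varx R ^+ k) n = (n == k)%:R.
Proof.
elim: k n => [|k ih] n; first by rewrite expr0.
rewrite exprS sserME; case: n => [|n].
  by rewrite big_ord1 /varx mul0r.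
rewrite big_ord_recl /varx mul0r add0r big_ord_recl /= mul1r ih subSS subn0 eqSS.
by rewrite big1 ?addr0 // => i _; rewrite mul0r.
Qed.

Lemma varxX_mulE k f n : (varx R ^+ k * f) n = if (k <= n)%N then f (n - k)%N else 0.
Proof.
rewrite sserME; case: ifP => kn.
  have kn' : (k < n.+1)%N by [].
  rewrite (bigD1 (Ordinal kn')) //= varxXE eqxx mul1r big1 ?addr0 // => i ik.
  rewrite varxXE; have -> : (i == k :> nat) = false; last by rewrite mul0r.
  by apply/eqP => e; case/eqP: ik; apply/val_inj.
apply: big1 => i _; rewrite varxXE; have -> : (i == k :> nat) = false; last by rewrite mul0r.
by apply/eqP => e; move: kn; rewrite -e -ltnS ltn_ord.
Qed.

Lemma phip_mulE f n : (phip R * f) n = SExt 0 (sg (c0 (f n))) 0 (sg (cm (f n))).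
Proof.
rewrite sserME big_ord_recl subn0 big1 ?addr0 => [|i _]; last by rewrite mul0r.
by apply: sextP; rewrite /= ?mul0r ?mul1r ?subr0 ?addr0 ?add0r.
Qed.

Lemma phim_mulE f n : (phim R * f) n = SExt 0 0 (sg (c0 (f n))) (- sg (cp (f n))).
Proof.
rewrite sserME big_ord_recl subn0 big1 ?addr0 => [|i _]; last by rewrite mul0r.
by apply: sextP; rewrite /= ?mul0r ?mul1r ?addr0 ?add0r.
Qed.

Lemma dxD : {morph @dx R : f g / f + g}.
Proof. by move=> f g; apply: sserP => n; rewrite /dx mulrnDl. Qed.
Lemma dphipD : {morph @dphip R : f g / f + g}.
Proof. by move=> f g; apply: sserP => n; apply: sextP; rewrite /= ?lam_signD ?addr0. Qed.
Lemma dphimD : {morph @dphim R : f g / f + g}.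
Proof. by move=> f g; apply: sserP => n; apply: sextP; rewrite /= ?lam_signD ?opprD ?addr0. Qed.

Lemma dxM f g : dx (f * g) = dx f * g + f * dx g.
Proof.
apply: sserP => n; rewrite sserDE {1}/dx !sserME.
(* The factor n + 1 is split as i + (n + 1 - i) between the two factors of each term. *)
transitivity (\sum_(i < n.+2) (f i *+ i * g (n.+1 - i)%N + f i * (g (n.+1 - i)%N *+ (n.+1 - i)%N))).
  rewrite -sumrMnl; apply: eq_bigr => i _.
  rewrite mulrnAl mulrnAr -mulrnDr subnKC //; by have := ltn_ord i; lia.
rewrite big_split /=; congr (_ + _).
  rewrite big_ord_recl mulr0n mul0r add0r; apply: eq_bigr => i _.
  by rewrite lift0 subSS.
rewrite big_ord_recr /= subnn mulr0n mulr0 addr0; apply: eq_bigr => i _.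
by rewrite /dx /= subSn // -ltnS.
Qed.

Lemma dphipM f g : dphip (f * g) = dphip f * g + sgS f * dphip g.
Proof.
apply: sserP => n; rewrite sserDE !sserME -big_split /=.
have -> : dphip (f * g) n = sext_dp (\sum_(i < n.+1) f i * g (n - i)%N) by [].
rewrite (big_morph _ (id1 := 0) (op1 := +%R) (_ : {morph @sext_dp R : a b / a + b})) //.
- by apply: eq_bigr => i _; exact: sext_dpM.
- by move=> a b; apply: sextP; rewrite /= ?lam_signD ?addr0.
- by apply: sextP; rewrite /= ?lam_sign0.
Qed.

Lemma dphimM f g : dphim (f * g) = dphim f * g + sgS f * dphim g.
Proof.
apply: sserP => n; rewrite sserDE !sserME -big_split /=.
have -> : dphim (f * g) n = sext_dm (\sum_(i < n.+1) f i * g (n - i)%N) by [].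
rewrite (big_morph _ (id1 := 0) (op1 := +%R) (_ : {morph @sext_dm R : a b / a + b})) //.
- by apply: eq_bigr => i _; exact: sext_dmM.
- by move=> a b; apply: sextP; rewrite /= ?lam_signD ?opprD ?addr0.
- by apply: sextP; rewrite /= ?lam_sign0 ?oppr0.
Qed.

Lemma sext_natmul (e : sext R) n : e *+ n = SExt (c0 e *+ n) (cp e *+ n) (cm e *+ n) (cpm e *+ n).
Proof. by elim: n => [|n ih] //; rewrite !mulrSr ih. Qed.

Lemma dphip_dphip f : dphip (dphip f) = 0.
Proof. by apply: sserP => n; apply: sextP; rewrite /= ?lam_sign0. Qed.
Lemma dphim_dphim f : dphim (dphim f) = 0.
Proof. by apply: sserP => n; apply: sextP; rewrite /= ?lam_sign0 ?oppr0. Qed.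
Lemma dphip_dphim f : dphip (dphim f) = - dphim (dphip f).
Proof. by apply: sserP => n; apply: sextP; rewrite /= ?lam_sign0 ?oppr0 ?lam_signN. Qed.
Lemma dphip_dx f : dphip (dx f) = dx (dphip f).
Proof.
by apply: sserP => n; rewrite /dphip /dx !sext_natmul /= !lam_signMn; apply: sextP; rewrite /= ?mul0rn.
Qed.
Lemma dphim_dx f : dphim (dx f) = dx (dphim f).
Proof.
by apply: sserP => n; rewrite /dphim /dx !sext_natmul /= !lam_signMn; apply: sextP; rewrite /= ?mul0rn ?mulNrn.
Qed.
Lemma sser_sign_dx f : sgS (dx f) = dx (sgS f).
Proof.
apply: sserP => n; rewrite /sgS /dx !sext_natmul /sext_sign /=.
by apply: sextP; rewrite /= ?mulNrn ?lam_signMn.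
Qed.
Lemma sser_sign_dphip f : sgS (dphip f) = - dphip (sgS f).
Proof. by apply: sserP => n; apply: sextP; rewrite /= ?lam_signN ?lam_signK ?opprK ?lam_sign0 ?oppr0. Qed.
Lemma sser_sign_dphim f : sgS (dphim f) = - dphim (sgS f).
Proof. by apply: sserP => n; apply: sextP; rewrite /= ?lam_signN ?lam_signK ?opprK ?lam_sign0 ?oppr0. Qed.

Lemma dx_varx : dx (varx R) = 1.
Proof. by apply: sserP => -[|n]; rewrite /dx /varx ?sser1E //= mul0rn. Qed.
Lemma dx_phip : dx (phip R) = 0.
Proof. by apply: sserP => n; rewrite /dx /phip /= mul0rn. Qed.
Lemma dx_phim : dx (phim R) = 0.
Proof. by apply: sserP => n; rewrite /dx /phim /= mul0rn. Qed.
Lemma dx_const (a : L) : dx (constS a) = 0.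
Proof. by apply: sserP => n; rewrite /dx /constS /= mul0rn. Qed.
Lemma dphip_varx : dphip (varx R) = 0.
Proof. by apply: sserP => n; rewrite /dphip /varx; case: eqP => _; apply: sextP; rewrite /= ?lam_sign0. Qed.
Lemma dphim_varx : dphim (varx R) = 0.
Proof. by apply: sserP => n; rewrite /dphim /varx; case: eqP => _; apply: sextP; rewrite /= ?lam_sign0 ?oppr0. Qed.
Lemma dphip_phip : dphip (phip R) = 1.
Proof. by apply: sserP => -[|n]; apply: sextP; rewrite /= ?lam_sign0 ?lam_sign1. Qed.
Lemma dphim_phim : dphim (phim R) = 1.
Proof. by apply: sserP => -[|n]; apply: sextP; rewrite /= ?lam_sign0 ?lam_sign1 ?oppr0. Qed.
Lemma dphip_phim : dphip (phim R) = 0.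
Proof. by apply: sserP => -[|n]; apply: sextP; rewrite /= ?lam_sign0 ?lam_sign1 ?oppr0. Qed.
Lemma dphim_phip : dphim (phip R) = 0.
Proof. by apply: sserP => -[|n]; apply: sextP; rewrite /= ?lam_sign0 ?lam_sign1 ?oppr0. Qed.
Lemma dphip_const (a : L) : dphip (constS a) = 0.
Proof. by apply: sserP => -[|n]; apply: sextP; rewrite /= ?lam_sign0. Qed.
Lemma dphim_const (a : L) : dphim (constS a) = 0.
Proof. by apply: sserP => -[|n]; apply: sextP; rewrite /= ?lam_sign0 ?oppr0. Qed.

(* x has weight 2. *)
Definition wt k f := forall n, sext_wt (k - 2 * n) (f n).

Lemma wtW k l f : (l <= k)%N -> wt k f -> wt l f.
Proof. by move=> lk h n; apply: sext_wtW (h n); lia. Qed.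
Lemma wt0 f : wt 0 f. Proof. by []. Qed.
Lemma wtD k f g : wt k f -> wt k g -> wt k (f + g).
Proof. by move=> hf hg n; exact: sext_wtD. Qed.
Lemma wtN k f : wt k f -> wt k (- f).
Proof. by move=> hf n; exact: sext_wtN. Qed.
Lemma wtB k f g : wt k f -> wt k g -> wt k (f - g).
Proof. by move=> hf hg; apply: wtD => //; exact: wtN. Qed.
Lemma wtZ k c f : wt k f -> wt k (c *: f).
Proof. by move=> hf n; exact: sext_wtZ. Qed.
Lemma wt_sum k (T : Type) (r : seq T) (P : pred T) (F : T -> S) :
  (forall i, P i -> wt k (F i)) -> wt k (\sum_(i <- r | P i) F i).
Proof. by move=> h; elim/big_ind: _ => //; exact: wtD. Qed.
Lemma wt_sign k f : wt k f -> wt k (sgS f).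
Proof. by move=> hf n; exact: sext_wt_sign. Qed.
Lemma wtM k l f g : wt k f -> wt l g -> wt (k + l) (f * g).
Proof.
move=> hf hg n; rewrite sserME; apply: sext_wt_sum => i _.
by apply: sext_wtW (sext_wtM (hf i) (hg (n - i)%N)); have := ltn_ord i; lia.
Qed.
Lemma wtMr k f g : wt k g -> wt k (f * g).
Proof. by move=> hg; exact: (wtM (wt0 f) hg). Qed.
Lemma wtMl k f g : wt k f -> wt k (f * g).
Proof. by move=> hf; rewrite -[k]addn0; exact: (wtM hf (wt0 g)). Qed.
Lemma wtX k f n : wt k f -> wt (k * n) (f ^+ n).
Proof.
move=> hf; elim: n => [|n ih]; first by rewrite muln0.
by rewrite exprS mulnS; exact: wtM.
Qed.
(** The heaviest monomial containing x^n is x^n phi+ phi-, of weight 2 n + 2; all later truncation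
    bounds come from this number. *)
Lemma wt_coef k f n : wt k f -> (2 * n + 2 < k)%N -> f n = 0.
Proof. by move=> hf h; apply: sext_wt_eq0 (hf n); lia. Qed.
Lemma wt_eq0 f : (forall k, wt k f) -> f = 0.
Proof. by move=> h; apply: sserP => n; apply: (wt_coef (h (2 * n + 3)%N)); lia. Qed.
Lemma wt_sep f g : (forall k, wt k (f - g)) -> f = g.
Proof. by move=> /wt_eq0 /eqP; rewrite subr_eq0 => /eqP. Qed.
Lemma wt_varx : wt 2 (varx R).
Proof.
move=> [|n]; first by split.
by have -> : (2 - 2 * n.+1 = 0)%N by lia.
Qed.
Lemma wt_phip : wt 1 (phip R).
Proof. by move=> [|n]; split. Qed.
Lemma wt_phim : wt 1 (phim R).
Proof. by move=> [|n]; split. Qed.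
Lemma wt_dx k f : wt k f -> wt (k - 2) (dx f).
Proof.
move=> hf n; rewrite /dx sext_natmul; have := hf n.+1.
by move=> [h1 h2 h3 h4]; split=> hk /=; rewrite ?h1 ?h2 ?h3 ?h4 ?mul0rn //; lia.
Qed.
Lemma wt_dphip k f : wt k f -> wt (k - 1) (dphip f).
Proof.
move=> hf n; have := hf n.
by move=> [h1 h2 h3 h4]; split=> hk /=; rewrite ?h2 ?h4 ?lam_sign0 //; lia.
Qed.
Lemma wt_dphim k f : wt k f -> wt (k - 1) (dphim f).
Proof.
move=> hf n; have := hf n.
by move=> [h1 h2 h3 h4]; split=> hk /=; rewrite ?h3 ?h4 ?lam_sign0 ?oppr0 //; lia.
Qed.

End Sser.

(** Sorts a combination of L_j, J_j, G+, G- by the derivatives u, v, w with respect to x, phi+,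
    phi-. No factor is moved past another, so the identity holds in any non-commutative ring and no
    sign rule enters. *)
Lemma ring_regroup (T : pzRingType) (a b c d e r x2 x1 x0 p m u v w : T) :
  - (a * - (x2 * u + r * x1 * (p * v + m * w)) + b * - (x1 * (p * v - m * w))
     + c * - (x1 * (v - m * u) + x0 * p * m * v) + d * - (x1 * (w - p * u) - x0 * p * m * w))
  = (a * x2 - c * x1 * m - d * x1 * p) * u
    + (a * r * x1 * p + b * x1 * p + c * x1 + c * x0 * p * m) * v
    + (a * r * x1 * m - b * x1 * m + d * x1 - d * x0 * p * m) * w.
Proof.
rewrite !(mulrDl, mulrDr, mulrN, mulNr, opprK, opprD, mulrA, addrA).
by rewrite [LHS](ACl (1*7*10*2*4*6*8*3*5*9*11)).
Qed.

(** * Vector fields *)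

Section VectorFields.
Variable R : realType.
Local Notation L := (Lam R).
Local Notation sg := (@lam_sign R).
Local Notation sgS := (@sser_sign R).
Local Notation S := (sser R).
Local Notation data := (data R).
Implicit Types (f g h : S) (A B : data).

(** The effect on a coefficient sequence of multiplication by x^k. *)
Definition shiftn k (u : nat -> L) n : L := if (k <= n)%N then u (n - k)%N else 0.

(* - vfield A = vfx A d/dx + vfp A d/dphi+ + vfm A d/dphi- *)
Definition vfx A : S := fun n => SExt (shiftn 2 (fun k => A.1.1.1 k : L) n)
  (- shiftn 1 (fun k => A.2 k : L) n) (- shiftn 1 (fun k => A.1.2 k : L) n) 0.
Definition vfp A : S := fun n => SExt (shiftn 1 (fun k => A.1.2 k : L) n)
  ((n.+1%:R / 2 : R[i]) *: shiftn 1 (fun k => A.1.1.1 k : L) n + shiftn 1 (fun k => A.1.1.2 k : L) n)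
  0 ((A.1.2 n : L) *+ n.+1).
Definition vfm A : S := fun n => SExt (shiftn 1 (fun k => A.2 k : L) n) 0
  ((n.+1%:R / 2 : R[i]) *: shiftn 1 (fun k => A.1.1.1 k : L) n - shiftn 1 (fun k => A.1.1.2 k : L) n)
  (- (A.2 n : L) *+ n.+1).

Definition vf A f : S := vfx A * dx f + vfp A * dphip f + vfm A * dphim f.

Local Notation x := (varx R).
Local Notation pp := (phip R).
Local Notation pm := (phim R).

Lemma ssum_trunc N (u : nat -> S) n : (forall k, (N <= k)%N -> u k n = 0) ->
  ssum u n = \sum_(k < N) u k n.
Proof.
move=> h; rewrite /ssum -(fsbig_widen `I_N) -?fsbig_ord // => k [_ /negP] /=.
by rewrite -leqNgt => /h.
Qed.

Lemma constS_xXE (a : L) k n : (constS a * x ^+ k) n = if n == k then SExt a 0 0 0 else 0.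
Proof. by rewrite constSE varxXE; case: eqP => _; rewrite ?mulr1 ?mulr0. Qed.

Definition vfx_term A k : S := constS (A.1.1.1 k : L) * x ^+ k.+2
  - constS (A.1.2 k : L) * x ^+ k.+1 * pm - constS (A.2 k : L) * x ^+ k.+1 * pp.
Definition vfp_term A k : S :=
  constS (A.1.1.1 k : L) * constS (k.+2%:R / 2)%:A * x ^+ k.+1 * pp
  + constS (A.1.1.2 k : L) * x ^+ k.+1 * pp
  + constS (A.1.2 k : L) * x ^+ k.+1 + constS (A.1.2 k : L) * (x ^+ k *+ k.+1) * pp * pm.
Definition vfm_term A k : S :=
  constS (A.1.1.1 k : L) * constS (k.+2%:R / 2)%:A * x ^+ k.+1 * pm
  - constS (A.1.1.2 k : L) * x ^+ k.+1 * pm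
  + constS (A.2 k : L) * x ^+ k.+1 - constS (A.2 k : L) * (x ^+ k *+ k.+1) * pp * pm.

Lemma vf_term A k f :
  - (constS (A.1.1.1 k : L) * Lop k.+1 f + constS (A.1.1.2 k : L) * Jop k.+1 f
     + constS (A.1.2 k : L) * Gpop k.+1 f + constS (A.2 k : L) * Gmop k.+1 f)
  = vfx_term A k * dx f + vfp_term A k * dphip f + vfm_term A k * dphim f.
Proof.
exact: ring_regroup.
Qed.

Lemma sum_shift (u : nat -> L) k N n : (n < N + k)%N ->
  \sum_(j < N) (if n == (j + k)%N then u j else 0) = shiftn k u n.
Proof.
move=> nN; rewrite /shiftn; case: leqP => kn.
  have h : (n - k < N)%N by lia.
  rewrite (bigD1 (Ordinal h)) //= subnK // eqxx big1 ?addr0 // => i ik.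
  case: eqP => // e; case/eqP: ik; apply/val_inj => /=; lia.
by apply: big1 => i _; case: eqP => // e; move: kn; rewrite e; lia.
Qed.

Definition emb (u : nat -> L) : S := fun n => SExt (u n) 0 0 0.

Lemma constSMn (a : L) n : constS (a *+ n) = constS a *+ n.
Proof. by elim: n => [|n ih]; rewrite ?constS0 // !mulrSr constSD ih. Qed.

Lemma sum_emb (u : nat -> L) c N n : (n < N + c)%N ->
  (\sum_(k < N) constS (u k) * x ^+ (k + c)) n = emb (shiftn c u) n.
Proof.
move=> nN; rewrite sser_sumE; apply: sextP; rewrite /= ?c0_sum ?cp_sum ?cm_sum ?cpm_sum.
- rewrite -(sum_shift _ nN); apply: eq_bigr => k _; rewrite constS_xXE; by case: eqP.
- by apply: big1 => k _; rewrite constS_xXE; case: eqP.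
- by apply: big1 => k _; rewrite constS_xXE; case: eqP.
- by apply: big1 => k _; rewrite constS_xXE; case: eqP.
Qed.

Lemma emb_mulE (u : nat -> L) (e : sext R) n :
  (emb u * (fun k => if k == 0%N then e else 0) : S) n = SExt (u n) 0 0 0 * e.
Proof.
rewrite sserME big_ord_recr /= subnn big1 ?add0r // => i _.
by have -> : (n - i == 0)%N = false by [have := ltn_ord i; lia]; rewrite mulr0.
Qed.

Lemma phi_mulE : pp * pm = fun k => if k == 0%N then SExt 0 0 0 1 else 0.
Proof.
apply: sserP => n; rewrite phip_mulE /phim; case: eqP => _; apply: sextP;
  by rewrite /= ?lam_sign0 ?lam_sign1.
Qed.

Lemma emb_phip (u : nat -> L) n : (emb u * pp) n = SExt 0 (u n) 0 0.
Proof.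
by rewrite emb_mulE; apply: sextP; rewrite /= ?lam_sign0 ?lam_sign1 ?mulr0 ?mulr1 ?mul0r ?oppr0 ?addr0.
Qed.
Lemma emb_phim (u : nat -> L) n : (emb u * pm) n = SExt 0 0 (u n) 0.
Proof.
by rewrite emb_mulE; apply: sextP; rewrite /= ?lam_sign0 ?lam_sign1 ?mulr0 ?mulr1 ?mul0r ?oppr0 ?addr0.
Qed.
Lemma emb_phipm (u : nat -> L) n : (emb u * pp * pm) n = SExt 0 0 0 (u n).
Proof.
rewrite -mulrA phi_mulE emb_mulE; apply: sextP;
  by rewrite /= ?lam_sign0 ?lam_sign1 ?mulr0 ?mulr1 ?mul0r ?oppr0 ?addr0.
Qed.

Lemma vfxE A : vfx A = emb (shiftn 2 (fun k => A.1.1.1 k : L))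
  - emb (shiftn 1 (fun k => A.1.2 k : L)) * pm - emb (shiftn 1 (fun k => A.2 k : L)) * pp.
Proof.
apply: sserP => n; rewrite !sserBE emb_phip emb_phim.
by apply: sextP; rewrite /= ?subr0 ?sub0r.
Qed.

Lemma shiftn_scale (a : nat -> L) n :
  shiftn 1 (fun k => (k.+2%:R / 2 : R[i]) *: a k) n = (n.+1%:R / 2 : R[i]) *: shiftn 1 a n.
Proof. by rewrite /shiftn; case: n => [|n] /=; rewrite ?scaler0 // subn1. Qed.

Lemma vfpE A : vfp A = emb (shiftn 1 (fun k => (k.+2%:R / 2 : R[i]) *: (A.1.1.1 k : L))) * pp
  + emb (shiftn 1 (fun k => A.1.1.2 k : L)) * pp
  + emb (shiftn 1 (fun k => A.1.2 k : L)) + emb (shiftn 0 (fun k => (A.1.2 k : L) *+ k.+1)) * pp * pm.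
Proof.
apply: sserP => n; rewrite !sserDE !emb_phip emb_phipm.
by apply: sextP; rewrite /= ?shiftn_scale ?addr0 ?add0r // /shiftn /= subn0.
Qed.

Lemma vfmE A : vfm A = emb (shiftn 1 (fun k => (k.+2%:R / 2 : R[i]) *: (A.1.1.1 k : L))) * pm
  - emb (shiftn 1 (fun k => A.1.1.2 k : L)) * pm
  + emb (shiftn 1 (fun k => A.2 k : L)) - emb (shiftn 0 (fun k => (A.2 k : L) *+ k.+1)) * pp * pm.
Proof.
apply: sserP => n; rewrite sserBE emb_phipm !sserDE sserNE !emb_phim.
apply: sextP; rewrite /= ?shiftn_scale ?oppr0 ?addr0 ?add0r //.
by rewrite /shiftn /= subn0 mulNrn.
Qed.

Lemma sum_emb_eq (F : nat -> S) (u : nat -> L) c N n :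
  (forall k, F k = constS (u k) * x ^+ (k + c)) -> (n < N)%N ->
  (\sum_(k < N) F k) n = emb (shiftn c u) n.
Proof.
move=> hF nN; rewrite -(@sum_emb _ _ N) ?ltn_addr //.
by congr (_ n); apply: eq_bigr => k _; exact: hF.
Qed.

Lemma constS_scale_r (r : R[i]) (a : L) : constS a * constS r%:A = constS (r *: a).
Proof. by rewrite -constSM lam_scalerAr mulr1. Qed.

Lemma sserD_eq f f' g g' n : f n = f' n -> g n = g' n -> (f + g) n = (f' + g') n.
Proof. by rewrite !sserDE => -> ->. Qed.
Lemma sserN_eq f f' n : f n = f' n -> (- f) n = (- f') n.
Proof. by rewrite !sserNE => ->. Qed.

Lemma vfx_sum A N n : (n < N)%N -> (\sum_(k < N) vfx_term A k) n = vfx A n.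
Proof.
move=> nN; rewrite /vfx_term !sumrB -!mulr_suml vfxE.
apply: sserD_eq; [apply: sserD_eq; [|apply: sserN_eq]|apply: sserN_eq].
- apply: (@sum_emb_eq (fun k => constS (A.1.1.1 k : L) * x ^+ k.+2) (fun k => A.1.1.1 k)) => // k.
  by rewrite addn2.
- apply: sserM_local => i iN.
  apply: (@sum_emb_eq (fun k => constS (A.1.2 k : L) * x ^+ k.+1) (fun k => A.1.2 k)) => [k|].
    by rewrite addn1.
  lia.
- apply: sserM_local => i iN.
  apply: (@sum_emb_eq (fun k => constS (A.2 k : L) * x ^+ k.+1) (fun k => A.2 k)) => [k|].
    by rewrite addn1.
  lia.
Qed.

Lemma vfpm_sum (ap am mp : nat -> L) (p q : S) N n : (n < N)%N ->
  (\sum_(k < N) (constS (ap k) * constS (k.+2%:R / 2)%:A * x ^+ k.+1 * p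
     + constS (am k) * x ^+ k.+1 * p + constS (mp k) * x ^+ k.+1
     + constS (mp k) * (x ^+ k *+ k.+1) * q)) n
  = (emb (shiftn 1 (fun k => (k.+2%:R / 2 : R[i]) *: ap k)) * p
     + emb (shiftn 1 am) * p + emb (shiftn 1 mp)
     + emb (shiftn 0 (fun k => mp k *+ k.+1)) * q) n.
Proof.
move=> nN; rewrite !big_split /= -!mulr_suml.
apply: sserD_eq; [apply: sserD_eq; [apply: sserD_eq|]|].
- apply: sserM_local => i iN.
  apply: (@sum_emb_eq (fun k => constS (ap k) * constS (k.+2%:R / 2)%:A * x ^+ k.+1)
    (fun k => (k.+2%:R / 2 : R[i]) *: ap k)) => [k|]; last lia.
  by rewrite addn1 constS_scale_r.
- apply: sserM_local => i iN.
  apply: (@sum_emb_eq (fun k => constS (am k) * x ^+ k.+1) am) => [k|]; last lia.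
  by rewrite addn1.
- by apply: (@sum_emb_eq (fun k => constS (mp k) * x ^+ k.+1) mp) => // k; rewrite addn1.
- apply: sserM_local => i iN.
  apply: (@sum_emb_eq (fun k => constS (mp k) * (x ^+ k *+ k.+1)) (fun k => mp k *+ k.+1))
    => [k|]; last lia.
  by rewrite addn0 constSMn mulrnAl mulrnAr.
Qed.

Lemma vfp_sum A N n : (n < N)%N -> (\sum_(k < N) vfp_term A k) n = vfp A n.
Proof.
move=> nN; rewrite vfpE -[X in _ + X]mulrA.
rewrite -(@vfpm_sum (fun k => A.1.1.1 k) (fun k => A.1.1.2 k) (fun k => A.1.2 k) _ _ _ _ nN).
by congr (_ n); apply: eq_bigr => k _; congr (_ + _); rewrite mulrA.
Qed.

Lemma vfm_sum A N n : (n < N)%N -> (\sum_(k < N) vfm_term A k) n = vfm A n.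
Proof.
move=> nN; have oppM (a b : S) : - a * b = a * - b by rewrite mulNr mulrN.
have embN (u : nat -> L) c : - emb (shiftn c u) = emb (shiftn c (fun k => - u k)).
  by apply: sserP => i; apply: sextP; rewrite /= ?oppr0 // /shiftn; case: ifP; rewrite ?oppr0.
transitivity ((emb (shiftn 1 (fun k => (k.+2%:R / 2 : R[i]) *: (A.1.1.1 k : L))) * pm
  + emb (shiftn 1 (fun k => - (A.1.1.2 k : L))) * pm + emb (shiftn 1 (fun k => A.2 k : L))
  + emb (shiftn 0 (fun k => (A.2 k : L) *+ k.+1)) * - (pp * pm)) n).
  rewrite -(@vfpm_sum (fun k => A.1.1.1 k) (fun k => - (A.1.1.2 k : L)) (fun k => A.2 k) _ _ _ _ nN).
  by congr (_ n); apply: eq_bigr => k _; rewrite /vfm_term constSN !mulNr mulrN mulrA.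
by rewrite vfmE -embN mulNr mulrN mulrA.
Qed.

Lemma wt_constS_x (a : L) k : wt (2 * k) (constS a * x ^+ k).
Proof. by apply: wtMr; apply: wtX; exact: wt_varx. Qed.

Lemma wt_vfx_term A k : wt (2 * k + 3) (vfx_term A k).
Proof.
apply: wtB; [apply: wtB|].
- by apply: wtW (wt_constS_x _ _); lia.
- by apply: wtW (wtM (wt_constS_x _ _) (wt_phim R)); lia.
- by apply: wtW (wtM (wt_constS_x _ _) (wt_phip R)); lia.
Qed.

Lemma wt_phi_term (a : L) k : wt (2 * k + 2) (constS a * (x ^+ k *+ k.+1) * pp * pm).
Proof.
rewrite mulrnAr -mulrnAl -constSMn.
by apply: wtW (wtM (wtM (wt_constS_x _ _) (wt_phip R)) (wt_phim R)); lia.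
Qed.

Lemma wt_vfp_term A k : wt (2 * k + 2) (vfp_term A k).
Proof.
rewrite /vfp_term constS_scale_r; apply: wtD; [apply: wtD; [apply: wtD|]|].
- by apply: wtW (wtM (wt_constS_x _ _) (wt_phip R)); lia.
- by apply: wtW (wtM (wt_constS_x _ _) (wt_phip R)); lia.
- by apply: wtW (wt_constS_x _ _); lia.
- exact: wt_phi_term.
Qed.

Lemma wt_vfm_term A k : wt (2 * k + 2) (vfm_term A k).
Proof.
rewrite /vfm_term constS_scale_r; apply: wtB; [apply: wtD; [apply: wtB|]|].
- by apply: wtW (wtM (wt_constS_x _ _) (wt_phim R)); lia.
- by apply: wtW (wtM (wt_constS_x _ _) (wt_phim R)); lia.
- by apply: wtW (wt_constS_x _ _); lia.
- exact: wt_phi_term.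
Qed.

(** The term of index k has weight at least 2 k + 2, so only k <= n contribute to the coefficient of
    x^n. The finite sums that remain are regrouped by [vf_term]. *)
Lemma vfieldE A f : - vfield A f = vf A f.
Proof.
pose T k := constS (A.1.1.1 k : L) * Lop k.+1 f + constS (A.1.1.2 k : L) * Jop k.+1 f
     + constS (A.1.2 k : L) * Gpop k.+1 f + constS (A.2 k : L) * Gmop k.+1 f.
have -> : vfield A f = ssum T by case: A @T => [[[a b] c] d].
have TE k : T k = - (vfx_term A k * dx f + vfp_term A k * dphip f + vfm_term A k * dphim f).
  by rewrite -vf_term opprK.
apply: sserP => n; rewrite sserNE (@ssum_trunc n.+1) => [|k nk].
  transitivity ((\sum_(k < n.+1) vfx_term A k * dx f + \sum_(k < n.+1) vfp_term A k * dphip f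
     + \sum_(k < n.+1) vfm_term A k * dphim f) n).
    rewrite -!big_split /= sser_sumE -sumrN; apply: eq_bigr => k _.
    by rewrite TE sserNE opprK.
  rewrite -!mulr_suml /vf !sserDE; congr (_ + _ + _); apply: sserM_local => i iN;
    [exact: vfx_sum|exact: vfp_sum|exact: vfm_sum].
rewrite TE sserNE (@wt_coef _ (2 * k + 2)) ?oppr0 //; last lia.
apply: wtD; [apply: wtD|]; apply: wtMl; [apply: wtW (wt_vfx_term A k); lia| |].
- exact: wt_vfp_term.
- exact: wt_vfm_term.
Qed.

Lemma sg_shift0 c (u : nat -> Lam0 R) n :
  sg (shiftn c (fun k => u k : L) n) = shiftn c (fun k => u k : L) n.
Proof. by rewrite /shiftn; case: ifP => _; rewrite ?lam_sign0 ?lam_sign0_even. Qed.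
Lemma sg_shift1 c (u : nat -> Lam1 R) n :
  sg (shiftn c (fun k => u k : L) n) = - shiftn c (fun k => u k : L) n.
Proof. by rewrite /shiftn; case: ifP => _; rewrite ?lam_sign0 ?oppr0 ?lam_sign1_odd. Qed.

Definition sg_simp := (lam_signN, lam_signB, lam_signD, lam_signZ, lam_signMn, sg_shift0,
  sg_shift1, lam_sign0, lam_sign1, lam_sign0_even, lam_sign1_odd).

Lemma vfx_even A : sgS (vfx A) = vfx A.
Proof. by apply: sserP => n; apply: sextP; rewrite /= ?sg_simp ?opprK. Qed.
Lemma vfp_odd A : sgS (vfp A) = - vfp A.
Proof. by apply: sserP => n; apply: sextP; rewrite /= ?sg_simp ?opprK ?oppr0 ?mulNrn. Qed.
Lemma vfm_odd A : sgS (vfm A) = - vfm A.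
Proof. by apply: sserP => n; apply: sextP; rewrite /= ?sg_simp ?opprK ?oppr0 ?mulNrn ?opprK. Qed.

Lemma vfD A : {morph vf A : f g / f + g}.
Proof.
by move=> f g; rewrite /vf dxD dphipD dphimD !mulrDr [RHS]addrACA; congr (_ + _); rewrite addrACA.
Qed.
Lemma vf0 A : vf A 0 = 0.
Proof. by apply: (addrI (vf A 0)); rewrite -vfD !addr0. Qed.
Lemma vfN A : {morph vf A : f / - f}.
Proof. by move=> f; apply: (addrI (vf A f)); rewrite -vfD !subrr vf0. Qed.

(** An even derivation: [vfp] and [vfm] are odd and multiply odd derivations, so moving them over
    [sgS f] undoes the sign in the rule for [dphip] and [dphim]. *)
Lemma vfM A f g : vf A (f * g) = vf A f * g + f * vf A g.
Proof.
have oddM (o h h' : S) : sgS o = - o -> o * (sgS h * h') = h * (o * h').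
  by move=> oo; rewrite mulrA (sser_odd_comm _ oo) sser_signK mulrA.
rewrite /vf dxM dphipM dphimM !mulrDr !mulrDl !mulrA.
rewrite (sser_even_comm f (vfx_even A)) -[_ * sgS f * _]mulrA oddM ?vfp_odd //.
rewrite -[vfm A * sgS f * _]mulrA oddM ?vfm_odd // !mulrA.
by rewrite !addrA [LHS](ACl (1*3*5*2*4*6)).
Qed.

Lemma vf_const A (a : L) : vf A (constS a) = 0.
Proof. by rewrite /vf dx_const dphip_const dphim_const !mulr0 !addr0. Qed.
Lemma vfC A (a : L) f : vf A (constS a * f) = constS a * vf A f.
Proof. by rewrite vfM vf_const mul0r add0r. Qed.
Lemma vfZ A (k : R[i]) f : vf A (k *: f) = k *: vf A f.
Proof. by rewrite -!constSZ vfC. Qed.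
Lemma vf1 A : vf A 1 = 0. Proof. by rewrite -constS1 vf_const. Qed.

Lemma vf_sign A f : sgS (vf A f) = vf A (sgS f).
Proof.
rewrite /vf !sser_signD !sser_signM vfx_even vfp_odd vfm_odd sser_sign_dx.
by rewrite sser_sign_dphip sser_sign_dphim !mulrNN.
Qed.

Lemma vf_varx A : vf A x = vfx A.
Proof. by rewrite /vf dx_varx dphip_varx dphim_varx !mulr0 !addr0 mulr1. Qed.
Lemma vf_phip A : vf A pp = vfp A.
Proof. by rewrite /vf dx_phip dphip_phip dphim_phip !mulr0 addr0 add0r mulr1. Qed.
Lemma vf_phim A : vf A pm = vfm A.
Proof. by rewrite /vf dx_phim dphip_phim dphim_phim !mulr0 !add0r mulr1. Qed.

(* The operators L_j and J_j have weight 2j, and G_(j-1/2) has weight 2j - 1. *)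
Definition dwt q A := [/\ (forall k, (2 * k + 2 < q)%N -> A.1.1.1 k = 0),
  (forall k, (2 * k + 2 < q)%N -> A.1.1.2 k = 0),
  (forall k, (2 * k + 1 < q)%N -> A.1.2 k = 0) &
  (forall k, (2 * k + 1 < q)%N -> A.2 k = 0)].

Lemma dwt1 A : dwt 1 A.
Proof. by split=> k; lia. Qed.

Lemma wt_vfx q A : dwt q A -> wt (q + 2) (vfx A).
Proof.
move=> [h1 h2 h3 h4] n; split=> hk /=; rewrite /shiftn //; case: leqP => // n1;
  by [rewrite h1 //; lia|rewrite ?h3 ?h4 ?oppr0 //; lia|rewrite oppr0].
Qed.

Lemma wt_vfp q A : dwt q A -> wt (q + 1) (vfp A).
Proof.
move=> [h1 h2 h3 h4] n; split=> hk /=; rewrite /shiftn //.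
- by case: leqP => // n1; rewrite h3 //; lia.
- case: leqP => /= n1; first by rewrite scaler0 addr0.
  by rewrite h1 ?h2 ?scaler0 ?addr0 //; lia.
- by rewrite h3 ?mul0rn //; lia.
Qed.

Lemma wt_vfm q A : dwt q A -> wt (q + 1) (vfm A).
Proof.
move=> [h1 h2 h3 h4] n; split=> hk /=; rewrite /shiftn //.
- by case: leqP => // n1; rewrite h4 //; lia.
- case: leqP => /= n1; first by rewrite scaler0 subr0.
  by rewrite h1 ?h2 ?scaler0 ?subr0 //; lia.
- by rewrite h4 ?oppr0 ?mul0rn //; lia.
Qed.

Lemma wt_vf q A k f : dwt q A -> wt k f -> wt (k + q) (vf A f).
Proof.
move=> h hf; apply: wtD; [apply: wtD|].
- by apply: wtW (wtM (wt_vfx h) (wt_dx hf)); lia.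
- by apply: wtW (wtM (wt_vfp h) (wt_dphip hf)); lia.
- by apply: wtW (wtM (wt_vfm h) (wt_dphim hf)); lia.
Qed.

Definition Dp f : S := dphip f + pm * dx f.
Definition Dm f : S := dphim f + pp * dx f.

Lemma DpM f g : Dp (f * g) = Dp f * g + sgS f * Dp g.
Proof.
rewrite /Dp dphipM dxM !mulrDr !mulrDl !mulrA.
by rewrite (sser_odd_comm f (sser_sign_phim R)) addrACA.
Qed.
Lemma DmM f g : Dm (f * g) = Dm f * g + sgS f * Dm g.
Proof.
rewrite /Dm dphimM dxM !mulrDr !mulrDl !mulrA.
by rewrite (sser_odd_comm f (sser_sign_phip R)) addrACA.
Qed.
Lemma DpD : {morph Dp : f g / f + g}.
Proof. by move=> f g; rewrite /Dp dphipD dxD mulrDr addrACA. Qed.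
Lemma DmD : {morph Dm : f g / f + g}.
Proof. by move=> f g; rewrite /Dm dphimD dxD mulrDr addrACA. Qed.

Lemma mul_phipE f n : (f * pp) n = SExt 0 (c0 (f n)) 0 (- cm (f n)).
Proof.
rewrite sserME big_ord_recr /= subnn big1 ?add0r => [|i _].
  by apply: sextP; rewrite /= ?lam_sign0 ?lam_sign1 ?mulr0 ?mulr1 ?addr0 ?subr0 ?add0r ?sub0r.
by rewrite /phip; have -> : (n - i == 0)%N = false by [have := ltn_ord i; lia]; rewrite mulr0.
Qed.
Lemma mul_phimE f n : (f * pm) n = SExt 0 0 (c0 (f n)) (cp (f n)).
Proof.
rewrite sserME big_ord_recr /= subnn big1 ?add0r => [|i _].
  by apply: sextP; rewrite /= ?lam_sign0 ?lam_sign1 ?mulr0 ?mulr1 ?addr0 ?subr0 ?add0r ?sub0r.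
by rewrite /phim; have -> : (n - i == 0)%N = false by [have := ltn_ord i; lia]; rewrite mulr0.
Qed.

Lemma dxE f n : dx f n = SExt (c0 (f n.+1) *+ n.+1) (cp (f n.+1) *+ n.+1)
  (cm (f n.+1) *+ n.+1) (cpm (f n.+1) *+ n.+1).
Proof. by rewrite /dx sext_natmul. Qed.

Lemma DpE f n : Dp f n = SExt (sg (cp (f n))) 0
  (sg (cpm (f n)) + sg (c0 (f n.+1)) *+ n.+1) (- sg (cp (f n.+1)) *+ n.+1).
Proof.
by rewrite /Dp sserDE phim_mulE dxE /=; apply: sextP; rewrite /= ?lam_signMn ?mulNrn ?addr0 ?add0r.
Qed.
Lemma DmE f n : Dm f n = SExt (sg (cm (f n)))
  (- sg (cpm (f n)) + sg (c0 (f n.+1)) *+ n.+1) 0 (sg (cm (f n.+1)) *+ n.+1).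
Proof.
by rewrite /Dm sserDE phip_mulE dxE /=; apply: sextP; rewrite /= ?lam_signMn ?addr0 ?add0r.
Qed.

Lemma shiftnS c (u : nat -> L) n : shiftn c.+1 u n.+1 = shiftn c u n.
Proof. by rewrite /shiftn ltnS subSS. Qed.
Lemma shiftn0 (u : nat -> L) n : shiftn 0 u n = u n.
Proof. by rewrite /shiftn /= subn0. Qed.

(** This and the next identities on [vfp] and [vfx] are the superconformal equations linearised at
    the identity. In those for [vfx], the two halves of the derivative of x^(j+1) are supplied by
    the factor (j+1)/2 in L_j. *)
Lemma Dp_vfm A : Dp (vfm A) = 0.
Proof.
apply: sserP => n; rewrite DpE; apply: sextP; rewrite /= ?sg_simp ?shiftnS ?shiftn0 //.
- by rewrite -mulrnDl addNr mul0rn.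
- by rewrite oppr0 mul0rn.
Qed.
Lemma Dm_vfp A : Dm (vfp A) = 0.
Proof.
apply: sserP => n; rewrite DmE; apply: sextP; rewrite /= ?sg_simp ?shiftnS ?shiftn0 //.
- by rewrite -mulNrn -mulrnDl ?opprK (subrr, addNr) mul0rn.
- by rewrite mul0rn.
Qed.

Lemma half_scale (a : L) n : a *+ n = (n%:R / 2 : R[i]) *: a + (n%:R / 2 : R[i]) *: a.
Proof. by rewrite -scalerDl -splitr scaler_nat. Qed.

Lemma Dp_vfx A : Dp (vfx A) = vfm A + Dp (vfp A) * pm.
Proof.
apply: sserP => n; rewrite sserDE mul_phimE !DpE.
apply: sextP; rewrite /= ?sg_simp ?shiftnS ?shiftn0 ?opprK ?addr0 ?add0r //.
by rewrite half_scale addrACA addNr addr0.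
Qed.
Lemma Dm_vfx A : Dm (vfx A) = vfp A + Dm (vfm A) * pp.
Proof.
apply: sserP => n; rewrite sserDE mul_phipE !DmE.
apply: sextP; rewrite /= ?sg_simp ?shiftnS ?shiftn0 ?opprK ?oppr0 ?addr0 ?add0r //.
by rewrite half_scale addrACA subrr addr0.
Qed.

(** The commutator of D+ with the vector field is a multiple of D+. This is the infinitesimal form
    of being superconformal and is integrated in [sconf_eop]. *)
Lemma Dp_vf A f : Dp (vf A f) = vf A (Dp f) + Dp (vfp A) * Dp f.
Proof.
have dpDp : dphip (Dp f) = - Dp (dphip f).
  rewrite /Dp dphipD dphip_dphip add0r dphipM dphip_phim mul0r add0r sser_sign_phim.
  by rewrite add0r dphip_dx mulNr.
have dmDp : dphim (Dp f) = dx f - Dp (dphim f).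
  rewrite /Dp dphimD dphimM dphim_phim mul1r sser_sign_phim dphim_dx dphip_dphim.
  by rewrite mulNr opprD opprK addrCA.
have dxDp : dx (Dp f) = Dp (dx f).
  by rewrite /Dp dxD dxM dx_phim mul0r add0r dphip_dx.
rewrite {1}/vf !DpD !DpM vfx_even vfp_odd vfm_odd Dp_vfx Dp_vfm mul0r add0r.
have -> : Dp (vfp A) * Dp f = Dp (vfp A) * dphip f + Dp (vfp A) * pm * dx f.
  by rewrite {2}/Dp mulrDr mulrA.
rewrite {1}/vf dpDp dmDp dxDp.
move: (Dp (vfp A)) (Dp (dphip f)) (Dp (dphim f)) (Dp (dx f)) => l u v w.
rewrite !mulrDl !mulrDr !mulrN !mulNr.
by rewrite !addrA [LHS](ACl (3*5*1*6*4*2)).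
Qed.

Lemma Dm_vf A f : Dm (vf A f) = vf A (Dm f) + Dm (vfm A) * Dm f.
Proof.
have dmDm : dphim (Dm f) = - Dm (dphim f).
  rewrite /Dm dphimD dphim_dphim add0r dphimM dphim_phip mul0r add0r sser_sign_phip.
  by rewrite add0r dphim_dx mulNr.
have dpDm : dphip (Dm f) = dx f - Dm (dphip f).
  rewrite /Dm dphipD dphipM dphip_phip mul1r sser_sign_phip dphip_dx dphip_dphim.
  by rewrite mulNr opprD [RHS]addrCA.
have dxDm : dx (Dm f) = Dm (dx f).
  by rewrite /Dm dxD dxM dx_phip mul0r add0r dphim_dx.
rewrite {1}/vf !DmD !DmM vfx_even vfp_odd vfm_odd Dm_vfx Dm_vfp mul0r add0r.
have -> : Dm (vfm A) * Dm f = Dm (vfm A) * dphim f + Dm (vfm A) * pp * dx f.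
  by rewrite {2}/Dm mulrDr mulrA.
rewrite {1}/vf dmDm dpDm dxDm.
move: (Dm (vfm A)) (Dm (dphip f)) (Dm (dphim f)) (Dm (dx f)) => l u v w.
rewrite !mulrDl !mulrDr !mulrN !mulNr.
by rewrite !addrA [LHS](ACl (3*1*4*6*5*2)).
Qed.

End VectorFields.

(** * Exponentials of vector fields *)

Section Exponential.
Variable R : realType.
Local Notation L := (Lam R).
Local Notation sg := (@lam_sign R).
Local Notation sgS := (@sser_sign R).
Local Notation S := (sser R).
Local Notation data := (data R).
Local Notation x := (varx R).
Local Notation pp := (phip R).
Local Notation pm := (phim R).
Implicit Types (f g h : S) (A B : data) (w v : S -> S).

Definition dpow w k f : S := (k`!%:R^-1 : R[i]) *: iter k w f.
Definition epart w N f : S := \sum_(k < N) dpow w k f.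
(** The exponential of an operator that raises weights: the term w^k / k! has weight at least k, and
    the coefficient of x^n does not see weights above 2 n + 2, hence the cut at 2 n + 3. *)
Definition eop w f : S := fun n => epart w (2 * n + 3) f n.

Definition raises w := forall k f, wt k f -> wt k.+1 (w f).
Definition scalar_op w := forall (k : R[i]) f, w (k *: f) = k *: w f.

Lemma dpow0 w f : dpow w 0 f = f.
Proof. by rewrite /dpow fact0 invr1 scale1r. Qed.

Lemma dpowS w k f : scalar_op w -> (k.+1%:R : R[i]) *: dpow w k.+1 f = w (dpow w k f).
Proof.
move=> wZ; rewrite /dpow wZ scalerA factS natrM invfM mulrA divff ?mul1r // pnatr_eq0.
Qed.

Lemma wt_dpow w k i f : raises w -> wt k f -> wt (k + i) (dpow w i f).
Proof.
move=> rw hf; apply: wtZ; elim: i => [|i ih] /=; first by rewrite addn0.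
by rewrite addnS; exact: rw.
Qed.

Lemma epart_diff w k N M f : raises w -> wt k f -> (N <= M)%N ->
  wt (k + N) (epart w M f - epart w N f).
Proof.
move=> rw hf; elim: M => [|M ih]; first by rewrite leqn0 => /eqP ->; rewrite subrr.
rewrite leq_eqVlt => /orP[/eqP ->|NM]; first by rewrite subrr.
rewrite /epart big_ord_recr /= addrAC; apply: wtD; first exact: ih.
by apply: wtW (wt_dpow M rw hf); lia.
Qed.

Lemma eopE w N n f : raises w -> (2 * n + 2 < N)%N -> eop w f n = epart w N f n.
Proof.
move=> rw nN; have h : (2 * n + 3 <= N)%N by lia.
have := wt_coef (n := n) (epart_diff rw (wt0 f) h); rewrite sserBE => hh.
by apply/eqP; rewrite eq_sym -subr_eq0 hh //; lia.
Qed.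

Lemma eop_trunc w k N f : raises w -> wt k f -> wt (k + N) (eop w f - epart w N f).
Proof.
move=> rw hf n; rewrite sserBE (@eopE _ (N + (2 * n + 3))) //; last lia.
by rewrite -sserBE; apply: (epart_diff rw hf); lia.
Qed.

(** Weights separate series, so approximation by the partial sums modulo every weight characterises
    e^w f. Identities between exponentials are proved by checking this criterion. *)
Lemma eop_unique w f g : raises w -> (forall N, wt N (g - epart w N f)) -> g = eop w f.
Proof.
move=> rw h; apply: wt_sep => N; rewrite -(subrKA (epart w N f)); apply: wtD; first exact: h.
by rewrite -opprB; apply: wtN; exact: (eop_trunc N rw (wt0 f)).
Qed.

Lemma wt_eop w k f : raises w -> wt k f -> wt k (eop w f).
Proof.
move=> rw hf; rewrite -[eop w f](subrK (epart w k f)); apply: wtD.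
  by apply: wtW (eop_trunc k rw hf); lia.
by apply: wt_sum => i _; apply: wtW (wt_dpow i rw hf); lia.
Qed.

Lemma eop_first w k f : raises w -> wt k f -> wt k.+1 (eop w f - f).
Proof.
move=> rw hf; have := eop_trunc 1 rw hf.
by rewrite /epart big_ord1 dpow0 addn1.
Qed.

Lemma iter_morph2 w v (phi : S -> S) k f : (forall f, phi (w f) = v (phi f)) ->
  phi (iter k w f) = iter k v (phi f).
Proof. by move=> h; elim: k => // k ih; rewrite !iterS h ih. Qed.

(** [d] is the weight that [phi] may lose, compensated by comparing with the partial sums up to N +
    d. Multiplication by constants and the sign use d = 0, the derivations D+ and D- use d = 1. *)
Lemma eop_intertwine w v (phi : S -> S) d f : raises w -> raises v ->
  {morph phi : f g / f + g} -> scalar_op phi ->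
  (forall k f, wt k f -> wt (k - d) (phi f)) ->
  (forall f, phi (w f) = v (phi f)) -> phi (eop w f) = eop v (phi f).
Proof.
move=> rw rv phiD phiZ phiwt hphi; apply: (eop_unique rv) => N.
have phi0 : phi 0 = 0 by apply: (addrI (phi 0)); rewrite -phiD !addr0.
have phiN : {morph phi : g / - g}.
  by move=> g; apply: (addrI (phi g)); rewrite -phiD !subrr phi0.
have phi_e M : phi (epart w M f) = epart v M (phi f).
  rewrite /epart (big_morph phi phiD phi0); apply: eq_bigr => i _.
  by rewrite /dpow phiZ (iter_morph2 _ _ hphi).
have -> : phi (eop w f) - epart v N (phi f) = phi (eop w f - epart w (N + d) f)
    + (epart v (N + d) (phi f) - epart v N (phi f)).
  by rewrite phiD phiN phi_e subrKA.
apply: wtD; last exact: (epart_diff rv (wt0 (phi f)) (leq_addr d N)).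
by rewrite -{1}(addnK d N); apply: phiwt; exact: (eop_trunc (N + d) rw (wt0 f)).
Qed.

Lemma eop_morph w f g : raises w -> {morph w : f g / f + g} ->
  eop w (f + g) = eop w f + eop w g.
Proof.
move=> rw wD; apply/esym/(eop_unique rw) => N.
have wi k : iter k w (f + g) = iter k w f + iter k w g.
  by elim: k => // k ih; rewrite !iterS ih wD.
have -> : epart w N (f + g) = epart w N f + epart w N g.
  by rewrite /epart -big_split; apply: eq_bigr => i _; rewrite /dpow wi scalerDr.
by rewrite opprD addrACA; apply: wtD; exact: (eop_trunc N rw (wt0 _)).
Qed.

Lemma triangle_sum (V : zmodType) (F : nat -> nat -> V) N :
  \sum_(k < N) \sum_(i < k.+1) F i (k - i)%N = \sum_(i < N) \sum_(j < (N - i)%N) F i j.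
Proof.
transitivity (\sum_(0 <= k < N) \sum_(0 <= i < N | (i < k.+1)%N) F i (k - i)%N).
  rewrite big_mkord; apply: eq_bigr => k _.
  by rewrite -(@big_nat_widen _ _ _ 0 k.+1 N xpredT) ?big_mkord.
rewrite (exchange_big_dep_nat xpredT) //= big_mkord; apply: eq_bigr => i _.
under eq_bigl do rewrite ltnS.
rewrite -(@big_nat_widenl _ _ _ i 0 N xpredT) //.
rewrite -{1}[val i]add0n big_addn big_mkord; apply: eq_bigr => j _.
by rewrite addnK.
Qed.

(** The square and the triangle of indices differ only by pairs with i + j >= N. *)
Lemma cauchy_wt (F : nat -> nat -> S) N : (forall i j, wt (i + j) (F i j)) ->
  wt N (\sum_(i < N) \sum_(j < N) F i j - \sum_(k < N) \sum_(i < k.+1) F i (k - i)%N).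
Proof.
move=> hF; rewrite triangle_sum -sumrB; apply: wt_sum => i _.
have hi := ltn_ord i.
rewrite -(big_mkord xpredT (F i)) -(big_mkord xpredT (F i)) (@big_cat_nat _ _ _ (N - i)) //=; last lia.
rewrite addrAC subrr add0r big_nat_cond; apply: wt_sum => j /andP[/andP[h1 h2] _].
by apply: wtW (hF i j); lia.
Qed.

Lemma dpow_leibniz w v1 v2 k f g : scalar_op w -> scalar_op v1 -> scalar_op v2 ->
  {morph w : f g / f + g} ->
  (forall f g, w (f * g) = v1 f * g + f * v2 g) ->
  dpow w k (f * g) = \sum_(i < k.+1) dpow v1 i f * dpow v2 (k - i) g.
Proof.
move=> wZ v1Z v2Z wD hM; elim: k => [|k ih].
  by rewrite big_ord1 subn0 !dpow0.
have k0 : (k.+1%:R : R[i]) != 0 by rewrite pnatr_eq0.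
apply: (scalerI k0); rewrite dpowS // ih.
have w0 : w 0 = 0 by apply: (addrI (w 0)); rewrite -wD !addr0.
rewrite (big_morph w wD w0) scaler_sumr.
under eq_bigr do rewrite hM.
rewrite big_split /=.
transitivity (\sum_(i < k.+2) ((i%:R : R[i]) *: (dpow v1 i f * dpow v2 (k.+1 - i) g)
   + ((k.+1 - i)%:R : R[i]) *: (dpow v1 i f * dpow v2 (k.+1 - i) g))); last first.
  apply: eq_bigr => i _; rewrite -scalerDl -natrD subnKC //.
  by have := ltn_ord i; lia.
rewrite big_split /=; congr (_ + _).
  rewrite [RHS]big_ord_recl /= scale0r add0r; apply: eq_bigr => i _.
  by rewrite /bump leq0n add1n subSS sser_scaleAl dpowS.
rewrite [RHS]big_ord_recr /= subnn scale0r addr0; apply: eq_bigr => i _.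
have hi := ltn_ord i; rewrite subSn; last by lia.
by rewrite -dpowS // sser_scaleAr.
Qed.

(** Besides derivations ([v1] = [v2] = [w]), this covers w = v2 + multiplication by a series, with
    [v1] = [w]; applied to 1 * f it factors e^w f as (e^w 1)(e^v2 f). *)
Lemma eop_leibniz w v1 v2 f g : scalar_op w -> scalar_op v1 -> scalar_op v2 ->
  {morph w : f g / f + g} -> raises w -> raises v1 -> raises v2 ->
  (forall f g, w (f * g) = v1 f * g + f * v2 g) ->
  eop w (f * g) = eop v1 f * eop v2 g.
Proof.
move=> wZ v1Z v2Z wD rw r1 r2 hM; apply/esym/(eop_unique rw) => N.
have e : epart w N (f * g) = \sum_(k < N) \sum_(i < k.+1) dpow v1 i f * dpow v2 (k - i) g.
  by apply: eq_bigr => k _; exact: dpow_leibniz.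
have q : epart v1 N f * epart v2 N g = \sum_(i < N) \sum_(j < N) dpow v1 i f * dpow v2 j g.
  by rewrite mulr_suml; apply: eq_bigr => i _; rewrite mulr_sumr.
rewrite -(subrKA (epart v1 N f * epart v2 N g)); apply: wtD.
  rewrite -(subrKA (epart v1 N f * eop v2 g)) -mulrBl -mulrBr; apply: wtD.
    by apply: wtMl; exact: (eop_trunc N r1 (wt0 f)).
  by apply: wtMr; exact: (eop_trunc N r2 (wt0 g)).
rewrite e q; apply: (@cauchy_wt (fun i j => dpow v1 i f * dpow v2 j g)) => i j.
exact: wtM (wt_dpow i r1 (wt0 f)) (wt_dpow j r2 (wt0 g)).
Qed.

Definition sconst_op w := forall (a : L) f, w (constS a * f) = constS a * w f.

Lemma sconst_scalar w : sconst_op w -> scalar_op w.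
Proof. by move=> h k f; rewrite -!constSZ h. Qed.

Lemma eop_const w (a : L) f : raises w -> {morph w : f g / f + g} -> sconst_op w ->
  eop w (constS a * f) = constS a * eop w f.
Proof.
move=> rw wD wC; apply/esym.
apply: (@eop_intertwine w w (fun f => constS a * f) 0 f rw rw).
- by move=> u v; rewrite mulrDr.
- by move=> k u; rewrite -sser_scaleAr.
- by move=> k u hu; rewrite subn0; exact: wtMr.
- by move=> u; rewrite wC.
Qed.

Lemma eop1 w : raises w -> w 1 = 0 -> scalar_op w -> eop w 1 = 1.
Proof.
move=> rw w1 wZ; apply/esym/(eop_unique rw) => -[|N]; first exact: wt0.
rewrite /epart big_ord_recl dpow0 big1 ?addr0 ?subrr // => i _.
rewrite lift0 /dpow iterSr w1 /=; have w0 : w 0 = 0 by rewrite -[0 in LHS](scale0r (1 : S)) wZ scale0r.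
by have -> : iter i w 0 = 0; [elim: (val i) => // j ih; rewrite iterS ih|rewrite scaler0].
Qed.

(* A weight-preserving even endomorphism of the superalgebra Lam[[x]][phi+, phi-]. *)
Record good (T : S -> S) : Prop := Good {
  goodD : {morph T : f g / f + g};
  goodC : sconst_op T;
  goodM : {morph T : f g / f * g};
  good1 : T 1 = 1;
  good_wt : forall k f, wt k f -> wt k (T f);
  good_sign : forall f, sgS (T f) = T (sgS f) }.

Lemma good_comp T U : good T -> good U -> good (T \o U).
Proof.
move=> [h1 h2 h3 h4 h5 h6] [k1 k2 k3 k4 k5 k6]; split=> /=.
- by move=> f g /=; rewrite k1 h1.
- by move=> a f /=; rewrite k2 h2.
- by move=> f g /=; rewrite k3 h3.
- by rewrite /= k4 h4.
- by move=> k f /k5 /h5.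
- by move=> f /=; rewrite h6 k6.
Qed.

Definition triple_of (T : S -> S) : triple R := (T x, T pp, T pm).

Definition sterms f : nat -> S := fun n => constS (c0 (f n)) * x ^+ n + constS (cp (f n)) * x ^+ n * pp
  + constS (cm (f n)) * x ^+ n * pm + constS (cpm (f n)) * x ^+ n * pp * pm.

Lemma sterms_sum f N : wt (2 * N) (f - \sum_(n < N) sterms f n).
Proof.
have E n : (\sum_(k < N) sterms f k) n = if (n < N)%N then f n else 0.
  have s (u : nat -> L) : (\sum_(k < N) (if n == k then u k else 0)) = if (n < N)%N then u n else 0.
    case: ltnP => nN.
      rewrite (bigD1 (Ordinal nN)) //= eqxx big1 ?addr0 // => i ik.
      by case: eqP => // e; case/eqP: ik; apply/val_inj.
    by apply: big1 => i _; case: eqP => // e; have := ltn_ord i; lia.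
  rewrite sser_sumE.
  transitivity (\sum_(k < N) (if n == k then f k else 0)).
    apply: eq_bigr => k _; rewrite /sterms !sserDE !mul_phimE !mul_phipE !constS_xXE.
    case: eqP => _;
      by apply: sextP; rewrite /= ?oppr0 ?addr0 ?add0r.
  apply: sextP; rewrite ?c0_sum ?cp_sum ?cm_sum ?cpm_sum.
  - transitivity (if (n < N)%N then c0 (f n) else 0); last by case: ifP.
    by rewrite -(s (fun n => c0 (f n))); apply: eq_bigr => k _; case: eqP.
  - transitivity (if (n < N)%N then cp (f n) else 0); last by case: ifP.
    by rewrite -(s (fun n => cp (f n))); apply: eq_bigr => k _; case: eqP.
  - transitivity (if (n < N)%N then cm (f n) else 0); last by case: ifP.
    by rewrite -(s (fun n => cm (f n))); apply: eq_bigr => k _; case: eqP.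
  - transitivity (if (n < N)%N then cpm (f n) else 0); last by case: ifP.
    by rewrite -(s (fun n => cpm (f n))); apply: eq_bigr => k _; case: eqP.
move=> n; rewrite sserBE E; case: ltnP => nN; first by rewrite subrr.
by have -> : (2 * N - 2 * n = 0)%N by lia.
Qed.

Definition cterms f (F : triple R) : nat -> S := fun n =>
  constS (c0 (f n)) * F.1.1 ^+ n + constS (cp (f n)) * F.1.1 ^+ n * F.1.2
  + constS (cm (f n)) * F.1.1 ^+ n * F.2 + constS (cpm (f n)) * F.1.1 ^+ n * F.1.2 * F.2.

Lemma wt_cterms f F n : wt 2 F.1.1 -> wt (2 * n) (cterms f F n).
Proof.
move=> hX; have h a : wt (2 * n) (constS a * F.1.1 ^+ n) by apply: wtMr; exact: wtX.
apply: wtD; [apply: wtD; [apply: wtD|]|].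
- exact: h.
- exact: wtMl.
- exact: wtMl.
- by do 2 apply: wtMl.
Qed.

Lemma scompE f F N n : wt 2 F.1.1 -> (n.+1 < N)%N ->
  scomp f F n = (\sum_(k < N) cterms f F k) n.
Proof.
move=> hX nN; have -> : scomp f F = ssum (cterms f F) by case: F hX => [[X P] M].
rewrite sser_sumE (@ssum_trunc _ N) // => k Nk.
by apply: wt_coef (wt_cterms f k hX) _; lia.
Qed.

Lemma scomp_trunc f F N : wt 2 F.1.1 -> wt (2 * N) (scomp f F - \sum_(k < N) cterms f F k).
Proof.
move=> hX n; rewrite sserBE; have [nN|nN] := leqP N n.
  by have -> : (2 * N - 2 * n = 0)%N by lia.
rewrite (@scompE _ _ N.+1) // big_ord_recr /= sserDE addrAC subrr add0r.
exact: wt_cterms.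
Qed.

(** Both sides agree on polynomials in x, phi+, phi- because [T] is a morphism over the constants;
    the remainders have high weight, which [T] preserves. *)
Lemma scomp_good T f : good T -> T f = scomp f (triple_of T).
Proof.
move=> gT; have hX : wt 2 (triple_of T).1.1 by apply: (good_wt gT); exact: wt_varx.
apply: wt_sep => k; apply: (@wtW _ (2 * k)); first lia.
have T0 : T 0 = 0 by apply: (addrI (T 0)); rewrite -(goodD gT) !addr0.
have TN : {morph T : g / - g}.
  by move=> g; apply: (addrI (T g)); rewrite -(goodD gT) !subrr T0.
have TX n : T (x ^+ n) = T x ^+ n.
  by elim: n => [|n ih]; rewrite ?expr0 ?(good1 gT) // !exprS (goodM gT) ih.
have e : T (\sum_(n < k) sterms f n) = \sum_(n < k) cterms f (triple_of T) n.
  rewrite (big_morph T (goodD gT) T0); apply: eq_bigr => n _.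
  by rewrite /sterms /cterms /= -!mulrA !(goodD gT) !(goodC gT) !(goodM gT) TX.
rewrite -(subrKA (T (\sum_(n < k) sterms f n))); apply: wtD.
  by rewrite -TN -(goodD gT); apply: (good_wt gT); exact: sterms_sum.
by rewrite e -opprB; apply: wtN; exact: scomp_trunc.
Qed.

Lemma tcomp_good T U : good U -> tcomp (triple_of T) (triple_of U) = triple_of (U \o T).
Proof. by move=> gU; rewrite /tcomp -!(scomp_good _ gU). Qed.

Lemma good_eq T U : good T -> good U -> triple_of T = triple_of U -> T =1 U.
Proof. by move=> gT gU e f; rewrite (scomp_good _ gT) (scomp_good _ gU) e. Qed.

Lemma raises_vf A : raises (vf A).
Proof. by move=> k f hf; rewrite -addn1; exact: wt_vf (dwt1 A) hf. Qed.

Lemma good_eop A : good (eop (vf A)).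
Proof.
have rw := raises_vf A; have wD := vfD A; have wC : sconst_op (vf A) by move=> a f; exact: vfC.
have wZ := sconst_scalar wC.
split.
- by move=> f g; exact: eop_morph.
- by move=> a f; exact: eop_const.
- by move=> f g; apply: eop_leibniz => // u v; exact: vfM.
- by apply: eop1 => //; exact: vf1.
- by move=> k f; exact: wt_eop.
- move=> f; apply: (@eop_intertwine _ _ sgS 0 f rw rw).
  + exact: sser_signD.
  + by move=> k u; exact: sser_signZ.
  + by move=> k u hu; rewrite subn0; exact: wt_sign.
  + by move=> u; exact: vf_sign.
Qed.

Lemma exp_vfieldE A f : exp_vfield A f = eop (vf A) f.
Proof.
have e k : constS (k`!%:R^-1 : R[i])%:A * iter k (fun g => - vfield A g) f = dpow (vf A) k f.
  rewrite constSZ /dpow; congr (_ *: _); elim: k => // k ih.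
  by rewrite !iterS ih vfieldE.
apply: sserP => n; rewrite (@eopE _ (2 * n + 3)) //; last lia.
  rewrite /epart sser_sumE /exp_vfield (@ssum_trunc _ (2 * n + 3)) => [|k nk].
    by apply: eq_bigr => k _; rewrite e.
  by rewrite e; apply: wt_coef (wt_dpow k (raises_vf A) (wt0 f)) _; lia.
exact: raises_vf.
Qed.

Lemma EtildeE A : Etilde A = triple_of (eop (vf A)).
Proof. by rewrite /Etilde !exp_vfieldE. Qed.

(* Superconformal substitutions are those that preserve the distributions
   spanned by D+ and D-. *)
Record sconf (T : S -> S) : Prop := Sconf {
  sconf_good : good T;
  sconf_p : exists u, forall f, Dp (T f) = u * T (Dp f);
  sconf_m : exists u, forall f, Dm (T f) = u * T (Dm f) }.

Lemma sconf_comp T U : sconf T -> sconf U -> sconf (T \o U).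
Proof.
move=> [gT [u hu] [v hv]] [gU [u' hu'] [v' hv']]; split.
- exact: good_comp.
- by exists (u * T u') => f; rewrite /= hu hu' (goodM gT) mulrA.
- by exists (v * T v') => f; rewrite /= hv hv' (goodM gT) mulrA.
Qed.

Lemma Dp_scalar : scalar_op (@Dp R).
Proof.
have e : sgS (constS (1%:A : L)) = constS 1%:A by rewrite sser_sign_const lam_signZ lam_sign1.
move=> k f; rewrite -constSZ DpM /Dp dphip_const dx_const mulr0 addr0 mul0r add0r.
by rewrite sser_sign_const lam_signZ lam_sign1 constSZ.
Qed.
Lemma Dm_scalar : scalar_op (@Dm R).
Proof.
move=> k f; rewrite -constSZ DmM /Dm dphim_const dx_const mulr0 addr0 mul0r add0r.
by rewrite sser_sign_const lam_signZ lam_sign1 constSZ.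
Qed.
Lemma wt_Dp k f : wt k f -> wt (k - 1) (Dp f).
Proof.
move=> hf; apply: wtD; first exact: wt_dphip.
by apply: wtW (wtM (wt_phim R) (wt_dx hf)); lia.
Qed.
Lemma wt_Dm k f : wt k f -> wt (k - 1) (Dm f).
Proof.
move=> hf; apply: wtD; first exact: wt_dphim.
by apply: wtW (wtM (wt_phip R) (wt_dx hf)); lia.
Qed.

(** The hypothesis says D w = v D with v = w + l. Hence D e^w f = e^v (D f), and splitting D f as 1
    * D f gives the multiplier u = e^v 1. *)
Lemma sconf_eop_aux A (D : S -> S) (l : S) : {morph D : f g / f + g} -> scalar_op D ->
  (forall k f, wt k f -> wt (k - 1) (D f)) -> wt 1 l ->
  (forall f, D (vf A f) = vf A (D f) + l * D f) ->
  exists u, forall f, D (eop (vf A) f) = u * eop (vf A) (D f).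
Proof.
move=> DD DZ Dwt hl hD; pose v (f : S) : S := (vf A f + l * f : S).
have rw := raises_vf A; have wD := vfD A; have wC : sconst_op (vf A) by move=> a f; exact: vfC.
have wZ := sconst_scalar wC.
have rv : raises v.
  by move=> k f hf; apply: wtD; [exact: rw|rewrite -add1n; exact: wtM].
have vD : {morph v : f g / f + g} by move=> f g; rewrite /v wD mulrDr addrACA.
have vZ : scalar_op v.
  by move=> k f; rewrite /v wZ [RHS]scalerDr sser_scaleAr.
exists (eop v 1) => f; rewrite (@eop_intertwine _ v D 1 f rw rv) //.
rewrite -[D f in LHS]mul1r; apply: eop_leibniz => // g h.
by rewrite /v vfM; move: (vf A g) (vf A h) => a b; rewrite mulrDl addrAC mulrA.
Qed.

Lemma sconf_eop A : sconf (eop (vf A)).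
Proof.
split; first exact: good_eop.
- apply: (@sconf_eop_aux A (@Dp R) (Dp (vfp A))).
  + exact: DpD.
  + exact: Dp_scalar.
  + exact: wt_Dp.
  + by apply: wtW (wt_Dp (wt_vfp (dwt1 A))).
  + by move=> f; exact: Dp_vf.
- apply: (@sconf_eop_aux A (@Dm R) (Dm (vfm A))).
  + exact: DmD.
  + exact: Dm_scalar.
  + exact: wt_Dm.
  + by apply: wtW (wt_Dm (wt_vfm (dwt1 A))).
  + by move=> f; exact: Dm_vf.
Qed.

End Exponential.

(** * Superconformal series as exponentials *)

Section Bijection.
Variable R : realType.
Local Notation L := (Lam R).
Local Notation L0 := (Lam0 R).
Local Notation sg := (@lam_sign R).
Local Notation sgS := (@sser_sign R).
Local Notation S := (sser R).
Local Notation data := (data R).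
Local Notation x := (varx R).
Local Notation pp := (phip R).
Local Notation pm := (phim R).
Implicit Types (f g h : S) (A B : data) (s t : L0) (T U : S -> S).

Lemma shiftn_mul (a : L) c (u : nat -> L) n :
  shiftn c (fun k => a * u k) n = a * shiftn c u n.
Proof. by rewrite /shiftn; case: ifP; rewrite ?mulr0. Qed.

Lemma vfx_dscale t A : vfx (dscale t A) = constS (t : L) * vfx A.
Proof.
case: A => [[[a b] c] d]; apply: sserP => n; rewrite constSE constS_mul_comp.
by apply: sextP; rewrite /= ?(shiftn_mul (t : L)) ?mulrN ?mulr0.
Qed.
Lemma vfp_dscale t A : vfp (dscale t A) = constS (t : L) * vfp A.
Proof.
case: A => [[[a b] c] d]; apply: sserP => n; rewrite constSE constS_mul_comp.
apply: sextP; rewrite /= ?(shiftn_mul (t : L)) ?mulrN ?mulr0 ?mulrnAr //.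
by rewrite mulrDr lam_scalerAr.
Qed.
Lemma vfm_dscale t A : vfm (dscale t A) = constS (t : L) * vfm A.
Proof.
case: A => [[[a b] c] d]; apply: sserP => n; rewrite constSE constS_mul_comp.
apply: sextP; rewrite /= ?(shiftn_mul (t : L)) ?mulrN ?mulr0 ?mulrnAr ?mulrN //.
by rewrite mulrBr lam_scalerAr.
Qed.
Lemma vf_dscale t A f : vf (dscale t A) f = constS (t : L) * vf A f.
Proof. by rewrite /vf vfx_dscale vfp_dscale vfm_dscale !mulrDr !mulrA. Qed.

Lemma iter_vf_dscale t A k f :
  iter k (vf (dscale t A)) f = constS ((t : L) ^+ k) * iter k (vf A) f.
Proof.
elim: k => [|k ih]; first by rewrite expr0 constS1 mul1r.
by rewrite !iterS ih vf_dscale vfC mulrA -constSM -exprS.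
Qed.

Lemma dpow_dscale_sum s t A k f :
  \sum_(i < k.+1) dpow (vf (dscale s A)) i (dpow (vf (dscale t A)) (k - i) f)
  = dpow (vf (dscale (s + t) A)) k f.
Proof.
rewrite /dpow iter_vf_dscale -[(_ + _ : L0) : L]/(lam0_val (s + t)) -lam0_valX [s + t]addrC exprDn.
have -> : lam0_val (\sum_(i < k.+1) t ^+ (k - i) * s ^+ i *+ 'C(k, i))
    = \sum_(i < k.+1) (t : L) ^+ (k - i) * (s : L) ^+ i *+ 'C(k, i).
  rewrite (big_morph (@lam0_val R) (id1 := 0) (op1 := +%R)) //.
  apply: eq_bigr => i _; rewrite -!lam0_valX.
  by elim: 'C(_, _) => // n ih; rewrite !mulrSr -ih.
rewrite (big_morph (@constS R) (@constSD R) (constS0 R)) mulr_suml scaler_sumr.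
apply: eq_bigr => i _; have hi := ltn_ord i.
have wZ : scalar_op (iter i (vf A)).
  by elim: (val i) => // j ih k' g; rewrite !iterS ih vfZ.
have wC : sconst_op (iter i (vf A)).
  by elim: (val i) => // j ih k' g; rewrite !iterS ih vfC.
rewrite iter_vf_dscale wZ iter_vf_dscale wC -iterD subnKC; last by lia.
rewrite -sser_scaleAr scalerA mulrA -constSM constSMn mulrnAl -scalerMnr -scaler_nat scalerA.
have -> : (s : L) ^+ i * (t : L) ^+ (k - i) = (t : L) ^+ (k - i) * (s : L) ^+ i.
  by rewrite -!lam0_valX lam0_commC.
congr (_ *: _).
have hk : (i <= k)%N by lia.
have F n : (n`!%:R : R[i]) != 0 by rewrite pnatr_eq0 -lt0n fact_gt0.
have C0 : ('C(k, i)%:R : R[i]) != 0 by rewrite pnatr_eq0 -lt0n bin_gt0.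
rewrite -(bin_fact hk) !natrM; move: (F i) (F (k - i)%N) C0.
move: (_%:R) (_%:R) (_%:R) => u v w u0 v0 w0.
by rewrite invfM mulrA mulfV // mul1r invfM.
Qed.

(** Even scalars are central and constant for the field, so the operators sw and tw commute; the
    binomial theorem ([dpow_dscale_sum]) adds the exponents degree by degree. *)
Lemma eop_dscale s t A f :
  eop (vf (dscale s A)) (eop (vf (dscale t A)) f) = eop (vf (dscale (s + t) A)) f.
Proof.
set v := vf (dscale s A); set w := vf (dscale t A).
have rv := raises_vf (dscale s A); have rw := raises_vf (dscale t A).
apply: (eop_unique (raises_vf _)) => N.
have e : epart (vf (dscale (s + t) A)) N f
    = \sum_(k < N) \sum_(i < k.+1) dpow v i (dpow w (k - i) f).
  by apply: eq_bigr => k _; rewrite dpow_dscale_sum.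
have dD k : {morph dpow v k : f g / f + g}.
  move=> a b; rewrite /dpow; have -> : iter k v (a + b) = iter k v a + iter k v b.
    by elim: k => // k ih; rewrite !iterS ih /v vfD.
  by rewrite scalerDr.
have d0 k : dpow v k 0 = 0 by apply: (addrI (dpow v k 0)); rewrite -dD !addr0.
have q : epart v N (epart w N f) = \sum_(i < N) \sum_(j < N) dpow v i (dpow w j f).
  by apply: eq_bigr => i _; rewrite (big_morph _ (dD i) (d0 i)).
rewrite -(subrKA (eop v (epart w N f))); apply: wtD.
  have gv := good_eop (dscale s A).
  have TN g : eop v (- g) = - eop v g.
    have T0 : eop v 0 = 0 by apply: (addrI (eop v 0)); rewrite -(goodD gv) !addr0.
    by apply: (addrI (eop v g)); rewrite -(goodD gv) !subrr T0.
  rewrite -TN -(goodD gv); apply: (good_wt gv); exact: (eop_trunc N rw (wt0 f)).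
rewrite -(subrKA (epart v N (epart w N f))); apply: wtD.
  exact: (eop_trunc N rv (wt0 _)).
rewrite e q; apply: (@cauchy_wt R (fun i j => dpow v i (dpow w j f))) => i j.
by rewrite addnC; apply: wt_dpow => //; rewrite -[j]add0n; apply: wt_dpow => //; exact: wt0.
Qed.

Lemma vf_data0 f : vf 0 f = 0.
Proof.
have h c n : shiftn c (fun _ => 0 : L) n = 0 by rewrite /shiftn; case: ifP.
have -> : vf 0 f = constS ((0 : L0) : L) * vf 0 f.
  rewrite -vf_dscale; congr (vf _ f).
  by congr (_, _, _, _); apply/funext => k; apply/val_inj; rewrite /= ?mul0r.
by rewrite constS0 mul0r.
Qed.

Lemma eop_data0 f : eop (vf 0) f = f.
Proof.
apply/esym/(eop_unique (raises_vf 0)) => -[|N]; first exact: wt0.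
rewrite /epart big_ord_recl dpow0 big1 ?addr0 ?subrr // => i _.
by rewrite lift0 /dpow iterS vf_data0 scaler0.
Qed.

Lemma dscale0 A : dscale 0 A = 0.
Proof. by case: A => [[[a b] c] d]; congr (_, _, _, _); apply/funext => k; apply/val_inj; rewrite /= ?mul0r. Qed.
Lemma dscale1 A : dscale 1 A = A.
Proof. by case: A => [[[a b] c] d]; congr (_, _, _, _); apply/funext => k; apply/val_inj; rewrite /= ?mul1r. Qed.
Lemma dscaleN A : dscale (- 1) A = - A.
Proof. by case: A => [[[a b] c] d]; congr (_, _, _, _); apply/funext => k; apply/val_inj; rewrite /= ?mulN1r. Qed.
Lemma dscaleA s t A : dscale s (dscale t A) = dscale (s * t) A.
Proof. by case: A => [[[a b] c] d]; congr (_, _, _, _); apply/funext => k; apply/val_inj; rewrite /= ?mulrA. Qed.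

Lemma eopNK A f : eop (vf (- A)) (eop (vf A) f) = f.
Proof. by rewrite -dscaleN -{2}(dscale1 A) eop_dscale addNr dscale0 eop_data0. Qed.
Lemma eopKN A f : eop (vf A) (eop (vf (- A)) f) = f.
Proof. by have := eopNK (- A) f; rewrite opprK. Qed.

Lemma shiftnB c (u v : nat -> L) n : shiftn c (fun k => u k - v k) n = shiftn c u n - shiftn c v n.
Proof. by rewrite /shiftn; case: ifP; rewrite ?subr0. Qed.

Lemma vfxB A B : vfx (A - B) = vfx A - vfx B.
Proof.
case: A B => [[[a b] c] d] [[[a' b'] c'] d']; apply: sserP => n; rewrite sserBE.
apply: sextP; rewrite /= ?subr0.
- exact: (shiftnB 2 (fun k => a k : L) (fun k => a' k : L)).
- by rewrite (shiftnB 1 (fun k => d k : L) (fun k => d' k : L)) opprB opprK addrC.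
- by rewrite (shiftnB 1 (fun k => c k : L) (fun k => c' k : L)) opprB opprK addrC.
- by [].
Qed.

Lemma vfpB A B : vfp (A - B) = vfp A - vfp B.
Proof.
case: A B => [[[a b] c] d] [[[a' b'] c'] d']; apply: sserP => n; rewrite sserBE.
apply: sextP; rewrite /= ?subr0.
- exact: (shiftnB 1 (fun k => c k : L) (fun k => c' k : L)).
- rewrite (shiftnB 1 (fun k => a k : L) (fun k => a' k : L)).
  by rewrite (shiftnB 1 (fun k => b k : L) (fun k => b' k : L)) scalerBr opprD addrACA.
- by [].
- by rewrite mulrnBl.
Qed.

Lemma vfmB A B : vfm (A - B) = vfm A - vfm B.
Proof.
case: A B => [[[a b] c] d] [[[a' b'] c'] d']; apply: sserP => n; rewrite sserBE.
apply: sextP; rewrite /= ?subr0.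
- exact: (shiftnB 1 (fun k => d k : L) (fun k => d' k : L)).
- by [].
- rewrite (shiftnB 1 (fun k => a k : L) (fun k => a' k : L)).
  rewrite (shiftnB 1 (fun k => b k : L) (fun k => b' k : L)) scalerBr !opprD !opprK.
  by rewrite addrACA.
- by rewrite opprB mulrnBl !mulNrn opprK addrC.
Qed.

Lemma vfB A B f : vf (A - B) f = vf A f - vf B f.
Proof.
rewrite /vf vfxB vfpB vfmB !mulrBl !opprD.
move: (vfx A * _) (vfx B * _) (vfp A * _) (vfp B * _) (vfm A * _) (vfm B * _) => a b c d e g.
by rewrite !addrA [LHS](ACl (1*3*5*2*4*6)).
Qed.

Lemma dwt_eq0 A : (forall q, dwt q A) -> A = 0.
Proof.
case: A => [[[a b] c] d] h; congr (_, _, _, _); apply/funext => k.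
- by have [h1 _ _ _] := h (2 * k + 3)%N; apply: h1; lia.
- by have [_ h1 _ _] := h (2 * k + 3)%N; apply: h1; lia.
- by have [_ _ h1 _] := h (2 * k + 3)%N; apply: h1; lia.
- by have [_ _ _ h1] := h (2 * k + 3)%N; apply: h1; lia.
Qed.

Lemma dwtD q A B : dwt q A -> dwt q B -> dwt q (A + B).
Proof.
case: A B => [[[a b] c] d] [[[a' b'] c'] d'] [h1 h2 h3 h4] [k1 k2 k3 k4].
by split=> k hk; [move: (h1 k hk) (k1 k hk)|move: (h2 k hk) (k2 k hk)
  |move: (h3 k hk) (k3 k hk)|move: (h4 k hk) (k4 k hk)];
  rewrite /= => e1 e2; rewrite -[LHS]/(_ k + _ k) e1 e2 addr0.
Qed.
Lemma dwtN q A : dwt q A -> dwt q (- A).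
Proof.
case: A => [[[a b] c] d] [h1 h2 h3 h4].
by split=> k hk; [move: (h1 k hk)|move: (h2 k hk)|move: (h3 k hk)|move: (h4 k hk)];
  rewrite /= => e1; rewrite -[LHS]/(- _ k) e1 oppr0.
Qed.
Lemma dwtW q r A : (r <= q)%N -> dwt q A -> dwt r A.
Proof.
move=> rq [h1 h2 h3 h4]; split=> k hk; [apply: h1|apply: h2|apply: h3|apply: h4]; lia.
Qed.

Lemma iter_vf_diff A B q k j f : (0 < q)%N -> dwt q (A - B) -> wt j f ->
  wt (j + q + k) (iter k.+1 (vf A) f - iter k.+1 (vf B) f).
Proof.
move=> q0 h hf; elim: k => [|k ih].
  by rewrite addn0 /= -vfB; exact: wt_vf.
rewrite [iter k.+2 _ _ in X in wt _ (X - _)]iterS [iter k.+2 _ _]iterS.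
rewrite -(subrKA (vf A (iter k.+1 (vf B) f))); apply: wtD.
  by rewrite -vfN -vfD addnS -addn1; apply: wt_vf ih; exact: dwt1.
rewrite -vfB; apply: (@wtW _ (j + k.+1 + q)); first lia.
apply: wt_vf => //; elim: (k.+1) => [|i ihi]; first by rewrite addn0.
by rewrite iterS addnS -addn1; apply: wt_vf ihi; exact: dwt1.
Qed.

(** The linear terms of the two exponentials differ by exactly [vf (A - B) f]. In every higher power
    the difference of weight q occurs together with at least one more application of a field, which
    raises the weight again. *)
Lemma eop_vf_diff A B q j f : (0 < q)%N -> dwt q (A - B) -> wt j f ->
  wt (j + q).+1 (eop (vf A) f - eop (vf B) f - vf (A - B) f).
Proof.
move=> q0 h hf; set K := (j + q).+1.
have e : epart (vf A) K.+1 f - epart (vf B) K.+1 f - vf (A - B) f =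
    \sum_(k < K.-1) (dpow (vf A) k.+2 f - dpow (vf B) k.+2 f).
  have -> : K = K.-1.+1 by [].
  rewrite /epart -sumrB 2!big_ord_recl !dpow0 subrr add0r vfB /dpow /=.
  by rewrite invr1 !scale1r addrAC subrr add0r.
rewrite -(subrK (epart (vf A) K.+1 f - epart (vf B) K.+1 f) (eop (vf A) f - eop (vf B) f)).
rewrite -[X in wt _ X]addrA e; apply: wtD.
  rewrite opprD opprK addrACA -opprB [- (_ - _)]opprB; apply: wtD.
    by apply: wtW (eop_trunc K.+1 (raises_vf A) (wt0 f)); lia.
  rewrite addrC -opprB; apply: wtN.
  by apply: wtW (eop_trunc K.+1 (raises_vf B) (wt0 f)); lia.
apply: wt_sum => k _; rewrite /dpow -scalerBr; apply: wtZ.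
by apply: wtW (iter_vf_diff k.+1 q0 h hf); lia.
Qed.

Definition to_even (a : L) : L0 := insubd 0 a.
Definition to_odd (a : L) : Lam1 R := insubd 0 a.

Lemma to_evenK (a : L) : sg a = a -> (to_even a : L) = a.
Proof. by move=> h; apply: insubdK; apply/asboolP/has_parity_even. Qed.
Lemma to_oddK (a : L) : sg a = - a -> (to_odd a : L) = a.
Proof. by move=> h; apply: insubdK; apply/asboolP/has_parity_odd. Qed.

(** To first order these coefficients of E~(A) are the entries of A. At x^(k+1) phi+ the field
    contributes A^-_(k+1) together with (k+2)/2 times A^+_(k+1), hence the subtraction. *)
Definition prj (F : triple R) : data :=
  (fun k => to_even (c0 (F.1.1 k.+2)),
   fun k => to_even (cp (F.1.2 k.+1) - (k.+2%:R / 2 : R[i]) *: c0 (F.1.1 k.+2)),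
   fun k => to_odd (c0 (F.1.2 k.+1)), fun k => to_odd (c0 (F.2 k.+1))).

Definition even_odd (F : triple R) := [/\ sgS F.1.1 = F.1.1, sgS F.1.2 = - F.1.2 & sgS F.2 = - F.2].

Lemma even_c0 f n : sgS f = f -> sg (c0 (f n)) = c0 (f n).
Proof. by move=> h; rewrite -{2}h. Qed.
Lemma odd_c0 f n : sgS f = - f -> sg (c0 (f n)) = - c0 (f n).
Proof. by move=> h; rewrite -[RHS]/(c0 ((- f) n)) -h. Qed.
Lemma odd_cp f n : sgS f = - f -> sg (cp (f n)) = cp (f n).
Proof. by move=> h; apply: oppr_inj; rewrite -[RHS]/(cp ((- f) n)) -h. Qed.
Lemma odd_cm f n : sgS f = - f -> sg (cm (f n)) = cm (f n).
Proof. by move=> h; apply: oppr_inj; rewrite -[RHS]/(cm ((- f) n)) -h. Qed.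
Lemma even_cpm f n : sgS f = f -> sg (cpm (f n)) = cpm (f n).
Proof. by move=> h; rewrite -{2}h. Qed.
Lemma even_cp f n : sgS f = f -> sg (cp (f n)) = - cp (f n).
Proof. by move=> h; rewrite -{2}h opprK. Qed.
Lemma even_cm f n : sgS f = f -> sg (cm (f n)) = - cm (f n).
Proof. by move=> h; rewrite -{2}h opprK. Qed.
Lemma odd_cpm f n : sgS f = - f -> sg (cpm (f n)) = - cpm (f n).
Proof. by move=> h; rewrite -[RHS]/(cpm ((- f) n)) -h. Qed.

Lemma prjE F : even_odd F -> [/\ forall k, ((prj F).1.1.1 k : L) = c0 (F.1.1 k.+2),
  forall k, ((prj F).1.1.2 k : L) = cp (F.1.2 k.+1) - (k.+2%:R / 2 : R[i]) *: c0 (F.1.1 k.+2),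
  forall k, ((prj F).1.2 k : L) = c0 (F.1.2 k.+1) & forall k, ((prj F).2 k : L) = c0 (F.2 k.+1)].
Proof.
move=> [h1 h2 h3]; split=> k /=.
- by rewrite to_evenK // even_c0.
- by rewrite to_evenK // lam_signB lam_signZ odd_cp // even_c0.
- by rewrite to_oddK // odd_c0.
- by rewrite to_oddK // odd_c0.
Qed.

Lemma even_odd_good T : good T -> even_odd (triple_of T).
Proof.
move=> gT; have TN : {morph T : g / - g}.
  have T0 : T 0 = 0 by apply: (addrI (T 0)); rewrite -(goodD gT) !addr0.
  by move=> g; apply: (addrI (T g)); rewrite -(goodD gT) !subrr T0.
by split; rewrite /= (good_sign gT) ?sser_sign_varx ?sser_sign_phip ?sser_sign_phim ?TN.
Qed.

Lemma dwt_diff A B (P Q : data) q :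
  (forall k, (2 * k + 2 < q)%N -> (P.1.1.1 k : L) - (Q.1.1.1 k : L) = (A.1.1.1 k : L) - (B.1.1.1 k : L)) ->
  (forall k, (2 * k + 2 < q)%N -> (P.1.1.2 k : L) - (Q.1.1.2 k : L) = (A.1.1.2 k : L) - (B.1.1.2 k : L)) ->
  (forall k, (2 * k + 1 < q)%N -> (P.1.2 k : L) - (Q.1.2 k : L) = (A.1.2 k : L) - (B.1.2 k : L)) ->
  (forall k, (2 * k + 1 < q)%N -> (P.2 k : L) - (Q.2 k : L) = (A.2 k : L) - (B.2 k : L)) ->
  dwt q (A - B - (P - Q)).
Proof.
case: A B P Q => [[[a b] c] d] [[[a' b'] c'] d'] [[[e f] g] h] [[[e' f'] g'] h'] /= h1 h2 h3 h4.
split=> k hk /=; apply/val_inj.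
- by rewrite -[LHS]/((a k : L) - (a' k : L) - ((e k : L) - (e' k : L))) h1 // subrr.
- by rewrite -[LHS]/((b k : L) - (b' k : L) - ((f k : L) - (f' k : L))) h2 // subrr.
- by rewrite -[LHS]/((c k : L) - (c' k : L) - ((g k : L) - (g' k : L))) h3 // subrr.
- by rewrite -[LHS]/((d k : L) - (d' k : L) - ((h k : L) - (h' k : L))) h4 // subrr.
Qed.

Lemma subr_scale_eq (u v y z a b : L) (r : R[i]) : u - v = r *: a + b -> y - z = a ->
  (u - r *: y) - (v - r *: z) = b.
Proof.
move=> uv yz; have -> : u - r *: y - (v - r *: z) = u - v - r *: (y - z).
  by rewrite scalerBr !opprB !addrA [LHS](ACl (1*4*3*2)).
by rewrite yz uv addrAC subrr add0r.
Qed.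

(** If A and B agree below weight q, then at weight q the entries of [prj (Etilde A)] and
    [prj (Etilde B)] differ exactly as those of A and B. Injectivity and surjectivity of E~ both
    rest on this unipotence. *)
Lemma prj_diff A B q : (0 < q)%N -> dwt q (A - B) ->
  dwt q.+1 (A - B - (prj (Etilde A) - prj (Etilde B))).
Proof.
move=> q0 h; have eoA := even_odd_good (good_eop A); have eoB := even_odd_good (good_eop B).
rewrite !EtildeE.
have [a1 a2 a3 a4] := prjE eoA; have [b1 b2 b3 b4] := prjE eoB.
have hx := eop_vf_diff q0 h (wt_varx R); have hp := eop_vf_diff q0 h (wt_phip R).
have hm := eop_vf_diff q0 h (wt_phim R).
rewrite vf_varx in hx; rewrite vf_phip in hp; rewrite vf_phim in hm.
have X k : (2 * k + 2 < q.+1)%N -> c0 (eop (vf A) x k.+2) - c0 (eop (vf B) x k.+2)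
    = (A.1.1.1 k : L) - (B.1.1.1 k : L).
  move=> hk; have [e _ _ _] := hx k.+2.
  transitivity (c0 (vfx (A - B) k.+2)).
    by apply/eqP; rewrite -subr_eq0; apply/eqP; apply: e; lia.
  by rewrite /= !shiftnS shiftn0.
have Y k : (2 * k + 2 < q.+1)%N -> cp (eop (vf A) pp k.+1) - cp (eop (vf B) pp k.+1)
    = (k.+2%:R / 2 : R[i]) *: ((A.1.1.1 k : L) - (B.1.1.1 k : L)) + ((A.1.1.2 k : L) - (B.1.1.2 k : L)).
  move=> hk; have [_ e _ _] := hp k.+1.
  transitivity (cp (vfp (A - B) k.+1)).
    by apply/eqP; rewrite -subr_eq0; apply/eqP; apply: e; lia.
  by rewrite /= !shiftnS !shiftn0.
have Z k : (2 * k + 1 < q.+1)%N -> c0 (eop (vf A) pp k.+1) - c0 (eop (vf B) pp k.+1)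
    = (A.1.2 k : L) - (B.1.2 k : L).
  move=> hk; have [e _ _ _] := hp k.+1.
  transitivity (c0 (vfp (A - B) k.+1)).
    by apply/eqP; rewrite -subr_eq0; apply/eqP; apply: e; lia.
  by rewrite /= !shiftnS !shiftn0.
have V k : (2 * k + 1 < q.+1)%N -> c0 (eop (vf A) pm k.+1) - c0 (eop (vf B) pm k.+1)
    = (A.2 k : L) - (B.2 k : L).
  move=> hk; have [e _ _ _] := hm k.+1.
  transitivity (c0 (vfm (A - B) k.+1)).
    by apply/eqP; rewrite -subr_eq0; apply/eqP; apply: e; lia.
  by rewrite /= !shiftnS !shiftn0.
have sub2 (a b c d : L) : a = b -> c = d -> a - c = b - d by move=> -> ->.
apply: dwt_diff => k hk.
- exact: etrans (sub2 _ _ _ _ (a1 k) (b1 k)) (X k hk).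
- exact: etrans (sub2 _ _ _ _ (a2 k) (b2 k)) (subr_scale_eq (Y k hk) (X k hk)).
- exact: etrans (sub2 _ _ _ _ (a3 k) (b3 k)) (Z k hk).
- exact: etrans (sub2 _ _ _ _ (a4 k) (b4 k)) (V k hk).
Qed.

Lemma Etilde_inj A B : Etilde A = Etilde B -> A = B.
Proof.
move=> e; apply/eqP; rewrite -subr_eq0; apply/eqP/dwt_eq0.
elim=> [|q ih]; first by split=> k; lia.
case: q ih => [|q] ih; first exact: dwt1.
by have := prj_diff (ltn0Sn q) ih; rewrite e subrr subr0.
Qed.

(* Since [A |-> prj (Etilde A)] is the identity up to terms involving only
   entries of smaller weight, iterating [A |-> A + F - prj (Etilde A)] converges. *)
Lemma prj_Etilde_surj (F : data) : exists A, prj (Etilde A) = F.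
Proof.
pose Phi A := A + (F - prj (Etilde A)).
have PhiD A B : Phi A - Phi B = A - B - (prj (Etilde A) - prj (Etilde B)).
  by rewrite /Phi !opprD !opprK; move: (prj _) (prj _) => a b;
    rewrite !addrA [LHS](ACl (1*4*3*6*2*5)) /= addrK.
have contr q A B : dwt q (A - B) -> dwt q.+1 (Phi A - Phi B).
  case: q => [|q] h; first exact: dwt1.
  by rewrite PhiD; exact: prj_diff.
pose a n := iter n Phi 0.
have aS n : dwt n (a n.+1 - a n).
  elim: n => [|n ih]; first by split=> k; lia.
  by apply: (contr n (a n.+1) (a n)).
have am n m : (n <= m)%N -> dwt n (a m - a n).
  elim: m => [|m ih]; first by rewrite leqn0 => /eqP ->; rewrite subrr; split.
  rewrite leq_eqVlt => /orP[/eqP ->|nm]; first by rewrite subrr; split.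
  by rewrite -(subrKA (a m)); apply: dwtD; [apply: dwtW (aS m)|exact: ih].
have aE n : a n.+1 = Phi (a n) by [].
clearbody a.
(* Entries at k are controlled by [dwt q] once 2 k + 2 < q, so they are stationary from the iterate
   2 k + 3 on. *)
pose A : data := (fun k => (a (2 * k + 3)%N).1.1.1 k, fun k => (a (2 * k + 3)%N).1.1.2 k,
  fun k => (a (2 * k + 3)%N).1.2 k, fun k => (a (2 * k + 3)%N).2 k).
have Aa n : dwt n (A - a n).
  have sub0 (V : zmodType) (u v : V) : v - u = 0 -> u - v = 0.
    by move=> h; rewrite -opprB h oppr0.
  split=> k hk.
  - rewrite -[LHS]/((a (2 * k + 3)%N).1.1.1 k - (a n).1.1.1 k).
    case: (leqP n (2 * k + 3)) => nk; first by have [h _ _ _] := am _ _ nk; exact: h.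
    by apply: sub0; have [h _ _ _] := am _ _ (ltnW nk); apply: h; lia.
  - rewrite -[LHS]/((a (2 * k + 3)%N).1.1.2 k - (a n).1.1.2 k).
    case: (leqP n (2 * k + 3)) => nk; first by have [_ h _ _] := am _ _ nk; exact: h.
    by apply: sub0; have [_ h _ _] := am _ _ (ltnW nk); apply: h; lia.
  - rewrite -[LHS]/((a (2 * k + 3)%N).1.2 k - (a n).1.2 k).
    case: (leqP n (2 * k + 3)) => nk; first by have [_ _ h _] := am _ _ nk; exact: h.
    by apply: sub0; have [_ _ h _] := am _ _ (ltnW nk); apply: h; lia.
  - rewrite -[LHS]/((a (2 * k + 3)%N).2 k - (a n).2 k).
    case: (leqP n (2 * k + 3)) => nk; first by have [_ _ _ h] := am _ _ nk; exact: h.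
    by apply: sub0; have [_ _ _ h] := am _ _ (ltnW nk); apply: h; lia.
exists A; apply/eqP; rewrite eq_sym -subr_eq0; apply/eqP/dwt_eq0 => n.
have -> : F - prj (Etilde A) = (Phi A - Phi (a n)) + (a n.+1 - A).
  by rewrite aE subrKA /Phi [A + _]addrC addrK.
apply: dwtD; first by apply: dwtW (contr _ _ _ (Aa n)).
by rewrite -opprB; apply: dwtN; apply: dwtW (Aa n.+1).
Qed.

Lemma series_parityP (p : bool) f : series_parity p f <-> sgS f = if p then - f else f.
Proof.
split=> [h|h n].
  apply: sserP => n; have [h1 h2 h3 h4] := h n; rewrite /sser_sign /sext_sign.
  case: p h h1 h2 h3 h4 => _ /=.
    move=> /has_parity_odd h1 /has_parity_even h2 /has_parity_even h3 /has_parity_odd h4.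
    by rewrite h1 h2 h3 h4.
  move=> /has_parity_even h1 /has_parity_odd h2 /has_parity_odd h3 /has_parity_even h4.
  by rewrite h1 h2 h3 h4; apply: sextP; rewrite /= ?opprK.
case: p h => h /=; split.
- by apply/has_parity_odd; exact: odd_c0.
- by apply/has_parity_even; exact: odd_cp.
- by apply/has_parity_even; exact: odd_cm.
- by apply/has_parity_odd; exact: odd_cpm.
- by apply/has_parity_even; exact: even_c0.
- by apply/has_parity_odd; exact: even_cp.
- by apply/has_parity_odd; exact: even_cm.
- by apply/has_parity_even; exact: even_cpm.
Qed.

Lemma conv_eq0 (u v : nat -> L) : u 0%N \is a GRing.unit -> (forall n, sg (u n) = u n) ->
  (forall n, \sum_(i < n.+1) u i * v (n - i)%N = 0) -> forall n, v n = 0.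
Proof.
move=> u0 ue h; elim/ltn_ind => n ih; have := h n.
rewrite big_ord_recl subn0 big1 ?addr0 => [/(congr1 (fun z => (u 0%N)^-1 * z))|i _].
  by rewrite mulKr // mulr0.
by rewrite lift0 ih ?mulr0 //; have := ltn_ord i; lia.
Qed.

Lemma natmul_eq0 (a : L) n : a *+ n.+1 = 0 -> a = 0.
Proof.
move=> h; apply: lamP => I; have /(congr1 (fun b : L => b I)) := h.
have -> : (a *+ n.+1) I = a I *+ n.+1.
  by elim: n.+1 {h} => // m ih; rewrite !mulrSr lamDE ih.
by rewrite lam0E => /eqP; rewrite mulrn_eq0 => /eqP.
Qed.

Lemma sg_eq0 (a : L) : sg a = 0 -> a = 0.
Proof. by move=> h; rewrite -[a]lam_signK h lam_sign0. Qed.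

Lemma Dp0 : Dp (0 : S) = 0.
Proof. by apply: (addrI (Dp (0 : S))); rewrite -DpD !addr0. Qed.
Lemma Dm0 : Dm (0 : S) = 0.
Proof. by apply: (addrI (Dm (0 : S))); rewrite -DmD !addr0. Qed.
Lemma DpN f : Dp (- f) = - Dp f.
Proof. by apply: (addrI (Dp f)); rewrite -DpD !subrr Dp0. Qed.
Lemma DmN f : Dm (- f) = - Dm f.
Proof. by apply: (addrI (Dm f)); rewrite -DmD !subrr Dm0. Qed.

Lemma superconformal_cm F : superconformal (@dx R) F -> forall n, cm (F.1.2 n) = 0.
Proof.
case: F => [[X P] M] [[_ _ _] [[_ /(congr1 (fun f : S => f)) h _ _] _]] n /=.
have /(congr1 (fun f : S => c0 (f n))) : Dm P = 0 := h.
by rewrite DmE /=; exact: sg_eq0.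
Qed.

Lemma superconformal_cpm F : superconformal (@dx R) F ->
  forall n, cpm (F.1.2 n) = c0 (F.1.2 n.+1) *+ n.+1.
Proof.
case: F => [[X P] M] [[_ pP _] [[_ h _ _] _]] n /=.
have {}h : Dm P = 0 := h; move/(congr1 (fun f : S => cp (f n))) : h.
rewrite DmE /= => /eqP; rewrite addrC subr_eq0 => /eqP h.
by apply: (can_inj (@lam_signK R)); rewrite -h lam_signMn.
Qed.

Lemma superconformal_cp F : superconformal (@dx R) F -> forall n, cp (F.2 n) = 0.
Proof.
case: F => [[X P] M] [[_ _ _] [[h _ _ _] _]] n /=.
have /(congr1 (fun f : S => c0 (f n))) : Dp M = 0 := h.
by rewrite DpE /=; exact: sg_eq0.
Qed.

Lemma superconformal_cpm' F : superconformal (@dx R) F ->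
  forall n, cpm (F.2 n) = - (c0 (F.2 n.+1) *+ n.+1).
Proof.
case: F => [[X P] M] [[_ _ pM] [[h _ _ _] _]] n /=.
have {}h : Dp M = 0 := h; move/(congr1 (fun f : S => cm (f n))) : h.
rewrite DpE /= => /eqP; rewrite addr_eq0 => /eqP h.
by apply: (can_inj (@lam_signK R)); rewrite h lam_signN lam_signMn.
Qed.

(** The phi- coefficient of the D+ equation and the phi+ coefficient of the D- equation contain the
    phi+ phi- coefficient of x~ with opposite signs. Their sum is twice the claim. *)
Lemma superconformal_c0' F : superconformal (@dx R) F -> vanishes0 F ->
  c0 (F.1.1 1%N) = cp (F.1.2 0%N) * cm (F.2 0%N).
Proof.
case: F => [[X P] M] sF [/= X0 P0 M0].
have cmP := superconformal_cm sF 0%N; have cpM := superconformal_cp sF 0%N.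
have [[/series_parityP pX /series_parityP pP /series_parityP pM] [[_ _ h1 h2] _]] := sF.
have {}h1 : Dp X = M * Dp P := h1; have {}h2 : Dm X = P * Dm M := h2.
have := congr1 (fun f : S => cm (f 0%N)) h1; have := congr1 (fun f : S => cp (f 0%N)) h2.
rewrite !sserME !big_ord1 subnn DpE DmE DpE DmE /= in cmP cpM *.
rewrite -![c0 (_ 0%N)]/(at0 _) P0 M0 !mul0r !add0r !lam_signK.
rewrite (even_cpm 0 pX) (even_c0 1 pX).
move=> e1 e2; have : c0 (X 1%N) *+ 2 = (cp (P 0%N) * cm (M 0%N)) *+ 2.
  rewrite mulr2n [RHS]mulr2n -{1}e1 -[in RHS](lam_even_comm _ (odd_cm 0 pM)) -e2.
  by rewrite addrACA [- _ + _]addrC subrr add0r.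
move=> /eqP; rewrite -subr_eq0 -mulrnBl => /eqP/natmul_eq0 /eqP.
by rewrite subr_eq0 => /eqP.
Qed.

(* c0 X, c0 P, c0 M and cp P determine a superconformal triple (X, P, M):
   the coefficient cm M is recovered by dividing by the invertible series cp P. *)
Lemma superconformal_unique F G : superconformal (@dx R) F -> superconformal (@dx R) G ->
  cp (F.1.2 0%N) \is a GRing.unit ->
  (forall n, c0 (F.1.1 n) = c0 (G.1.1 n)) -> (forall n, c0 (F.1.2 n) = c0 (G.1.2 n)) ->
  (forall n, c0 (F.2 n) = c0 (G.2 n)) -> (forall n, cp (F.1.2 n) = cp (G.1.2 n)) -> F = G.
Proof.
move=> sF sG uF h1 h2 h3 h4.
have eP : F.1.2 = G.1.2.
  apply: sserP => n; apply: sextP => //; first by rewrite !superconformal_cm.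
  by rewrite !superconformal_cpm // h2.
have M_cp n : cp (F.2 n) = cp (G.2 n) by rewrite !superconformal_cp.
have M_cpm n : cpm (F.2 n) = cpm (G.2 n) by rewrite !superconformal_cpm' // h3.
move: F G sF sG uF h1 h2 h3 h4 eP M_cp M_cpm => [[X P] M] [[X' P'] M'] /=.
move=> sF sG uF h1 _ h3 _ eP M_cp M_cpm; subst P'.
have [[/series_parityP pX /series_parityP pP /series_parityP pM] [[_ _ hp hm] _]] := sF.
have [[/series_parityP pX' _ /series_parityP pM'] [[_ _ hp' hm'] _]] := sG.
pose d n := cm (M n) - cm (M' n); pose Y := X - X'.
have dM : M - M' = fun n => SExt 0 0 (d n) 0.
  by apply: sserP => n; rewrite sserBE; apply: sextP; rewrite /= ?h3 ?M_cp ?M_cpm ?subrr.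

have eYp : Dp Y = (M - M') * Dp P.
  by rewrite /Y DpD DpN mulrBl -[Dp X]/(dphip X + pm * dx X) hp -[Dp X']/(dphip X' + pm * dx X') hp'.
have eYm : Dm Y = P * Dm (M - M').
  rewrite /Y DmD DmN DmD DmN mulrBr.
  by rewrite -[Dm X]/(dphim X + pp * dx X) hm -[Dm X']/(dphim X' + pp * dx X') hm'.
have Y0 n : c0 (Y n) = 0 by rewrite /Y sserBE /= h1 subrr.
have kE n : sg (cp (P n)) = cp (P n) by exact: odd_cp.
have dE n : sg (d n) = d n by rewrite /d lam_signB !odd_cm.
have pY : sgS Y = Y by rewrite /Y sser_signD sser_signN pX pX'.
have YE : Y = X - X' by [].
clearbody Y.
(* The D+ equation gives [cpm Y], and the D- equation gives [- cpm Y], as one and the same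
   convolution; hence both vanish, and [d] with them because [cp P] starts with a unit. *)
have a1 n : cpm (Y n) = \sum_(i < n.+1) cp (P i) * d (n - i)%N.
  have := congr1 (fun f : S => cm (f n)) eYp.
  rewrite DpE /= Y0 lam_sign0 mul0rn addr0 even_cpm // => ->.
  rewrite dM sserME cm_sum (reindex_inj rev_ord_inj); apply: eq_bigr => i _.
  rewrite DpE /= subSS mul0r add0r lam_signK; have -> : (n - (n - i) = i)%N by have := ltn_ord i; lia.
  exact: lam_even_comm.
have a2 n : - cpm (Y n) = \sum_(i < n.+1) cp (P i) * d (n - i)%N.
  have := congr1 (fun f : S => cp (f n)) eYm.
  rewrite DmE /= Y0 lam_sign0 mul0rn addr0 even_cpm // => ->.
  rewrite dM sserME cp_sum; apply: eq_bigr => i _.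
  by rewrite DmE /= !lam_sign0 oppr0 mul0rn addr0 mulr0 add0r lam_signK.
have Ypm n : cpm (Y n) = 0.
  apply: (@natmul_eq0 _ 1); rewrite mulr2n {1}a1 -a2 addNr //.
have d0 : forall n, d n = 0.
  by apply: (conv_eq0 (u := fun n => cp (P n))) => // n; rewrite -a1.
have dM0 : M - M' = 0 by rewrite dM; apply: sserP => n; rewrite d0.
have eM : M = M' by apply/eqP; rewrite -subr_eq0 dM0.
have Yp n : cp (Y n) = 0.
  have := congr1 (fun f : S => c0 (f n)) eYp; rewrite dM0 mul0r DpE /=; exact: sg_eq0.
have Ym n : cm (Y n) = 0.
  have := congr1 (fun f : S => c0 (f n)) eYm; rewrite dM0 Dm0 mulr0 DmE /=; exact: sg_eq0.
have Y00 : Y = 0 by apply: sserP => n; apply: sextP; rewrite ?Y0 ?Yp ?Ym ?Ypm.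
by rewrite eM; congr (_, _, _); apply/eqP; rewrite -subr_eq0 -YE Y00.
Qed.

End Bijection.

(** * Scalings, the full map E^, and data as operators *)

Section DataGroup.
Variable R : realType.
Local Notation L := (Lam R).
Local Notation L0 := (Lam0 R).
Local Notation sg := (@lam_sign R).
Local Notation sgS := (@sser_sign R).
Local Notation S := (sser R).
Local Notation data := (data R).
Local Notation pdata := (pdata R).
Local Notation x := (varx R).
Local Notation pp := (phip R).
Local Notation pm := (phim R).
Implicit Types (f g h : S) (A B : data) (T U : S -> S) (q r : L0) (al be : pdata).

Lemma DpC (c : L) f : sg c = c -> Dp (constS c * f) = constS c * Dp f.
Proof.
move=> ec; rewrite DpM sser_sign_const ec /Dp dphip_const dx_const mulr0 addr0.
by rewrite mul0r add0r.
Qed.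
Lemma DmC (c : L) f : sg c = c -> Dm (constS c * f) = constS c * Dm f.
Proof.
move=> ec; rewrite DmM sser_sign_const ec /Dm dphim_const dx_const mulr0 addr0.
by rewrite mul0r add0r.
Qed.

Lemma constS_even_comm (c : L) f : sg c = c -> constS c * f = f * constS c.
Proof. by move=> ec; apply: sser_even_comm; rewrite sser_sign_const ec. Qed.

Definition leading T (a b : L) := wt 2 (T pp - constS a * pp) /\ wt 2 (T pm - constS b * pm).

Lemma leading_coef T a b : leading T a b ->
  [/\ cp (T pp 0%N) = a & cm (T pm 0%N) = b].
Proof.
have h (c : L) f : (constS c * f) 0%N = SExt c 0 0 0 * f 0%N by rewrite constSE.
move=> [hp hm]; split.
- have [_ e _ _] := hp 0%N; have /eqP := e isT; rewrite sserBE h subr_eq0 => /eqP ->.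
  by rewrite /= mul0r mulr1 addr0.
- have [_ _ e _] := hm 0%N; have /eqP := e isT; rewrite sserBE h subr_eq0 => /eqP ->.
  by rewrite /= mul0r mulr1 addr0.
Qed.

Lemma leading_comp T U a b c d : good T -> leading T a b -> leading U c d ->
  leading (T \o U) (c * a) (d * b).
Proof.
move=> gT [ta tb] [uc ud]; have TN g : T (- g) = - T g.
  have T0 : T 0 = 0 by apply: (addrI (T 0)); rewrite -(goodD gT) !addr0.
  by apply: (addrI (T g)); rewrite -(goodD gT) !subrr T0.
split; rewrite constSM -mulrA.
- rewrite -(subrKA (T (constS c * pp))); apply: wtD.
    by rewrite -TN -(goodD gT); apply: (good_wt gT).
  by rewrite (goodC gT) -mulrBr; apply: wtMr.
- rewrite -(subrKA (T (constS d * pm))); apply: wtD.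
    by rewrite -TN -(goodD gT); apply: (good_wt gT).
  by rewrite (goodC gT) -mulrBr; apply: wtMr.
Qed.

Lemma lam_unit_neq0 (a : L) : a \is a GRing.unit -> a != 0.
Proof. by apply: contraTneq => ->; rewrite unitr0. Qed.

(** The equations are D (T f) = u T (D f) for f = x, phi+, phi-. Since D+ phi+ = 1 and D- phi- = 1,
    the multipliers are D+ (T phi+) and D- (T phi-). *)
Lemma sconf_superconformal T a b : sconf T -> leading T a b -> a != 0 -> b != 0 ->
  superconformal (@dx R) (triple_of T).
Proof.
move=> [gT [u hu] [v hv]] lT a0 b0; have [ea eb] := leading_coef lT.
have [/= eX eP eM] := even_odd_good gT.
have T0 : T 0 = 0 by apply: (addrI (T 0)); rewrite -(goodD gT) !addr0.
have Dpp : Dp pp = 1 by rewrite /Dp dphip_phip dx_phip mulr0 addr0.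
have Dpm : Dp pm = 0 by rewrite /Dp dphip_phim dx_phim mulr0 addr0.
have Dmm : Dm pm = 1 by rewrite /Dm dphim_phim dx_phim mulr0 addr0.
have Dmp : Dm pp = 0 by rewrite /Dm dphim_phip dx_phip mulr0 addr0.
have Dpx : Dp x = pm by rewrite /Dp dphip_varx dx_varx mulr1 add0r.
have Dmx : Dm x = pp by rewrite /Dm dphim_varx dx_varx mulr1 add0r.
have uE : Dp (T pp) = u by rewrite hu Dpp (good1 gT) mulr1.
have vE : Dm (T pm) = v by rewrite hv Dmm (good1 gT) mulr1.
have ue : sgS u = u.
  rewrite -uE /Dp sser_signD sser_signM sser_sign_dphip sser_sign_phim sser_sign_dx eP.
  by rewrite -[X in _ = X]opprK -[- (_ + _)]/(- Dp (T pp)) -DpN /Dp opprD mulNr.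
have ve : sgS v = v.
  rewrite -vE /Dm sser_signD sser_signM sser_sign_dphim sser_sign_phip sser_sign_dx eM.
  by rewrite -[X in _ = X]opprK -[- (_ + _)]/(- Dm (T pm)) -DmN /Dm opprD mulNr.
rewrite /superconformal /triple_of; split; [|split].
- by split; apply/series_parityP.
- split.
  + by rewrite -[LHS]/(Dp (T pm)) hu Dpm T0 mulr0.
  + by rewrite -[LHS]/(Dm (T pp)) hv Dmp T0 mulr0.
  + by rewrite -[LHS]/(Dp (T x)) -[X in _ * X]/(Dp (T pp)) uE hu Dpx (sser_even_comm _ ue).
  + by rewrite -[LHS]/(Dm (T x)) -[X in _ * X]/(Dm (T pm)) vE hv Dmx (sser_even_comm _ ve).
- split; apply/eqP.
  + move=> /(congr1 (fun f : S => c0 (f 0%N))); rewrite -[_ + _]/(Dp (T pp)) DpE /= ea.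
    by move/sg_eq0/eqP; rewrite (negbTE a0).
  + move=> /(congr1 (fun f : S => c0 (f 0%N))); rewrite -[_ + _]/(Dm (T pm)) DmE /= eb.
    by move/sg_eq0/eqP; rewrite (negbTE b0).
Qed.

Lemma good_vanishes T : good T -> vanishes0 (triple_of T).
Proof.
move=> gT; have h k f : wt k.+1 f -> at0 (T f) = 0.
  by move=> /(good_wt gT) hf; have [e _ _ _] := hf 0%N; exact: e.
by split; [exact: (h _ _ (wt_varx R))|exact: (h _ _ (wt_phip R))|exact: (h _ _ (wt_phim R))].
Qed.

Lemma leading_eop A : leading (eop (vf A)) 1 1.
Proof.
rewrite /leading constS1 !mul1r; split.
- by apply: (eop_first (raises_vf A)); exact: wt_phip.
- by apply: (eop_first (raises_vf A)); exact: wt_phim.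
Qed.

Lemma superconformal_Etilde A : superconformal (@dx R) (Etilde A).
Proof.
rewrite EtildeE; apply: (sconf_superconformal (sconf_eop A) (leading_eop A));
  exact: oner_neq0.
Qed.

Lemma one_coefs_eop A : one_coefs (triple_of (eop (vf A))).
Proof.
have [e1 e2] := leading_coef (leading_eop A).
by split; rewrite /at0 /= /dphip /dphim /= ?e1 ?e2 lam_sign1.
Qed.

(** Some E~(A) has the coefficients recorded by [prj] in common with F. Of those required by
    [superconformal_unique], the missing ones are fixed by the normalisation at zero and, for the
    coefficient of x, by [superconformal_c0']. *)
Lemma Etilde_surj F : superconformal (@dx R) F -> vanishes0 F -> one_coefs F ->
  exists A, Etilde A = F.
Proof.
move=> sF vF oF; have [A hA] := prj_Etilde_surj (prj F); exists A.
have sE := superconformal_Etilde A; have vE : vanishes0 (Etilde A).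
  by rewrite EtildeE; exact/good_vanishes/good_eop.
have oE : one_coefs (Etilde A) by rewrite EtildeE; exact: one_coefs_eop.
have eo G : superconformal (@dx R) G -> even_odd G.
  by move: G => [[X P] M] [[/series_parityP h1 /series_parityP h2 /series_parityP h3] _].
have o1 (G : triple R) : one_coefs G -> cp (G.1.2 0%N) = 1.
  move=> [h _]; apply: (can_inj (@lam_signK R)); rewrite lam_sign1 -h.
  by [].
have o2 (G : triple R) : one_coefs G -> cm (G.2 0%N) = 1.
  move=> [_ h]; apply: (can_inj (@lam_signK R)); rewrite lam_sign1 -h.
  by [].
have [a1 a2 a3 a4] := prjE (eo _ sE); have [b1 b2 b3 b4] := prjE (eo _ sF).
have hX n : c0 ((Etilde A).1.1 n) = c0 (F.1.1 n).
  case: n => [|[|k]]; first by have [e _ _] := vE; have [e' _ _] := vF; exact: etrans e (esym e').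
    by rewrite !superconformal_c0' // !o1 // !o2.
  by rewrite -a1 -b1 hA.
apply: superconformal_unique => //.
- by rewrite o1 // unitr1.
- case=> [|k]; first by have [_ e _] := vE; have [_ e' _] := vF; exact: etrans e (esym e').
  by rewrite -a3 -b3 hA.
- case=> [|k]; first by have [_ _ e] := vE; have [_ _ e'] := vF; exact: etrans e (esym e').
  by rewrite -a4 -b4 hA.
- case=> [|k]; first by rewrite !o1.
  have := a2 k; rewrite hA b2 hX => /eqP; rewrite -subr_eq0 opprB addrA subrK subr_eq0.
  by move/eqP.
Qed.

Section Diagonal.
Variables k0 kp km kpm : nat -> L0.

Definition diag_op f : S := fun n => SExt ((k0 n : L) * c0 (f n)) ((kp n : L) * cp (f n))
  ((km n : L) * cm (f n)) ((kpm n : L) * cpm (f n)).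

Lemma lam0_mulACA (u v : L0) (a b : L) : (u : L) * a * ((v : L) * b) = ((u * v : L0) : L) * (a * b).
Proof. by rewrite -mulrA [a * _]mulrA -(lam0_commC v a) -!mulrA. Qed.

Lemma sg_mul0 (u : L0) (a : L) : sg ((u : L) * a) = (u : L) * sg a.
Proof. by rewrite lam_signM lam_sign0_even. Qed.

Hypothesis k00 : k0 0%N = 1.
Hypothesis k0D : forall i j, k0 (i + j)%N = k0 i * k0 j.
Hypothesis kpD : forall i j, kp (i + j)%N = k0 i * kp j.
Hypothesis kmD : forall i j, km (i + j)%N = k0 i * km j.
Hypothesis kpmD : forall i j, kpm (i + j)%N = k0 i * kpm j.
Hypothesis kpkm : forall i j, kpm (i + j)%N = kp i * km j.

Lemma diag_opM f g : diag_op (f * g) = diag_op f * diag_op g.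
Proof.
apply: sserP => n; rewrite /diag_op !sserME.
apply: sextP; rewrite /= ?c0_sum ?cp_sum ?cm_sum ?cpm_sum mulr_sumr; apply: eq_bigr => i _;
  have e : n = (i + (n - i))%N by [have := ltn_ord i; lia];
  rewrite {1}e /= ?sg_mul0 !lam0_mulACA ?mulrDr ?mulrBr.
- by rewrite k0D.
- by rewrite -kpD [kp _ * _]mulrC -kpD [(n - i + i)%N]addnC.
- by rewrite -kmD [km _ * _]mulrC -kmD [(n - i + i)%N]addnC.
- rewrite -kpmD [kpm _ * _]mulrC -kpmD -kpkm [km _ * _]mulrC -kpkm [(n - i + i)%N]addnC.
  by rewrite mulrN.
Qed.

Lemma good_diag : good diag_op.
Proof.
split.
- by move=> f g; apply: sserP => n; apply: sextP; rewrite /= mulrDr.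
- move=> a f; apply: sserP => n; rewrite constSE /diag_op constSE !constS_mul_comp.
  by apply: sextP; rewrite /= !mulrA (lam0_commC _ a).
- exact: diag_opM.
- by apply: sserP => -[|n]; apply: sextP; rewrite /= ?mulr0 // k00 mulr1.
- move=> k f hf n; have [h1 h2 h3 h4] := hf n.
  by split=> hk /=; rewrite ?h1 ?h2 ?h3 ?h4 ?mulr0.
- by move=> f; apply: sserP => n; apply: sextP; rewrite /= sg_mul0 ?mulrN.
Qed.

Variables q r : L0.
Hypothesis kp_q : forall n, kp n = q * k0 n.
Hypothesis kpm_q : forall n, kpm n = q * km n.
Hypothesis k0_q : forall n, k0 n.+1 = q * km n.
Hypothesis kpS_q : forall n, kp n.+1 = q * kpm n.
Hypothesis km_r : forall n, km n = r * k0 n.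
Hypothesis kpm_r : forall n, kpm n = r * kp n.
Hypothesis k0_r : forall n, k0 n.+1 = r * kp n.
Hypothesis kmS_r : forall n, km n.+1 = r * kpm n.

(** The hypotheses on [q] compare the scaling factor of each coefficient of f with that of the
    coefficient of D+ f to which it contributes; those on [r] do the same for D-. The multipliers
    are the constants q and r. *)
Lemma sconf_diag : sconf diag_op.
Proof.
have V (a b c : L0) : a = b * c -> (a : L) = (b : L) * (c : L) by move=> ->.
split; first exact: good_diag.
- exists (constS (q : L)) => f; apply: sserP => n; rewrite constSE constS_mul_comp DpE.
  apply: sextP; rewrite [in RHS]/diag_op DpE /= ?sg_mul0 ?mulr0 //.
  + by rewrite (V _ _ _ (kp_q _)) mulrA.
  + by rewrite (V _ _ _ (kpm_q _)) (V _ _ _ (k0_q _)) !mulrDr !mulrnAr !mulrA.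
  + by rewrite (V _ _ _ (kpS_q _)) !mulrnAr !mulrN mulrA.
- exists (constS (r : L)) => f; apply: sserP => n; rewrite constSE constS_mul_comp DmE.
  apply: sextP; rewrite [in RHS]/diag_op DmE /= ?sg_mul0 ?mulr0 //.
  + by rewrite (V _ _ _ (km_r _)) mulrA.
  + by rewrite (V _ _ _ (kpm_r _)) (V _ _ _ (k0_r _)) !mulrDr !mulrnAr !mulrN !mulrA.
  + by rewrite (V _ _ _ (kmS_r _)) !mulrnAr mulrA.
Qed.

End Diagonal.

(** The pull-back along (q r x, q phi+, r phi-); the factor of x is the one forced by
    [superconformal_c0']. *)
Definition sc q r := diag_op (fun n => (q * r) ^+ n) (fun n => (q * r) ^+ n * q)
  (fun n => (q * r) ^+ n * r) (fun n => (q * r) ^+ n.+1).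

Lemma sconf_sc q r : sconf (sc q r).
Proof.
apply: (@sconf_diag _ _ _ _ _ _ _ _ _ _ q r).
- by rewrite expr0.
- by move=> i j; rewrite exprD.
- by move=> i j; rewrite exprD mulrA.
- by move=> i j; rewrite exprD mulrA.
- by move=> i j; rewrite -addnS exprD.
- by move=> i j; rewrite mulrACA -exprD -exprSr.
- by move=> n; rewrite mulrC.
- by move=> n; rewrite exprSr mulrCA.
- by move=> n; rewrite exprSr mulrCA.
- by move=> n; rewrite mulrC.
- by move=> n; rewrite mulrC.
- by move=> n; rewrite exprSr [X in _ * X]mulrC mulrCA.
- by move=> n; rewrite exprSr [X in _ * X]mulrC mulrCA.
- by move=> n; rewrite mulrC.
Qed.

Lemma good_sc q r : good (sc q r). Proof. exact: sconf_good (sconf_sc q r). Qed.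

Lemma sc_varx q r : sc q r x = constS ((q * r : L0) : L) * x.
Proof.
apply: sserP => n; rewrite constSE constS_mul_comp /sc /diag_op /varx; case: eqP => [->|_];
  by apply: sextP; rewrite /= ?mulr0.
Qed.
Lemma sc_phip q r : sc q r pp = constS (q : L) * pp.
Proof.
apply: sserP => -[|n]; rewrite constSE constS_mul_comp; apply: sextP; rewrite /= ?mulr0 //.
by rewrite mul1r.
Qed.
Lemma sc_phim q r : sc q r pm = constS (r : L) * pm.
Proof.
apply: sserP => -[|n]; rewrite constSE constS_mul_comp; apply: sextP; rewrite /= ?mulr0 //.
by rewrite mul1r.
Qed.

Lemma leading_sc q r : leading (sc q r) q r.
Proof. by rewrite /leading sc_phip sc_phim !subrr. Qed.

Lemma sc_comp q r q' r' f : sc q r (sc q' r' f) = sc (q * q') (r * r') f.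
Proof.
have V (a b c : L0) (u : L) : b * c = a -> (b : L) * ((c : L) * u) = (a : L) * u.
  by move=> <-; rewrite mulrA.
have e n : (q * q' * (r * r')) ^+ n = (q * r) ^+ n * (q' * r') ^+ n.
  by rewrite -exprMn mulrACA.
by apply: sserP => n; apply: sextP; apply: V; rewrite e // mulrACA.
Qed.
Lemma sc11 f : sc 1 1 f = f.
Proof.
have e n : (1 * 1 : L0) ^+ n = 1 by rewrite mulr1 expr1n.
by apply: sserP => n; apply: sextP; rewrite /= e ?mulr1 mul1r.
Qed.

(* [rep al] is the pull-back of series along [Ehat al]. *)
Definition qpart (u : uquot R) : L0 := (val (repr u)).1 * (val (repr u)).2.
Definition rpart (u : uquot R) : L0 := (val (repr u)).1 * (val (repr u)).2^-1.
Definition rep al f : S := eop (vf al.2) (sc (qpart al.1) (rpart al.1) f).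

Lemma units2P (u : units2 R) : (val u).1 \is a GRing.unit /\ (val u).2 \is a GRing.unit.
Proof. by rewrite !lam0_unitP; apply/andP; exact: valP u. Qed.

Lemma qpart_unit u : qpart u \is a GRing.unit.
Proof. by have [h1 h2] := units2P (repr u); rewrite unitrM h1 h2. Qed.
Lemma rpart_unit u : rpart u \is a GRing.unit.
Proof. by have [h1 h2] := units2P (repr u); rewrite unitrM unitrV h1 h2. Qed.

Lemma lam0_unitL q : q \is a GRing.unit -> (q : L) \is a GRing.unit.
Proof. by rewrite lam0_unitP lam_unitP. Qed.

Lemma sconf_rep al : sconf (rep al).
Proof. exact: sconf_comp (sconf_eop _) (sconf_sc _ _). Qed.
Lemma good_rep al : good (rep al). Proof. exact: sconf_good (sconf_rep al). Qed.

Lemma leading_rep al : leading (rep al) (qpart al.1 : L) (rpart al.1 : L).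
Proof.
have := leading_comp (good_eop al.2) (leading_eop al.2) (leading_sc (qpart al.1) (rpart al.1)).
by rewrite !mulr1.
Qed.

Lemma EhatE al : Ehat al = triple_of (rep al).
Proof.
rewrite /Ehat EtildeE /triple_of /rep; have [u1 u2] := units2P (repr al.1).
rewrite sc_varx sc_phip sc_phim !(goodC (good_eop al.2)) /qpart /rpart.
case: (val (repr al.1)) u1 u2 => a b /= u1 u2; congr (constS _ * _, constS _ * _, constS _ * _).
by rewrite -[RHS]/(lam0_val (a * b * (a * b^-1))) mulrACA mulrV // mulr1.
Qed.

Lemma sc_inv q r f : q \is a GRing.unit -> r \is a GRing.unit -> sc q r (sc q^-1 r^-1 f) = f.
Proof. by move=> uq ur; rewrite sc_comp !mulrV // sc11. Qed.
Lemma sc_invV q r f : q \is a GRing.unit -> r \is a GRing.unit -> sc q^-1 r^-1 (sc q r f) = f.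
Proof. by move=> uq ur; rewrite sc_comp !mulVr // sc11. Qed.

Lemma lam0_inj (a b : L0) : (a : L) = b -> a = b.
Proof. exact: val_inj. Qed.

(** Multiplying the two equations gives (a - a')(a + a') = 0. The bodies of the two factors add up
    to twice that of a, so one factor is a unit and the other is 0. *)
Lemma pair_sign_eq (a b a' b' : L0) : a \is a GRing.unit -> b \is a GRing.unit ->
  b' \is a GRing.unit -> a * b = a' * b' -> a * b^-1 = a' * b'^-1 ->
  ((a, b) == (a', b')) || ((a, b) == - (a', b')).
Proof.
move=> u1 u2 v2 e1 e2.
have a2 : (a - a') * (a + a') = 0.
  have h (c d : L0) : d \is a GRing.unit -> c * d * (c * d^-1) = c * c.
    by move=> ud; rewrite mulrACA mulrV // mulr1.
  have := h a b u2; rewrite e1 e2 (h a' b' v2) => e.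
  by rewrite -subr_sqr !expr2 e subrr.
have two : body ((a - a') : L0) != 0 \/ body ((a + a') : L0) != 0.
  case: (eqVneq (body ((a - a') : L0)) 0) => h1; [right|by left].
  apply: contraTneq u1 => h2; rewrite lam0_unitP negbK.
  have : body ((a - a') : L0) + body ((a + a') : L0) = body a *+ 2.
    rewrite -[body ((a - a') : L0)]/(body a - body a') -[body ((a + a') : L0)]/(body a + body a').
    by rewrite addrACA addNr addr0 mulr2n.
  by rewrite h1 h2 addr0 => /esym/eqP; rewrite mulrn_eq0.
case: two => /lam0_unit h.
- have : a + a' = 0 by apply: (mulrI h); rewrite a2 mulr0.
  move/eqP; rewrite addr_eq0 => /eqP ea; apply/orP; right; apply/eqP.
  congr (_, _); first exact: ea; apply: (mulrI u1); rewrite e1 ea.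
  by rewrite /= mulrNN.
- have : a - a' = 0 by apply: (mulIr h); rewrite a2 mul0r.
  move/eqP; rewrite subr_eq0 => /eqP ea; apply/orP; left; apply/eqP.
  by congr (_, _) => //; apply: (mulrI u1); rewrite e1 ea.
Qed.

Lemma uquot_eq (u v : uquot R) : qpart u = qpart v -> rpart u = rpart v -> u = v.
Proof.
move=> eq er; rewrite -(reprK u) -(reprK v); apply/eqmodP.
have [u1 u2] := units2P (repr u); have [v1 v2] := units2P (repr v).
have := pair_sign_eq u1 u2 v2 eq er.
by rewrite -!surjective_pairing.
Qed.

Lemma rep_inj al be : rep al =1 rep be -> al = be.
Proof.
move=> e; have [a1 a2] := leading_coef (leading_rep al).
have [b1 b2] := leading_coef (leading_rep be).
have eq : qpart al.1 = qpart be.1 by apply: lam0_inj; rewrite -a1 e.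
have er : rpart al.1 = rpart be.1 by apply: lam0_inj; rewrite -a2 e.
have eu := uquot_eq eq er.
have eA : al.2 = be.2.
  apply: Etilde_inj; rewrite !EtildeE.
  have h f : eop (vf al.2) f = eop (vf be.2) f.
    rewrite -(sc_inv f (qpart_unit al.1) (rpart_unit al.1)).
    by have := e (sc (qpart al.1)^-1 (rpart al.1)^-1 f); rewrite /rep -!eu.
  have e' : eop (vf al.2) = eop (vf be.2) by apply/funext => f; exact: h.
  by rewrite e'.
by case: al be eu eA {e a1 a2 b1 b2 eq er} => [u A] [v B] /= -> ->.
Qed.

Lemma uclassK (a b : L0) : a \is a GRing.unit -> b \is a GRing.unit ->
  qpart (uclass a b) = a * b /\ rpart (uclass a b) = a * b^-1.
Proof.
move=> ua ub; have ab : (body a != 0) && (body b != 0) by rewrite -!lam0_unitP ua.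
pose u := Units2 (units2_val := (a, b)) ab.
have eu : uclass a b = \pi_(uquot R) u.
  by rewrite /uclass; congr (\pi _); apply/val_inj; rewrite insubdK.
have : same_up_to_sign (repr (uclass a b)) u by apply/eqmodP; rewrite reprK eu.
rewrite /qpart /rpart => /orP[] /eqP -> //=.
by rewrite mulrNN invrN mulrNN.
Qed.

Lemma uone_parts : qpart (uone R) = 1 /\ rpart (uone R) = 1.
Proof. by have [-> ->] := uclassK (unitr1 L0) (unitr1 L0); rewrite invr1 mulr1. Qed.

Lemma rep_one A f : rep (uone R, A) f = eop (vf A) f.
Proof. by rewrite /rep /=; have [-> ->] := uone_parts; rewrite sc11. Qed.

Lemma rep_id f : rep (uone R, 0) f = f.
Proof. by rewrite rep_one eop_data0. Qed.

(** Dividing the coordinates by q r, q and r, where q and r are the coefficients of phi+ and phi-,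
    reduces to [Etilde_surj]. The parameters must satisfy a b = q and a / b = r, so a is a square
    root of q r and b = q / a. *)
Lemma Ehat_surj F : superconformal (@dx R) F -> vanishes0 F -> unit_coefs F ->
  exists al, Ehat al = F.
Proof.
move: F => [[X P] M] sF [/= X0 P0 M0] [/= uP uM].
have [[hX hP hM] [[e1 e2 e3 e4] [n1 n2]]] := sF.
have pP := proj1 (series_parityP true P) hP; have pM := proj1 (series_parityP true M) hM.
have pX := proj1 (series_parityP false X) hX.
pose q := to_even (cp (P 0%N)); pose r := to_even (cm (M 0%N)).
have qE : (q : L) = cp (P 0%N) by rewrite to_evenK // odd_cp.
have rE : (r : L) = cm (M 0%N) by rewrite to_evenK // odd_cm.
have uq : q \is a GRing.unit by rewrite lam0_unitP -lam_unitP qE -(odd_cp 0 pP).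
have ur : r \is a GRing.unit by rewrite lam0_unitP -lam_unitP rE -(odd_cm 0 pM).
have ev (c : L0) : sg c = c by exact: lam_sign0_even.
have cK (c : L0) : c \is a GRing.unit -> constS (c : L) * constS ((c^-1 : L0) : L) = 1.
  by move=> uc; rewrite -constSM -[_ * _]/(lam0_val (c * c^-1)) mulrV // constS1.
pose F' : triple R := (constS ((q * r)^-1 : L0) * X, constS (q^-1 : L0) * P, constS (r^-1 : L0) * M).
have uqr : q * r \is a GRing.unit by rewrite unitrM uq.
have sF' : superconformal (@dx R) F'.
  have nz (c : L0) (f : S) : c \is a GRing.unit -> f != 0 -> constS ((c^-1 : L0) : L) * f != 0.
    move=> uc; apply: contraNneq => h.
    by rewrite -[f]mul1r -(cK c uc) -mulrA h mulr0.
  split; [|split].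
  - split; apply/series_parityP; rewrite sser_signM sser_sign_const ev ?pX ?pP ?pM ?mulrN //.
  - split.
    + by rewrite -[LHS]/(Dp (constS _ * M)) DpC // -[Dp M]/(dphip M + pm * dx M) e1 mulr0.
    + by rewrite -[LHS]/(Dm (constS _ * P)) DmC // -[Dm P]/(dphim P + pp * dx P) e2 mulr0.
    + rewrite -[LHS]/(Dp (constS _ * X)) DpC // -[Dp X]/(dphip X + pm * dx X) e3.
      rewrite -[X in _ = _ * X]/(Dp (constS _ * P)) DpC // -[_ + _]/(Dp P).
      rewrite mulrA -[RHS]mulrA [M * (_ * _)]mulrA -(constS_even_comm M (ev (q^-1))) !mulrA.
      by rewrite -constSM invrM // -[lam0_val (r^-1) * _]/(lam0_val (r^-1 * q^-1)).
    + rewrite -[LHS]/(Dm (constS _ * X)) DmC // -[Dm X]/(dphim X + pp * dx X) e4.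
      rewrite -[X in _ = _ * X]/(Dm (constS _ * M)) DmC // -[_ + _]/(Dm M).
      rewrite mulrA -[RHS]mulrA [P * (_ * _)]mulrA -(constS_even_comm P (ev (r^-1))) !mulrA.
      by rewrite -constSM [q * r]mulrC invrM // -[lam0_val (q^-1) * _]/(lam0_val (q^-1 * r^-1)).
  - split; [rewrite -[_ + _]/(Dp (constS _ * P)) DpC //|rewrite -[_ + _]/(Dm (constS _ * M)) DmC //];
      exact: nz.
have at0C (c : L) f : at0 (constS c * f) = c * at0 f by rewrite /at0 constSE constS_mul_comp.
have [A hA] : exists A, Etilde A = F'.
  apply: Etilde_surj => //; first by split; rewrite at0C ?X0 ?P0 ?M0 mulr0.
  split; rewrite /at0 /= constSE constS_mul_comp /=.
  - by rewrite -qE -[_ * _]/(lam0_val (q^-1 * q)) mulVr // lam_sign1.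
  - by rewrite -rE -[_ * _]/(lam0_val (r^-1 * r)) mulVr // lam_sign1.
have [a ha] : exists a : L0, a ^+ 2 = q * r by apply: lam0_sqrt; rewrite -lam0_unitP.
have ua : a \is a GRing.unit by rewrite -(@unitrX_pos _ a 2) // ha.
pose b := q / a; have ub : b \is a GRing.unit by rewrite unitrM uq unitrV.
have [hq hr] := uclassK ua ub.
have hab : a * b = q by rewrite /b mulrC divrK.
have hab' : a * b^-1 = r.
  by rewrite /b invrM ?unitrV // invrK mulrA -expr2 ha mulrC mulKr.
exists (uclass a b, A); rewrite EhatE /triple_of /rep /= hq hr hab hab'.
rewrite sc_varx sc_phip sc_phim !(goodC (good_eop A)).
move: hA; rewrite EtildeE => -[-> -> ->].
by rewrite !mulrA !cK // !mul1r.
Qed.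

Lemma unit_coefs_leading T a b : leading T a b -> a \is a GRing.unit -> b \is a GRing.unit ->
  unit_coefs (triple_of T).
Proof.
move=> lT ua ub; have [ea eb] := leading_coef lT.
have us (c : L) : c \is a GRing.unit -> sg c \is a GRing.unit.
  by rewrite !lam_unitP /body lam_signE cardfs0 expr0 mul1r.
by split; rewrite /at0 /= ?ea ?eb; exact: us.
Qed.

(** The source of closure: products and inverses of operators of data are superconformal with
    invertible linear part, hence come from data again. *)
Lemma rep_surj T a b : sconf T -> leading T a b -> a \is a GRing.unit -> b \is a GRing.unit ->
  exists al, rep al =1 T.
Proof.
move=> sT lT ua ub; have gT := sconf_good sT.
have [|al hal] := Ehat_surj (sconf_superconformal sT lT (lam_unit_neq0 ua) (lam_unit_neq0 ub))
  (good_vanishes gT).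
  exact: unit_coefs_leading lT ua ub.
by exists al; apply: good_eq => //; [exact: good_rep|rewrite -EhatE].
Qed.

Lemma Ehat_inj : injective (@Ehat R).
Proof.
move=> al be e; apply: rep_inj; apply: (good_eq (good_rep al) (good_rep be)).
exact: etrans (esym (EhatE al)) (etrans e (EhatE be)).
Qed.

Lemma Ehat_invK al : Ehat_inv (Ehat al) = al.
Proof.
apply: Ehat_inj.
exact: (@xgetPex _ (uone R, 0) [set be | Ehat be = Ehat al] (ex_intro _ al erefl)).
Qed.

Lemma rep_comp_ex al be : exists ga, rep ga =1 rep al \o rep be.
Proof.
have uM (a b : L0) : a \is a GRing.unit -> b \is a GRing.unit -> (a : L) * (b : L) \is a GRing.unit.
  by move=> ua ub; apply: (@lam0_unitL (a * b)); rewrite unitrM ua.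
exact: (rep_surj (sconf_comp (sconf_rep al) (sconf_rep be))
  (leading_comp (good_rep al) (leading_rep al) (leading_rep be))
  (uM _ _ (qpart_unit _) (qpart_unit _)) (uM _ _ (rpart_unit _) (rpart_unit _))).
Qed.

(** The default value in [Ehat_inv] is never taken, since [rep_comp_ex] exhibits the composite
    series as a value of [Ehat]. *)
Lemma rep_circ al be : rep (circ al be) =1 rep al \o rep be.
Proof.
have [ga hga] := rep_comp_ex al be.
rewrite /circ !EhatE tcomp_good; last exact: good_rep.
have -> : triple_of (rep al \o rep be) = Ehat ga by rewrite EhatE /triple_of !hga.
by rewrite Ehat_invK.
Qed.

Lemma rep_inv_ex al : exists be, (forall f, rep al (rep be f) = f) /\ (forall f, rep be (rep al f) = f).
Proof.
pose U := sc (qpart al.1)^-1 (rpart al.1)^-1 \o eop (vf (- al.2)).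
have uq := qpart_unit al.1; have ur := rpart_unit al.1.
have [be hbe] : exists be, rep be =1 U.
  apply: (rep_surj (sconf_comp (sconf_sc _ _) (sconf_eop _))
    (leading_comp (good_sc _ _) (leading_sc _ _) (leading_eop _)));
    by rewrite mul1r lam0_unitL // unitrV.
exists be; split=> f; rewrite ?hbe /rep /U /=.
- by rewrite sc_inv // eopKN.
- by rewrite eopNK sc_invV.
Qed.

End DataGroup.

(** * Groups of data *)

Section FaithfulActions.
Variables (T X : Type) (m : T -> T -> T) (e : T) (F : T -> X -> X).
Hypotheses (Finj : forall a b, F a =1 F b -> a = b)
  (Fm : forall a b, F (m a b) =1 F a \o F b) (Fe : F e =1 id).

Lemma faithful_mulA a b c : m (m a b) c = m a (m b c).
Proof. by apply: Finj => u; rewrite !Fm /= !Fm. Qed.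

Lemma faithful_mul1 a : m e a = a /\ m a e = a.
Proof. by split; apply: Finj => u; rewrite Fm /= Fe. Qed.

Lemma faithful_mulV a b : (forall u, F a (F b u) = u) -> m a b = e.
Proof. by move=> h; apply: Finj => u; rewrite Fm /= h Fe. Qed.

End FaithfulActions.

Section AbstractGroups.
Variables (T : Type) (m : T -> T -> T).

Lemma group_on_graph (D : set T) (e : T) : (forall a b c, m (m a b) c = m a (m b c)) ->
  (forall a, m e a = a /\ m a e = a) -> D e -> (forall a b, D a -> D b -> D (m a b)) ->
  (forall a, D a -> exists2 b, D b & m a b = e /\ m b a = e) -> group_on D (graph2 m).
Proof.
move=> mA m1 De Dm Di; split.
- by move=> a b Da Db; exists (m a b); [exact: Dm|].
- by move=> a b c ab bc w _ _ _; rewrite /graph2 => -> -> ->; rewrite mA.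
- exists e => // a Da; have [e1 e2] := m1 a; split=> //.
  by have [b Db [ab ba]] := Di a Da; exists b.
Qed.

Lemma group_on_image (T' : Type) (i : T -> T') (op : T' -> T' -> T' -> Prop) (D : set T) :
  (forall x y w, D x -> D y -> op (i x) (i y) w <-> w = i (m x y)) ->
  group_on D (graph2 m) -> group_on (i @` D) op.
Proof.
move=> hop [Dm mA [e De he]]; have Dm' a b : D a -> D b -> D (m a b).
  by move=> Da Db; have [c Dc h] := Dm a b Da Db; have /h -> : graph2 m a b (m a b) by [].
split.
- move=> _ _ [a Da <-] [b Db <-]; exists (i (m a b)); first by exists (m a b) => //; exact: Dm'.
  by move=> w; exact: hop.
- move=> _ _ _ xy yz w [a Da <-] [b Db <-] [c Dc <-] /(hop _ _ _ Da Db) ->.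
  move=> /(hop _ _ _ (Dm' _ _ Da Db) Dc) -> /(hop _ _ _ Db Dc) ->.
  by apply/(hop _ _ _ Da (Dm' _ _ Db Dc)); congr i; exact: mA Da Db Dc erefl erefl erefl.
- exists (i e) => [|_ [a Da <-]]; first by exists e.
  have h y z w : D y -> D z -> graph2 m y z w -> op (i y) (i z) (i w).
    by move=> Dy Dz yz; apply/(hop _ _ _ Dy Dz)/congr1.
  have [e1 e2 [b Db [ab ba]]] := he a Da; split; [exact: h|exact: h|].
  by exists (i b); [exists b|split; exact: h].
Qed.

(** Along [i] the operation is [m], along [j] it is [m] with its arguments exchanged; the
    anti-automorphism [v], in practice inversion, turns [j] into a homomorphism. *)
Lemma isomorphic_anti (T1 T2 : Type) (v : T -> T) (i : T -> T1) (k : T1 -> T) (j : T -> T2)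
    (op1 : T1 -> T1 -> T1 -> Prop) (op2 : T2 -> T2 -> T2 -> Prop) (D : set T) :
  group_on D (graph2 m) -> (forall x, D x -> D (v x)) -> involutive v ->
  (forall x y, v (m x y) = m (v y) (v x)) -> cancel i k ->
  (forall x y w, D x -> D y -> op1 (i x) (i y) w <-> w = i (m x y)) ->
  (forall x y w, D x -> D y -> op2 (j x) (j y) w <-> w = j (m y x)) ->
  (forall x y, D x -> D y -> j x = j y -> x = y) -> isomorphic_on (i @` D) op1 (j @` D) op2.
Proof.
move=> gD Dv vK vm ik h1 h2 jinj.
have h2' x y w : D x -> D y -> op2 (j (v x)) (j (v y)) w <-> w = j (v (m x y)).
  by move=> Dx Dy; rewrite vm; apply: h2; exact: Dv.
have ejv : j @` D = (j \o v) @` D.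
  apply/seteqP; split=> _ [x Dx <-]; exists (v x) => //=; try exact: Dv.
  by rewrite vK.
split; [exact: group_on_image|by rewrite ejv; exact: group_on_image|].
exists (fun w => j (v (k w))); split; first split.
- by move=> _ [x Dx <-]; rewrite /= ik; exists (v x) => //; exact: Dv.
- move=> _ _ /set_mem[x Dx <-] /set_mem[y Dy <-]; rewrite !ik => /jinj e.
  by rewrite -(vK x) e ?vK //; exact: Dv.
- move=> _ [x Dx <-]; exists (i (v x)); first by exists (v x) => //; exact: Dv.
  by rewrite ik vK.
- move=> _ _ z [x Dx <-] [y Dy <-] /(h1 _ _ _ Dx Dy) ->; rewrite !ik; exact/h2'.
Qed.

Lemma group_on_flip (D : set T) : group_on D (graph2 m) -> group_on D (graph2 (fun a b => m b a)).
Proof.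
rewrite /graph2 => -[Dm mA [e De he]]; split.
- by move=> a b Da Db; exact: Dm.
- by move=> a b c ab bc w Da Db Dc -> -> ->; exact/esym/(mA c b a _ _ _ Dc Db Da erefl erefl erefl).
- exists e => // a Da; have [e1 e2 [b Db [ab ba]]] := he a Da; split=> //.
  by exists b.
Qed.

End AbstractGroups.

Section Groups.
Variable R : realType.
Local Notation C := (R[i]).
Local Notation L := (Lam R).
Local Notation L0 := (Lam0 R).
Local Notation sg := (@lam_sign R).
Local Notation sgS := (@sser_sign R).
Local Notation S := (sser R).
Local Notation data := (data R).
Local Notation pdata := (pdata R).
Local Notation x := (varx R).
Local Notation pp := (phip R).
Local Notation pm := (phim R).
Local Notation uone := (uone R).
Implicit Types (f g h : S) (A B : data) (T U : S -> S) (al be : pdata).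

Local Opaque circ eop vf Etilde.

Lemma eq_triple_of T U : T =1 U -> triple_of T = triple_of U.
Proof. by move=> /funext ->. Qed.

Lemma eop_vf_inj A B : eop (vf A) =1 eop (vf B) -> A = B.
Proof. by move=> /eq_triple_of e; apply: Etilde_inj; rewrite !EtildeE. Qed.

Lemma circA al be ga : circ (circ al be) ga = circ al (circ be ga).
Proof. exact: (faithful_mulA (@rep_inj R) (@rep_circ R)). Qed.

Lemma circ1 al : circ (uone, 0) al = al /\ circ al (uone, 0) = al.
Proof. exact: (faithful_mul1 (@rep_inj R) (@rep_circ R) (@rep_id R)). Qed.

Lemma circ_inv al : exists be, circ al be = (uone, 0) /\ circ be al = (uone, 0).
Proof.
have [be [h1 h2]] := rep_inv_ex al; exists be.
have V := faithful_mulV (@rep_inj R) (@rep_circ R) (@rep_id R).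
by split; [exact: V h1|exact: V h2].
Qed.

Lemma circ_data_ex A B : exists D, circ (uone, A) (uone, B) = (uone, D).
Proof.
exists (circ (uone, A) (uone, B)).2; rewrite [LHS]surjective_pairing; congr (_, _).
have e := rep_circ (uone, A) (uone, B).
have [a1 a2] := leading_coef (leading_rep (circ (uone, A) (uone, B))).
have [b1 b2] := leading_coef (leading_comp (good_rep (uone, A)) (leading_rep (uone, A)) (leading_rep (uone, B))).
have [u1 u2] := uone_parts R.
apply: uquot_eq; apply: lam0_inj.
- by rewrite -a1 e b1 u1; exact: mulr1.
- by rewrite -a2 e b2 u2; exact: mulr1.
Qed.

Fact dcirc_key A B : {D | circ (uone, A) (uone, B) = (uone, D)}.
Proof. exact: cid (circ_data_ex A B). Qed.
Definition dcirc A B : data := sval (dcirc_key A B).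

Lemma circ_data A B : circ (uone, A) (uone, B) = (uone, dcirc A B).
Proof. exact: svalP (dcirc_key A B). Qed.

Lemma eop_dcirc A B f : eop (vf (dcirc A B)) f = eop (vf A) (eop (vf B) f).
Proof. by rewrite -!rep_one -circ_data rep_circ. Qed.

Lemma dcirc_dscale s t A : dcirc (dscale s A) (dscale t A) = dscale (s + t) A.
Proof. by apply: eop_vf_inj => f; rewrite eop_dcirc eop_dscale. Qed.

Lemma dcircA A B D : dcirc (dcirc A B) D = dcirc A (dcirc B D).
Proof. exact: (faithful_mulA eop_vf_inj eop_dcirc). Qed.

Lemma dcirc1 A : dcirc 0 A = A /\ dcirc A 0 = A.
Proof. exact: (faithful_mul1 eop_vf_inj eop_dcirc (@eop_data0 R)). Qed.

Lemma dcircN A : dcirc A (- A) = 0 /\ dcirc (- A) A = 0.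
Proof.
have V := faithful_mulV eop_vf_inj eop_dcirc (@eop_data0 R).
by split; apply: V; [exact: eopKN|exact: eopNK].
Qed.

(** Closure under negation is closure under inverses, because e^(-w) inverts e^w ([dcircN]). *)
Definition dgroup (D : set data) : Prop :=
  [/\ D 0, forall A, D A -> D (- A) & forall A B, D A -> D B -> D (dcirc A B)].

Lemma dgroupT : dgroup setT. Proof. by []. Qed.

Lemma dgroupI D D' : dgroup D -> dgroup D' -> dgroup (D `&` D').
Proof.
move=> [h1 h2 h3] [k1 k2 k3]; split=> [//|A [a b]|A B [a b] [c d]]; split; auto.
Qed.

Lemma group_circ : group_on setT (graph2 (@circ R)).
Proof.
apply: (group_on_graph (e := (uone, 0))); [exact: circA|exact: circ1|by []|by []|].
by move=> al _; have [be h] := circ_inv al; exists be.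
Qed.

Lemma group_with_one D : dgroup D -> group_on (with_one D) (graph2 (@circ R)).
Proof.
move=> [D0 DN Dm]; apply: (group_on_graph (e := (uone, 0))); [exact: circA|exact: circ1|by []| |].
- move=> [u A] [v B] [/= -> hA] [/= -> hB]; rewrite circ_data; split=> //=; exact: Dm.
- move=> [u A] [/= -> hA]; exists (uone, - A); first by split=> //=; exact: DN.
  by have [e1 e2] := dcircN A; rewrite !circ_data e1 e2.
Qed.

Definition untwist A : data :=
  let: (Ap, Am, Mp, Mm) := A in (Ap, - Am, 'i *: Mp, 'i *: Mm).

Lemma twistK : cancel (@twist R) untwist.
Proof.
move=> [[[a b] c] d]; rewrite /= opprK.
by rewrite !scalerA mulrN -expr2 sqrCi opprK !scale1r.
Qed.

Lemma untwistK : cancel untwist (@twist R).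
Proof.
move=> [[[a b] c] d]; rewrite /= opprK.
by rewrite !scalerA mulNr -expr2 sqrCi opprK !scale1r.
Qed.

Lemma twistN A : twist (- A) = - twist A.
Proof. by case: A => [[[a b] c] d]; congr (_, _, _, _); rewrite scalerN. Qed.

Lemma twist0 : twist 0 = 0 :> data.
Proof. by congr (_, _, _, _); rewrite ?oppr0 ?scaler0. Qed.

Lemma twist_dscale t A : twist (dscale t A) = dscale t (twist A).
Proof.
case: A => [[[a b] c] d]; congr (_, _, _, _); apply/funext => k; apply/val_inj.
- by rewrite /= mulrN.
- exact/esym/(lam_scalerAr _ (t : L) (c k : L)).
- exact/esym/(lam_scalerAr _ (t : L) (d k : L)).
Qed.

Lemma Etilde_invK A : Etilde_inv (Etilde A) = A.
Proof.
apply: Etilde_inj.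
exact: (@xgetPex _ 0 [set B | Etilde B = Etilde A] (ex_intro _ A erefl)).
Qed.

(** After twisting, [circoo] is the composition of series with [A] outermost, whereas [dcirc]
    composes operators and thus applies its first argument innermost. *)
Lemma twist_circoo A B : twist (circoo A B) = dcirc (twist B) (twist A).
Proof.
have e : Etilde_inv (tcomp (Etilde (twist A)) (Etilde (twist B))) = dcirc (twist B) (twist A).
  rewrite !EtildeE tcomp_good; last exact: good_eop.
  rewrite -[RHS]Etilde_invK; congr Etilde_inv.
  by rewrite EtildeE; apply: eq_triple_of => f; rewrite eop_dcirc.
rewrite /circoo e.
by apply: (@xgetPex _ 0 [set D | twist D = _]); exists (untwist (dcirc (twist B) (twist A))); exact: untwistK.
Qed.

Lemma circooE A B : circoo A B = untwist (dcirc (twist B) (twist A)).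
Proof. by rewrite -twist_circoo twistK. Qed.

Local Opaque circoo.

Lemma circooA A B D : circoo (circoo A B) D = circoo A (circoo B D).
Proof.
rewrite (circooE (circoo A B)) (twist_circoo A B) -dcircA -(twist_circoo B D).
by rewrite -circooE.
Qed.

Lemma circoo1 A : circoo 0 A = A /\ circoo A 0 = A.
Proof. by have [e1 e2] := dcirc1 (twist A); rewrite !circooE twist0 e1 e2 twistK. Qed.

Lemma circooN A : circoo A (- A) = 0 /\ circoo (- A) A = 0.
Proof.
have [e1 e2] := dcircN (twist A).
by rewrite !circooE twistN e1 e2; split; rewrite -[RHS]twistK twist0.
Qed.

Lemma circoo_dscale s t A : circoo (dscale s A) (dscale t A) = dscale (s + t) A.
Proof. by rewrite circooE !twist_dscale dcirc_dscale -twist_dscale twistK addrC. Qed.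

Lemma oppr_circoo A B : - circoo B A = circoo (- A) (- B).
Proof.
have h (X Y : data) : circoo X Y = 0 -> Y = - X.
  move=> e; have [_ e'] := circooN X; rewrite -[Y](circoo1 _).1 -e' circooA e.
  exact: (circoo1 _).2.
apply/esym/h; rewrite circooA -(circooA A) (circooN A).1 (circoo1 _).1.
exact: (circooN B).1.
Qed.

Lemma group_circoo D : dgroup D -> group_on [set A | D (twist A)] (graph2 (@circoo R)).
Proof.
move=> [D0 DN Dm]; apply: (group_on_graph (e := 0)); [exact: circooA|exact: circoo1| | |].
- by rewrite /mkset twist0.
- by move=> A B /= hA hB; rewrite twist_circoo; exact: Dm.
- move=> A /= hA; exists (- A); last exact: circooN.
  by rewrite /mkset (twistN A); exact: DN.
Qed.

(** The two constructors of [sew] overlap only when both spheres are the identity, and there they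
    give the same result. *)
Lemma sew_at_zero al be w : sew (0, al) (0, be) w <-> w = (0, circ al be).
Proof.
split=> [h|->]; last exact: sew_zero.
inversion h; first by [].
by rewrite (circ1 (uone, 0)).1 (circoo1 _).1.
Qed.

Lemma sew_at_infty A B w : sew (B, (uone, 0)) (A, (uone, 0)) w <-> w = (circoo A B, (uone, 0)).
Proof.
split=> [h|->]; last exact: sew_infty.
inversion h; last by [].
by rewrite (circ1 (uone, 0)).1 (circoo1 _).1.
Qed.

Lemma at_zeroE (P : set pdata) : at_zero P = (fun al => (0, al)) @` P.
Proof.
apply/seteqP; split=> [[X al] [/= -> h]|_ [al h <-]] //; by exists al.
Qed.

Lemma at_inftyE (D : set data) : at_infty D = (fun A => (A, (uone, 0))) @` D.
Proof.
apply/seteqP; split=> [[A al] [/= h ->]|_ [A h <-]] //; by exists A.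
Qed.

Lemma group_at_zero (P : set pdata) : group_on P (graph2 (@circ R)) -> group_on (at_zero P) (@sew R).
Proof. by rewrite at_zeroE; apply: group_on_image => al be w _ _; exact: sew_at_zero. Qed.

Lemma group_at_infty (D : set data) : group_on D (graph2 (@circoo R)) -> group_on (at_infty D) (@sew R).
Proof.
move=> /group_on_flip; rewrite at_inftyE; apply: group_on_image.
by move=> A B w _ _; exact: sew_at_infty.
Qed.

Lemma iso_at_zero (P : set pdata) : iso_on (at_zero P) (@sew R) P (graph2 (@circ R)) snd.
Proof.
split; first split.
- by move=> [X al] [/= _ h].
- by move=> [X al] [Y be] /set_mem[/= -> _] /set_mem[/= -> _] /= ->.
- by move=> al h; exists (0, al).
- by move=> [X al] [Y be] w [/= -> _] [/= -> _] /sew_at_zero ->.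
Qed.

(** Sewing at infinity multiplies in the order opposite to [circoo]. The inverse - A undoes the
    reversal and, being a negation, maps each family with prescribed zeros to itself. *)
Lemma iso_at_infty :
  iso_on (at_infty setT) (@sew R) setT (graph2 (@circoo R)) (fun w => - w.1).
Proof.
split; first split.
- by [].
- by move=> [X al] [Y be] /set_mem[/= _ ->] /set_mem[/= _ ->] /= /oppr_inj ->.
- by move=> A _; exists (- A, (uone, 0)) => //=; rewrite opprK.
- move=> [X al] [Y be] w [/= _ ->] [/= _ ->] /sew_at_infty -> /=; exact: oppr_circoo.
Qed.

(** A polynomial of size at most N with the N distinct roots 0, ..., N - 1. *)
Lemma vandermonde0 (N : nat) (v : nat -> C) :
  (forall n : nat, \sum_(k < N) (n%:R : C) ^+ k * v k = 0) -> forall k, (k < N)%N -> v k = 0.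
Proof.
move=> h k kN; pose p : {poly C} := \poly_(j < N) v j.
have p0 : p = 0.
  apply: (@roots_geq_poly_eq0 _ _ [seq (n%:R : C) | n <- iota 0 N]).
  - apply/allP => _ /mapP[n _ ->]; rewrite /root horner_poly; apply/eqP.
    by rewrite -[RHS](h n); apply: eq_bigr => j _; rewrite mulrC.
  - by rewrite map_inj_uniq ?iota_uniq // => a b /eqP; rewrite eqr_nat => /eqP.
  - by rewrite size_map size_iota size_poly.
by have := congr1 (fun q : {poly C} => q`_k) p0; rewrite coef_poly kN coef0.
Qed.

(** The linear forms that are continuous for the topology defined by weights. *)
Definition local_form (l : S * S -> C) : Prop :=
  [/\ forall p q : S * S, l (p + q) = l p + l q, forall k p, l (k *: p) = k * l p
    & exists n, forall f g, wt n f -> wt n g -> l (f, g) = 0].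

(** Subspaces cut out by continuous forms, so that limits modulo weights, such as exponentials, stay
    inside. *)
Definition coef_space (Y : set (S * S)) : Prop :=
  exists F : set (S * S -> C), (forall l, F l -> local_form l) /\
    Y = [set p | forall l, F l -> l p = 0].

Lemma coef_spaceZ Y (k : C) p : coef_space Y -> Y p -> Y (k *: p).
Proof.
by move=> [F [hF ->]] h l hl; have [_ -> _] := hF l hl; rewrite h // mulr0.
Qed.

Lemma coef_spaceI Y Z : coef_space Y -> coef_space Z -> coef_space (Y `&` Z).
Proof.
move=> [F [hF ->]] [G [hG ->]]; exists (F `|` G); split=> [l [/hF|/hG]//|].
apply/seteqP; split=> [p [h1 h2] l [/h1|/h2]//|p h]; split=> l hl; apply: h; [left|right]; exact: hl.
Qed.

Lemma coef_space_forall (I : Type) (Y : I -> set (S * S)) :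
  (forall i, coef_space (Y i)) -> coef_space [set p | forall i, Y i p].
Proof.
move=> /choice[F hF]; exists (fun l => exists i, F i l); split.
  by move=> l [j hj]; exact: (proj1 (hF j)).
apply/seteqP; split=> [p h l [i hl]|p h i].
  by have := h i; rewrite (hF i).2; exact.
by rewrite (hF i).2 => l hl; apply: h; exists i.
Qed.

Lemma coef_space_coef (h : S * S -> L) : (forall p q : S * S, h (p + q) = h p + h q) ->
  (forall k p, h (k *: p) = k *: h p) ->
  (exists n, forall f g, wt n f -> wt n g -> h (f, g) = 0) ->
  coef_space [set p | h p = 0].
Proof.
move=> hD hZ [n hn]; exists (fun l => exists I, l = fun p => h p I); split.
  move=> _ [I ->]; split=> [p q|k p|]; first by rewrite hD.
    by rewrite hZ.
  by exists n => f g hf hg; rewrite hn.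
apply/seteqP; split=> [p /= p0 _ [I ->]|p hp]; first by rewrite p0.
apply/lamP => I.
exact: (hp (fun p0 => h p0 I) (ex_intro _ I erefl)).
Qed.

Definition stab (Y : set (S * S)) (T : S -> S) : Prop := forall p, Y p -> Y (T p.1, T p.2).

Lemma local_form_sum l (r : seq nat) (F : nat -> S * S) : local_form l ->
  l (\sum_(k <- r) F k) = \sum_(k <- r) l (F k).
Proof.
move=> [lD lZ _]; apply: (big_morph l lD).
by rewrite -[0 in LHS](scale0r 0) lZ mul0r.
Qed.

Lemma pair_sum (r : seq nat) (F G : nat -> S) :
  (\sum_(k <- r) F k, \sum_(k <- r) G k) = \sum_(k <- r) (F k, G k) :> S * S.
Proof. by elim: r => [|k r ih]; rewrite ?big_nil // !big_cons -ih. Qed.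

Lemma local_form_eop l : local_form l ->
  exists N, forall w, raises w -> forall M f g, (N <= M)%N ->
  l (eop w f, eop w g) = \sum_(k < M) l (dpow w k f, dpow w k g).
Proof.
move=> hl; have [lD lZ [N hN]] := hl; exists N => w rw M f g NM.
rewrite -(big_mkord xpredT (fun k => l (dpow w k f, dpow w k g))) -(local_form_sum _ _ hl) -pair_sum.
rewrite !big_mkord -!/(epart w M _) -[in LHS](subrK (epart w M f) (eop w f)).
rewrite -[in LHS](subrK (epart w M g) (eop w g)) -[(_ + _, _ + _)]/((_, _) + (_, _)) lD hN ?add0r //.
- by apply: wtW (eop_trunc M rw (wt0 f)).
- by apply: wtW (eop_trunc M rw (wt0 g)).
Qed.

Lemma vf_dscale_nat n A f : vf (dscale n%:R A) f = (n%:R : C) *: vf A f.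
Proof.
rewrite vf_dscale -constSZ; congr (constS _ * _).
rewrite scaler_nat; elim: n => // n ih; rewrite !mulrS.
exact: (congr1 (fun u : L => 1 + u) ih).
Qed.

Lemma dpow_dscale_nat n A k f :
  dpow (vf (dscale n%:R A)) k f = (n%:R : C) ^+ k *: dpow (vf A) k f.
Proof.
rewrite /dpow scalerA mulrC -scalerA; congr (_ *: _).
elim: k => [|k ih]; first by rewrite scale1r.
by rewrite !iterS ih vf_dscale_nat vfZ scalerA -exprS.
Qed.

(* e^(n w) preserves Y for every natural number n, and is a polynomial in n modulo high weights. *)
Lemma stab_eop Y A : coef_space Y -> stab Y (vf A) <-> stab Y (eop (vf A)).
Proof.
move=> [F [hF eY]]; have YZ := fun k p => @coef_spaceZ Y k p (ex_intro _ F (conj hF eY)).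
split=> h [f g] Yp.
  have Yi k : Y (dpow (vf A) k f, dpow (vf A) k g).
    by apply: (YZ _ (_, _)); elim: k => //= k; exact: h.
  rewrite eY => l hl; have [N hN] := local_form_eop (hF l hl).
  rewrite (hN _ (raises_vf A) N) // big1 // => k _.
  by have := Yi k; rewrite eY; exact.
have Yn n : Y (eop (vf (dscale n%:R A)) f, eop (vf (dscale n%:R A)) g).
  elim: n => [|n ih]; first by rewrite dscale0 !eop_data0.
  have e u : eop (vf (dscale n.+1%:R A)) u = eop (vf A) (eop (vf (dscale n%:R A)) u).
    have e := eop_dscale 1 n%:R A u; rewrite dscale1 in e; rewrite mulrS; exact: esym e.
  by move: (e f) (e g) => -> ->; exact: h ih.
rewrite eY => l hl; have [_ lZ _] := hF l hl.
have [N hN] := local_form_eop (hF l hl).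
(* As a function of n, the form on e^(nw)(f, g) is a polynomial of size N + 2; its coefficient of n
   is the form on w (f, g), and N + 2 rather than N makes sure that this index occurs. *)
have := @vandermonde0 N.+2 (fun k => l (dpow (vf A) k f, dpow (vf A) k g)) _ 1.
have d1 u : dpow (vf A) 1 u = vf A u by rewrite /dpow -[1`!]/1%N invr1 scale1r.
rewrite !d1; apply=> // n.
have := Yn n; rewrite eY => /(_ l hl); rewrite (hN _ (raises_vf _) N.+2) //; last lia.
move=> e; rewrite -[RHS]e; apply: eq_bigr => k _.
move: (dpow_dscale_nat n A k f) (dpow_dscale_nat n A k g) => -> ->.
exact: esym (lZ _ (dpow (vf A) k f, dpow (vf A) k g)).
Qed.

(** Zero and negation are evident for w, products are evident for e^w; [stab_eop] passes between the
    two. *)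
Lemma coef_space_stab Y : coef_space Y -> dgroup [set A | stab Y (vf A)].
Proof.
move=> cY; have h A := stab_eop A cY; have YZ := fun k p => @coef_spaceZ Y k p cY; split.
- by move=> [f g] Yp; rewrite /= !vf_data0 -[(_, _)](scale0r (f, g)); exact: YZ.
- move=> A hA [f g] Yp /=; rewrite -!dscaleN !vf_dscale constSN constS1 !mulN1r.
  have YN (u v : S) : Y (u, v) -> Y (- u, - v).
    by move=> /(YZ (- 1)); rewrite -[_ *: _]/(- 1 *: u, - 1 *: v) !scaleN1r.
  exact: YN (hA _ Yp).
- move=> A B /h hA /h hB; apply/h => -[f g] Yp.
  rewrite -[(_, _).1]/f -[(_, _).2]/g (eop_dcirc A B f) (eop_dcirc A B g).
  by apply: (hA (_, _)); exact: hB Yp.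
Qed.

Lemma c0Mn (e : sext R) k : c0 (e *+ k) = c0 e *+ k.
Proof. by rewrite -(card_ord k) -!sumr_const c0_sum. Qed.
Lemma cpMn (e : sext R) k : cp (e *+ k) = cp e *+ k.
Proof. by rewrite -(card_ord k) -!sumr_const cp_sum. Qed.
Lemma cmMn (e : sext R) k : cm (e *+ k) = cm e *+ k.
Proof. by rewrite -(card_ord k) -!sumr_const cm_sum. Qed.
Lemma cpmMn (e : sext R) k : cpm (e *+ k) = cpm e *+ k.
Proof. by rewrite -(card_ord k) -!sumr_const cpm_sum. Qed.

Local Transparent vf.
Lemma c0_vf A f n : c0 (vf A f n) = \sum_(i < n.+1) (c0 (vfx A i * dx f (n - i)%N)
  + c0 (vfp A i * dphip f (n - i)%N) + c0 (vfm A i * dphim f (n - i)%N)).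
Proof.
by rewrite -[LHS]/(c0 (\sum_(i < n.+1) _) + c0 (\sum_(i < n.+1) _) + c0 (\sum_(i < n.+1) _)) !c0_sum -!big_split.
Qed.
Lemma cp_vf A f n : cp (vf A f n) = \sum_(i < n.+1) (cp (vfx A i * dx f (n - i)%N)
  + cp (vfp A i * dphip f (n - i)%N) + cp (vfm A i * dphim f (n - i)%N)).
Proof.
by rewrite -[LHS]/(cp (\sum_(i < n.+1) _) + cp (\sum_(i < n.+1) _) + cp (\sum_(i < n.+1) _)) !cp_sum -!big_split.
Qed.
Lemma cm_vf A f n : cm (vf A f n) = \sum_(i < n.+1) (cm (vfx A i * dx f (n - i)%N)
  + cm (vfp A i * dphip f (n - i)%N) + cm (vfm A i * dphim f (n - i)%N)).
Proof.
by rewrite -[LHS]/(cm (\sum_(i < n.+1) _) + cm (\sum_(i < n.+1) _) + cm (\sum_(i < n.+1) _)) !cm_sum -!big_split.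
Qed.
Lemma cpm_vf A f n : cpm (vf A f n) = \sum_(i < n.+1) (cpm (vfx A i * dx f (n - i)%N)
  + cpm (vfp A i * dphip f (n - i)%N) + cpm (vfm A i * dphim f (n - i)%N)).
Proof.
by rewrite -[LHS]/(cpm (\sum_(i < n.+1) _) + cpm (\sum_(i < n.+1) _) + cpm (\sum_(i < n.+1) _)) !cpm_sum -!big_split.
Qed.

(** What remains in the first component is a(x) phi-, and a(x) phi+ for [no_cp]. The constant term
    of w phi- is made of the M^-, that of w phi+ of the M^+, so stability detects the vanishing of
    these sequences. *)
Definition no_cm : set (S * S) :=
  [set p | forall n, [/\ c0 (p.1 n) = 0, cp (p.1 n) = 0 & cpm (p.1 n) = 0]].
Definition no_cp : set (S * S) :=
  [set p | forall n, [/\ c0 (p.1 n) = 0, cm (p.1 n) = 0 & cpm (p.1 n) = 0]].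

Lemma shiftn_zero c (u : nat -> L) n : (forall k, u k = 0) -> shiftn c u n = 0.
Proof. by move=> h; rewrite /shiftn h if_same. Qed.

Lemma wt_local n : exists N, forall f g, wt N f -> wt N g -> f n = 0 /\ g n = 0.
Proof. by exists (2 * n + 3)%N => f g hf hg; split; apply: (@wt_coef R (2 * n + 3)) => //; lia. Qed.

Lemma coef_space_c0 n : coef_space [set p | c0 (p.1 n) = 0].
Proof.
apply: (@coef_space_coef (fun p => c0 (p.1 n))) => //.
by have [N h] := wt_local n; exists N => f g hf hg; have [/= -> _] := h f g hf hg.
Qed.
Lemma coef_space_cp n : coef_space [set p | cp (p.1 n) = 0].
Proof.
apply: (@coef_space_coef (fun p => cp (p.1 n))) => //.
by have [N h] := wt_local n; exists N => f g hf hg; have [/= -> _] := h f g hf hg.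
Qed.
Lemma coef_space_cm n : coef_space [set p | cm (p.1 n) = 0].
Proof.
apply: (@coef_space_coef (fun p => cm (p.1 n))) => //.
by have [N h] := wt_local n; exists N => f g hf hg; have [/= -> _] := h f g hf hg.
Qed.
Lemma coef_space_cpm n : coef_space [set p | cpm (p.1 n) = 0].
Proof.
apply: (@coef_space_coef (fun p => cpm (p.1 n))) => //.
by have [N h] := wt_local n; exists N => f g hf hg; have [/= -> _] := h f g hf hg.
Qed.
Lemma coef_space_cpcm n : coef_space [set p | cp (p.2 n) - cm (p.1 n) = 0].
Proof.
apply: (@coef_space_coef (fun p => cp (p.2 n) - cm (p.1 n))).
- by move=> p q; rewrite opprD addrACA.
- by move=> k p; rewrite scalerBr.
- have [N h] := wt_local n; exists N => f g hf hg; have [/= -> ->] := h f g hf hg.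
  exact: subrr.
Qed.

Lemma coef_space_cmcp n : coef_space [set p | cm (p.2 n) - cp (p.1 n) = 0].
Proof.
apply: (@coef_space_coef (fun p => cm (p.2 n) - cp (p.1 n))).
- by move=> p q; rewrite opprD addrACA.
- by move=> k p; rewrite scalerBr.
- have [N h] := wt_local n; exists N => f g hf hg; have [/= -> ->] := h f g hf hg.
  exact: subrr.
Qed.

Lemma coef_space_and3 (P Q T : nat -> set (S * S)) : (forall n, coef_space (P n)) ->
  (forall n, coef_space (Q n)) -> (forall n, coef_space (T n)) ->
  coef_space [set p | forall n, [/\ P n p, Q n p & T n p]].
Proof.
move=> hP hQ hT.
have -> : [set p | forall n, [/\ P n p, Q n p & T n p]] = [set p | forall n, (P n `&` (Q n `&` T n)) p].
  by apply/seteqP; split=> p h n; have := h n; [case|case=> ? []].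
by apply: coef_space_forall => n; do ![apply: coef_spaceI].
Qed.

(** Pairs in which phi- in the first series and phi+ in the second have the same coefficients. L_j
    scales phi+ and phi- alike and J_j oppositely, so once M^- = 0 stability means A^- = 0. *)
Definition balanced_m : set (S * S) := no_cm `&` [set p | forall n, cp (p.2 n) - cm (p.1 n) = 0].
Definition balanced_p : set (S * S) := no_cp `&` [set p | forall n, cm (p.2 n) - cp (p.1 n) = 0].
(** The index n + (n != 0) takes every value but 1, so the first component is c x + b(x) phi- + d(x)
    phi+ phi-. Once M^- = 0, the term in x alone of w x is the series of the A^+, which must
    vanish. *)
Definition line_m : set (S * S) :=
  [set p | forall n, cp (p.1 n) = 0] `&` [set p | forall n, c0 (p.1 (n + (n != 0%N))%N) = 0].
Definition line_p : set (S * S) :=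
  [set p | forall n, cm (p.1 n) = 0] `&` [set p | forall n, c0 (p.1 (n + (n != 0%N))%N) = 0].

Lemma vf_pp_pm A : vf A pp = vfp A /\ vf A pm = vfm A.
Proof. by rewrite vf_phip vf_phim. Qed.

Ltac vanish H := rewrite /= /dx !(c0Mn, cpMn, cmMn, cpmMn, H, oppr0, mul0rn, lam_sign0, mulr0, mul0r, subr0, addr0).

Lemma data_eq0 (T : zmodType) (emb : T -> L) (u : nat -> T) : injective emb -> emb 0 = 0 ->
  (forall n, emb (u n) = 0) -> u = 0.
Proof. by move=> hi h0 h; apply/funext => n; apply: hi; rewrite h. Qed.

Lemma subr_addC (V : zmodType) (u v : V) : u - v - (u + v) = - (v *+ 2).
Proof. by rewrite opprD addrACA subrr add0r mulr2n opprD. Qed.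

Lemma shiftn1S (u : nat -> L) n : shiftn 1 u n.+1 = u n.
Proof. by rewrite /shiftn subSS subn0. Qed.

Lemma stab_no_cm A : A.2 = 0 <-> stab no_cm (vf A).
Proof.
case: A => [[[a b] c] d]; split=> [/= -> [f g] h n|h].
  have z1 k : shiftn 1 (fun k => (0 : nat -> Lam1 R) k : L) k = 0 by exact: shiftn_zero.
  rewrite -[X in X n]/(vf (a, b, c, 0) f).
  have h0 k : c0 (f k) = 0 by have [] := h k.
  have hp k : cp (f k) = 0 by have [] := h k.
  have hpm k : cpm (f k) = 0 by have [] := h k.
  by split; rewrite ?c0_vf ?cp_vf ?cpm_vf; apply: big1 => i _; vanish (h0, hp, hpm, z1).
apply: (@data_eq0 _ (@lam1_val R)); [exact: val_inj|by []|move=> n].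
have [|+ _ _] := h (pm, 0) _ n.+1; first by case.
by rewrite (vf_pp_pm _).2 /= shiftn1S.
Qed.

Lemma stab_no_cp A : A.1.2 = 0 <-> stab no_cp (vf A).
Proof.
case: A => [[[a b] c] d]; split=> [/= -> [f g] h n|h].
  have z1 k : shiftn 1 (fun k => (0 : nat -> Lam1 R) k : L) k = 0 by exact: shiftn_zero.
  rewrite -[X in X n]/(vf (a, b, 0, d) f).
  have h0 k : c0 (f k) = 0 by have [] := h k.
  have hp k : cm (f k) = 0 by have [] := h k.
  have hpm k : cpm (f k) = 0 by have [] := h k.
  by split; rewrite ?c0_vf ?cm_vf ?cpm_vf; apply: big1 => i _; vanish (h0, hp, hpm, z1).
apply: (@data_eq0 _ (@lam1_val R)); [exact: val_inj|by []|move=> n].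
have [|+ _ _] := h (pp, 0) _ n.+1; first by case.
by rewrite (vf_pp_pm _).1 /= shiftn1S.
Qed.

Lemma stab_balanced_m A : A.2 = 0 -> A.1.1.2 = 0 <-> stab balanced_m (vf A).
Proof.
case: A => [[[a b] c] d] /= ->.
split=> [-> [f g] [h hb]|h].
  split; first exact: (proj1 (stab_no_cm (a, 0, c, 0)) erefl _ h).
  move=> n; rewrite -[X in cm (X n)]/(vf (a, 0, c, 0) f) -[X in cp (X n)]/(vf (a, 0, c, 0) g).
  have z1 k : shiftn 1 (fun k => (0 : nat -> Lam1 R) k : L) k = 0 by exact: shiftn_zero.
  have z0 k : shiftn 1 (fun k => (0 : nat -> L0) k : L) k = 0 by exact: shiftn_zero.
  have h0 k : c0 (f k) = 0 by have [] := h k.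
  have hp k : cp (f k) = 0 by have [] := h k.
  have hpm k : cpm (f k) = 0 by have [] := h k.
  have hbk k : cp (g k) = cm (f k) by have /= := hb k; move/eqP; rewrite subr_eq0 => /eqP.
  rewrite cp_vf cm_vf -sumrB; apply: big1 => i _.
  by vanish (h0, hp, hpm, z1, z0, hbk, add0r); rewrite subrr.
apply: (@data_eq0 _ (@lam0_val R)); [exact: val_inj|by []|move=> n].
have [|_ /(_ n.+1)] := h (pm, pp); first by split=> [] [|k] //=; rewrite subrr.
rewrite -[X in cm (X _)]/(vf (a, b, c, 0) pm) -[X in cp (X _)]/(vf (a, b, c, 0) pp).
rewrite (vf_pp_pm _).1 (vf_pp_pm _).2 /= !shiftn1S.
move: (_ *: _) (b n : L) => u v; rewrite opprB addrC addrA subrK -mulr2n.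
exact: natmul_eq0.
Qed.

Lemma stab_balanced_p A : A.1.2 = 0 -> A.1.1.2 = 0 <-> stab balanced_p (vf A).
Proof.
case: A => [[[a b] c] d] /= ->.
split=> [-> [f g] [h hb]|h].
  split; first exact: (proj1 (stab_no_cp (a, 0, 0, d)) erefl _ h).
  move=> n; rewrite -[X in cp (X n)]/(vf (a, 0, 0, d) f) -[X in cm (X n)]/(vf (a, 0, 0, d) g).
  have z1 k : shiftn 1 (fun k => (0 : nat -> Lam1 R) k : L) k = 0 by exact: shiftn_zero.
  have z0 k : shiftn 1 (fun k => (0 : nat -> L0) k : L) k = 0 by exact: shiftn_zero.
  have h0 k : c0 (f k) = 0 by have [] := h k.
  have hp k : cm (f k) = 0 by have [] := h k.
  have hpm k : cpm (f k) = 0 by have [] := h k.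
  have hbk k : cm (g k) = cp (f k) by have /= := hb k; move/eqP; rewrite subr_eq0 => /eqP.
  rewrite cp_vf cm_vf -sumrB; apply: big1 => i _.
  by vanish (h0, hp, hpm, z1, z0, hbk, add0r); rewrite subrr.
apply: (@data_eq0 _ (@lam0_val R)); [exact: val_inj|by []|move=> n].
have [|_ /(_ n.+1)] := h (pp, pm); first by split=> [] [|k] //=; rewrite subrr.
rewrite -[X in cp (X _)]/(vf (a, b, 0, d) pp) -[X in cm (X _)]/(vf (a, b, 0, d) pm).
rewrite (vf_pp_pm _).1 (vf_pp_pm _).2 /= !shiftn1S.
move: (_ *: _) (b n : L) => u v; rewrite subr_addC => e.
by apply: (@natmul_eq0 _ _ 1); apply: oppr_inj; rewrite e oppr0.
Qed.

Lemma stab_line_m A : A.2 = 0 -> A.1.1.1 = 0 <-> stab line_m (vf A).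
Proof.
case: A => [[[a b] c] d] /= ->.
split=> [-> [f g] [h1 h2]|h].
  have z1 k : shiftn 1 (fun k => (0 : nat -> Lam1 R) k : L) k = 0 by exact: shiftn_zero.
  have z0 k : shiftn 1 (fun k => (0 : nat -> L0) k : L) k = 0 by exact: shiftn_zero.
  have z2 k : shiftn 2 (fun k => (0 : nat -> L0) k : L) k = 0 by exact: shiftn_zero.
  split=> n; [rewrite -[X in cp (X _)]/(vf (0, b, c, 0) f) cp_vf|rewrite -[X in c0 (X _)]/(vf (0, b, c, 0) f) c0_vf]; apply: big1 => i _;
    by vanish (h1, z1, z2).
apply: (@data_eq0 _ (@lam0_val R)); [exact: val_inj|by []|move=> n].
have [|_ /(_ n.+1)] := h (x, 0); first by split=> [] [|[|k]].
by rewrite -[X in c0 (X _)]/(vf (a, b, c, 0) x) vf_varx addn1 /= /shiftn subSS subn1.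
Qed.

Lemma stab_line_p A : A.1.2 = 0 -> A.1.1.1 = 0 <-> stab line_p (vf A).
Proof.
case: A => [[[a b] c] d] /= ->.
split=> [-> [f g] [h1 h2]|h].
  have z1 k : shiftn 1 (fun k => (0 : nat -> Lam1 R) k : L) k = 0 by exact: shiftn_zero.
  have z0 k : shiftn 1 (fun k => (0 : nat -> L0) k : L) k = 0 by exact: shiftn_zero.
  have z2 k : shiftn 2 (fun k => (0 : nat -> L0) k : L) k = 0 by exact: shiftn_zero.
  split=> n; [rewrite -[X in cm (X _)]/(vf (0, b, 0, d) f) cm_vf|rewrite -[X in c0 (X _)]/(vf (0, b, 0, d) f) c0_vf]; apply: big1 => i _;
    by vanish (h1, z1, z2).
apply: (@data_eq0 _ (@lam0_val R)); [exact: val_inj|by []|move=> n].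
have [|_ /(_ n.+1)] := h (x, 0); first by split=> [] [|[|k]].
by rewrite -[X in c0 (X _)]/(vf (a, b, 0, d) x) vf_varx addn1 /= /shiftn subSS subn1.
Qed.

(** The relative form is needed because the criteria for A^- = 0 and A^+ = 0 are only available
    inside a group where one of M^+, M^- vanishes. *)
Lemma dgroup_stab_in D Y (E : set data) : dgroup D -> coef_space Y ->
  (forall A, D A -> E A <-> stab Y (vf A)) -> dgroup (D `&` E).
Proof.
move=> gD /coef_space_stab gY h.
have -> : D `&` E = D `&` [set A | stab Y (vf A)].
  by apply/seteqP; split=> A [hD /(h A hD)].
exact: dgroupI.
Qed.

Lemma coef_space_no_cm : coef_space no_cm.
Proof.
by apply: coef_space_and3; [exact: coef_space_c0|exact: coef_space_cp|exact: coef_space_cpm].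
Qed.
Lemma coef_space_no_cp : coef_space no_cp.
Proof.
by apply: coef_space_and3; [exact: coef_space_c0|exact: coef_space_cm|exact: coef_space_cpm].
Qed.

(** An intersection of the group M^- = 0 with those of the conditions A^- = 0, A^+ = 0 (each taken
    inside it) and M^+ = 0 that the flags impose. *)
Lemma dgroup_family_m ap am mp : dgroup (vanishing_family (R := R) (ap, am, mp, false)).
Proof.
pose D : set data := [set A | A.2 = 0].
have gD : dgroup D.
  rewrite -[D]setTI; apply: (dgroup_stab_in dgroupT coef_space_no_cm) => A _; exact: stab_no_cm.
have g1 : dgroup (D `&` [set A | A.1.1.2 = 0]).
  apply: (dgroup_stab_in gD _ stab_balanced_m); apply: coef_spaceI coef_space_no_cm _.
  by apply: coef_space_forall; exact: coef_space_cpcm.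
have g2 : dgroup (D `&` [set A | A.1.1.1 = 0]).
  apply: (dgroup_stab_in gD _ stab_line_m); apply: coef_spaceI; apply: coef_space_forall => n.
    exact: coef_space_cp.
  exact: coef_space_c0.
have g3 : dgroup [set A : data | A.1.2 = 0].
  rewrite -[[set _ | _]]setTI; apply: (dgroup_stab_in dgroupT coef_space_no_cp) => A _; exact: stab_no_cp.
have gif (b : bool) E : dgroup E -> dgroup (if b then setT else E) by case: b.
have := dgroupI gD (dgroupI (gif am _ g1) (dgroupI (gif ap _ g2) (gif mp _ g3))).
congr dgroup; apply/seteqP; split=> [A [d0 [h1 [h2 h3]]]|A [/orP h1 /orP h2 /orP h3 /eqP d0]].
  by split=> //=; [move: h2; case: ap|move: h1; case: am|move: h3; case: mp|apply/eqP] => //= [[_ /eqP]|[_ /eqP]|/eqP].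
split=> //; split; first by case: am h2 => //= -[//|/eqP].
by split; [case: ap h1|case: mp h3] => //= -[//|/eqP].
Qed.

Lemma dgroup_family_p ap am mm : dgroup (vanishing_family (R := R) (ap, am, false, mm)).
Proof.
pose D : set data := [set A | A.1.2 = 0].
have gD : dgroup D.
  rewrite -[D]setTI; apply: (dgroup_stab_in dgroupT coef_space_no_cp) => A _; exact: stab_no_cp.
have g1 : dgroup (D `&` [set A | A.1.1.2 = 0]).
  apply: (dgroup_stab_in gD _ stab_balanced_p); apply: coef_spaceI coef_space_no_cp _.
  by apply: coef_space_forall; exact: coef_space_cmcp.
have g2 : dgroup (D `&` [set A | A.1.1.1 = 0]).
  apply: (dgroup_stab_in gD _ stab_line_p); apply: coef_spaceI; apply: coef_space_forall => n.
    exact: coef_space_cm.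
  exact: coef_space_c0.
have g3 : dgroup [set A : data | A.2 = 0].
  rewrite -[[set _ | _]]setTI; apply: (dgroup_stab_in dgroupT coef_space_no_cm) => A _; exact: stab_no_cm.
have gif (b : bool) E : dgroup E -> dgroup (if b then setT else E) by case: b.
have := dgroupI gD (dgroupI (gif am _ g1) (dgroupI (gif ap _ g2) (gif mm _ g3))).
congr dgroup; apply/seteqP; split=> [A [d0 [h1 [h2 h3]]]|A [/orP h1 /orP h2 /eqP d0 /orP h3]].
  by split=> //=; [move: h2; case: ap|move: h1; case: am|apply/eqP|move: h3; case: mm] => //= [[_ /eqP]|[_ /eqP]|/eqP].
split=> //; split; first by case: am h2 => //= -[//|/eqP].
by split; [case: ap h1|case: mm h3] => //= -[//|/eqP].
Qed.

(** No listed family leaves both M^+ and M^- free, in keeping with the fact that brackets of the G^+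
    with the G^- produce L's and J's. *)
Lemma dgroup_family b : b \in families -> dgroup (vanishing_family (R := R) b).
Proof.
case: b => [[[ap am] mp] mm] hb.
have : ~~ mp || ~~ mm by case: ap am mp mm hb => [] [] [] [].
by case/orP => /negbTE ->; [exact: dgroup_family_p|exact: dgroup_family_m].
Qed.

Lemma vanishing_twist b A : vanishing_family b (twist A) <-> vanishing_family (R := R) b A.
Proof.
have z (u : nat -> Lam1 R) : (- 'i *: u == 0) = (u == 0).
  by rewrite scaler_eq0 oppr_eq0 (negPf (neq0Ci _)).
by case: b A => [[[ap am] mp] mm] [[[p q] r] s] /=; rewrite oppr_eq0 !z.
Qed.

Local Opaque vf twist.

Lemma subgroup_with_one D : dgroup D -> subgroup_on (with_one D) (with_one setT) (graph2 (@circ R)).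
Proof.
move=> gD; split; [exact: group_with_one dgroupT|by move=> al [h1 _]; split|exact: group_with_one].
Qed.

Lemma subgroup_at_zero (P Q : set pdata) : subgroup_on P Q (graph2 (@circ R)) ->
  subgroup_on (at_zero P) (at_zero Q) (@sew R).
Proof.
by move=> [gQ PQ gP]; split; [exact: group_at_zero|move=> w [h1 h2]; split=> //; exact: PQ|exact: group_at_zero].
Qed.

Lemma subgroup_at_infty (D E : set data) : subgroup_on D E (graph2 (@circoo R)) ->
  subgroup_on (at_infty D) (at_infty E) (@sew R).
Proof.
by move=> [gE DE gD]; split; [exact: group_at_infty|move=> w [h1 h2]; split=> //; exact: DE|exact: group_at_infty].
Qed.

Lemma subgroup_circoo (D E : set data) : dgroup D -> dgroup E -> D `<=` E ->
  subgroup_on [set A | D (twist A)] [set A | E (twist A)] (graph2 (@circoo R)).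
Proof. by move=> gD gE DE; split; [exact: group_circoo|move=> A; exact: DE|exact: group_circoo]. Qed.

Lemma groups_at_zero : exists phi : SK1 R -> pdata,
     [/\ group_on (at_zero setT) (@sew R),
         group_on setT (graph2 (@circ R)),
         iso_on (at_zero setT) (@sew R) setT (graph2 (@circ R)) phi,
         subgroup_on (at_zero (with_one setT)) (at_zero setT) (@sew R) /\
         subgroup_on (with_one setT) setT (graph2 (@circ R)) /\
         iso_on (at_zero (with_one setT)) (@sew R)
           (with_one setT) (graph2 (@circ R)) phi
       & forall b, b \in families ->
         [/\ subgroup_on (with_one (@vanishing_family R b)) (with_one setT) (graph2 (@circ R)),
             subgroup_on (at_zero (with_one (@vanishing_family R b)))
               (at_zero (with_one setT)) (@sew R)
           & phi @` at_zero (with_one (@vanishing_family R b)) = with_one (@vanishing_family R b)]].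
Proof.
have g1 : subgroup_on (with_one setT) setT (graph2 (@circ R)).
  by split; [exact: group_circ|by []|exact: group_with_one dgroupT].
exists snd; split; [exact: group_at_zero group_circ|exact: group_circ|exact: iso_at_zero| |].
- by split; [exact: subgroup_at_zero|split; [exact: g1|exact: iso_at_zero]].
- move=> b /dgroup_family gb; have g2 := subgroup_with_one gb.
  split; [exact: g2|exact: subgroup_at_zero|].
  by apply/seteqP; split=> [_ [w [_ hw] <-]|al hal] //; exists (0, al).
Qed.

Lemma vanishingN b A : vanishing_family b (- A) <-> vanishing_family (R := R) b A.
Proof. by case: b A => [[[ap am] mp] mm] [[[p q] r] s] /=; rewrite !oppr_eq0. Qed.

Lemma groups_at_infty : exists psi : SK1 R -> data,
     [/\ group_on (at_infty setT) (@sew R),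
         group_on setT (graph2 (@circoo R)),
         iso_on (at_infty setT) (@sew R) setT (graph2 (@circoo R)) psi
       & forall b, b \in families ->
         [/\ subgroup_on (@vanishing_family R b) setT (graph2 (@circoo R)),
             subgroup_on (at_infty (@vanishing_family R b)) (at_infty setT) (@sew R)
           & psi @` at_infty (@vanishing_family R b) = @vanishing_family R b]].
Proof.
have gT := group_circoo dgroupT.
exists (fun w => - w.1); split; [exact: group_at_infty gT|exact: gT|exact: iso_at_infty|].
move=> b /dgroup_family gb; have g2 := subgroup_circoo gb dgroupT (@subsetT _ _).
have e : [set A | vanishing_family b (twist A)] = vanishing_family (R := R) b.
  by apply/seteqP; split=> A /vanishing_twist.
rewrite e in g2; split; [exact: g2|exact: subgroup_at_infty g2|].
apply/seteqP; split=> [_ [w [hw _] <-]|A hA]; first exact/vanishingN.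
by exists (- A, (uone, 0)) => /=; rewrite ?opprK //; split=> //; exact/vanishingN.
Qed.

End Groups.

(** * Exponentials in Lam and one-parameter homomorphisms *)

Section ScalarPowers.
Variable R : realType.
Local Notation C := (R[i]).
Local Notation L0 := (Lam0 R).
Local Notation uone := (uone R).
Implicit Types (a b s t : L0) (f : sser R).

Definition etrunc N a : L0 := \sum_(k < N) (k`!%:R^-1 : C) *: a ^+ k.

Lemma lam0_scaleMM (k l : C) a b : (k *: a) * (l *: b) = (k * l) *: (a * b).
Proof. by apply/val_inj; exact: (etrans (esym (scalerAl _ _ _)) (etrans (congr1 _ (lam_scalerAr _ _ _)) (scalerA _ _ _))). Qed.

Lemma pow0_ge a n m : a ^+ n = 0 -> (n <= m)%N -> a ^+ m = 0.
Proof. by move=> h /subnKC <-; rewrite exprD h mul0r. Qed.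

Lemma etrunc_ge a n m : a ^+ n = 0 -> (n <= m)%N -> etrunc m a = etrunc n a.
Proof.
move=> h nm; rewrite /etrunc -!(big_mkord xpredT (fun k => (k`!%:R^-1 : C) *: a ^+ k)).
rewrite (@big_cat_nat _ _ _ n) //= [X in _ + X]big_nat_cond [X in _ + X]big1 ?addr0 // => k /andP[/andP[nk _] _].
by rewrite (pow0_ge h nk) scaler0.
Qed.

(** Pairs (i, j) with i + j >= n + n have i >= n or j >= n and contribute 0, so the triangle of the
    binomial expansion may be completed to a square. *)
Lemma etruncD a b n : a ^+ n = 0 -> b ^+ n = 0 -> etrunc (n + n) (a + b) = etrunc n a * etrunc n b.
Proof.
move=> ha hb; rewrite -(etrunc_ge ha (leq_addr n n)) -(etrunc_ge hb (leq_addr n n)).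
pose F i j : L0 := ((i`!%:R^-1 : C) *: a ^+ i) * ((j`!%:R^-1 : C) *: b ^+ j).
transitivity (\sum_(k < n + n) \sum_(i < k.+1) F i (k - i)%N).
  apply: eq_bigr => k _; rewrite addrC exprDn scaler_sumr; apply: eq_bigr => i _.
  have ik : (i <= k)%N by rewrite -ltnS.
  have sn (v : L0) m : v *+ m = (m%:R : C) *: v by rewrite scaler_nat.
  rewrite /F lam0_scaleMM sn scalerA [b ^+ _ * _]mulrC; congr (_ *: _).
  rewrite -(bin_fact ik) !natrM; field.
  by rewrite !pnatr_eq0 -!lt0n !fact_gt0 bin_gt0 ik.
rewrite triangle_sum mulr_suml; apply: eq_bigr => i _; rewrite mulr_sumr.
have hi := ltn_ord i.
rewrite -(big_mkord xpredT (F i)) -(big_mkord xpredT (F i)) (@big_cat_nat _ _ _ (n + n - i) 0 (n + n)) //=; last lia.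
rewrite [X in _ = _ + X]big_nat_cond [X in _ = _ + X]big1 ?addr0 // => j /andP[/andP[h1 h2] _].
rewrite /F; have [ni|ni] := leqP n i; first by rewrite (pow0_ge ha ni) scaler0 mul0r.
by rewrite (pow0_ge hb) ?scaler0 ?mulr0 //; lia.
Qed.

Definition soul a : L0 := a - (body a)%:A.

Lemma bodyD a b : body (a + b : L0) = body a + body b. Proof. by []. Qed.

Lemma soulD a b : soul (a + b) = soul a + soul b.
Proof. by rewrite /soul bodyD scalerDl opprD addrACA. Qed.

Lemma soul_pow0 a : exists n, soul a ^+ n = 0.
Proof.
have [|n hn] := @soul_nilpotent _ (soul a : Lam R).
  rewrite -[LHS]/(body a - body a * body 1) body1 mulr1 subrr //.
by exists n; apply/val_inj; exact: etrans (lam0_valX _ _) hn.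
Qed.

Lemma expLE a n : soul a ^+ n = 0 -> expL a = cexp (body a) *: etrunc n (soul a).
Proof.
move=> hn; congr (_ *: _).
rewrite -(fsbig_widen `I_n) -?fsbig_ord // => k [_ /negP] /=.
by rewrite -leqNgt => nk; rewrite (pow0_ge hn nk) scaler0.
Qed.

Lemma cexpD (z w : C) : cexp (z + w) = cexp z * cexp w.
Proof.
case: z w => [a b] [c d]; rewrite /cexp /= expRD cosD sinD.
by apply/eqP; rewrite eq_complex /=; apply/andP; split; apply/eqP; ring.
Qed.

Lemma cexp0 : cexp (0 : C) = 1.
Proof. by rewrite /cexp /= expR0 cos0 sin0 mul1r. Qed.

Lemma expLD a b : expL (a + b) = expL a * expL b.
Proof.
have [n hn] := soul_pow0 a; have [m hm] := soul_pow0 b.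
have ha := pow0_ge hn (leq_addr m n); have hb := pow0_ge hm (leq_addl n m).
rewrite (expLE ha) (expLE hb) lam0_scaleMM -etruncD // -cexpD -bodyD -soulD; apply: expLE.
rewrite soulD exprDn big1 // => i _.
have [h|h] := leqP (n + m) i; first by rewrite (pow0_ge hb h) mulr0 mul0rn.
by rewrite (pow0_ge ha) ?mul0r ?mul0rn //; lia.
Qed.

Lemma expL0 : expL (0 : L0) = 1.
Proof.
have s0 : soul 0 ^+ 1 = 0 by rewrite expr1 /soul (_ : body _ = 0) // scale0r subr0.
by rewrite (expLE s0) /etrunc big_ord1 expr0 invr1 (_ : body _ = 0) // cexp0 !scale1r.
Qed.

Lemma expL_unit a : expL a \is a GRing.unit.
Proof. by apply/unitrP; exists (expL (- a)); rewrite -!expLD addNr subrr expL0. Qed.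

Lemma rep_scaling (u : uquot R) f : rep (u, 0) f = sc (qpart u) (rpart u) f.
Proof. exact: eop_data0. Qed.

Lemma circ_scale a b c d : a \is a GRing.unit -> b \is a GRing.unit -> c \is a GRing.unit ->
  d \is a GRing.unit -> circ (uclass a b, 0) (uclass c d, 0) = (uclass (a * c) (b * d), 0) :> pdata R.
Proof.
move=> ua ub uc ud; apply: (@rep_inj R) => f; rewrite rep_circ.
have [e1 e2] := uclassK ua ub; have [e3 e4] := uclassK uc ud.
have uac : a * c \is a GRing.unit by rewrite unitrM ua.
have ubd : b * d \is a GRing.unit by rewrite unitrM ub.
have [e5 e6] := uclassK uac ubd.
rewrite [RHS]rep_scaling [LHS]rep_scaling [X in sc _ _ X]rep_scaling e1 e2 e3 e4 e5 e6 sc_comp.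
have eb : a / b * (c / d) = a * c / (b * d).
  exact: etrans (mulrACA a _ c _) (congr1 _ (etrans (mulrC _ _) (esym (invrM ub ud)))).
by rewrite (mulrACA a b c d) eb.
Qed.

Lemma homs_from_additive (A : data R) (lp lm : L0) :
     [/\ hom_from_additive (fun t : L0 => (0, (uclass (expL (t * lp)) 1, 0)))
           (at_zero setT) (@sew R),
         hom_from_additive (fun t : L0 => (0, (uclass 1 (expL (t * lm)), 0)))
           (at_zero setT) (@sew R),
         hom_from_additive (fun t : L0 => (0, (uone, dscale t A)))
           (at_zero setT) (@sew R)
       & hom_from_additive (fun t : L0 => (dscale t A, (uone, 0)))
           (at_infty setT) (@sew R)].
Proof.
split; split=> // s t.
- by apply/sew_at_zero; rewrite circ_scale ?expL_unit ?unitr1 // -expLD -mulrDl mulr1.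
- by apply/sew_at_zero; rewrite circ_scale ?expL_unit ?unitr1 // -expLD -mulrDl mulr1.
- by apply/sew_at_zero; rewrite circ_data dcirc_dscale.
- by apply/sew_at_infty; rewrite circoo_dscale addrC.
Qed.

End ScalarPowers.

(** * Convergence *)

Section Norms.
Variable R : realType.
Local Notation C := (R[i]).
Local Notation L := (Lam R).
Local Notation sg := (@lam_sign R).
Local Notation S := (sser R).
Implicit Types (z w : C) (a b : L) (I J : {fset nat}) (e l t r s : R) (f g : S).

(** The modulus as an element of [R], so that estimates take place in an ordered field rather than
    in [R[i]]. *)
Definition cnorm z : R := complex.Re `|z|.

Lemma cnE z : `|z| = (cnorm z)%:C%C.
Proof. by rewrite /cnorm normc_def. Qed.

Lemma complex_real_inj (u v : R) : (u%:C)%C = (v%:C)%C -> u = v.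
Proof. by case. Qed.

Lemma cn_ge0 z : 0 <= cnorm z.
Proof. by rewrite -lecR -cnE normr_ge0. Qed.
Lemma cn0 : cnorm 0 = 0. Proof. by rewrite /cnorm normr0. Qed.
Lemma cn1 : cnorm 1 = 1. Proof. by rewrite /cnorm normr1. Qed.
Lemma cnN z : cnorm (- z) = cnorm z. Proof. by rewrite /cnorm normrN. Qed.
Lemma cnM z w : cnorm (z * w) = cnorm z * cnorm w.
Proof. by apply: complex_real_inj; rewrite -cnE normrM !cnE -rmorphM. Qed.
Lemma cnD z w : cnorm (z + w) <= cnorm z + cnorm w.
Proof. by rewrite -lecR -cnE rmorphD /= -!cnE ler_normD. Qed.
Lemma cnB z w : cnorm (z - w) <= cnorm z + cnorm w.
Proof. by rewrite -(cnN w) cnD. Qed.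
Lemma cn_eq0 z : cnorm z = 0 -> z = 0.
Proof. by move=> h; apply/eqP; rewrite -normr_eq0 cnE h. Qed.
Lemma cnX z n : cnorm (z ^+ n) = cnorm z ^+ n.
Proof. by elim: n => [|n ih]; rewrite ?expr0 ?cn1 // !exprS cnM ih. Qed.
Lemma cnR e : cnorm (e%:C%C) = `|e|.
Proof. by apply: complex_real_inj; rewrite -cnE normc_def /= expr0n addr0 sqrtr_sqr. Qed.
Lemma cn_sum (T : Type) (r : seq T) P (F : T -> C) :
  cnorm (\sum_(k <- r | P k) F k) <= \sum_(k <- r | P k) cnorm (F k).
Proof.
elim/big_ind2: _ => [|u u' v v' h h'|//]; first by rewrite cn0.
exact: le_trans (cnD _ _) (lerD h h').
Qed.
Lemma cn_signM n z : cnorm ((-1) ^+ n * z) = cnorm z.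
Proof. by rewrite cnM cnX cnN cn1 expr1n mul1r. Qed.

(* e is the radius allotted to the zeta's; in nE and Q, t is that of phi+ and phi-, and r that of x. *)
Definition nL I e a : R := \sum_(J <- fpowerset I) cnorm (a J) * e ^+ #|` J|.

Lemma nL_ge0 I e a : 0 <= e -> 0 <= nL I e a.
Proof. by move=> e0; apply: sumr_ge0 => J _; rewrite mulr_ge0 ?cn_ge0 ?exprn_ge0. Qed.
Lemma nL0 I e : nL I e 0 = 0.
Proof. by apply: big1 => J _; rewrite cn0 mul0r. Qed.
Lemma nLN I e a : nL I e (- a) = nL I e a.
Proof. by apply: eq_bigr => J _; rewrite cnN. Qed.
Lemma nL_sg I e a : nL I e (sg a) = nL I e a.
Proof. by apply: eq_bigr => J _; rewrite lam_signE cn_signM. Qed.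
Lemma nLD I e a b : 0 <= e -> nL I e (a + b) <= nL I e a + nL I e b.
Proof.
move=> e0; rewrite /nL -big_split /=; apply: ler_sum => J _.
by rewrite -mulrDl ler_wpM2r ?exprn_ge0 // cnD.
Qed.
Lemma nLB I e a b : 0 <= e -> nL I e (a - b) <= nL I e a + nL I e b.
Proof. by move=> e0; rewrite -(nLN _ _ b) nLD. Qed.
Lemma nL_sum I e (T : Type) (r : seq T) P (F : T -> L) : 0 <= e ->
  nL I e (\sum_(k <- r | P k) F k) <= \sum_(k <- r | P k) nL I e (F k).
Proof.
move=> e0; elim/big_ind2: _ => [|u u' v v' h h'|//]; first by rewrite nL0.
exact: le_trans (nLD _ _ _ e0) (lerD h h').
Qed.
Lemma nL1 I e : nL I e 1 = 1.
Proof.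
rewrite /nL (big_fsetD1 fset0); last by rewrite fpowersetE fsub0set.
rewrite -[LHS]/(_ + _) lam1E eqxx cn1 cardfs0 expr0 mulr1 big_seq big1 ?addr0 // => J.
by rewrite in_fsetD1 lam1E => /andP[/negPf -> _]; rewrite cn0 mul0r.
Qed.

Lemma ler_sum_sub (T : eqType) (r' r : seq T) (F : T -> R) : uniq r -> uniq r' ->
  {subset r <= r'} -> (forall k, 0 <= F k) -> \sum_(k <- r) F k <= \sum_(k <- r') F k.
Proof.
move=> ur ur' sub F0; rewrite [leRHS](bigID (mem r)) /= -[X in _ <= X + _]big_filter.
have h : perm_eq [seq k <- r' | k \in r] r.
  apply: uniq_perm; rewrite ?filter_uniq // => k; rewrite mem_filter.
  by case: (boolP (k \in r)) => // /sub ->.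
by rewrite (perm_big _ h) lerDl sumr_ge0.
Qed.

(** A product of coefficients is charged e^|J| e^|K| = e^|J u K| for disjoint J and K; the pairs
    that are not disjoint only enlarge the right-hand side. *)
Lemma nLM I e a b : 0 <= e -> nL I e (a * b) <= nL I e a * nL I e b.
Proof.
move=> e0; pose F J K := cnorm (a J) * e ^+ #|` J| * (cnorm (b K) * e ^+ #|` K|).
have F0 J K : 0 <= F J K by rewrite !mulr_ge0 ?cn_ge0 ?exprn_ge0.
apply: (@le_trans _ _ (\sum_(M <- fpowerset I) \sum_(J <- fpowerset M) F J (M `\` J)%fset)).
  apply: ler_sum => M _; rewrite lamME.
  apply: (@le_trans _ _ (\sum_(J <- fpowerset M) cnorm (a J) * cnorm (b (M `\` J)%fset) * e ^+ #|` M|)).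
    rewrite -mulr_suml ler_wpM2r ?exprn_ge0 //; apply: le_trans (cn_sum _ _ _) _.
    by apply: ler_sum => J _; rewrite -mulrA cn_signM cnM.
  rewrite le_eqVlt; apply/orP; left; apply/eqP; rewrite big_seq [RHS]big_seq.
  apply: eq_bigr => J; rewrite fpowersetE => JM; rewrite /F mulrACA -exprD.
  by rewrite cardfsDS // subnKC // fsubset_leq_card.
rewrite (fpowerset_flatten I (fun J K _ => F J K)) mulr_suml; apply: ler_sum => J _.
rewrite mulr_sumr -/(F J); set E := fpowerset I.
have -> : \sum_(K <- E) cnorm (a J) * e ^+ #|` J| * (cnorm (b K) * e ^+ #|` K|) = \sum_(K <- E) F J K by [].
have sub : (fpowerset (I `\` J) `<=` E)%fset.
  apply/fsubsetP => K; rewrite !fpowersetE => h; exact: fsubset_trans h (fsubsetDl _ _).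
by apply: ler_sum_sub => //; exact/fsubsetP.
Qed.

Lemma nLX I e a n : 0 <= e -> nL I e (a ^+ n) <= nL I e a ^+ n.
Proof.
move=> e0; elim: n => [|n ih]; first by rewrite !expr0 nL1.
rewrite !exprS; apply: le_trans (nLM _ _ _ e0) _; apply: ler_wpM2l => //; exact: nL_ge0.
Qed.

Lemma nL_le I e e' a : 0 <= e -> e <= e' -> nL I e a <= nL I e' a.
Proof.
move=> e0 ee; apply: ler_sum => J _; rewrite ler_wpM2l ?cn_ge0 //.
by apply: lerXn2r; rewrite ?nnegrE // (le_trans e0).
Qed.

(** Every soul term carries at least one factor e. Small e thus brings the norm close to the modulus
    of the body, whatever [I] is. *)
Lemma nL_split I e a : 0 <= e -> e <= 1 -> nL I e a <= cnorm (body a) + e * nL I 1 a.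
Proof.
move=> e0 e1; rewrite /nL (big_fsetD1 fset0); last by rewrite fpowersetE fsub0set.
rewrite [X in _ + e * X](big_fsetD1 fset0); last by rewrite fpowersetE fsub0set.
rewrite cardfs0 !expr0 !mulr1 -/(body a) mulrDr addrA -addrA lerD ?lerDl ?mulr_ge0 ?cn_ge0 //.
rewrite mulr_sumr -[leLHS]add0r lerD ?mulr_ge0 ?cn_ge0 // big_seq [leRHS]big_seq.
apply: ler_sum => J; rewrite in_fsetD1 => /andP[J0 _].
rewrite expr1n mulr1 mulrC ler_wpM2r ?cn_ge0 //.
have : (0 < #|` J|)%N by rewrite cardfs_gt0.
case: #|` J| => // n _; rewrite exprS -[leRHS]mulr1 ler_wpM2l // exprn_ile1 //.
Qed.

Lemma nL_coef I J e a : 0 <= e -> (J `<=` I)%fset -> cnorm (a J) * e ^+ #|` J| <= nL I e a.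
Proof.
move=> e0 JI; rewrite /nL (big_fsetD1 J) /=; last by rewrite fpowersetE.
by rewrite lerDl; apply: sumr_ge0 => K _; rewrite mulr_ge0 ?cn_ge0 ?exprn_ge0.
Qed.

Lemma nL_coef1 I a : cnorm (a I) <= nL I 1 a.
Proof. by have := @nL_coef I I 1 a ler01 (fsubset_refl I); rewrite expr1n mulr1. Qed.

Lemma nL_rescale I e a : 0 < e -> e <= 1 -> nL I 1 a * e ^+ #|` I| <= nL I e a.
Proof.
move=> e0 e1; rewrite /nL mulr_suml big_seq [leRHS]big_seq; apply: ler_sum => J.
rewrite fpowersetE => JI; rewrite expr1n mulr1 ler_wpM2l ?cn_ge0 //.
rewrite -(subnK (fsubset_leq_card JI)) exprD -[leRHS]mul1r.
by apply: ler_wpM2r; [exact: exprn_ge0 (ltW e0)|exact: exprn_ile1 (ltW e0) e1].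
Qed.

Definition nE I e (t : R) (u : sext R) : R :=
  nL I e (c0 u) + t * (nL I e (cp u) + nL I e (cm u)) + t ^+ 2 * nL I e (cpm u).

Lemma nE_ge0 I e t u : 0 <= e -> 0 <= t -> 0 <= nE I e t u.
Proof. by move=> e0 t0; rewrite !addr_ge0 ?mulr_ge0 ?addr_ge0 ?nL_ge0 ?exprn_ge0. Qed.
Lemma nE0 I e t : nE I e t 0 = 0.
Proof. by rewrite /nE /= !nL0 addr0 !mulr0 !addr0. Qed.
Lemma nEN I e t u : nE I e t (- u) = nE I e t u.
Proof. by rewrite /nE /= !nLN. Qed.

Lemma nED I e t u v : 0 <= e -> 0 <= t -> nE I e t (u + v) <= nE I e t u + nE I e t v.
Proof.
move=> e0 t0; rewrite /nE /=.
rewrite [leRHS](_ : _ = (nL I e (c0 u) + nL I e (c0 v))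
  + t * ((nL I e (cp u) + nL I e (cp v)) + (nL I e (cm u) + nL I e (cm v)))
  + t ^+ 2 * (nL I e (cpm u) + nL I e (cpm v))); last by ring.
by rewrite !lerD ?nLD // ler_wpM2l ?exprn_ge0 ?lerD ?nLD.
Qed.

Lemma nE_sum I e t (T : Type) (r : seq T) P (F : T -> sext R) : 0 <= e -> 0 <= t ->
  nE I e t (\sum_(k <- r | P k) F k) <= \sum_(k <- r | P k) nE I e t (F k).
Proof.
move=> e0 t0; elim/big_ind2: _ => [|u u' v v' h h'|//]; first by rewrite nE0.
exact: le_trans (nED _ _ _ e0 t0) (lerD h h').
Qed.

Lemma nEM I e t u v : 0 <= e -> 0 <= t -> nE I e t (u * v) <= nE I e t u * nE I e t v.
Proof.
move=> e0 t0; have n0 a := @nL_ge0 I e a e0.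
have M a b := @nLM I e a b e0; have Ms a b : nL I e (a * sg b) <= nL I e a * nL I e b.
  by rewrite -[nL I e b]nL_sg.
have D a b x y : nL I e a <= x -> nL I e b <= y -> nL I e (a + b) <= x + y.
  by move=> ha hb; apply: le_trans (nLD I a b e0) (lerD ha hb).
have B a b x y : nL I e a <= x -> nL I e b <= y -> nL I e (a - b) <= x + y.
  by move=> ha hb; apply: le_trans (nLB I a b e0) (lerD ha hb).
have h0 := M (c0 u) (c0 v).
have hp := D _ _ _ _ (M (c0 u) (cp v)) (Ms (cp u) (c0 v)).
have hm := D _ _ _ _ (M (c0 u) (cm v)) (Ms (cm u) (c0 v)).
have hpm := D _ _ _ _ (B _ _ _ _ (D _ _ _ _ (M (c0 u) (cpm v)) (Ms (cp u) (cm v))) (Ms (cm u) (cp v))) (M (cpm u) (c0 v)).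
rewrite /nE; apply: le_trans (lerD (lerD h0 (ler_wpM2l t0 (lerD hp hm))) (ler_wpM2l (exprn_ge0 2 t0) hpm)) _.
move: (n0 (c0 u)) (n0 (cp u)) (n0 (cm u)) (n0 (cpm u)) (n0 (c0 v)) (n0 (cp v)) (n0 (cm v)) (n0 (cpm v)).
move: (nL I e (c0 u)) (nL I e (cp u)) (nL I e (cm u)) (nL I e (cpm u)) => a p m q.
move: (nL I e (c0 v)) (nL I e (cp v)) (nL I e (cm v)) (nL I e (cpm v)) => a' p' m' q'.
move=> ha hp' hm' hq ha' hp'' hm'' hq'; rewrite -subr_ge0.
rewrite (_ : _ - _ = t ^+ 2 * (p * p' + m * m') + t ^+ 3 * ((p + m) * q' + q * (p' + m')) + t ^+ 4 * (q * q'));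
  last by ring.
by rewrite !(addr_ge0, mulr_ge0, exprn_ge0).
Qed.

Lemma nE1 I e t : nE I e t 1 = 1.
Proof. by rewrite /nE /= !nL0 nL1 addr0 !mulr0 !addr0. Qed.

Definition Q I e t r M f : R := \sum_(n < M) nE I e t (f n) * r ^+ n.

Section QNorm.
Variables (I : {fset nat}) (e t r : R).
Hypotheses (e0 : 0 <= e) (t0 : 0 <= t) (r0 : 0 <= r).

Lemma Q_ge0 M f : 0 <= Q I e t r M f.
Proof. by apply: sumr_ge0 => n _; rewrite mulr_ge0 ?nE_ge0 ?exprn_ge0. Qed.
Lemma Q0 M : Q I e t r M 0 = 0.
Proof. by apply: big1 => n _; rewrite nE0 mul0r. Qed.
Lemma QN M f : Q I e t r M (- f) = Q I e t r M f.
Proof. by apply: eq_bigr => n _; rewrite nEN. Qed.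
Lemma QD M f g : Q I e t r M (f + g) <= Q I e t r M f + Q I e t r M g.
Proof.
rewrite /Q -big_split /=; apply: ler_sum => n _; rewrite -mulrDl.
by rewrite ler_wpM2r ?exprn_ge0 ?nED.
Qed.
Lemma QB M f g : Q I e t r M (f - g) <= Q I e t r M f + Q I e t r M g.
Proof. by rewrite -(QN _ g) QD. Qed.
Lemma Q_sum M (T : Type) (s : seq T) P (F : T -> S) :
  Q I e t r M (\sum_(k <- s | P k) F k) <= \sum_(k <- s | P k) Q I e t r M (F k).
Proof.
elim/big_ind2: _ => [|u u' v v' h h'|//]; first by rewrite Q0.
exact: le_trans (QD _ _ _) (lerD h h').
Qed.
Lemma Q_mono M M' f : (M <= M')%N -> Q I e t r M f <= Q I e t r M' f.
Proof.
move=> MM; rewrite /Q -!(big_mkord xpredT (fun n => nE I e t (f n) * r ^+ n)).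
rewrite (@big_cat_nat _ _ _ M 0 M') //= lerDl.
by apply: sumr_ge0 => n _; rewrite mulr_ge0 ?nE_ge0 ?exprn_ge0.
Qed.

Lemma QM M f g : Q I e t r M (f * g) <= Q I e t r M f * Q I e t r M g.
Proof.
pose F i j := nE I e t (f i) * r ^+ i * (nE I e t (g j) * r ^+ j).
have F0 i j : 0 <= F i j by rewrite !mulr_ge0 ?nE_ge0 ?exprn_ge0.
apply: (@le_trans _ _ (\sum_(k < M) \sum_(i < k.+1) F i (k - i)%N)).
  apply: ler_sum => k _; rewrite sserME.
  apply: le_trans (ler_wpM2r (exprn_ge0 _ r0) (nE_sum _ _ _ _ e0 t0)) _.
  rewrite mulr_suml; apply: ler_sum => i _.
  rewrite -[X in r ^+ X](@subnKC i) 1?exprD; last by rewrite -ltnS.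
  rewrite /F mulrACA ler_wpM2r ?mulr_ge0 ?exprn_ge0 ?nEM //.
rewrite triangle_sum /Q mulr_suml; apply: ler_sum => i _; rewrite mulr_sumr.
rewrite -!(big_mkord xpredT (F i)) (@big_cat_nat _ _ _ (M - i) 0 M) //=; last exact: leq_subr.
by rewrite lerDl; apply: sumr_ge0 => j _.
Qed.

Lemma Q1 M : Q I e t r M 1 <= 1.
Proof.
case: M => [|M]; first by rewrite /Q big_ord0.
rewrite /Q big_ord_recl sser1E nE1 expr0 mulr1 big1 ?addr0 // => n _.
by rewrite sser1E /= nE0 mul0r.
Qed.

Lemma QX M f n : Q I e t r M (f ^+ n) <= Q I e t r M f ^+ n.
Proof.
elim: n => [|n ih]; first by rewrite !expr0 Q1.
rewrite !exprS; apply: le_trans (QM _ _ _) _; apply: ler_wpM2l => //; exact: Q_ge0.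
Qed.

Lemma Q_const M (a : L) f : Q I e t r M (constS a * f) <= nL I e a * Q I e t r M f.
Proof.
rewrite /Q mulr_sumr; apply: ler_sum => n _; rewrite constSE mulrA.
rewrite ler_wpM2r ?exprn_ge0 //; apply: le_trans (nEM _ _ _ e0 t0) _.
by rewrite {1}/nE /= !nL0 addr0 !mulr0 !addr0.
Qed.

End QNorm.

Lemma nE_le I e e' t t' u : 0 <= e -> e <= e' -> 0 <= t -> t <= t' -> nE I e t u <= nE I e' t' u.
Proof.
move=> e0 ee t0 tt; have n0 a := @nL_ge0 I e a e0; have hn a := @nL_le I e e' a e0 ee.
rewrite /nE !lerD // ler_pM ?exprn_ge0 ?addr_ge0 ?lerD //.
by apply: lerXn2r; rewrite ?nnegrE // (le_trans t0).
Qed.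

Lemma Q_le I e e' t t' r r' M f : 0 <= e -> e <= e' -> 0 <= t -> t <= t' -> 0 <= r -> r <= r' ->
  Q I e t r M f <= Q I e' t' r' M f.
Proof.
move=> e0 ee t0 tt r0 rr; apply: ler_sum => n _; rewrite ler_pM ?nE_ge0 ?exprn_ge0 ?nE_le //.
by apply: lerXn2r; rewrite ?nnegrE // (le_trans r0).
Qed.

Lemma nL_split0 I e a : 0 <= e -> e <= 1 -> nL I e a <= nL fset0 1 a + e * nL I 1 a.
Proof.
move=> e0 e1; apply: le_trans (nL_split I a e0 e1) _; rewrite lerD2r.
by have := nL_coef1 fset0 a.
Qed.

Lemma nE_split I e u : 0 <= e -> e <= 1 -> nE I e 1 u <= nE fset0 1 1 u + e * nE I 1 1 u.
Proof.
move=> e0 e1; rewrite /nE expr1n !mul1r.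
rewrite [leRHS](_ : _ = (nL fset0 1 (c0 u) + e * nL I 1 (c0 u))
  + ((nL fset0 1 (cp u) + e * nL I 1 (cp u)) + (nL fset0 1 (cm u) + e * nL I 1 (cm u)))
  + (nL fset0 1 (cpm u) + e * nL I 1 (cpm u))); last by ring.
by rewrite !lerD ?nL_split0.
Qed.

Lemma Q_split I e r M f : 0 <= e -> e <= 1 -> 0 <= r ->
  Q I e 1 r M f <= Q fset0 1 1 r M f + e * Q I 1 1 r M f.
Proof.
move=> e0 e1 r0; rewrite /Q mulr_sumr -big_split /=; apply: ler_sum => n _.
by rewrite mulrA -mulrDl ler_wpM2r ?exprn_ge0 ?nE_split.
Qed.

Lemma nE_rescale I e l u : 0 < e -> e <= 1 -> 0 < l -> l <= 1 ->
  nE I 1 1 u * (e ^+ #|` I| * l ^+ 2) <= nE I e l u.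
Proof.
move=> e0 e1 l0 l1; have h a := nL_rescale I a e0 e1; have n0 a := @nL_ge0 I e a (ltW e0).
have h1 a : nL I 1 a * (e ^+ #|` I| * l ^+ 2) <= nL I e a * l ^+ 2.
  by rewrite mulrA ler_wpM2r ?h // exprn_ge0 // ltW.
have ll : l ^+ 2 <= l by rewrite expr2 -[leRHS]mulr1 ler_wpM2l // ltW.
have l2 : l ^+ 2 <= 1 by rewrite exprn_ile1 // ltW.
rewrite /nE expr1n !mul1r !mulrDl !mulrDr !lerD //; apply: le_trans (h1 _) _.
- by rewrite -[leRHS]mulr1 ler_wpM2l.
- by rewrite mulrC ler_wpM2r.
- by rewrite mulrC ler_wpM2r.
- by rewrite mulrC.
Qed.

Lemma Q_rescale I e l r M f : 0 < e -> e <= 1 -> 0 < l -> l <= 1 -> 0 <= r ->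
  Q I 1 1 r M f * (e ^+ #|` I| * l ^+ 2) <= Q I e l r M f.
Proof.
move=> e0 e1 l0 l1 r0; rewrite /Q mulr_suml; apply: ler_sum => n _.
by rewrite mulrAC ler_wpM2r ?exprn_ge0 ?nE_rescale.
Qed.

(** Scaling x by l^2 and phi+, phi- by l multiplies a monomial of weight v by l^v, and l <= 1. *)
Lemma Q_wt I e l r M (w : nat) f : 0 <= e -> 0 <= l -> l <= 1 -> 0 <= r -> wt w f ->
  Q I e l (l ^+ 2 * r) M f <= l ^+ w * Q I e 1 r M f.
Proof.
move=> e0 l0 l1 r0 hf; rewrite /Q mulr_sumr; apply: ler_sum => n _.
rewrite exprMn !mulrA ler_wpM2r ?exprn_ge0 // -exprM.
have hl i j : (i <= j)%N -> l ^+ j <= l ^+ i.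
  by move=> ij; rewrite -(subnK ij) exprD -[leRHS]mul1r ler_wpM2r ?exprn_ge0 ?exprn_ile1.
have [h0 h1 h1' h2] := hf n; have n0 a := @nL_ge0 I e a e0.
have k0 : nL I e (c0 (f n)) * l ^+ (2 * n) <= l ^+ w * nL I e (c0 (f n)).
  case: (ltnP 0 (w - 2 * n)) => [/h0 ->|h]; first by rewrite nL0 mul0r mulr0.
  by rewrite mulrC ler_wpM2r // hl //; lia.
have k1 a : ((1 < w - 2 * n)%N -> a = 0) -> l * nL I e a * l ^+ (2 * n) <= l ^+ w * nL I e a.
  move=> ha; case: (ltnP 1 (w - 2 * n)) => [/ha ->|h]; first by rewrite nL0 mulr0 mul0r mulr0.
  by rewrite mulrAC -exprS ler_wpM2r // hl //; lia.
have k2 a : ((2 < w - 2 * n)%N -> a = 0) -> l ^+ 2 * nL I e a * l ^+ (2 * n) <= l ^+ w * nL I e a.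
  move=> ha; case: (ltnP 2 (w - 2 * n)) => [/ha ->|h]; first by rewrite nL0 mulr0 mul0r mulr0.
  by rewrite mulrAC -exprD ler_wpM2r // hl //; lia.
rewrite /nE expr1n !mul1r !mulrDl !mulrDr !mulrDl.
by rewrite !lerD ?k0 ?k1 ?k2.
Qed.

(** The bound may depend on [I], the radius may not. Fixing the radii of the zeta's and phi's to be
    1 is harmless: by [Q_rescale] other positive radii at most 1 only change the bound. *)
Definition conv (r : R) f : Prop := forall I, exists B, forall M, Q I 1 1 r M f <= B.

Lemma convW r r' f : 0 <= r' -> r' <= r -> conv r f -> conv r' f.
Proof.
move=> r0 rr h I; have [B hB] := h I; exists B => M; apply: le_trans (hB M).
exact: Q_le.
Qed.

Lemma conv_unscale r f : (forall I, exists e l B, [/\ 0 < e, e <= 1, 0 < l, l <= 1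
  & forall M, Q I e l r M f <= B]) -> 0 <= r -> conv r f.
Proof.
move=> h r0 I; have [e [l [B [e0 e1 l0 l1 hB]]]] := h I.
have p0 : 0 < e ^+ #|` I| * l ^+ 2 by rewrite mulr_gt0 ?exprn_gt0.
exists (B / (e ^+ #|` I| * l ^+ 2)) => M; rewrite ler_pdivlMr //.
exact: le_trans (Q_rescale I M f e0 e1 l0 l1 r0) (hB M).
Qed.

(** Here the bound no longer depends on [I]; the dependence is moved into e. The bodies alone are
    bounded by B0, and with e = 1 / (B + 1) all soul terms together add at most 1. *)
Lemma conv_small r f : 0 <= r -> conv r f -> exists C, 0 <= C /\ forall I, exists e,
  [/\ 0 < e, e <= 1 & forall M, Q I e 1 r M f <= C].
Proof.
move=> r0 h; have [B0 hB0] := h fset0; exists (B0 + 1); split.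
  by rewrite addr_ge0 //; apply: le_trans (hB0 0%N); exact: Q_ge0.
move=> I; have [B hB] := h I; have B0' : 0 <= B by apply: le_trans (hB 0%N); exact: Q_ge0.
have p : 0 < B + 1 by rewrite ltr_wpDl.
exists (B + 1)^-1; split; first by rewrite invr_gt0.
  by rewrite invf_le1 // lerDr.
move=> M; apply: le_trans (Q_split _ _ _ _ _ _) _; rewrite ?invr_ge0 ?(ltW p) //.
  by rewrite invf_le1 // lerDr.
apply: lerD; first exact: hB0.
rewrite mulrC ler_pdivrMr // mul1r; apply: le_trans (hB M) _; by rewrite lerDl.
Qed.

(* The radius parameter l does not depend on I: this is what makes the domains of convergence open. *)
Lemma conv_shrink r f s : 0 < r -> conv r f -> wt 1 f -> 0 < s -> exists l, [/\ 0 < l, l <= 1 &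
  forall l', 0 < l' -> l' <= l -> forall I, exists e, [/\ 0 < e, e <= 1
    & forall e' M, 0 < e' -> e' <= e -> Q I e' l' (l' ^+ 2 * r) M f <= s]].
Proof.
move=> r0 h hf s0; have [B [B0 hB]] := conv_small (ltW r0) h.
have p : 0 < B + 1 by rewrite ltr_wpDl.
exists (Num.min 1 (s / (B + 1))); rewrite lt_min ltr01 divr_gt0 // ge_min lexx; split=> // l l0.
rewrite le_min => /andP[l1 lB] I; have [e [e0 e1 he]] := hB I; exists e; split=> // e' M e'0 ee.
apply: le_trans (Q_wt _ _ _ _ _ _ hf) _; rewrite ?(ltW e'0) ?(ltW l0) ?(ltW r0) // expr1.
apply: (@le_trans _ _ (s / (B + 1) * (B + 1))); last by rewrite divfK // gt_eqF.
apply: ler_pM => //; [exact: ltW|exact: Q_ge0 (ltW e'0) ler01 (ltW r0) _ _|].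
apply: (@le_trans _ _ B); last by rewrite lerDl.
by apply: le_trans (he M); apply: Q_le; rewrite ?(ltW e'0) ?(ltW r0).
Qed.

Definition tri_wt (G : triple R) := [/\ wt 2 G.1.1, wt 1 G.1.2 & wt 1 G.2].

Lemma Q_coef_eq I e t r M f g : (forall n, (n < M)%N -> f n = g n) -> Q I e t r M f = Q I e t r M g.
Proof. by move=> h; apply: eq_bigr => n _; rewrite h. Qed.

Section TripleNorm.
Variables (I : {fset nat}) (e l t s : R) (G : triple R).
Hypotheses (e0 : 0 <= e) (l0 : 0 <= l) (t0 : 0 <= t) (s0 : 0 <= s).
Hypothesis hX : forall M, Q I e l t M G.1.1 <= s.
Variable d : R.
Hypothesis hP : forall M, Q I e l t M G.1.2 <= d.
Hypothesis hM : forall M, Q I e l t M G.2 <= d.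

Lemma Q_cterms f n M : Q I e l t M (cterms f G n) <= nE I e d (f n) * s ^+ n.
Proof.
have d0 : 0 <= d by apply: le_trans (hP 0); exact: Q_ge0.
have n0 a := @nL_ge0 I e a e0; have q0 g := Q_ge0 I e0 l0 t0 M g.
have qX : Q I e l t M (G.1.1 ^+ n) <= s ^+ n.
  apply: le_trans (QX _ e0 l0 t0 _ _ _) _; apply: lerXn2r => //; by rewrite nnegrE.
have h a : Q I e l t M (constS a * G.1.1 ^+ n) <= nL I e a * s ^+ n.
  by apply: le_trans (Q_const I e0 l0 t0 M a _) _; rewrite ler_wpM2l.
have D := QD I e0 l0 t0 M; have MM := QM I e0 l0 t0 M.
rewrite /nE !mulrDl mulrDr !mulrDl; apply: le_trans (D _ _) (lerD _ _); last first.
  apply: le_trans (MM _ _) _; rewrite expr2 -!mulrA mulrC mulrA; apply: ler_pM => //.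
  apply: le_trans (MM _ _) _; rewrite mulrC; apply: ler_pM => //.
rewrite addrA; apply: le_trans (D _ _) (lerD _ _); last first.
  by apply: le_trans (MM _ _) _; rewrite -mulrA mulrC; apply: ler_pM.
apply: le_trans (D _ _) (lerD _ _); first exact: h.
by apply: le_trans (MM _ _) _; rewrite -mulrA mulrC; apply: ler_pM.
Qed.

Lemma Q_scomp f M : wt 2 G.1.1 -> exists N, Q I e l t M (scomp f G) <= Q I e d s N f.
Proof.
move=> wX; exists M.+1; have e1 : Q I e l t M (scomp f G) = Q I e l t M (\sum_(k < M.+1) cterms f G k).
  by apply: Q_coef_eq => n nM; rewrite (@scompE _ f G M.+1).
rewrite e1; apply: le_trans (Q_sum _ e0 l0 t0 _ _ _ _) _.
by apply: ler_sum => n _; exact: Q_cterms.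
Qed.

End TripleNorm.

Definition conv3 r (G : triple R) := [/\ conv r G.1.1, conv r G.1.2 & conv r G.2].

Lemma conv_shrink3 r G s d : 0 < r -> conv3 r G -> tri_wt G -> 0 < s -> 0 < d ->
  exists l, [/\ 0 < l, l <= 1 &
  forall l', 0 < l' -> l' <= l -> forall I, exists e, [/\ 0 < e, e <= 1
    & forall e', 0 < e' -> e' <= e -> [/\ forall M, Q I e' l' (l' ^+ 2 * r) M G.1.1 <= s,
      forall M, Q I e' l' (l' ^+ 2 * r) M G.1.2 <= d & forall M, Q I e' l' (l' ^+ 2 * r) M G.2 <= d]]].
Proof.
move=> r0 [c1 c2 c3] [w1 w2 w3] s0 d0.
have [l1 [p1 q1 h1]] := conv_shrink r0 c1 (wtW (isT : (1 <= 2)%N) w1) s0.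
have [l2 [p2 q2 h2]] := conv_shrink r0 c2 w2 d0.
have [l3 [p3 q3 h3]] := conv_shrink r0 c3 w3 d0.
exists (Num.min l1 (Num.min l2 l3)); rewrite !lt_min p1 p2 p3 !ge_min q1; split=> // l l0.
rewrite !le_min => /and3P[k1 k2 k3] I.
have [e1 [u1 v1 g1]] := h1 l l0 k1 I; have [e2 [u2 v2 g2]] := h2 l l0 k2 I.
have [e3 [u3 v3 g3]] := h3 l l0 k3 I.
exists (Num.min e1 (Num.min e2 e3)); rewrite !lt_min u1 u2 u3 !ge_min v1; split=> // e e0.
by rewrite !le_min => /and3P[m1 m2 m3]; split=> M; [exact: g1|exact: g2|exact: g3].
Qed.

(** The source is shrunk until G maps it into |x| <= r, |phi+-| <= 1; the composite is then
    dominated by f on that region. *)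
Lemma conv_scomp r r' f G : 0 < r -> 0 < r' -> conv r f -> conv3 r' G -> tri_wt G ->
  exists2 r'', 0 < r'' & conv r'' (scomp f G).
Proof.
move=> r0 r'0 cf cG wG; have [l [l0 l1 h]] := conv_shrink3 r'0 cG wG r0 ltr01.
exists (l ^+ 2 * r'); first by rewrite mulr_gt0 ?exprn_gt0.
apply: conv_unscale => [I|]; last by rewrite mulr_ge0 ?exprn_ge0 ?ltW.
have [e [e0 e1 he]] := h l l0 (lexx _) I; have [hX hP hM] := he e e0 (lexx _).
have [B hB] := cf I; exists e, l, B; split=> // M.
have [wX _ _] := wG.
have [|N hN] := Q_scomp (ltW e0) (ltW l0) _ (ltW r0) hX hP hM f M wX.
  by rewrite mulr_ge0 ?exprn_ge0 ?ltW.
apply: le_trans hN _; apply: le_trans (hB N); apply: Q_le => //; exact: ltW.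
Qed.

End Norms.

(** * Values of convergent series *)

Section Evaluation.
Variable R : realType.
Local Notation C := (R[i]).
Local Notation L := (Lam R).
Local Notation sg := (@lam_sign R).
Local Notation S := (sser R).
Local Notation spoint := (spoint R).
Implicit Types (z w : C) (a b : L) (I J : {fset nat}) (e l t r s : R) (f g : S) (p q : spoint).

Definition odd_eval p (u : sext R) : L :=
  c0 u + cp u * p.1.2 + cm u * p.2 + cpm u * p.1.2 * p.2.

Lemma odd_sqr0 (th : Lam1 R) : (th : L) * th = 0.
Proof.
have h : (th : L) * th = - ((th : L) * th).
  by rewrite {1}(@lam_odd_comm _ (th : L) th (lam_sign1_odd th)) lam_sign1_odd mulNr.
by apply: (@natmul_eq0 _ _ 1); rewrite mulr2n {1}h addNr.
Qed.

Lemma esD p u v : odd_eval p (u + v) = odd_eval p u + odd_eval p v.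
Proof. by rewrite /odd_eval /= !mulrDl !addrA [LHS](ACl (1*3*5*7*2*4*6*8)). Qed.

(** Odd elements of Lam obey the same sign rules as phi+ and phi- and square to 0, so substituting
    them is multiplicative. *)
Lemma esM p u v : odd_eval p (u * v) = odd_eval p u * odd_eval p v.
Proof.
rewrite /odd_eval /=; case: p => [[_ al] be] /=.
have A b y : y * (al : L) * b = y * sg b * al.
  by rewrite -mulrA (lam_odd_comm _ (lam_sign1_odd al)) mulrA.
have B b y : y * (be : L) * b = y * sg b * be.
  by rewrite -mulrA (lam_odd_comm _ (lam_sign1_odd be)) mulrA.
have AA y : y * (al : L) * al = 0 by rewrite -mulrA odd_sqr0 mulr0.
have BB y : y * (be : L) * be = 0 by rewrite -mulrA odd_sqr0 mulr0.
have BA y : y * (be : L) * al = - (y * al * be).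
  by rewrite -mulrA (lam_odd_comm _ (lam_sign1_odd be)) lam_sign1_odd mulNr mulrN mulrA.
rewrite !(mulrDl, mulrDr) !mulrA !mulNr.
rewrite !(A (c0 v), A (cp v), A (cm v), A (cpm v), B (c0 v), B (cp v), B (cm v), B (cpm v)).
rewrite !(A (sg (c0 v)), A (sg (cp v)), A (sg (cm v)), A (sg (cpm v))) !lam_signK.
rewrite !(BA, AA, BB, mul0r, addr0, oppr0, mulNr).
by rewrite !addrA [LHS](ACl (1*2*4*6*3*7*5*8*9)).
Qed.

Lemma es_sum p (T : Type) (r : seq T) P (F : T -> sext R) :
  odd_eval p (\sum_(k <- r | P k) F k) = \sum_(k <- r | P k) odd_eval p (F k).
Proof.
apply: (big_morph (odd_eval p) (esD p)).
by rewrite /odd_eval /= !mul0r !addr0.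
Qed.

Definition partial_eval N f p : L := \sum_(n < N) odd_eval p (f n) * (p.1.1 : L) ^+ n.

Lemma pevD N f g p : partial_eval N (f + g) p = partial_eval N f p + partial_eval N g p.
Proof. by rewrite /partial_eval -big_split; apply: eq_bigr => n _; rewrite /= -mulrDl -esD. Qed.

Lemma pev_sum N p (T : Type) (s : seq T) P (F : T -> S) :
  partial_eval N (\sum_(k <- s | P k) F k) p = \sum_(k <- s | P k) partial_eval N (F k) p.
Proof.
apply: (big_morph (fun f => partial_eval N f p) (fun f g => pevD N f g p)).
by apply: big1 => n _; rewrite /odd_eval /= !mul0r !addr0 mul0r.
Qed.

Lemma pevN N f p : partial_eval N (- f) p = - partial_eval N f p.
Proof.
apply: (addrI (partial_eval N f p)); rewrite -pevD !subrr.
by apply: big1 => n _; rewrite /odd_eval /= !mul0r !addr0 mul0r.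
Qed.

Lemma pev_eq N f g p : (forall n, (n < N)%N -> f n = g n) -> partial_eval N f p = partial_eval N g p.
Proof. by move=> h; apply: eq_bigr => n _; rewrite h. Qed.

Definition limL I e (u : nat -> L) v := forall d, 0 < d -> exists N0, forall N, (N0 <= N)%N ->
  nL I e (u N - v) <= d.

Section Limits.
Variables (I : {fset nat}) (e : R).
Hypothesis e0 : 0 <= e.
Local Notation lim := (limL I e).

Lemma limL_eventually (u u' : nat -> L) v N1 : (forall N, (N1 <= N)%N -> u N = u' N) ->
  lim u v -> lim u' v.
Proof.
move=> h hu d d0; have [N0 hN0] := hu d d0; exists (maxn N0 N1) => N.
by rewrite geq_max => /andP[h1 h2]; rewrite -h // hN0.
Qed.

Lemma limL_const v : lim (fun=> v) v.
Proof. by move=> d d0; exists 0%N => N _; rewrite subrr nL0 ltW. Qed.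

Lemma limLD u u' v v' : lim u v -> lim u' v' -> lim (fun N => u N + u' N) (v + v').
Proof.
move=> h h' d d0; have d2 : 0 < d / 2 by rewrite divr_gt0.
have [N0 hN0] := h _ d2; have [N1 hN1] := h' _ d2; exists (maxn N0 N1) => N.
rewrite geq_max => /andP[h1 h2]; rewrite opprD addrACA; apply: le_trans (nLD _ _ _ e0) _.
by rewrite [d]splitr lerD // ?hN0 ?hN1.
Qed.

Lemma limLN u v : lim u v -> lim (fun N => - u N) (- v).
Proof. by move=> h d d0; have [N0 hN0] := h d d0; exists N0 => N /hN0; rewrite -opprD nLN. Qed.

Lemma limL_sum (T : Type) (s : seq T) (F : T -> nat -> L) (v : T -> L) :
  (forall k, lim (F k) (v k)) -> lim (fun N => \sum_(k <- s) F k N) (\sum_(k <- s) v k).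
Proof.
move=> h; elim: s => [|k s ih].
  by rewrite big_nil; apply: (limL_eventually (u := fun=> 0) (N1 := 0)) (limL_const 0) => N _; rewrite big_nil.
rewrite big_cons; apply: (limL_eventually (N1 := 0)) (limLD (h k) ih) => N _.
by rewrite big_cons.
Qed.

Lemma limL_bound u v B : lim u v -> (forall N, nL I e (u N) <= B) -> nL I e v <= B.
Proof.
move=> h hB; apply/ler_addgt0Pr => d d0; have [N0 hN0] := h d d0.
rewrite -[v](subrK (u N0)) addrC; apply: le_trans (nLD _ _ _ e0) _.
by rewrite lerD // -nLN opprB hN0.
Qed.

Lemma limL_equiv (u w : nat -> L) : lim (fun N => u N - w N) 0 -> forall v, lim u v <-> lim w v.
Proof.
move=> h v; split=> hv.
  have := limLD hv (limLN h); rewrite oppr0 addr0; apply: (limL_eventually (N1 := 0)) => N _.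
  by rewrite opprB addrC subrK.
have := limLD h hv; rewrite add0r; apply: (limL_eventually (N1 := 0)) => N _.
by rewrite subrK.
Qed.

End Limits.

Lemma limL_radius I e u v : 0 < e -> e <= 1 -> limL I e u v <-> limL I 1 u v.
Proof.
move=> e0 e1; split=> h d d0.
  have p : 0 < e ^+ #|` I| by rewrite exprn_gt0.
  have [|N0 hN0] := h (d * e ^+ #|` I|); first by rewrite mulr_gt0.
  exists N0 => N /hN0; move/(le_trans (nL_rescale I _ e0 e1)).
  by rewrite ler_pM2r.
have [N0 hN0] := h d d0; exists N0 => N /hN0; apply: le_trans; apply: nL_le => //; exact: ltW.
Qed.

Lemma limL_unique u v v' : (forall I, limL I 1 u v) -> (forall I, limL I 1 u v') -> v = v'.
Proof.
move=> h h'; apply: lamP => I; apply/eqP; rewrite -subr_eq0; apply/eqP/cn_eq0.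
apply/eqP; rewrite eq_le cn_ge0 andbT; apply/ler_addgt0Pr => d d0; rewrite add0r.
have d2 : 0 < d / 2 by rewrite divr_gt0.
have [N0 hN0] := h I _ d2; have [N1 hN1] := h' I _ d2; set N := maxn N0 N1.
have k0 := hN0 N (leq_maxl _ _); have k1 := hN1 N (leq_maxr _ _).
rewrite -[v I - v' I]/((v - v') I); apply: le_trans (nL_coef1 _ _) _.
have -> : v - v' = (u N - v') - (u N - v) by rewrite opprB [RHS]addrC subrKA.
by apply: le_trans (nLB _ _ _ ler01) _; rewrite [d]splitr lerD.
Qed.

Lemma mono_cauchy (u : nat -> R) B : (forall m n, (m <= n)%N -> u m <= u n) -> (forall n, u n <= B) ->
  forall d, 0 < d -> exists m, forall N, (m <= N)%N -> u N - u m <= d.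
Proof.
move=> mono hB d d0; have hs : has_sup (range u).
  by split; [exists (u 0%N), 0%N|exists B => _ [n _ <-]].
have [_ [m _ <-] hm] := sup_adherent d0 hs; exists m => N mN.
rewrite lerBlDr addrC -lerBlDr; apply: le_trans (ltW hm).
by rewrite lerD2r; apply: ub_le_sup; [case: hs|exists N].
Qed.

Section PointNorm.
Variables (I : {fset nat}) (e l t : R) (p : spoint).
Hypotheses (e0 : 0 <= e) (l0 : 0 <= l) (t0 : 0 <= t).
Hypotheses (hz : nL I e p.1.1 <= t) (hp : nL I e p.1.2 <= l) (hm : nL I e p.2 <= l).

Lemma nL_es u : nL I e (odd_eval p u) <= nE I e l u.
Proof.
have n0 a := @nL_ge0 _ I e a e0.
have M a b y : nL I e b <= y -> nL I e (a * b) <= y * nL I e a.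
  by move=> hb; apply: le_trans (nLM _ _ _ e0) _; rewrite mulrC ler_wpM2r.
rewrite /odd_eval /nE mulrDr addrA; apply: le_trans (nLD _ _ _ e0) (lerD _ _); last first.
  apply: le_trans (M _ _ _ hm) _; rewrite expr2 -mulrA; apply: ler_wpM2l => //; exact: M.
apply: le_trans (nLD _ _ _ e0) (lerD _ _); last exact: M.
by apply: le_trans (nLD _ _ _ e0) (lerD _ _); last exact: M.
Qed.

Lemma nL_term f n : nL I e (odd_eval p (f n) * (p.1.1 : L) ^+ n) <= nE I e l (f n) * t ^+ n.
Proof.
apply: le_trans (nLM _ _ _ e0) _; apply: ler_pM => //; try exact: nL_ge0; first exact: nL_es.
by apply: le_trans (nLX _ _ _ e0) _; apply: lerXn2r => //; rewrite nnegrE ?nL_ge0.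
Qed.

Lemma nL_pev N f : nL I e (partial_eval N f p) <= Q I e l t N f.
Proof. by apply: le_trans (nL_sum _ _ _ _ e0) _; apply: ler_sum => n _; exact: nL_term. Qed.

Lemma nL_pev_diff m N f : (m <= N)%N ->
  nL I e (partial_eval N f p - partial_eval m f p) <= Q I e l t N f - Q I e l t m f.
Proof.
move=> mN; rewrite /partial_eval /Q.
rewrite -!(big_mkord xpredT (fun n => odd_eval p (f n) * (p.1.1 : L) ^+ n)).
rewrite -!(big_mkord xpredT (fun n => nE I e l (f n) * t ^+ n)).
rewrite !(@big_cat_nat _ _ _ m 0 N) //= ![_ + _ - _]addrAC !subrr !add0r.
by apply: le_trans (nL_sum _ _ _ _ e0) _; apply: ler_sum => n _; exact: nL_term.
Qed.

(** The pairs in the product of partial sums that are missing from the partial sum of the product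
    have i + j >= N >= 2 m, hence lie outside the square of side m. *)
Lemma nL_pevM m N f g : (m + m <= N)%N ->
  nL I e (partial_eval N f p * partial_eval N g p - partial_eval N (f * g) p)
    <= Q I e l t N f * Q I e l t N g - Q I e l t m f * Q I e l t m g.
Proof.
move=> mN.
pose F i j := odd_eval p (f i) * (p.1.1 : L) ^+ i * (odd_eval p (g j) * (p.1.1 : L) ^+ j).
pose G i j := nE I e l (f i) * t ^+ i * (nE I e l (g j) * t ^+ j).
have G0 i j : 0 <= G i j by rewrite !mulr_ge0 ?nE_ge0 ?exprn_ge0.
have FG i j : nL I e (F i j) <= G i j.
  by apply: le_trans (nLM _ _ _ e0) _; apply: ler_pM; rewrite ?nL_ge0 ?nL_term.
have -> : partial_eval N (f * g) p = \sum_(i < N) \sum_(j < N - i) F i j.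
  rewrite -triangle_sum; apply: eq_bigr => k _; rewrite sserME es_sum mulr_suml.
  apply: eq_bigr => i _; rewrite esM /F -!mulrA; congr (_ * _).
  rewrite -[in RHS](lam0_valX _ i) (lam0_commC (_ ^+ i)) -mulrA lam0_valX -exprD subnK //.
  by rewrite -ltnS.
have prod (T : pzRingType) (u v : nat -> T) M : (\sum_(i < M) u i) * (\sum_(j < M) v j)
    = \sum_(i < M) \sum_(j < M) u i * v j.
  by rewrite mulr_suml; apply: eq_bigr => i _; rewrite mulr_sumr.
have split i (T : zmodType) (H : nat -> T) : (i < N)%N ->
    \sum_(j < N) H j - \sum_(j < N - i) H j = \sum_((N - i)%N <= j < N) H j.
  move=> iN; rewrite -!(big_mkord xpredT H) (@big_cat_nat _ _ _ (N - i) 0 N) //= ?leq_subr //.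
  by rewrite addrAC subrr add0r.
pose u i := odd_eval p (f i) * (p.1.1 : L) ^+ i; pose v i := odd_eval p (g i) * (p.1.1 : L) ^+ i.
rewrite (prod _ u v N) -sumrB; apply: le_trans (nL_sum _ _ _ _ e0) _.
apply: (@le_trans _ _ (\sum_(i < N) (\sum_(j < N) G i j - \sum_(j < N - i) G i j))).
  apply: ler_sum => i _; rewrite (split i _ (F i)) // (split i _ (G i)) //.
  by apply: le_trans (nL_sum _ _ _ _ e0) _; exact: ler_sum.
pose u' i := nE I e l (f i) * t ^+ i; pose v' i := nE I e l (g i) * t ^+ i.
rewrite sumrB (prod _ u' v' N) (prod _ u' v' m) lerD2l lerN2.
rewrite -!(big_mkord xpredT (fun i => \sum_(j < N - i) G i j)).
rewrite -(big_mkord xpredT (fun i => \sum_(j < m) G i j)).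
rewrite (@big_cat_nat _ _ _ m 0 N) //=; last by lia.
rewrite -[leLHS]addr0 lerD //; last by apply: sumr_ge0 => i _; exact: sumr_ge0.
rewrite big_nat_cond [leRHS]big_nat_cond; apply: ler_sum => i /andP[/andP[_ im] _].
rewrite -!(big_mkord xpredT (G i)) (@big_cat_nat _ _ _ m 0 (N - i)) //=; last by lia.
by rewrite lerDl sumr_ge0.
Qed.

Definition bounded f := exists B, forall M, Q I e l t M f <= B.

Lemma bounded_mul f g : bounded f -> bounded g -> bounded (f * g).
Proof.
move=> [B hB] [D hD]; exists (B * D) => M; apply: le_trans (QM I e0 l0 t0 M f g) _.
by apply: ler_pM; rewrite ?Q_ge0.
Qed.

Lemma bounded_const a : bounded (constS a).
Proof.
exists (nL I e a) => M; have := Q_const I e0 l0 t0 M a 1; rewrite mulr1 => h.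
apply: le_trans h _; rewrite -[leRHS]mulr1 ler_wpM2l ?nL_ge0 //; exact: Q1.
Qed.

Lemma lim_pevM f g a b : bounded f -> bounded g -> limL I e (fun N => partial_eval N f p) a ->
  limL I e (fun N => partial_eval N g p) b -> limL I e (fun N => partial_eval N (f * g) p) (a * b).
Proof.
move=> [B hB] [D hD] ha hb.
have B0 : 0 <= B by apply: le_trans (hB 0%N); exact: Q_ge0.
have D0 : 0 <= D by apply: le_trans (hD 0%N); exact: Q_ge0.
have qm M M' h : (M <= M')%N -> Q I e l t M h <= Q I e l t M' h by exact: Q_mono.
have q0 M h : 0 <= Q I e l t M h by exact: Q_ge0.
have cau := @mono_cauchy (fun M => Q I e l t M f * Q I e l t M g) (B * D).
move=> d d0; have d3 : 0 < d / 3%:R by rewrite divr_gt0.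
have [||m hQ] := cau _ _ _ d3; first by move=> M M' MM; apply: ler_pM; rewrite ?qm.
  by move=> M; apply: ler_pM.
have p1 : 0 < d / 3%:R / (D + 1) by rewrite divr_gt0 // ltr_wpDl.
have p2 : 0 < d / 3%:R / (nL I e a + 1) by rewrite divr_gt0 // ltr_wpDl // nL_ge0.
have [N1 h1] := ha _ p1; have [N2 h2] := hb _ p2.
exists (maxn (m + m) (maxn N1 N2)) => N; rewrite !geq_max => /and3P[mN n1 n2].
have -> : partial_eval N (f * g) p - a * b = - (partial_eval N f p * partial_eval N g p - partial_eval N (f * g) p)
    + ((partial_eval N f p - a) * partial_eval N g p + a * (partial_eval N g p - b)).
  by rewrite mulrBl mulrBr subrKA opprB subrKA.
apply: le_trans (nLD _ _ _ e0) _; rewrite nLN.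
have -> : d = d / 3%:R + (d / 3%:R + d / 3%:R).
  by rewrite -!mulrDl -[X in X + (X + X)]mulr1 -!mulrDr mulrC; field.
apply: lerD; first exact: le_trans (nL_pevM f g mN) (hQ N (leq_trans (leq_addr m m) mN)).
apply: le_trans (nLD _ _ _ e0) _; apply: lerD; apply: le_trans (nLM _ _ _ e0) _.
  apply: (@le_trans _ _ (d / 3%:R / (D + 1) * (D + 1))); last by rewrite divfK // gt_eqF // ltr_wpDl.
  apply: ler_pM; rewrite ?nL_ge0 ?h1 //; apply: le_trans (nL_pev _ _) _; apply: le_trans (hD N) _.
  by rewrite lerDl.
rewrite mulrC; apply: (@le_trans _ _ (d / 3%:R / (nL I e a + 1) * (nL I e a + 1))).
  by apply: ler_pM; rewrite ?nL_ge0 ?h2 // lerDl.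
by rewrite divfK // gt_eqF // ltr_wpDl // nL_ge0.
Qed.

Lemma lim_pev_const a : limL I e (fun N => partial_eval N (constS a) p) a.
Proof.
apply: (limL_eventually (u := fun=> a) (N1 := 1)) (limL_const I e a) => -[//|N] _.
rewrite /partial_eval big_ord_recl big1 ?addr0 ?expr0 ?mulr1 => [|n _].
  by rewrite /odd_eval /= !mul0r !addr0.
by rewrite /odd_eval /= !mul0r !addr0 mul0r.
Qed.

End PointNorm.

Section Composition.
Variables (I : {fset nat}) (e l t s d : R) (p q : spoint) (G : triple R).
Hypotheses (e0 : 0 <= e) (l0 : 0 <= l) (t0 : 0 <= t) (s0 : 0 <= s) (d0 : 0 <= d).
Hypotheses (hz : nL I e p.1.1 <= t) (hp : nL I e p.1.2 <= l) (hm : nL I e p.2 <= l).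
Hypotheses (hX : forall M, Q I e l t M G.1.1 <= s).
Hypotheses (hP : forall M, Q I e l t M G.1.2 <= d) (hM : forall M, Q I e l t M G.2 <= d).
Hypotheses (qX : limL I e (fun N => partial_eval N G.1.1 p) q.1.1)
  (qP : limL I e (fun N => partial_eval N G.1.2 p) q.1.2) (qM : limL I e (fun N => partial_eval N G.2 p) q.2).
Hypothesis wX : wt 2 G.1.1.

Lemma lim_pev_cterms f n :
  limL I e (fun N => partial_eval N (cterms f G n) p) (odd_eval q (f n) * (q.1.1 : L) ^+ n).
Proof.
have bX : bounded I e l t G.1.1 by exists s. have bP : bounded I e l t G.1.2 by exists d.
have bM : bounded I e l t G.2 by exists d.
have bc a := bounded_const I e0 l0 t0 a.
have M := lim_pevM e0 l0 t0 hz hp hm; have bMul := bounded_mul (I := I) e0 l0 t0.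
have [bXn lXn] : bounded I e l t (G.1.1 ^+ n) /\
    limL I e (fun N => partial_eval N (G.1.1 ^+ n) p) ((q.1.1 : L) ^+ n).
  elim: n => [|n [ih1 ih2]].
    by rewrite !expr0 -constS1; split; [exact: bc|exact: lim_pev_const].
  by rewrite !exprS; split; [exact: bMul|exact: M].
have h a : bounded I e l t (constS a * G.1.1 ^+ n) /\
    limL I e (fun N => partial_eval N (constS a * G.1.1 ^+ n) p) (a * (q.1.1 : L) ^+ n).
  by split; [exact: bMul|apply: M => //; exact: lim_pev_const].
have zc (b : L) : (q.1.1 : L) ^+ n * b = b * (q.1.1 : L) ^+ n.
  by rewrite -lam0_valX lam0_commC.
have -> : odd_eval q (f n) * (q.1.1 : L) ^+ n = c0 (f n) * (q.1.1 : L) ^+ n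
    + cp (f n) * (q.1.1 : L) ^+ n * q.1.2 + cm (f n) * (q.1.1 : L) ^+ n * q.2
    + cpm (f n) * (q.1.1 : L) ^+ n * q.1.2 * q.2.
  by rewrite /odd_eval !mulrDl; congr (_ + _ + _ + _); rewrite -!mulrA ?zc -?mulrA.
have [b1 l1] := h (c0 (f n)); have [b2 l2] := h (cp (f n)).
have [b3 l3] := h (cm (f n)); have [b4 l4] := h (cpm (f n)).
have r2 := M _ _ _ _ b2 bP l2 qP; have r3 := M _ _ _ _ b3 bM l3 qM.
have r4 := M _ _ _ _ (bMul _ _ b4 bP) bM (M _ _ _ _ b4 bP l4 qP) qM.
apply: (limL_eventually (N1 := 0)) (limLD e0 (limLD e0 (limLD e0 l1 r2) r3) r4) => N _.
by rewrite -!pevD.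
Qed.

Lemma nL_value : [/\ nL I e q.1.1 <= s, nL I e q.1.2 <= d & nL I e q.2 <= d].
Proof.
split; [apply: (limL_bound e0 qX)|apply: (limL_bound e0 qP)|apply: (limL_bound e0 qM)] => N;
  by apply: le_trans (nL_pev e0 l0 t0 hz hp hm N _) _.
Qed.

(** The outer series is cut at an index m: the finitely many terms below m converge one by one by
    [lim_pev_cterms], and on both sides the rest is bounded by the tail of the norm of f. *)
Lemma lim_pev_scomp f : bounded I e d s f -> forall v,
  limL I e (fun N => partial_eval N (scomp f G) p) v <-> limL I e (fun N => partial_eval N f q) v.
Proof.
move=> [B hB]; apply: (limL_equiv e0) => c c0.
have [kX kP kM] := nL_value.
have c3 : 0 < c / 3%:R by rewrite divr_gt0.
have [||m hm3] := @mono_cauchy (fun N => Q I e d s N f) B _ _ _ c3; [|exact: hB|].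
  by move=> M M' MM; exact: Q_mono.
have lm := limL_sum e0 (iota 0 m) (lim_pev_cterms f).
have [N0 hN0] := lm _ c3.
exists (maxn N0 m) => N; rewrite geq_max => /andP[N0N mN]; rewrite subr0.
pose N' := (maxn N.+1 m).
have e1 : partial_eval N (scomp f G) p = partial_eval N (\sum_(n < N') cterms f G n) p.
  apply: pev_eq => n nN; apply: (scompE f wX); exact: leq_trans (leq_maxl _ _).
have e2 : partial_eval N (\sum_(n < N') cterms f G n) p
    = \sum_(n <- iota 0 m) partial_eval N (cterms f G n) p + partial_eval N (\sum_(m <= n < N') cterms f G n) p.
  rewrite -(big_mkord xpredT (cterms f G)) (@big_cat_nat _ _ _ m 0 N') //=; last exact: leq_maxr.
  by rewrite pevD pev_sum /index_iota subn0.
have e3 : \sum_(n <- iota 0 m) odd_eval q (f n) * (q.1.1 : L) ^+ n = partial_eval m f q.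
  by rewrite -[iota 0 m]/(iota 0 m) -{1}[m]subn0 -/(index_iota 0 m) big_mkord.
rewrite e1 e2 -[partial_eval N f q](subrK (partial_eval m f q)) -e3.
have h1 := hN0 N N0N.
have h2 : nL I e (partial_eval N (\sum_(m <= n < N') cterms f G n) p) <= c / 3%:R.
  apply: le_trans (nL_pev e0 l0 t0 hz hp hm _ _) _; apply: le_trans (Q_sum _ e0 l0 t0 _ _ _ _) _.
  apply: le_trans (hm3 N' _); last exact: leq_maxr.
  rewrite /Q -!(big_mkord xpredT (fun n => nE I e d (f n) * s ^+ n)).
  rewrite (@big_cat_nat _ _ _ m 0 N') //=; last exact: leq_maxr.
  rewrite addrAC subrr add0r; apply: ler_sum => n _.
  exact: (Q_cterms e0 l0 t0 s0 hX hP hM).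
have h3 : nL I e (partial_eval N f q - partial_eval m f q) <= c / 3%:R.
  exact: le_trans (nL_pev_diff e0 d0 s0 kX kP kM f mN) (hm3 N mN).
move: h1 h2 h3; rewrite -e3.
move: (\sum_(_ <- _) partial_eval _ _ _) (\sum_(_ <- _) odd_eval _ _ * _) (partial_eval N (\sum_(_ <= _ < _) _) p) (partial_eval N f q).
move=> a b a' b' h1 h2 h3.
have -> : a + a' - (b' - b + b) = (a - b) + (a' - (b' - b)) by rewrite [- (b' - b + b)]opprD [- (b' - b) - b]addrC addrACA.
have -> : c = c / 3%:R + (c / 3%:R + c / 3%:R) by field.
apply: le_trans (nLD _ _ _ e0) (lerD h1 _).
exact: le_trans (nLB _ _ _ e0) (lerD h2 h3).
Qed.

End Composition.

Lemma sterm_sum f p n :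
  \sum_(s : bool) \sum_(t : bool) sterm f p (n, s, t) = odd_eval p (f n) * (p.1.1 : L) ^+ n.
Proof.
have zc (b : L) : (p.1.1 : L) ^+ n * b = b * (p.1.1 : L) ^+ n.
  by rewrite -lam0_valX lam0_commC.
rewrite !big_bool /=; case: p zc => [[z al] be] /= zc; rewrite !expr0 !expr1 !mulr1.
rewrite addrA [LHS](ACl (4*2*3*1)) /odd_eval /= !mulrDl.
by congr (_ + _ + _ + _); rewrite -!mulrA ?zc -?mulrA.
Qed.

Lemma sterm_pev N f p I :
  \sum_(n < N) \sum_(s : bool) \sum_(t : bool) sterm f p (val n, s, t) I = partial_eval N f p I.
Proof.
rewrite /partial_eval lam_sumE; apply: eq_bigr => n _; rewrite -sterm_sum lam_sumE.
by apply: eq_bigr => s _; rewrite lam_sumE.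
Qed.

Lemma cvgC_P (u : nat -> C) (v : C) :
  ((fun N => u N : C^o) @ \oo --> (v : C^o)) <->
  (forall d : R, 0 < d -> exists N0, forall N, (N0 <= N)%N -> cnorm (u N - v) <= d).
Proof.
split=> [/cvgrPdist_le h d d0|h].
  have [|N0 _ hN] := h (d%:C%C); first by rewrite ltcR.
  exists N0 => N NN; have := hN N NN; rewrite /= distrC cnE lecR //.
apply/cvgrPdist_le => eps eps0.
have e0 : 0 < complex.Re eps by move: eps0; rewrite ltcE => /andP[].
have eE : eps = (complex.Re eps)%:C%C.
  by move: eps0; rewrite ltcE => /andP[/eqP h0 _]; case: eps h0 {e0} => a b /= ->.
have [N0 hN] := h _ e0; exists N0 => // N NN /=.
by rewrite distrC cnE eE lecR hN.
Qed.

(** Convergence of the partial sums alone; the absolute convergence demanded by [has_sum] is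
    recovered from [regular] in [value_has_sum]. *)
Definition value f p v := forall I, limL I 1 (fun N => partial_eval N f p) v.

Lemma limL_of_coef (u : nat -> L) (v : L) I :
  (forall J d, 0 < d -> exists N0, forall N, (N0 <= N)%N -> cnorm (u N J - v J) <= d) -> limL I 1 u v.
Proof.
move=> hJ.
have hs d : 0 < d -> exists N0, forall N, (N0 <= N)%N ->
    \sum_(J <- fpowerset I) cnorm (u N J - v J) <= d.
  elim: (enum_fset (fpowerset I)) d => [|J r ih] d d0.
    by exists 0%N => N _; rewrite big_nil ltW.
  have d2 : 0 < d / 2 by rewrite divr_gt0.
  have [N0 h0] := ih _ d2; have [N1 h1] := hJ J _ d2.
  exists (maxn N0 N1) => N; rewrite geq_max => /andP[n0 n1].
  by rewrite big_cons [d]splitr lerD ?h0 ?h1.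
move=> d d0; have [N0 hN] := hs d d0; exists N0 => N NN; apply: le_trans (hN N NN).
by rewrite /nL; apply: ler_sum => J _; rewrite expr1n mulr1.
Qed.

Lemma has_sum_value f p v : has_sum f p v -> value f p v.
Proof.
move=> h I; apply: limL_of_coef => J; apply/cvgC_P; have [_ hc] := h J; apply: cvg_trans hc.
by apply: near_eq_cvg; apply: nearW => N; rewrite sterm_pev.
Qed.

Lemma value_unique f p v v' : value f p v -> value f p v' -> v = v'.
Proof. exact: limL_unique. Qed.

Definition regular p f := forall I, exists e l t, [/\ 0 < e <= 1, 0 <= l, 0 <= t,
  [/\ nL I e p.1.1 <= t, nL I e p.1.2 <= l & nL I e p.2 <= l] & bounded I e l t f].

Lemma nL_sterm I e l t p f n (s1 s2 : bool) : 0 <= e -> 0 <= l -> 0 <= t ->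
  nL I e p.1.1 <= t -> nL I e p.1.2 <= l -> nL I e p.2 <= l ->
  nL I e (sterm f p (n, s1, s2)) <= nE I e l (f n) * t ^+ n.
Proof.
move=> e0 l0 t0; case: p => [[z al] be] /= hz ha hb.
have M a b y : nL I e b <= y -> nL I e (a * b) <= nL I e a * y.
  by move=> hb'; apply: le_trans (nLM _ _ _ e0) _; rewrite ler_wpM2l // nL_ge0.
have M' a b x y : nL I e a <= x -> nL I e b <= y -> nL I e (a * b) <= x * y.
  by move=> ha' hb'; apply: le_trans (nLM _ _ _ e0) _; apply: ler_pM; rewrite ?nL_ge0.
have zX : nL I e ((z : L) ^+ n) <= t ^+ n.
  by apply: le_trans (nLX _ _ _ e0) _; apply: lerXn2r => //; rewrite nnegrE ?nL_ge0.
have h (c : L) : nL I e (c * (z : L) ^+ n) <= nL I e c * t ^+ n by exact: M.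
have n0 a := @nL_ge0 _ I e a e0; have t0n := exprn_ge0 n t0.
have p1 a : 0 <= l * nL I e a by rewrite mulr_ge0.
have p2 a : 0 <= l ^+ 2 * nL I e a by rewrite mulr_ge0 ?exprn_ge0.
rewrite /nE; case: s1 s2 => [] [] /=; rewrite ?expr0 ?expr1 ?mulr1.
- apply: le_trans (M' _ _ _ _ (M' _ _ _ _ (h _) ha) hb) _.
  rewrite (_ : _ * l * l = l ^+ 2 * nL I e (cpm (f n)) * t ^+ n); last by ring.
  by rewrite ler_wpM2r // lerDr addr_ge0 // mulrDr addr_ge0.
- apply: le_trans (M' _ _ _ _ (h _) ha) _.
  by rewrite mulrAC ler_wpM2r // mulrC mulrDr -addrA addrC -!addrA lerDl !addr_ge0.
- apply: le_trans (M' _ _ _ _ (h _) hb) _.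
  rewrite mulrAC ler_wpM2r //.
  by move: (n0 (c0 (f n))) (p1 (cp (f n))) (p2 (cpm (f n))); lra.
- by apply: le_trans (h _) _; rewrite ler_wpM2r // -addrA lerDl addr_ge0 // mulrDr addr_ge0.
Qed.

Lemma value_has_sum f p v : regular p f -> value f p v -> has_sum f p v.
Proof.
move=> hr hv I; have [e [l [t [/andP[e0 e1] l0 t0 [hz ha hb] [B hB]]]]] := hr I; split; last first.
  have : (fun N => partial_eval N f p I : C^o) @ \oo --> (v I : C^o).
    apply/cvgC_P => d d0; have [N0 hN] := hv I d d0; exists N0 => N NN.
    by apply: le_trans (hN N NN); exact: (nL_coef1 I (partial_eval N f p - v)).
  apply: cvg_trans; apply: near_eq_cvg; apply: nearW => N; by rewrite sterm_pev.
have eI : 0 < e ^+ #|` I| by rewrite exprn_gt0.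
have bt n (s1 s2 : bool) : cnorm (sterm f p (n, s1, s2) I) <= nE I e l (f n) * t ^+ n / e ^+ #|` I|.
  rewrite ler_pdivlMr //; apply: le_trans (nL_coef _ (ltW e0) (fsubset_refl I)) _.
  exact: nL_sterm (ltW e0) l0 t0 hz ha hb.
have B0 : 0 <= B by apply: le_trans (hB 0%N); exact: Q_ge0 (ltW e0) l0 t0 _ _.
(* Four monomials share each power of x, whence the factor 4. *)
suff : (\esum_(k in [set: nat * bool * bool]) `|(complex.Re `|sterm f p k I|)%:E| <= ((B / e ^+ #|` I|) *+ 4)%:E)%E.
  by move=> hh; apply: le_lt_trans hh _; rewrite ltry.
apply: ub_ereal_sup => _ [X [fX _] <-].
rewrite fsbig_finite //.
pose N := (\max_(k <- fset_set X) k.1.1).+1.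
pose F (k : nat * bool * bool) : R := cnorm (sterm f p k I).
have -> : (\sum_(i <- fset_set X) `|(complex.Re `|sterm f p i I|)%:E|
    = (\sum_(i <- fset_set X) F i)%:E)%E.
  rewrite -sumEFin; apply: eq_bigr => k _ /=; congr _%:E.
  by rewrite ger0_norm // -/(cnorm _) cn_ge0.
rewrite lee_fin.
pose r' := [seq (n, c) | n <- [seq (n, c) | n <- iota 0 N, c <- [:: true; false]], c <- [:: true; false]].
apply: (@le_trans _ _ (\sum_(k <- r') F k)).
  apply: ler_sum_sub; first exact: fset_uniq.
  - apply: allpairs_uniq; [apply: allpairs_uniq; [exact: iota_uniq|by []|]|by []|];
      by move=> [? ?] [? ?] _ _ /= [-> ->].
  - move=> [[n b] b'] hk; apply/allpairsP; exists ((n, b), b'); split; [|by case: b' {hk}|by []].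
    apply/allpairsP; exists (n, b); split; [|by case: b {hk}|by []].
    rewrite mem_iota /= add0n ltnS.
    by rewrite (big_rem _ hk) leq_maxl.
  - by move=> k; exact: cn_ge0.
rewrite /r' !big_allpairs_dep.
apply: (@le_trans _ _ (\sum_(n <- iota 0 N) (nE I e l (f n) * t ^+ n / e ^+ #|` I|) *+ 4)).
  by apply: ler_sum => n _; rewrite !big_cons !big_nil /= !addr0 -[_ *+ 4]/(_ + (_ + (_ + _))) -addrA !lerD ?bt.
rewrite sumrMnl lerMn2r //= -mulr_suml ler_pM2r ?invr_gt0 //.
apply: le_trans (hB N); rewrite /Q -(big_mkord xpredT (fun n => nE I e l (f n) * t ^+ n)).
by rewrite /index_iota subn0.
Qed.

Lemma has_sumP f p v : regular p f -> has_sum f p v <-> value f p v.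
Proof. by move=> h; split; [exact: has_sum_value|exact: value_has_sum]. Qed.

Lemma body_odd (th : Lam1 R) : body th = 0.
Proof. by have := lam_sign1_odd th => /(congr1 (fun a : L => a fset0)); rewrite lam_signE cardfs0 mul1r lamNE => /eqP; rewrite -addr_eq0 -mulr2n mulrn_eq0 /= => /eqP. Qed.

Lemma small_nL I a t : cnorm (body a) < t -> exists e, [/\ 0 < e, e <= 1 &
  forall e', 0 < e' -> e' <= e -> nL I e' a <= t].
Proof.
move=> h; have p : 0 < nL I 1 a + 1 by rewrite ltr_wpDl ?nL_ge0.
have q : 0 < (t - cnorm (body a)) / (nL I 1 a + 1) by rewrite divr_gt0 // subr_gt0.
exists (Num.min 1 ((t - cnorm (body a)) / (nL I 1 a + 1))); rewrite lt_min ltr01 q ge_min lexx.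
split=> // e e0; rewrite le_min => /andP[e1 e2].
apply: le_trans (nL_split I a (ltW e0) e1) _; rewrite addrC -lerBrDr.
move: e2; rewrite ler_pdivlMr //; apply: le_trans; apply: ler_wpM2l; first exact: ltW.
by rewrite lerDl.
Qed.

Lemma small_point I p t l : cnorm (body p.1.1) < t -> 0 < l -> exists e, [/\ 0 < e, e <= 1 &
  forall e', 0 < e' -> e' <= e -> [/\ nL I e' p.1.1 <= t, nL I e' p.1.2 <= l & nL I e' p.2 <= l]].
Proof.
move=> ht l0; have [e1 [p1 q1 h1]] := small_nL I ht.
have ho (th : Lam1 R) : cnorm (body th) < l by rewrite body_odd cn0.
have [e2 [p2 q2 h2]] := small_nL I (ho p.1.2); have [e3 [p3 q3 h3]] := small_nL I (ho p.2).
exists (Num.min e1 (Num.min e2 e3)); rewrite !lt_min p1 p2 p3 !ge_min q1; split=> // e e0.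
by rewrite !le_min => /and3P[m1 m2 m3]; split; [exact: h1|exact: h2|exact: h3].
Qed.

Lemma conv_regular r f p : conv r f -> cnorm (body p.1.1) < r -> regular p f.
Proof.
move=> cf h I; have r0 : 0 < r := le_lt_trans (cn_ge0 _) h.
have [e [e0 e1 he]] := small_point I h (@ltr01 R); have [B hB] := cf I.
exists e, 1, r; rewrite e0 e1; split=> //; [exact: ltW|exact: he|].
by exists B => M; apply: le_trans (hB M); apply: Q_le => //; exact: ltW.
Qed.

Definition value3 (G : triple R) p q := [/\ value G.1.1 p q.1.1, value G.1.2 p q.1.2 & value G.2 p q.2].

(* For small zeta's, G maps |x| <= l^2 r, |phi+-| <= l into |x| <= s, |phi+-| <= 1. *)
Definition shrinks l r (G : triple R) s := [/\ 0 < l, l <= 1, 0 < r &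
  forall I, exists e, [/\ 0 < e, e <= 1 & forall e', 0 < e' -> e' <= e ->
    [/\ forall M, Q I e' l (l ^+ 2 * r) M G.1.1 <= s,
      forall M, Q I e' l (l ^+ 2 * r) M G.1.2 <= 1 & forall M, Q I e' l (l ^+ 2 * r) M G.2 <= 1]]].

Lemma conv_shrinks r G s : 0 < r -> conv3 r G -> tri_wt G -> 0 < s -> exists l, shrinks l r G s.
Proof.
move=> r0 cG wG s0; have [l [l0 l1 h]] := conv_shrink3 r0 cG wG s0 ltr01.
by exists l; split=> // I; exact: h.
Qed.

(** An equivalence, since the two sequences of partial evaluations differ by a null sequence.
    Composition of germs reads it from right to left, inversion from left to right. *)
Lemma value_scomp l r G s p q : shrinks l r G s -> wt 2 G.1.1 -> 0 < s ->
  cnorm (body p.1.1) < l ^+ 2 * r -> value3 G p q -> cnorm (body q.1.1) <= s /\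
  forall f, conv s f -> forall v, value (scomp f G) p v <-> value f q v.
Proof.
move=> [l0 l1 r0 h] wX s0 hp [vX vP vM].
have key I : exists e, [/\ 0 < e, e <= 1, nL I e q.1.1 <= s &
    forall f, conv s f -> forall v,
    limL I e (fun N => partial_eval N (scomp f G) p) v <-> limL I e (fun N => partial_eval N f q) v].
  have [e1 [p1 q1 h1]] := small_point I hp l0; have [e2 [p2 q2 h2]] := h I.
  pose e := Num.min e1 e2; have e0 : 0 < e by rewrite lt_min p1.
  have le1 : e <= e1 by rewrite ge_min lexx. have le2 : e <= e2 by rewrite ge_min lexx orbT.
  have e01 : e <= 1 := le_trans le1 q1.
  have [k1 k2 k3] := h1 e e0 le1; have [m1 m2 m3] := h2 e e0 le2.
  have t0 : 0 <= l ^+ 2 * r by rewrite mulr_ge0 ?exprn_ge0 ?ltW.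
  have L u v : limL I 1 u v -> limL I e u v by move/(limL_radius I u v e0 e01).
  exists e; split; [exact: e0|exact: e01| |].
    by have [] := nL_value (ltW e0) (ltW l0) t0 k1 k2 k3 m1 m2 m3 (L _ _ (vX I)) (L _ _ (vP I)) (L _ _ (vM I)).
  move=> f cf v; apply: (lim_pev_scomp (ltW e0) (ltW l0) t0 (ltW s0) ler01 k1 k2 k3 m1 m2 m3 _ _ _ wX).
  - exact: L (vX I).
  - exact: L (vP I).
  - exact: L (vM I).
  - by have [B hB] := cf I; exists B => M; apply: le_trans (hB M); apply: Q_le => //; exact: ltW.
split.
  have [e [e0 e1 hq _]] := key fset0; apply: le_trans hq.
  by have := nL_coef (q.1.1 : L) (ltW e0) (fsubset_refl fset0); rewrite cardfs0 mulr1.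
move=> f cf v; split=> hv I; have [e [e0 e1 _ /(_ f cf v) he]] := key I.
- exact/(limL_radius _ _ _ e0 e1)/(he.1 ((limL_radius _ _ _ e0 e1).2 (hv I))).
- exact/(limL_radius _ _ _ e0 e1)/(he.2 ((limL_radius _ _ _ e0 e1).2 (hv I))).
Qed.

Lemma near0P (P : set spoint) :
  near0 P <-> exists2 rho : R, 0 < rho & forall p, cnorm (body p.1.1) < rho -> P p.
Proof.
split=> [[U [oU U0 hU]]|[rho rho0 h]].
  have : nbhs (0 : C^o) U by apply: open_nbhs_nbhs.
  move=> /nbhs_ballP[eps /= eps0 he]; exists (complex.Re eps).
    by move: eps0; rewrite ltcE => /andP[].
  move=> p hp; apply: hU; apply: he; rewrite -ball_normE /= sub0r normrN cnE.
  have -> : eps = (complex.Re eps)%:C%C.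
    by move: eps0; rewrite ltcE => /andP[/eqP h0 _]; case: eps h0 {hp} => a b /= ->.
  by rewrite ltcR.
exists (ball (0 : C^o) (rho%:C%C)); split.
- by apply: ball_open; rewrite ltcR.
- by apply: ballxx; rewrite ltcR.
- by move=> p; rewrite -ball_normE /= sub0r normrN cnE ltcR; exact: h.
Qed.

End Evaluation.

(** * Fresh generators and convergence of inverse series *)

Section InverseConvergence.
Variable R : realType.
Local Notation C := (R[i]).
Local Notation L := (Lam R).
Local Notation sg := (@lam_sign R).
Local Notation S := (sser R).
Local Notation spoint := (spoint R).
Local Notation x := (varx R).
Local Notation pp := (phip R).
Local Notation pm := (phim R).
Implicit Types (a b : L) (I J K U V W : {fset nat}) (e l t r s : R) (f g h : S) (p q : spoint) (G F : triple R).

Definition zeta_fun (k : nat) : ghat R := fun I => (I == [fset k]%fset)%:R.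

Lemma zeta_fin k : zeta_fun k \in @fin_supp R.
Proof.
apply/asboolP; apply: (@sub_finite_set _ _ [set [fset k]%fset]); last exact: finite_set1.
by move=> I; rewrite /= /zeta_fun; case: (I =P _) => // _ /eqP.
Qed.

Definition zeta_lam k : L := MkLam (zeta_fin k).

Lemma zeta_odd k : zeta_lam k \in @odd_pred R.
Proof.
apply/asboolP => I hI; rewrite -[LHS]/((I == [fset k]%fset)%:R : C).
by case: eqP => // e; move: hI; rewrite e cardfs1.
Qed.

Definition zeta k : Lam1 R := MkLam1 (zeta_odd k).

(** Multiplication by a generator absent from J merely moves the coefficient, up to sign. With fresh
    generators as odd coordinates, the coefficients of phi+, phi- and phi+ phi- can be read from
    values. *)
Lemma cn_mul_zeta a k J : k \notin J -> cnorm ((a * zeta k) (k |` J)%fset) = cnorm (a J).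
Proof.
move=> kJ; rewrite lamME (big_fsetD1 J) /=; last by rewrite fpowersetE fsubsetU1.
rewrite big_seq big1 ?addr0 => [|K]; last first.
  rewrite in_fsetD1 fpowersetE => /andP[KJ sub]; rewrite /zeta_fun; case: eqP => [e|]; last by rewrite mulr0.
  case/eqP: KJ; rewrite -(fsetDK sub) e; apply/fsetP => j.
  by rewrite in_fsetD1 in_fset1U; case: eqP => [->|] //=; rewrite (negPf kJ).
rewrite /zeta_fun; have -> : ((k |` J) `\` J)%fset = [fset k]%fset.
  apply/fsetP => j; rewrite in_fsetD in_fset1U in_fset1; case: (eqVneq j k) => [->|] /=; first by rewrite kJ.
  by case: (j \in J).
by rewrite eqxx mulr1 cn_signM.
Qed.

Lemma fresh I : exists k, k \notin I.
Proof.
exists (\max_(j <- I) j).+1; apply/negP => h.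
have : ((\max_(j <- I) j).+1 <= \max_(j <- I) j)%N by rewrite [leqRHS](big_rem _ h) leq_maxl.
by rewrite ltnn.
Qed.

Definition rpoint (z : C) (th ph : Lam1 R) : spoint := (z%:A, th, ph).

Lemma body_scalar (z : C) : body (z%:A : Lam0 R) = z.
Proof. by rewrite -[LHS]/(z * body 1) body1 mulr1. Qed.

Lemma scalarX (z : C) n : ((z%:A : Lam0 R) : L) ^+ n = (z ^+ n)%:A.
Proof.
elim: n => [|n ih]; first by rewrite !expr0 scale1r.
rewrite !exprS ih -[((z%:A : Lam0 R) : L)]/(z *: (1 : L)) -scalerAl mul1r scalerA //.
Qed.

Lemma lam_scalar_coef (a : L) (z : C) I : (a * z%:A) I = a I * z.
Proof. by rewrite lam_scalerAr mulr1 lamZE mulrC. Qed.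

Lemma summable_terms f p I (s1 s2 : bool) : summable [set: nat * bool * bool]
    (fun k => (complex.Re `|sterm f p k I|)%:E) ->
  exists B, forall N, \sum_(n < N) cnorm (sterm f p (val n, s1, s2) I) <= B.
Proof.
move=> h; have := h; rewrite summableE => hf.
exists (fine (\esum_(k in [set: nat * bool * bool]) `|(complex.Re `|sterm f p k I|)%:E|)%E) => N.
rewrite -lee_fin fineK //; apply: ereal_sup_ubound => /=.
pose r := [seq (n, s1, s2) | n <- iota 0 N]; exists [set` r]; first by split => //; exact: finite_seq.
have ur : uniq r by rewrite map_inj_uniq ?iota_uniq // => i j [].
rewrite -(fsbig_seq _ _ ur) /r big_map -sumEFin.
rewrite -(big_mkord xpredT (fun n => (cnorm (sterm f p (n, s1, s2) I))%:E)) /index_iota subn0.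
apply: eq_bigr => n _ /=; congr _%:E; rewrite ger0_norm //; exact: cn_ge0.
Qed.

Section Sterm.
Variables (f : S) (z : Lam0 R) (th ph : Lam1 R) (n : nat).
Lemma sterm_ff : sterm f (z, th, ph) (n, false, false) = c0 (f n) * (z : L) ^+ n.
Proof. exact: etrans (mulr1 _) (mulr1 _). Qed.
Lemma sterm_tf : sterm f (z, th, ph) (n, true, false) = cp (f n) * (z : L) ^+ n * th.
Proof. exact: mulr1. Qed.
Lemma sterm_ft : sterm f (z, th, ph) (n, false, true) = cm (f n) * (z : L) ^+ n * ph.
Proof. exact: (congr1 (fun a => a * (ph : L)) (mulr1 _)). Qed.
Lemma sterm_tt : sterm f (z, th, ph) (n, true, true) = cpm (f n) * (z : L) ^+ n * th * ph.
Proof. by []. Qed.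
End Sterm.

(** Two distinct generators k and m outside [I] serve as odd coordinates. The four coefficients at J
    then appear at the monomials J, k J, m J and m k J, and absolute summability there bounds
    them. *)
Lemma conv_of_sum r f : 0 < r ->
  (forall th ph, exists v, has_sum f (rpoint r%:C%C th ph) v) -> conv r f.
Proof.
move=> r0 h I; have [k kI] := fresh I; have [m] := fresh (k |` I)%fset.
rewrite in_fset1U negb_or => /andP[mk mI].
have bnd th ph (s1 s2 : bool) J : exists B, forall N,
    \sum_(n < N) cnorm (sterm f (rpoint r%:C%C th ph) (val n, s1, s2) J) <= B.
  have [v hv] := h th ph; have [hs _] := hv J; exact: summable_terms hs.
have cX n : cnorm ((r%:C%C : C) ^+ n) = r ^+ n by rewrite cnX cnR ger0_norm // ltW.
have key J : (J `<=` I)%fset -> exists B, forall N, \sum_(n < N)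
    (cnorm (c0 (f n) J) + (cnorm (cp (f n) J) + cnorm (cm (f n) J)) + cnorm (cpm (f n) J)) * r ^+ n <= B.
  move=> JI; have kJ : k \notin J by apply: contra kI; exact: (fsubsetP JI).
  have mJ : m \notin (k |` J)%fset.
    by rewrite in_fset1U negb_or mk; apply: contra mI; exact: (fsubsetP JI).
  have mJ' : m \notin J by apply: contra mI; exact: (fsubsetP JI).
  have [B0 h0] := bnd (zeta k) (zeta m) false false J.
  have [B1 h1] := bnd (zeta k) (zeta m) true false (k |` J)%fset.
  have [B2 h2] := bnd (zeta k) (zeta m) false true (m |` J)%fset.
  have [B3 h3] := bnd (zeta k) (zeta m) true true (m |` (k |` J))%fset.
  exists (B0 + (B1 + B2) + B3) => N; apply: le_trans (lerD (lerD (h0 N) (lerD (h1 N) (h2 N))) (h3 N)).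
  rewrite -!big_split; apply: ler_sum => n _.
  rewrite /rpoint sterm_ff sterm_tf sterm_ft sterm_tt !cn_mul_zeta // scalarX !lam_scalar_coef.
  by rewrite !cnM cX /= -!mulrDl.
have /choice[B hB] : forall J, exists B, (J `<=` I)%fset -> forall N, \sum_(n < N)
    (cnorm (c0 (f n) J) + (cnorm (cp (f n) J) + cnorm (cm (f n) J)) + cnorm (cpm (f n) J)) * r ^+ n <= B.
  move=> J; have [/key[B hB]|_] := boolP (J `<=` I)%fset; last by exists 0.
  by exists B.
exists (\sum_(J <- fpowerset I) B J) => N.
have -> : Q I 1 1 r N f = \sum_(J <- fpowerset I) \sum_(n < N)
    (cnorm (c0 (f n) J) + (cnorm (cp (f n) J) + cnorm (cm (f n) J)) + cnorm (cpm (f n) J)) * r ^+ n.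
  rewrite exchange_big; apply: eq_bigr => n _; rewrite -mulr_suml; congr (_ * _).
  rewrite /nE /nL expr1n !mul1r -!big_split /=; apply: eq_bigr => J _.
  by rewrite expr1n !mulr1.
rewrite big_seq [leRHS]big_seq; apply: ler_sum => J; rewrite fpowersetE => JI; exact: hB.
Qed.

Definition wt_trunc k f : S := fun n => SExt (if (2 * n < k)%N then c0 (f n) else 0)
  (if (2 * n + 1 < k)%N then cp (f n) else 0) (if (2 * n + 1 < k)%N then cm (f n) else 0)
  (if (2 * n + 2 < k)%N then cpm (f n) else 0).

Lemma wt_sub_trunc k f : wt k (f - wt_trunc k f).
Proof. by move=> n; split=> h; rewrite /= ifT ?subrr //; lia. Qed.

Lemma tr_wt k f : wt k f -> wt_trunc k f = 0.
Proof.
move=> hf; apply: sserP => n; have [h0 h1 h2 h3] := hf n; apply: sextP => /=; case: ifP => // h.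
- by apply: h0; lia.
- by apply: h1; lia.
- by apply: h2; lia.
- by apply: h3; lia.
Qed.

Lemma trB k f g : wt_trunc k (f - g) = wt_trunc k f - wt_trunc k g.
Proof. by apply: sserP => n; apply: sextP => /=; case: ifP; rewrite ?subr0. Qed.

Lemma tr_eq k f g : wt k (f - g) -> wt_trunc k f = wt_trunc k g.
Proof. by move=> /tr_wt; rewrite trB => /eqP; rewrite subr_eq0 => /eqP. Qed.

Lemma wt_trunc_coef k f n : (2 * n + 2 < k)%N -> wt_trunc k f n = f n.
Proof. by move=> h; apply: sextP; rewrite /= ifT //; lia. Qed.

Lemma wt_tr_keep w k f : wt w f -> wt w (wt_trunc k f).
Proof.
move=> hf n; have [h0 h1 h2 h3] := hf n.
by split=> h /=; case: ifP => // _; [apply: h0|apply: h1|apply: h2|apply: h3].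
Qed.

Lemma nL_if I e (c : bool) a : 0 <= e -> nL I e (if c then a else 0) <= nL I e a.
Proof. by case: c => // e0; rewrite nL0 nL_ge0. Qed.

Lemma Q_tr I e l t M k f : 0 <= e -> 0 <= l -> 0 <= t -> Q I e l t M (wt_trunc k f) <= Q I e l t M f.
Proof.
move=> e0 l0 t0; apply: ler_sum => n _; rewrite ler_wpM2r ?exprn_ge0 // /nE.
by rewrite !lerD ?ler_wpM2l ?exprn_ge0 ?lerD ?nL_if.
Qed.

(** One factor of weight 2 is replaced by f - g of weight b + 1, leaving b + 2 n - 1. For n = 0 this
    count fails under truncated subtraction, so the vanishing is recorded separately. *)
Lemma wt_powdiff (b : nat) f g n : wt 2 f -> wt 2 g -> wt b.+1 (f - g) ->
  wt (b + 2 * n - 1) (f ^+ n - g ^+ n) /\ (n = 0%N -> f ^+ n - g ^+ n = 0).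
Proof.
move=> hf hg hfg; split; last by move=> ->; rewrite !expr0 subrr.
elim: n => [|n ih]; first by rewrite !expr0 subrr.
have -> : f ^+ n.+1 - g ^+ n.+1 = (f - g) * f ^+ n + g * (f ^+ n - g ^+ n).
  by rewrite mulrBl mulrBr -!exprS addrA subrK.
apply: wtD; first by apply: wtW (wtM hfg (wtX n hf)); lia.
case: n ih => [|n] ih; first by rewrite !expr0 subrr mulr0.
by apply: wtW (wtM hg ih); lia.
Qed.

Lemma sum4_diff (T : pzRingType) (a1 a2 a3 a4 u1 u2 u3 u4 v1 v2 v3 v4 : T) :
  a1 * u1 + a2 * u2 + a3 * u3 + a4 * u4 - (a1 * v1 + a2 * v2 + a3 * v3 + a4 * v4)
  = a1 * (u1 - v1) + a2 * (u2 - v2) + a3 * (u3 - v3) + a4 * (u4 - v4).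
Proof. by rewrite !mulrBr !opprD !addrA [RHS](ACl (1*3*5*7*2*4*6*8)). Qed.

Lemma cterms_diff h G F n : cterms h G n - cterms h F n =
  constS (c0 (h n)) * (G.1.1 ^+ n - F.1.1 ^+ n)
  + constS (cp (h n)) * (G.1.1 ^+ n * G.1.2 - F.1.1 ^+ n * F.1.2)
  + constS (cm (h n)) * (G.1.1 ^+ n * G.2 - F.1.1 ^+ n * F.2)
  + constS (cpm (h n)) * (G.1.1 ^+ n * G.1.2 * G.2 - F.1.1 ^+ n * F.1.2 * F.2).
Proof.
rewrite -sum4_diff /cterms.
move: (G.1.1 ^+ n) (F.1.1 ^+ n) G.1.2 F.1.2 G.2 F.2 (constS _) (constS _) (constS _) (constS _).
by move=> *; rewrite !mulrA.
Qed.

(* Raising the weight by w gains w - 1 orders of accuracy: the contraction behind the inversion. *)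
Lemma wt_scomp_diff (w b : nat) h G F : (0 < w)%N -> wt w h -> tri_wt G -> tri_wt F ->
  wt b.+1 (G.1.1 - F.1.1) -> wt b (G.1.2 - F.1.2) -> wt b (G.2 - F.2) ->
  wt (b + w - 1) (scomp h G - scomp h F).
Proof.
move=> w0 hh [gX gP gM] [fX fP fM] dX dP dM; set N := (b + w)%N.
have -> : scomp h G - scomp h F = (scomp h G - \sum_(k < N) cterms h G k)
    + \sum_(k < N) (cterms h G k - cterms h F k) - (scomp h F - \sum_(k < N) cterms h F k).
  by rewrite sumrB subrKA opprB subrKA.
apply: wtD; [apply: wtD|apply: wtN]; last 1 first.
- by apply: wtW (scomp_trunc h N fX); rewrite /N; lia.
- by apply: wtW (scomp_trunc h N gX); rewrite /N; lia.
apply: wt_sum => n _; have [h0 h1 h1' h2] := hh n; move: (val n) h0 h1 h1' h2 => {}n h0 h1 h1' h2.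
have [pd pd0] := wt_powdiff n gX fX dX.
have C0 (a : L) u j : ((0 < j)%N -> a = 0) -> (j = 0%N -> wt (b + w - 1) u) -> wt (b + w - 1) (constS a * u).
  by move=> ha hu; case: j ha hu => [|j] ha hu; [apply: wtMr; exact: hu|rewrite ha // constS0 mul0r].
have dP' : wt (b + 2 * n) (G.1.1 ^+ n * G.1.2 - F.1.1 ^+ n * F.1.2).
  rewrite (_ : _ - _ = (G.1.1 ^+ n - F.1.1 ^+ n) * G.1.2 + F.1.1 ^+ n * (G.1.2 - F.1.2)); last first.
    by rewrite mulrBl mulrBr addrA subrK.
  apply: wtD; last by apply: wtW (wtM (wtX n fX) dP); lia.
  case: (posnP n) => [n0|n0]; first by rewrite pd0 // mul0r.
  by apply: wtW (wtM pd gP); lia.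
have dM' : wt (b + 2 * n) (G.1.1 ^+ n * G.2 - F.1.1 ^+ n * F.2).
  rewrite (_ : _ - _ = (G.1.1 ^+ n - F.1.1 ^+ n) * G.2 + F.1.1 ^+ n * (G.2 - F.2)); last first.
    by rewrite mulrBl mulrBr addrA subrK.
  apply: wtD; last by apply: wtW (wtM (wtX n fX) dM); lia.
  case: (posnP n) => [n0|n0]; first by rewrite pd0 // mul0r.
  by apply: wtW (wtM pd gM); lia.
have dPM : wt (b + 2 * n + 1) (G.1.1 ^+ n * G.1.2 * G.2 - F.1.1 ^+ n * F.1.2 * F.2).
  rewrite (_ : _ - _ = (G.1.1 ^+ n * G.1.2 - F.1.1 ^+ n * F.1.2) * G.2
    + F.1.1 ^+ n * F.1.2 * (G.2 - F.2)); last by rewrite mulrBl mulrBr addrA subrK.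
  apply: wtD; first by apply: wtW (wtM dP' gM); lia.
  by apply: wtW (wtM (wtM (wtX n fX) fP) dM); lia.
rewrite cterms_diff; apply: wtD; [apply: wtD; [apply: wtD|]|].
- apply: (C0 _ _ (w - 2 * n)%N) => // hw; case: (posnP n) => [n0|n0]; first by rewrite pd0.
  by apply: wtW pd; lia.
- by apply: (C0 _ _ (w - 2 * n - 1)%N) => hw; [apply: h1; lia|apply: wtW dP'; lia].
- by apply: (C0 _ _ (w - 2 * n - 1)%N) => hw; [apply: h1'; lia|apply: wtW dM'; lia].
- by apply: (C0 _ _ (w - 2 * n - 2)%N) => hw; [apply: h2; lia|apply: wtW dPM; lia].
Qed.

Lemma Q_varx I e l t M : 0 <= t -> Q I e l t M x <= t.
Proof.
move=> t0; have z n : (n != 1)%N -> nE I e l (x n) * t ^+ n = 0.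
  by move=> n1; rewrite /varx (negPf n1) nE0 mul0r.
case: M => [|[|M]]; first by rewrite /Q big_ord0.
  by rewrite /Q big_ord_recl big_ord0 addr0 z.
rewrite /Q big_ord_recl z // add0r big_ord_recl /= /bump /= /varx eqxx nE1 mul1r expr1.
by rewrite big1 ?addr0 // => n _; rewrite (_ : (_ == 1%N) = false) // nE0 mul0r.
Qed.

Lemma Q_phi I e l t M : 0 <= l -> Q I e l t M pp <= l /\ Q I e l t M pm <= l.
Proof.
move=> l0; have z f n : (forall n, f n.+1 = 0) -> nE I e l (f n.+1) * t ^+ n.+1 = 0.
  by move=> ->; rewrite nE0 mul0r.
case: M => [|M]; first by rewrite /Q !big_ord0.
rewrite /Q !big_ord_recl expr0 !mulr1 !big1 ?addr0; try by move=> n _; exact: z.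
by rewrite /nE /= !nL0 nL1 !addr0 !add0r !mulr0 !mulr1 !addr0.
Qed.

Lemma convB r f g : 0 <= r -> conv r f -> conv r g -> conv r (f - g).
Proof.
move=> r0 hf hg I; have [B hB] := hf I; have [D hD] := hg I; exists (B + D) => M.
by apply: le_trans (QB I ler01 ler01 r0 M f g) (lerD _ _).
Qed.

Lemma conv_varx r : 0 <= r -> conv r x.
Proof. by move=> r0 I; exists r => M; exact: Q_varx. Qed.
Lemma conv_phi r : conv r pp /\ conv r pm.
Proof. by split=> I; exists 1 => M; have [] := @Q_phi I 1 1 r M ler01. Qed.

(** From U (T v) = v the inverse solves U v = v - U h with h = T v - v. As h has higher weight than
    v, small radii make it small, and iterating from 0 keeps all approximations within fixed bounds,
    which pass to the limit coefficient by coefficient. *)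
Lemma conv_inverse r (T U : S -> S) : 0 < r -> good U -> (forall f, U (T f) = f) -> wt 3 (T x - x) ->
  wt 2 (T pp - pp) -> wt 2 (T pm - pm) -> conv3 r (triple_of T) ->
  exists2 r', 0 < r' & conv3 r' (triple_of U).
Proof.
move=> r0 gU UT wX wP wM [cX cP cM]; have [cpp cpm] := conv_phi r.
pose hX := T x - x; pose hP := T pp - pp; pose hM := T pm - pm.
have small h : conv r h -> exists C : R, 0 <= C /\ forall I, exists e : R, [/\ 0 < e, e <= 1
    & forall M, Q I e 1 r M h <= C] by exact: conv_small (ltW r0).
have [C1 [C10 h1]] := small _ (convB (ltW r0) cX (conv_varx (ltW r0))).
have [C2 [C20 h2]] := small _ (convB (ltW r0) cP cpp).
have [C3 [C30 h3]] := small _ (convB (ltW r0) cM cpm).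
pose D := C1 + C2 + C3 + 1; have D1 : 1 <= D by rewrite lerDr !addr_ge0.
have D0 : 0 < D by apply: lt_le_trans ltr01 D1.
have [d1 d2 d3] : [/\ C1 <= D, C2 <= D & C3 <= D] by rewrite /D; split; lra.
pose m := Num.min 1 r; have m0 : 0 < m by rewrite lt_min ltr01 r0.
have [m1 mr] : m <= 1 /\ m <= r by rewrite !ge_min !lexx orbT.
(* Chosen so that l D = m / 2 is at most 1/2 and at most r / 2. The corrections l^2 D and l^3 D then
   use at most half of the target radii l and l^2 r, and the coordinates themselves use a half and a
   quarter because the source radius is l' = l / 2. *)
pose l := m / (2 * D).
have l0 : 0 < l by rewrite divr_gt0 // mulr_gt0.
have lD : l * D = m / 2 by rewrite /l; field; rewrite gt_eqF.
have l1 : l <= 1 by rewrite ler_pdivrMr ?mulr_gt0 // mul1r; lra.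
pose l' := l / 2; have l'0 : 0 < l' by rewrite divr_gt0.
have l'1 : l' <= 1 by rewrite /l'; lra.
have eqG (T0 : S) : U (T0) = scomp T0 (triple_of U) by exact: scomp_good.
have UB f g : U (f - g) = U f - U g.
  have U0 : U 0 = 0 by apply: (addrI (U 0)); rewrite -(goodD gU) !addr0.
  by apply: (addIr (U g)); rewrite subrK -(goodD gU) subrK.
have fixp v h : h = T v - v -> U v = v - scomp h (triple_of U).
  by move=> ->; rewrite -eqG UB UT opprB addrC subrK.
have [gX gP gM] : tri_wt (triple_of U).
  by split; apply: (good_wt gU); [exact: wt_varx|exact: wt_phip|exact: wt_phim].
(* [wt_scomp_diff] wants one more order of accuracy in x than in phi+, phi-. As the corrections have
   weights 3 and 2, one step leads from accuracy (k + 1, k) to (k + 2, k + 1). *)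
pose G k : triple R := (wt_trunc k.+1 (U x), wt_trunc k (U pp), wt_trunc k (U pm)).
have wG k : tri_wt (G k) by split; exact: wt_tr_keep.
have step k w v h : (0 < w)%N -> wt w h -> h = T v - v ->
    wt_trunc (k + w - 1) (U v) = wt_trunc (k + w - 1) (v - scomp h (G k)).
  move=> w0 hw eh; rewrite (fixp v h eh); apply: tr_eq; rewrite opprB addrC subrKA.
  have wd j (f : S) : wt j (wt_trunc j f - f) by rewrite -opprB; apply: wtN; exact: wt_sub_trunc.
  by apply: wt_scomp_diff => //; exact: wd.
exists (l' ^+ 2 * r); first by rewrite mulr_gt0 ?exprn_gt0.
have bound I : exists e, [/\ 0 < e, e <= 1 & forall k M, [/\ Q I e l' (l' ^+ 2 * r) M (G k).1.1 <= l ^+ 2 * r,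
    Q I e l' (l' ^+ 2 * r) M (G k).1.2 <= l & Q I e l' (l' ^+ 2 * r) M (G k).2 <= l]].
  have [e1 [p1 q1 k1]] := h1 I; have [e2 [p2 q2 k2]] := h2 I; have [e3 [p3 q3 k3]] := h3 I.
  pose e := Num.min e1 (Num.min e2 e3).
  have [ee1 ee2 ee3] : [/\ e <= e1, e <= e2 & e <= e3] by rewrite /e !ge_min !lexx !orbT.
  have e0 : 0 < e by rewrite !lt_min p1 p2.
  have e01 : e <= 1 by exact: le_trans ee1 q1.
  exists e; split=> // k.
  have t0 : 0 <= l' ^+ 2 * r by rewrite mulr_ge0 ?exprn_ge0 ?ltW.
  have hb w e' C h M : wt w h -> e <= e' -> C <= D -> (forall M, Q I e' 1 r M h <= C) ->
      Q I e l (l ^+ 2 * r) M h <= l ^+ w * D.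
    move=> hw ee CD hC; apply: le_trans (Q_wt _ _ (ltW e0) (ltW l0) l1 (ltW r0) hw) _.
    apply: ler_wpM2l; first exact: exprn_ge0 (ltW l0).
    apply: le_trans CD; apply: le_trans (hC M).
    by apply: Q_le => //; exact: ltW.
  have b1 M : Q I e l (l ^+ 2 * r) M hX <= l ^+ 3 * D by exact: hb wX ee1 d1 k1.
  have b2 M : Q I e l (l ^+ 2 * r) M hP <= l ^+ 2 * D by exact: hb wP ee2 d2 k2.
  have b3 M : Q I e l (l ^+ 2 * r) M hM <= l ^+ 2 * D by exact: hb wM ee3 d3 k3.
  have s0 : 0 <= l ^+ 2 * r by rewrite mulr_ge0 ?exprn_ge0 ?ltW.
  elim: k => [|k ih] M.
    have z j f : wt j f -> Q I e l' (l' ^+ 2 * r) M (wt_trunc j f) = 0 by move=> hf; rewrite tr_wt // Q0.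
    by rewrite /G /= !z //; [split=> //; exact: ltW|exact: wtW gX].
  have comp h N0 B : (forall N, Q I e l (l ^+ 2 * r) N h <= B) ->
      Q I e l' (l' ^+ 2 * r) N0 (scomp h (G k)) <= B.
    move=> hB; have [wG1 _ _] := wG k.
    have [N hN] := @Q_scomp _ I e l' (l' ^+ 2 * r) (l ^+ 2 * r) (G k) (ltW e0) (ltW l'0) t0 s0
      (fun M => let: And3 a _ _ := ih M in a) l (fun M => let: And3 _ a _ := ih M in a)
      (fun M => let: And3 _ _ a := ih M in a) h N0 wG1.
    exact: le_trans hN (hB N).
  have sX := step k 3%N x hX isT wX erefl; have sP := step k 2%N pp hP isT wP erefl.
  have sM := step k 2%N pm hM isT wM erefl.
  have ekX : (k + 3 - 1 = k.+2)%N by rewrite addn3 subn1.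
  have ekP : (k + 2 - 1 = k.+1)%N by rewrite addn2 subn1.
  rewrite ekX in sX; rewrite ekP in sP sM; rewrite /G /= sX sP sM.
  have tri (N0 : nat) v h B j : (forall N, Q I e l (l ^+ 2 * r) N h <= B) ->
      Q I e l' (l' ^+ 2 * r) N0 (wt_trunc j (v - scomp h (G k))) <= Q I e l' (l' ^+ 2 * r) N0 v + B.
    move=> hB; apply: le_trans (Q_tr _ _ _ _ (ltW e0) (ltW l'0) t0) _.
    by apply: le_trans (QB I (ltW e0) (ltW l'0) t0 N0 _ _) _; rewrite lerD2l; exact: comp.
  have [qp qm] := @Q_phi I e l' (l' ^+ 2 * r) M (ltW l'0).
  have lle : l ^+ 2 * D <= l / 2.
    by rewrite expr2 -mulrA lD mulrA ler_pM2r ?invr_gt0 // -[leRHS]mulr1 ler_wpM2l // ltW.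
  split.
  - apply: le_trans (tri M x hX _ _ b1) _.
    apply: (@le_trans _ _ (l' ^+ 2 * r + l ^+ 2 * (r / 2))).
      apply: lerD; first exact: Q_varx.
      rewrite exprSr -mulrA lD; apply: ler_wpM2l; first exact: exprn_ge0 (ltW l0).
      by rewrite ler_pM2r ?invr_gt0.
    rewrite [leLHS](_ : _ = l ^+ 2 * r * (3%:R / 4%:R)); last by rewrite /l'; field.
    rewrite -[leRHS]mulr1; apply: ler_wpM2l => //; clear; lra.
  - by apply: le_trans (tri M pp hP _ _ b2) _; rewrite /l' in qp *; lra.
  - by apply: le_trans (tri M pm hM _ _ b3) _; rewrite /l' in qm *; lra.
have fin f j : (forall I, exists e, [/\ 0 < e, e <= 1 & forall k M, Q I e l' (l' ^+ 2 * r) M (wt_trunc (k + j) f) <= 1 + l ^+ 2 * r]) -> conv (l' ^+ 2 * r) f.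
  move=> hf; apply: conv_unscale => [I|]; last by rewrite mulr_ge0 ?exprn_ge0 ?ltW.
  have [e [e0 e1 he]] := hf I; exists e, l', (1 + l ^+ 2 * r); split=> // M.
  apply: le_trans (he (2 * M + 3)%N M); rewrite (@Q_coef_eq _ I e l' _ M f (wt_trunc (2 * M + 3 + j) f)) //.
  by move=> n nM; rewrite wt_trunc_coef; [|clear -nM; lia].
have lr0 : 0 <= l ^+ 2 * r by rewrite mulr_ge0 ?exprn_ge0 ?ltW.
split; [apply: (fin _ 1%N)|apply: (fin _ 0%N)|apply: (fin _ 0%N)] => I;
  have [e [e0 e1 he]] := bound I; exists e; split=> // k M; have [k1 k2 k3] := he k M.
- by rewrite addn1; apply: le_trans k1 _; rewrite lerDr.
- by rewrite addn0; apply: le_trans k2 _; lra.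
- by rewrite addn0; apply: le_trans k3 _; lra.
Qed.

End InverseConvergence.

(** * Zeros of scalar series *)

Section ScalarSeries.
Variable R : realType.
Local Notation C := (R[i]).
Implicit Types (g h u : nat -> C) (r s d B z : R).

Definition tends (v : nat -> C) (l : C) := forall d, 0 < d -> exists N0, forall N, (N0 <= N)%N ->
  cnorm (v N - l) <= d.

Lemma mono_lim (v : nat -> R) B : (forall m n, (m <= n)%N -> v m <= v n) -> (forall n, v n <= B) ->
  exists l, forall d, 0 < d -> exists N0, forall N, (N0 <= N)%N -> `|v N - l| <= d.
Proof.
move=> mono hB; have hs : has_sup (range v).
  by split; [exists (v 0%N), 0%N|exists B => _ [n _ <-]].
exists (sup (range v)) => d d0; have [_ [m _ <-] hm] := sup_adherent d0 hs; exists m => N mN.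
have h1 : v N <= sup (range v) by apply: ub_le_sup; [case: hs|exists N].
have h2 := mono _ _ mN.
rewrite distrC ger0_norm ?subr_ge0 // lerBlDr addrC -lerBlDr; apply: le_trans h2; exact: ltW.
Qed.

Lemma cn_Re (z : C) : `|complex.Re z| <= cnorm z.
Proof. by rewrite -lecR -cnE normc_ge_Re. Qed.

Lemma cn_Im (z : C) : `|complex.Im z| <= cnorm z.
Proof.
have := cn_Re (- 'i * z); rewrite cnM cnN.
have -> : cnorm ('i : C) = 1 by rewrite /cnorm normCi.
have -> : complex.Re (- 'i * z) = complex.Im z; last by rewrite mul1r.
by case: z => a b; rewrite -[('i : C)]/(0 +i* 1)%C; simpc.
Qed.

Lemma cn_le (z : C) : cnorm z <= `|complex.Re z| + `|complex.Im z|.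
Proof.
case: z => a b; rewrite /=.
have -> : (a +i* b)%C = a%:C%C + 'i * b%:C%C by rewrite -[('i : C)]/(0 +i* 1)%C; simpc.
apply: le_trans (cnD _ _) _; rewrite cnM !cnR (_ : cnorm ('i : C) = 1) ?mul1r //.
by rewrite /cnorm normCi.
Qed.

Lemma subr_add_sub (V : zmodType) (a b c e : V) : a - (c - e) = a + b - c - (b - e).
Proof. by rewrite !opprB -!addrA [b + (_ + (_ - b))]addrCA [b + (e - b)]addrC subrK [- c + _]addrC. Qed.

Lemma series_tends u B : (forall N, \sum_(n < N) cnorm (u n) <= B) ->
  exists l, tends (fun N => \sum_(n < N) u n) l.
Proof.
move=> hB.
have real (f : C -> R) : (forall w : C, `|f w| <= cnorm w) ->
    exists l, forall d, 0 < d -> exists N0, forall N, (N0 <= N)%N -> `|\sum_(n < N) f (u n) - l| <= d.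
  move=> hf.
  (* Adding the modulus makes the terms nonnegative and the partial sums monotone; it is subtracted
     again afterwards. *)
  have [||l1 h1] := @mono_lim (fun N => \sum_(n < N) (f (u n) + cnorm (u n))) (B + B).
  - move=> m n mn; rewrite -!(big_mkord xpredT (fun n => f (u n) + cnorm (u n))).
    rewrite (@big_cat_nat _ _ _ m 0 n) //= lerDl; apply: sumr_ge0 => k _.
    by have := hf (u k); rewrite ler_norml => /andP[]; lra.
  - move=> n; rewrite big_split /=; apply: lerD; last exact: hB.
    apply: le_trans (hB n); apply: ler_sum => k _.
    by apply: le_trans (hf _); exact: ler_norm.
  have [|l2 h2] := @mono_lim (fun N => \sum_(n < N) cnorm (u n)) B _ hB.
    move=> m n mn; rewrite -!(big_mkord xpredT (fun n => cnorm (u n))).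
    by rewrite (@big_cat_nat _ _ _ m 0 n) //= lerDl; apply: sumr_ge0 => k _; exact: cn_ge0.
  exists (l1 - l2) => d d0; have d2 : 0 < d / 2 by rewrite divr_gt0.
  have [N1 k1] := h1 _ d2; have [N2 k2] := h2 _ d2; exists (maxn N1 N2) => N.
  rewrite geq_max => /andP[n1 n2]; have := k1 N n1; have := k2 N n2; rewrite big_split /= => a1 a2.
  rewrite (subr_add_sub (V := R) _ (\sum_(n < N) cnorm (u n))).
  by apply: le_trans (ler_normB _ _) _; rewrite [d]splitr lerD.
have [a ha] := real _ cn_Re; have [b hb] := real _ cn_Im; exists (a +i* b)%C => d d0.
have d2 : 0 < d / 2 by rewrite divr_gt0.
have [N1 k1] := ha _ d2; have [N2 k2] := hb _ d2; exists (maxn N1 N2) => N.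
rewrite geq_max => /andP[n1 n2]; apply: le_trans (cn_le _) _; rewrite [d]splitr.
have eR (F : nat -> C) : complex.Re (\sum_(n < N) F n) = \sum_(n < N) complex.Re (F n) by rewrite raddf_sum.
have eI (F : nat -> C) : complex.Im (\sum_(n < N) F n) = \sum_(n < N) complex.Im (F n) by rewrite raddf_sum.
rewrite !raddfB /= eR eI; exact: lerD (k1 N n1) (k2 N n2).
Qed.

Lemma sum_terms_small (v : nat -> R) B : (forall n, 0 <= v n) -> (forall N, \sum_(n < N) v n <= B) ->
  forall d, 0 < d -> exists N0, forall N, (N0 <= N)%N -> v N <= d.
Proof.
move=> v0 hB d d0; have [|m hm] := @mono_cauchy R (fun N => \sum_(n < N) v n) B _ hB d d0.
  move=> m n mn; rewrite -!(big_mkord xpredT v).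
  by rewrite (@big_cat_nat _ _ _ m 0 n) //= lerDl; exact: sumr_ge0.
exists m => N mN; apply: le_trans (hm N.+1 (leqW mN)).
rewrite big_ord_recr /= -addrA addrC -addrA -[leLHS]addr0 lerD2l addrC subr_ge0.
rewrite -!(big_mkord xpredT v) (@big_cat_nat _ _ _ m 0 N) //= lerDl; exact: sumr_ge0.
Qed.

Definition gsum g (z : R) N : C := \sum_(n < N) g n * (z%:C%C) ^+ n.

(* Division of a power series by z - z0 at a zero z0. *)
Definition gdiv g (z0 : R) : nat -> C := fun n => - (gsum g z0 n.+1 / (z0%:C%C) ^+ n.+1).

Lemma gdiv_rec g z0 : z0 != 0 -> g 0%N = - (z0%:C%C * gdiv g z0 0) /\
  forall n, g n.+1 = gdiv g z0 n - z0%:C%C * gdiv g z0 n.+1.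
Proof.
move=> z00; have w0 : (z0%:C%C : C) != 0 by rewrite fmorph_eq0.
split.
  by rewrite /gdiv /gsum big_ord1 expr0 mulr1 expr1 mulrN opprK mulrC divfK.
move=> n; have wn : (z0%:C%C : C) ^+ n.+1 != 0 by rewrite expf_neq0.
rewrite /gdiv [gsum g z0 n.+2]/gsum big_ord_recr /= -/(gsum g z0 n.+1).
move: (gsum g z0 n.+1) (g n.+1) => a b; rewrite [_ ^+ n.+2]exprS.
move: wn w0; move: (z0%:C%C : C) (z0%:C%C ^+ n.+1 : C) => w wn wn0 w0; field.
by rewrite wn0.
Qed.

Lemma gsum_gdiv g z0 z N : z0 != 0 -> gsum g z N.+1 =
  (z%:C%C - z0%:C%C) * gsum (gdiv g z0) z N - z0%:C%C * gdiv g z0 N * (z%:C%C) ^+ N.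
Proof.
move=> z00; have [h0 hn] := gdiv_rec g z00; elim: N => [|N ih].
  by rewrite /gsum big_ord1 big_ord0 expr0 !mulr1 mulr0 sub0r h0.
rewrite [LHS]big_ord_recr -/(gsum g z N.+1) /= ih hn [gsum _ _ N.+1]big_ord_recr -/(gsum _ z N) /= exprS.
move: (gsum _ _ _) (gdiv _ _ _) (gdiv _ _ _) (z%:C%C : C) (z0%:C%C : C) => a b c w w0.
by move: (w ^+ N) => y; ring.
Qed.

(** At a zero, the head of the series is minus its tail, so the quotient has coefficients sum_(k >
    n) g_k z0^(k-1-n). Exchanging the sums leaves, for each k, the geometric sum (r^k - z0^k) / (r -
    z0). The slack d pays for working with a finite part K of the tail. *)
Lemma gdiv_bound g z0 r s B : 0 < z0 -> z0 <= s -> s < r ->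
  (forall N, \sum_(n < N) cnorm (g n) * r ^+ n <= B) -> tends (gsum g z0) 0 ->
  forall N, \sum_(n < N) cnorm (gdiv g z0 n) * r ^+ n <= B / (r - s).
Proof.
move=> z00 zs sr hB hz N; have r0 : 0 < r by lra.
have zr : 0 < r - z0 by lra. have B0 : 0 <= B by have := hB 0%N; rewrite big_ord0.
apply: (@le_trans _ _ (B / (r - z0))); last first.
  by apply: ler_wpM2l => //; rewrite lef_pV2 ?posrE; lra.
pose c := \sum_(n < N) r ^+ n / z0 ^+ n.+1.
have c0 : 0 <= c by apply: sumr_ge0 => n _; rewrite divr_ge0 ?exprn_ge0 ?ltW.
apply/ler_addgt0Pr => d d0; have p : 0 < d / (c + 1) by rewrite divr_gt0 // ltr_wpDl.
have [K0 hK] := hz _ p; pose K := (maxn K0 N).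
have hn n : (n < N)%N -> cnorm (gdiv g z0 n) * r ^+ n <=
    d / (c + 1) * (r ^+ n / z0 ^+ n.+1) + \sum_(k < K | (n < k)%N) cnorm (g k) * (r ^+ n * z0 ^+ (k.-1 - n)).
  move=> nN; have cz k : cnorm ((z0%:C%C : C) ^+ k) = z0 ^+ k by rewrite cnX cnR ger0_norm // ltW.
  have nK : (n.+1 <= K)%N by rewrite leq_max nN orbT.
  have e : gsum g z0 n.+1 = gsum g z0 K - \sum_(n.+1 <= k < K) g k * (z0%:C%C) ^+ k.
    rewrite /gsum -!(big_mkord xpredT (fun k => g k * (z0%:C%C) ^+ k)).
    by rewrite (@big_cat_nat _ _ _ n.+1 0 K) //= addrK.
  rewrite /gdiv cnN cnM.
  have -> : cnorm (((z0%:C%C : C) ^+ n.+1)^-1) = (z0 ^+ n.+1)^-1.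
    by rewrite -rmorphXn -fmorphV cnR ger0_norm // invr_ge0 exprn_ge0 // ltW.
  have i0 : 0 <= (z0 ^+ n.+1)^-1 * r ^+ n by rewrite mulr_ge0 ?invr_ge0 ?exprn_ge0 ?ltW.
  rewrite -mulrA e; apply: le_trans (ler_wpM2r i0 (cnB _ _)) _; rewrite mulrDl; apply: lerD.
    rewrite [r ^+ n / _]mulrC; apply: ler_wpM2r => //.
    by have := hK K (leq_maxl _ _); rewrite subr0.
  apply: le_trans (ler_wpM2r i0 (cn_sum _ _ _)) _; rewrite mulr_suml.
  rewrite (big_nat_widenl n.+1 0) //= big_mkord; apply: ler_sum => k nk.
  rewrite cnM cz -mulrA; apply: ler_wpM2l; first exact: cn_ge0.
  have -> : k = (n.+1 + (k.-1 - n))%N :> nat by clear -nk; lia.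
  rewrite exprD mulrA [_ * (z0 ^+ n.+1)^-1]mulrAC divff ?mul1r ?expf_neq0 ?gt_eqF // mulrC.
  by have -> : ((n.+1 + (k.-1 - n)).-1 - n = k.-1 - n)%N by clear; lia.
apply: (@le_trans _ _ (\sum_(n < N) (d / (c + 1) * (r ^+ n / z0 ^+ n.+1) +
    \sum_(k < K | (n < k)%N) cnorm (g k) * (r ^+ n * z0 ^+ (k.-1 - n))))).
  by apply: ler_sum => n _; exact: hn.
rewrite big_split /= -mulr_sumr addrC; apply: lerD; last first.
  by rewrite mulrAC ler_pdivrMr ?ltr_wpDl // ler_wpM2l ?(ltW d0) // lerDl.
rewrite (exchange_big_dep xpredT) //=; apply: (@le_trans _ _ (\sum_(k < K) cnorm (g k) * r ^+ k / (r - z0))).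
  apply: ler_sum => k _; rewrite -mulr_sumr -mulrA; apply: ler_wpM2l; first exact: cn_ge0.
  rewrite ler_pdivlMr //.
  apply: (@le_trans _ _ ((\sum_(n < k) r ^+ n * z0 ^+ (k.-1 - n)) * (r - z0))).
    apply: ler_wpM2r; first exact: ltW.
    have F0 n : 0 <= r ^+ n * z0 ^+ (k.-1 - n) by rewrite mulr_ge0 ?exprn_ge0 ?ltW.
    rewrite -(big_mkord (fun n => (n < k)%N) (fun n => r ^+ n * z0 ^+ (k.-1 - n))).
    rewrite -(big_mkord xpredT (fun n => r ^+ n * z0 ^+ (k.-1 - n))).
    rewrite -big_filter; apply: ler_sum_sub => //; [by rewrite filter_uniq ?iota_uniq|exact: iota_uniq|].
    by move=> n; rewrite mem_filter !mem_index_iota => /andP[-> _].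
  have := subrXX z0 r k; rewrite (eq_bigr (fun n : 'I_k => r ^+ n * z0 ^+ (k.-1 - n))).
    by move=> h; rewrite mulrC -opprB mulNr -h opprB lerBlDr lerDl exprn_ge0 // ltW.
  by move=> n _; rewrite mulrC.
by rewrite -mulr_suml ler_wpM2r ?invr_ge0 ?(ltW zr).
Qed.

(** In [gsum_gdiv] the boundary term tends to 0, being bounded by z0 times a term of a convergent
    series, and the factor z - z0 can be divided out. *)
Lemma gdiv_zero g z0 z r s B : 0 < z0 -> z0 <= s -> s < r -> 0 < z -> z <= s -> z != z0 ->
  (forall N, \sum_(n < N) cnorm (g n) * r ^+ n <= B) -> tends (gsum g z0) 0 -> tends (gsum g z) 0 ->
  tends (gsum (gdiv g z0) z) 0.
Proof.
move=> z00 zs sr z0' zs' zz hB h0 hz; have hb := gdiv_bound z00 zs sr hB h0.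
have w0 : (z%:C%C : C) - z0%:C%C != 0 by rewrite -rmorphB fmorph_eq0 subr_eq0.
have c0 : 0 < cnorm ((z%:C%C : C) - z0%:C%C).
  by rewrite -rmorphB cnR normr_gt0 subr_eq0.
have r0 : 0 <= r by lra.
move=> d d0; have p : 0 < d * cnorm ((z%:C%C : C) - z0%:C%C) / 2 by rewrite divr_gt0 ?mulr_gt0.
have p' : 0 < d * cnorm ((z%:C%C : C) - z0%:C%C) / 2 / z0 by rewrite divr_gt0.
have [N1 h1] := hz _ p; have [N2 h2] := sum_terms_small (fun n => mulr_ge0 (cn_ge0 (gdiv g z0 n)) (exprn_ge0 n r0)) hb p'.
exists (maxn N1 N2) => N; rewrite geq_max => /andP[n1 n2].
have e : gsum (gdiv g z0) z N - 0 =
    (gsum g z N.+1 - 0 + z0%:C%C * gdiv g z0 N * (z%:C%C) ^+ N) / (z%:C%C - z0%:C%C).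
  by rewrite !subr0 (gsum_gdiv g z N (lt0r_neq0 z00)) subrK mulrC mulKf.
have cV (w : C) : w != 0 -> cnorm w^-1 = (cnorm w)^-1.
  move=> wn; apply: (mulfI (x := cnorm w)); first by apply/eqP => /cn_eq0 /eqP; rewrite (negPf wn).
  by rewrite -cnM !divff ?cn1 //; apply/eqP => /cn_eq0 /eqP; rewrite (negPf wn).
rewrite e cnM cV // ler_pdivrMr //; apply: le_trans (cnD _ _) _.
rewrite [d * _]splitr; apply: lerD; first exact: h1 (leqW n1).
rewrite !cnM cnX !cnR !ger0_norm ?(ltW z00) ?(ltW z0') //.
rewrite -mulrA mulrC -ler_pdivlMr //; apply: le_trans (h2 N n2).
apply: ler_wpM2l; first exact: cn_ge0.
by apply: lerXn2r; rewrite ?nnegrE ?(ltW z0') //; lra.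
Qed.

(** Dividing by z - z0 costs a factor 1 / (r - s) in the bound and multiplying back costs at most 2
    s; as r >= 5 s, each zero gains a factor 2 s / (r - s) <= 1/2. *)
Lemma zeros_bound g r s B (zs : seq R) : 0 < s -> 5%:R * s <= r ->
  (forall N, \sum_(n < N) cnorm (g n) * r ^+ n <= B) -> uniq zs ->
  (forall z, z \in zs -> [/\ 0 < z, z <= s & tends (gsum g z) 0]) ->
  forall N, \sum_(n < N) cnorm (g n) * s ^+ n <= 2^-1 ^+ size zs * B.
Proof.
move=> s0 sr; have sr' : s < r by lra. have r0 : 0 < r by lra.
elim: zs g B => [|z0 zs ih] g B hB /=.
  move=> _ _ N; rewrite expr0 mul1r; apply: le_trans (hB N); apply: ler_sum => n _.
  apply: ler_wpM2l; first exact: cn_ge0.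
  by apply: lerXn2r; rewrite ?nnegrE ?(ltW s0) ?(ltW r0) // ltW.
move=> /andP[z0zs uzs] hz N; have [z00 z0s hz0] := hz z0 (mem_head _ _).
have ih' := ih (gdiv g z0) _ (gdiv_bound z00 z0s sr' hB hz0) uzs.
have {}ih : forall N, \sum_(n < N) cnorm (gdiv g z0 n) * s ^+ n <= 2^-1 ^+ size zs * (B / (r - s)).
  apply: ih' => z zzs; have zin : z \in z0 :: zs by rewrite in_cons zzs orbT.
  have [k1 k2 k3] := hz z zin; split=> //; apply: (gdiv_zero z00 z0s sr' k1 k2 _ hB hz0 k3).
  by apply: contraNneq z0zs => <-.
have [g0 gn] := gdiv_rec g (lt0r_neq0 z00).
have hsum K : \sum_(n < K.+1) cnorm (g n) * s ^+ n <=
    z0 * (\sum_(n < K.+1) cnorm (gdiv g z0 n) * s ^+ n) + s * \sum_(n < K) cnorm (gdiv g z0 n) * s ^+ n.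
  have cz : cnorm (z0%:C%C : C) = z0 by rewrite cnR ger0_norm // ltW.
  elim: K => [|K ihK].
    by rewrite !big_ord1 big_ord0 mulr0 addr0 expr0 !mulr1 {1}g0 cnN cnM cz.
  rewrite big_ord_recr /= [X in z0 * X]big_ord_recr [X in s * X]big_ord_recr /= !mulrDr.
  rewrite addrACA; apply: lerD ihK _; rewrite gn.
  apply: le_trans (ler_wpM2r (exprn_ge0 _ (ltW s0)) (cnB _ _)) _; rewrite mulrDl cnM cz addrC.
  rewrite [s * (_ * _)]mulrCA -exprS -mulrA addrC.
  exact: lexx.
case: N => [|N]; first by rewrite big_ord0 mulr_ge0 ?exprn_ge0 // (le_trans _ (hB 0%N)) // big_ord0.
apply: le_trans (hsum N) _.
have q0 : 0 <= 2^-1 ^+ size zs * (B / (r - s)).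
  by have := ih 0%N; rewrite big_ord0.
apply: (@le_trans _ _ (s * (2^-1 ^+ size zs * (B / (r - s))) + s * (2^-1 ^+ size zs * (B / (r - s))))).
  apply: lerD; last by apply: ler_wpM2l; [exact: ltW|exact: ih].
  by apply: ler_pM => //; [exact: ltW|apply: sumr_ge0 => n _; rewrite mulr_ge0 ?cn_ge0 ?exprn_ge0 ?ltW].
rewrite exprS; set y := 2^-1 ^+ size zs; have y0 : 0 <= y by rewrite exprn_ge0.
have B0 : 0 <= B by have := hB 0%N; rewrite big_ord0.
rewrite (_ : _ + _ = y * B * (2 * s / (r - s))); last by field; lra.
rewrite -[leRHS]mulrA [leRHS]mulrC; apply: ler_wpM2l; first exact: mulr_ge0.
by rewrite ler_pdivrMr; lra.
Qed.

(** Arbitrarily many zeros give the bound 2^(-M) B for every M, without any compactness or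
    accumulation argument. *)
Lemma zeros_eq0 g r s B (Z : set R) : 0 < s -> 5%:R * s <= r ->
  (forall N, \sum_(n < N) cnorm (g n) * r ^+ n <= B) -> infinite_set Z ->
  (forall z, Z z -> [/\ 0 < z, z <= s & tends (gsum g z) 0]) -> forall n, g n = 0.
Proof.
move=> s0 sr hB iZ hZ n; apply: cn_eq0; apply/eqP; rewrite eq_le cn_ge0 andbT.
have B0 : 0 <= B by have := hB 0%N; rewrite big_ord0.
suff : cnorm (g n) * s ^+ n <= 0 by rewrite pmulr_lle0 ?exprn_gt0.
apply/ler_addgt0Pr => d d0; rewrite add0r.
pose M := Num.bound (B / d); have [X XZ hM] := infinite_set_fset M iZ.
apply: (@le_trans _ _ (\sum_(k < n.+1) cnorm (g k) * s ^+ k)).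
  by rewrite big_ord_recr /= lerDr; apply: sumr_ge0 => k _; rewrite mulr_ge0 ?cn_ge0 ?exprn_ge0 ?ltW.
apply: le_trans (zeros_bound s0 sr hB (fset_uniq X) (fun z zX => hZ z (XZ z zX)) n.+1) _.
have hb : B / d < M%:R by rewrite archi_boundP // divr_ge0 // ltW.
have h2 : (M%:R : R) <= 2 ^+ #|` X|.
  rewrite -natrX ler_nat; apply: leq_trans hM _; exact/ltnW/ltn_expl.
rewrite exprVn mulrC ler_pdivrMr ?exprn_gt0 // mulrC -ler_pdivrMr //.
by apply: le_trans h2; exact: ltW.
Qed.

Lemma itv_not_countable s : 0 < s -> ~ countable [set z : R | 0 < z <= s].
Proof.
move=> s0 /countable_lebesgue_measure0.
have -> : [set z : R | 0 < z <= s] = `]0, s]%classic.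
  by apply/seteqP; split=> z /=; rewrite in_itv.
by rewrite lebesgue_measure_itv /= lte_fin s0 sube0 => /eqP; rewrite eqe gt_eqF.
Qed.

Local Notation L := (Lam R).

(* Finite support at every point forces a common finite support: otherwise countably many nonzero
   power series would have zeros filling up an interval. *)
Lemma uniform_support (a : nat -> L) r : 0 < r ->
  (forall J, exists B, forall N, \sum_(n < N) cnorm (a n J) * r ^+ n <= B) ->
  (forall z, 0 < z -> z < r -> exists v : L, forall J, tends (gsum (fun n => a n J) z) (v J)) ->
  exists V, forall n, supported V (a n).
Proof.
move=> r0 hB hv; pose s := r / 5%:R; have s0 : 0 < s by rewrite divr_gt0.
have sr : 5%:R * s <= r by rewrite /s mulrC divfK.
have s1 : s < r by rewrite ltr_pdivrMr // ltr_pMr // ltr1n.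
pose V (N : nat) : {fset nat} := [fset i in iota 0 N]%fset.
have inV N i : (i \in V N) = (i < N)%N by rewrite /V !inE mem_iota.
pose E N : set R := [set z | 0 < z <= s /\ exists2 v : L, supported (V N) v &
  forall J, tends (gsum (fun n => a n J) z) (v J)].
have [N iN] : exists N, infinite_set (E N).
  apply: contrapT => h; apply: (itv_not_countable s0).
  have -> : [set z : R | 0 < z <= s] = \bigcup_N E N.
    apply/seteqP; split=> [z /= /andP[z0 zs]|z [N _ []]//].
    have [v hvv] := hv z z0 (le_lt_trans zs s1); have [U hU] := supported_ex v.
    exists (\max_(i <- U) i).+1 => //; split; first by rewrite z0.
    exists v => //; apply: supportedW hU; apply/fsubsetP => i iU.
    have le_i : (i <= \max_(j <- U) j)%N by rewrite (big_rem _ iU) leq_maxl.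
    by rewrite inV ltnS.
  apply: bigcup_countable => // N _; apply: finite_set_countable.
  by apply: contrapT => iN; apply: h; exists N.
exists (V N) => n J JV; have [B hBJ] := hB J.
(* At the points of [E N] the value has no coefficient at J because J is not contained in [V N]; the
   scalar series at J has infinitely many zeros. *)
apply: (@zeros_eq0 (fun n => a n J) r s B (E N) s0 sr hBJ iN) => z [/andP[z0 zs] [v sv hvv]].
by split=> //; have := hvv J; rewrite sv.
Qed.

End ScalarSeries.

(** * Finite supports and inverse values *)

Section Projections.
Variable R : realType.
Local Notation C := (R[i]).
Local Notation L := (Lam R).
Local Notation sg := (@lam_sign R).
Local Notation S := (sser R).
Local Notation sgS := (@sser_sign R).
Local Notation spoint := (spoint R).
Local Notation x := (varx R).
Local Notation pp := (phip R).
Local Notation pm := (phim R).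
Implicit Types (a b : L) (I J K U V W : {fset nat}) (e l t r s : R) (f g h : S) (p q : spoint) (G F : triple R).

Definition cut_fun W (g : {fset nat} -> C) : ghat R := fun I => if (I `<=` W)%fset then g I else 0.

Lemma cut_fin W (g : {fset nat} -> C) : cut_fun W g \in @fin_supp R.
Proof.
apply/asboolP; apply: (@sub_finite_set _ _ [set` fpowerset W]); last exact: finite_fset.
by move=> I /=; rewrite /cut_fun fpowersetE; case: ifP; rewrite ?eqxx.
Qed.

Definition cut W (g : {fset nat} -> C) : L := MkLam (cut_fin W g).

Lemma cutE W (g : {fset nat} -> C) I : cut W g I = if (I `<=` W)%fset then g I else 0. Proof. by []. Qed.

Lemma supported_cut W (g : {fset nat} -> C) : supported W (cut W g).
Proof. by move=> I /negPf IW; rewrite cutE IW. Qed.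

(** Setting all generators outside W to 0; by [prLM] this is an endomorphism of the algebra. *)
Definition proj_lam W a : L := cut W (fun I => a I).

Lemma prLE W a I : proj_lam W a I = if (I `<=` W)%fset then a I else 0. Proof. by []. Qed.

Lemma prL_id W a : supported W a -> proj_lam W a = a.
Proof. by move=> h; apply: lamP => I; rewrite prLE; case: ifP => // /negbT /h ->. Qed.

Lemma supported_prL W a : supported W (proj_lam W a). Proof. exact: supported_cut. Qed.

Lemma prLD W a b : proj_lam W (a + b) = proj_lam W a + proj_lam W b.
Proof. by apply: lamP => I; rewrite lamDE !prLE; case: ifP; rewrite ?addr0. Qed.
Lemma prLN W a : proj_lam W (- a) = - proj_lam W a.
Proof. by apply: lamP => I; rewrite lamNE !prLE; case: ifP; rewrite ?oppr0. Qed.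
Lemma prL0 W : proj_lam W 0 = 0.
Proof. by apply: lamP => I; rewrite prLE lam0E; case: ifP. Qed.
Lemma prL1 W : proj_lam W 1 = 1. Proof. exact/prL_id/supported1. Qed.
Lemma prL_sg W a : proj_lam W (sg a) = sg (proj_lam W a).
Proof. by apply: lamP => I; rewrite lam_signE !prLE lam_signE; case: ifP; rewrite ?mulr0. Qed.

Lemma prLM W a b : proj_lam W (a * b) = proj_lam W a * proj_lam W b.
Proof.
apply: lamP => I; rewrite prLE; case: ifP => [IW|/negbT IW]; last first.
  by rewrite (supportedM (@supported_prL W a) (@supported_prL W b) IW).
rewrite !lamME big_seq [RHS]big_seq; apply: eq_bigr => J; rewrite fpowersetE => JI.
by rewrite !prLE (fsubset_trans JI IW) (fsubset_trans (fsubsetDl _ _) IW).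
Qed.

Lemma nL_prL W I e a : 0 <= e -> nL I e (proj_lam W a) <= nL I e a.
Proof.
move=> e0; apply: ler_sum => J _; rewrite prLE; case: ifP => // _.
by rewrite cn0 mul0r mulr_ge0 ?cn_ge0 ?exprn_ge0.
Qed.

Definition proj_sext W (u : sext R) : sext R := SExt (proj_lam W (c0 u)) (proj_lam W (cp u)) (proj_lam W (cm u)) (proj_lam W (cpm u)).
Definition proj_ser W f : S := fun n => proj_sext W (f n).

Lemma prED W u v : proj_sext W (u + v) = proj_sext W u + proj_sext W v.
Proof. by apply: sextP; rewrite /= prLD. Qed.
Lemma prE0 W : proj_sext W 0 = 0.
Proof. by apply: sextP; rewrite /= prL0. Qed.
Lemma prEM W u v : proj_sext W (u * v) = proj_sext W u * proj_sext W v.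
Proof. by apply: sextP; rewrite /= ?(prLD, prLN, prLM, prL_sg). Qed.

Lemma prSD W f g : proj_ser W (f + g) = proj_ser W f + proj_ser W g.
Proof. by apply: sserP => n; exact: prED. Qed.
Lemma prS0 W : proj_ser W 0 = 0.
Proof. by apply: sserP => n; exact: prE0. Qed.
Lemma prS_sum W (T : Type) (s : seq T) P (F : T -> S) :
  proj_ser W (\sum_(k <- s | P k) F k) = \sum_(k <- s | P k) proj_ser W (F k).
Proof. exact: (big_morph (proj_ser W) (prSD W) (prS0 W)). Qed.
Lemma prSM W f g : proj_ser W (f * g) = proj_ser W f * proj_ser W g.
Proof.
apply: sserP => n; rewrite /proj_ser !sserME (big_morph (proj_sext W) (prED W) (prE0 W)).
by apply: eq_bigr => i _; exact: prEM.
Qed.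
Lemma prS_const W a : proj_ser W (constS a) = constS (proj_lam W a).
Proof. by apply: sserP => -[|n]; apply: sextP; rewrite /= ?prL0. Qed.
Lemma prS1 W : proj_ser W 1 = 1. Proof. by rewrite -constS1 prS_const prL1. Qed.
Lemma prSX W f n : proj_ser W (f ^+ n) = proj_ser W f ^+ n.
Proof. by elim: n => [|n ih]; rewrite ?expr0 ?prS1 // !exprS prSM ih. Qed.
Lemma prS_sg W f : proj_ser W (sgS f) = sgS (proj_ser W f).
Proof. by apply: sserP => n; apply: sextP; rewrite /= ?prLN prL_sg. Qed.
Lemma prS_varx W : proj_ser W x = x.
Proof. by apply: sserP => -[|[|n]]; apply: sextP; rewrite /= ?prL0 ?prL1. Qed.
Lemma prS_phi W : proj_ser W pp = pp /\ proj_ser W pm = pm.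
Proof. by split; apply: sserP => -[|n]; apply: sextP; rewrite /= ?prL0 ?prL1. Qed.

Lemma wt_prS W k f : wt k f -> wt k (proj_ser W f).
Proof.
by move=> h n; have [h1 h2 h3 h4] := h n; split=> hn; rewrite /= ?h1 ?h2 ?h3 ?h4 ?prL0.
Qed.

Definition proj_triple W G : triple R := (proj_ser W G.1.1, proj_ser W G.1.2, proj_ser W G.2).

Lemma prS_scomp W f G : wt 2 G.1.1 -> proj_ser W (scomp f G) = scomp (proj_ser W f) (proj_triple W G).
Proof.
move=> wX; apply: sserP => n; rewrite /proj_ser !(@scompE _ _ _ n.+2) //; last exact: wt_prS.
have := prS_sum W (index_enum 'I_n.+2) xpredT (fun k : 'I_n.+2 => cterms f G k).
move=> /(congr1 (fun f : S => f n)); rewrite {1}/proj_ser => ->.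
congr (_ n); apply: eq_bigr => k _; rewrite /cterms /=.
by rewrite !(prSD, prSM, prS_const, prSX).
Qed.

Lemma nE_prE W I e t u : 0 <= e -> 0 <= t -> nE I e t (proj_sext W u) <= nE I e t u.
Proof.
move=> e0 t0; have h a := nL_prL W I a e0; have t2 : 0 <= t ^+ 2 := exprn_ge0 2 t0.
by rewrite /nE /= !lerD // ler_wpM2l // lerD.
Qed.

Lemma Q_prS W I e l t M f : 0 <= e -> 0 <= l -> 0 <= t -> Q I e l t M (proj_ser W f) <= Q I e l t M f.
Proof. by move=> e0 l0 t0; apply: ler_sum => n _; apply: ler_wpM2r; rewrite ?exprn_ge0 ?nE_prE. Qed.

Lemma conv_prS W r f : 0 <= r -> conv r f -> conv r (proj_ser W f).
Proof. by move=> r0 h I; have [B hB] := h I; exists B => M; apply: le_trans (hB M); exact: Q_prS. Qed.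

Lemma shrinks_prT W l r G s : shrinks l r G s -> shrinks l r (proj_triple W G) s.
Proof.
move=> [l0 l1 r0 h]; split=> // I; have [e [e0 e1 he]] := h I; exists e; split=> // e' p1 p2.
have t0 : 0 <= l ^+ 2 * r by rewrite mulr_ge0 ?exprn_ge0 ?ltW.
have [k1 k2 k3] := he e' p1 p2.
by split=> M; [apply: le_trans (k1 M)|apply: le_trans (k2 M)|apply: le_trans (k3 M)];
  apply: Q_prS => //; exact: ltW.
Qed.

Lemma supportedD W a b : supported W a -> supported W b -> supported W (a + b).
Proof. by move=> ha hb I IW; rewrite lamDE ha ?hb ?addr0. Qed.
Lemma supportedN W a : supported W a -> supported W (- a).
Proof. by move=> ha I IW; rewrite lamNE ha ?oppr0. Qed.
Lemma supported_sum W (T : Type) (s : seq T) P (F : T -> L) :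
  (forall k, supported W (F k)) -> supported W (\sum_(k <- s | P k) F k).
Proof. by move=> h; apply: big_rec => [I _|k a _ ha]; [exact: lam0E|exact: supportedD]. Qed.
Lemma supportedX W a n : supported W a -> supported W (a ^+ n).
Proof. by move=> h; elim: n => [|n ih]; [exact: supported1|rewrite exprS; exact: supportedM]. Qed.

Definition point_supported W p := [/\ supported W p.1.1, supported W p.1.2 & supported W p.2].

Lemma supported_pev W f p N : supported W p.1.1 -> (forall n, supported W (odd_eval p (f n))) ->
  supported W (partial_eval N f p).
Proof. by move=> hz hf; apply: supported_sum => n; apply: supportedM => //; exact: supportedX. Qed.

Lemma supported_prE W p u : point_supported W p -> supported W (odd_eval p (proj_sext W u)).
Proof.
by move=> [_ hp hm]; rewrite /odd_eval /=; do !apply: supportedD; do ?apply: supportedM => //; exact: supported_prL.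
Qed.

Lemma prL_pev W f p N : point_supported W p -> proj_lam W (partial_eval N f p) = partial_eval N (proj_ser W f) p.
Proof.
move=> [hz hp hm]; rewrite /partial_eval (big_morph (proj_lam W) (prLD W) (prL0 W)); apply: eq_bigr => n _.
rewrite prLM (prL_id (supportedX n hz)) /odd_eval /= !prLD !prLM.
by rewrite (prL_id hp) (prL_id hm).
Qed.

Lemma pev_sg N f p : partial_eval N (sgS f) p = sg (partial_eval N f p).
Proof.
rewrite /partial_eval (big_morph sg (@lam_signD R) (@lam_sign0 R)); apply: eq_bigr => n _.
rewrite lam_signM -[in RHS](lam0_valX p.1.1 n) lam_sign0_even lam0_valX; congr (_ * _).
rewrite /odd_eval /= !lam_signD !lam_signM !lam_sign1_odd.
by rewrite !(mulrN, mulNr) opprK.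
Qed.

Lemma value_sg f p v : value f p v -> value (sgS f) p (sg v).
Proof.
by move=> h I d /(h I)[N0 hN]; exists N0 => N /hN; rewrite pev_sg -lam_signB nL_sg.
Qed.

Lemma value_even f p v : sgS f = f -> value f p v -> (to_even v : L) = v.
Proof. by move=> e h; apply: to_evenK; by apply: (value_unique (value_sg h)); rewrite e. Qed.

Lemma valueN f p v : value f p v -> value (- f) p (- v).
Proof.
move=> h I; apply: (limL_eventually (N1 := 0)) (limLN (h I)) => N _; by rewrite pevN.
Qed.

Lemma value_odd f p v : sgS f = - f -> value f p v -> (to_odd v : L) = v.
Proof.
move=> e h; apply: to_oddK; apply: (value_unique (value_sg h)); rewrite e; exact: valueN.
Qed.

(** Coefficientwise limits always exist within the radius of convergence. What could fail is that
    they form an element of Lam; here the partial sums stay in the finite algebra on W, so the limit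
    may be cut down to W. *)
Lemma value_ex W r f p : conv r f -> cnorm (body p.1.1) < r -> (forall N, supported W (partial_eval N f p)) ->
  exists2 v, supported W v & value f p v.
Proof.
move=> cf hp hs.
have lim J : exists l : C, tends (fun N => partial_eval N f p J) l.
  have [e [l [t [/andP[e0 e1] l0 t0 [hz ha hb] [B hB]]]]] := conv_regular cf hp J.
  have eJ : 0 < e ^+ #|` J| by rewrite exprn_gt0.
  have [N|l' hl] := @series_tends R (fun n => (odd_eval p (f n) * (p.1.1 : L) ^+ n) J) (B / e ^+ #|` J|).
    rewrite ler_pdivlMr // mulr_suml; apply: le_trans (hB N); apply: ler_sum => n _.
    apply: le_trans (nL_coef _ (ltW e0) (fsubset_refl J)) _.
    exact: (nL_term (ltW e0) l0 t0 hz ha hb).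
  by exists l' => d /hl[N0 hN]; exists N0 => N /hN; rewrite /partial_eval lam_sumE.
have [l hl] := choice lim; exists (cut W l); first exact: supported_cut.
move=> I; apply: limL_of_coef => J d d0; rewrite cutE; case: ifP => [_|/negbT JW]; first exact: hl.
by exists 0%N => N _; rewrite hs // subrr cn0 ltW.
Qed.

(** The ideal generated by the zeta_k with k in U: each monomial that occurs meets U. *)
Definition in_ideal U a := forall J, [disjoint J & U]%fset -> a J = 0.

Lemma in_idealMl U a b : in_ideal U b -> in_ideal U (a * b).
Proof.
move=> h J JU; rewrite lamME big1 // => K _; rewrite h ?mulr0 //.
by apply: fdisjointWl JU; exact: fsubsetDl.
Qed.

Lemma in_idealMr U a b : in_ideal U a -> in_ideal U (a * b).
Proof.
move=> h J JU; rewrite lamME big_seq big1 // => K; rewrite fpowersetE => KJ.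
by rewrite h ?mulr0 ?mul0r //; apply: fdisjointWl JU.
Qed.

Lemma in_idealD U a b : in_ideal U a -> in_ideal U b -> in_ideal U (a + b).
Proof. by move=> ha hb J JU; rewrite lamDE ha ?hb ?addr0. Qed.

Lemma in_ideal_sum U (T : Type) (s : seq T) P (F : T -> L) :
  (forall k, in_ideal U (F k)) -> in_ideal U (\sum_(k <- s | P k) F k).
Proof. by move=> h; apply: big_rec => [I _|k a _ ha]; [exact: lam0E|exact: in_idealD]. Qed.

Lemma in_idealW U V a : (U `<=` V)%fset -> in_ideal U a -> in_ideal V a.
Proof. by move=> UV h J JV; apply: h; apply: fdisjointWr JV. Qed.

Lemma in_ideal_odd U (th : L) : sg th = - th -> supported U th -> in_ideal U th.
Proof.
move=> ho hs J JU; have [JU'|/hs//] := boolP (J `<=` U)%fset.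
have J0 : J = fset0 by apply/eqP; rewrite -fsubset0; move: JU; rewrite -fsetI_eq0 (fsetIidPl JU') => /eqP ->.
have := congr1 (fun a : L => a J) ho; rewrite J0 lam_signE cardfs0 mul1r lamNE => /eqP.
by rewrite -addr_eq0 -mulr2n mulrn_eq0 /= => /eqP.
Qed.

Lemma in_ideal_prL U W a : in_ideal U a -> in_ideal U (proj_lam W a).
Proof. by move=> h J JU; rewrite prLE h // if_same. Qed.

Lemma in_ideal_value U f p v : (forall n, in_ideal U (c0 (f n))) -> in_ideal U p.1.2 -> in_ideal U p.2 ->
  value f p v -> in_ideal U v.
Proof.
move=> hf hp hm hv J JU; apply/cn_eq0/eqP; rewrite eq_le cn_ge0 andbT; apply/ler_addgt0Pr => d d0.
have [N0 hN] := hv J d d0; have := le_trans (nL_coef1 J _) (hN N0 (leqnn _)).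
rewrite lamDE lamNE (_ : partial_eval N0 f p J = 0) ?sub0r ?cnN ?add0r //.
apply: (@in_ideal_sum U) JU => n; apply: in_idealMr; rewrite /odd_eval.
do !apply: in_idealD; [exact: hf|exact: in_idealMl..].
Qed.

(** The factor contributed by b lies in W and contains some k in U, so the complementary factor J of
    K omits k and cannot lie in W; such coefficients of a vanish by hypothesis. *)
Lemma mul_coef0 W U a b K : supported W b -> in_ideal U b -> ~~ (K `<=` W)%fset ->
  (forall k J, k \in U -> k \in K -> k \notin J -> (J `<=` K)%fset -> ~~ (J `<=` W)%fset -> a J = 0) ->
  (a * b) K = 0.
Proof.
move=> sb ib KW h; rewrite lamME big_seq big1 // => J; rewrite fpowersetE => JK.
have [D|] := boolP [disjoint (K `\` J)%fset & U]%fset; first by rewrite ib ?mulr0.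
rewrite -fsetI_eq0 => /fset0Pn[k]; rewrite in_fsetI in_fsetD => /andP[/andP[kJ kK] kU].
have [DW|/sb ->] := boolP (K `\` J `<=` W)%fset; last by rewrite mulr0.
rewrite (h k J) ?mulr0 ?mul0r //; apply: contraNN KW => JW.
by rewrite -(fsetUDid JK) fsubUset JW.
Qed.

Lemma coef_of_zeta W a k K : supported W (a * zeta R k) -> k \notin K -> ~~ (K `<=` W)%fset -> a K = 0.
Proof.
move=> h kK KW; apply: cn_eq0; rewrite -(cn_mul_zeta a kK) h ?cn0 //.
by rewrite fsubUset (negPf KW) andbF.
Qed.

Definition odd_point (th ph : Lam1 R) : spoint := (0, th, ph).

Lemma odd_eval00 u : odd_eval (odd_point 0 0) u = c0 u.
Proof. by change (c0 u + cp u * 0 + cm u * 0 + cpm u * 0 * 0 = c0 u); rewrite !mulr0 !addr0. Qed.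
Lemma odd_evalp th u : odd_eval (odd_point th 0) u = c0 u + cp u * th.
Proof. by change (c0 u + cp u * th + cm u * 0 + cpm u * th * 0 = c0 u + cp u * th); rewrite !mulr0 !addr0. Qed.
Lemma odd_evalm ph u : odd_eval (odd_point 0 ph) u = c0 u + cm u * ph.
Proof.
change (c0 u + cp u * 0 + cm u * ph + cpm u * 0 * ph = c0 u + cm u * ph).
by rewrite !mulr0 mul0r !addr0.
Qed.

(* The odd coordinates of p only involve the generators in U, so it is enough to test the
   coefficients of u on those generators. *)
Lemma supported_es W U p u : point_supported W p -> in_ideal U p.1.2 -> in_ideal U p.2 ->
  (forall th ph : Lam1 R, th \in 0 :: [seq zeta R k | k <- U] -> ph \in 0 :: [seq zeta R k | k <- U] ->
    supported W (odd_eval (odd_point th ph) u)) -> supported W (odd_eval p u).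
Proof.
move=> [_ sp sm] ip im h; have z0 := mem_head (0 : Lam1 R) [seq zeta R k | k <- U].
have zU k : k \in U -> zeta R k \in 0 :: [seq zeta R k | k <- U].
  by move=> kU; rewrite in_cons map_f ?orbT.
have h00 : supported W (c0 u) by rewrite -odd_eval00; exact: h.
have hp k : k \in U -> supported W (cp u * zeta R k).
  move=> kU; have := supportedD (h _ 0 (zU k kU) z0) (supportedN h00).
  by rewrite odd_evalp addrC addKr.
have hm k : k \in U -> supported W (cm u * zeta R k).
  move=> kU; have := supportedD (h 0 _ z0 (zU k kU)) (supportedN h00).
  by rewrite odd_evalm addrC addKr.
have hpm k k' : k \in U -> k' \in U -> supported W (cpm u * zeta R k * zeta R k').
  move=> kU kU'; have := supportedD (h _ _ (zU k kU) (zU k' kU'))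
    (supportedN (supportedD (supportedD h00 (hp k kU)) (hm k' kU'))).
  by rewrite /odd_eval /= [X in X + _]addrC addrK.
rewrite /odd_eval; do !apply: supportedD; first exact: h00.
- move=> K KW; apply: (mul_coef0 sp ip KW) => k J kU _ kJ _ JW; exact: (coef_of_zeta (hp k kU)).
- move=> K KW; apply: (mul_coef0 sm im KW) => k J kU _ kJ _ JW; exact: (coef_of_zeta (hm k kU)).
- move=> K KW; apply: (mul_coef0 sm im KW) => k J kU _ kJ _ JW.
  apply: (mul_coef0 sp ip JW) => k' J' kU' kJ' kJ'' JJ' JW'.
  have kk : k \notin (k' |` J')%fset.
    rewrite in_fset1U negb_or; apply/andP; split; first by apply: contraNneq kJ => ->.
    by apply: contraNN kJ; exact: (fsubsetP JJ').
  apply: cn_eq0; rewrite -(cn_mul_zeta _ kJ'') -(cn_mul_zeta _ kk) hpm ?cn0 //.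
  by rewrite !fsubUset (negPf JW') !andbF.
Qed.

Lemma support_uniform r f : 0 < r -> conv r f ->
  (forall z, 0 < z -> z < r -> forall th ph, exists v, value f (rpoint z%:C%C th ph) v) ->
  forall q : Lam1 R * Lam1 R, exists V, forall n, supported V (odd_eval (odd_point q.1 q.2) (f n)).
Proof.
move=> r0 cf hv [th ph]; apply: (@uniform_support R _ r r0) => [J|z z0 zr].
  have [|e [e0 e1 he]] := @small_point R J (odd_point th ph) r 1 _ ltr01; first by rewrite -[body _]/(0 : C) cn0.
  have [_ hp hm] := he e e0 (lexx e); have [B hB] := cf J; exists (B / e ^+ #|` J|) => N.
  rewrite ler_pdivlMr ?exprn_gt0 // mulr_suml; apply: le_trans (hB N).
  apply: (@le_trans _ _ (Q J e 1 r N f)); last by apply: Q_le => //; exact: ltW.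
  apply: ler_sum => n _; rewrite mulrAC; apply: ler_wpM2r; first by rewrite exprn_ge0 // ltW.
  apply: le_trans (nL_coef _ (ltW e0) (fsubset_refl J)) _.
  exact: (nL_es (ltW e0) ler01 hp hm).
have [v hvv] := hv z z0 zr th ph; exists v => J d d0; have [N0 hN] := hvv J d d0; exists N0 => N NN.
apply: le_trans (hN N NN); rewrite (_ : gsum _ z N - v J = (partial_eval N f (rpoint z%:C%C th ph) - v) J); first exact: nL_coef1.
rewrite lamDE lamNE; congr (_ - _); rewrite /partial_eval lam_sumE; apply: eq_bigr => n _.
by have -> : ((rpoint z%:C%C th ph).1.1 : L) ^+ n = ((z%:C%C : C) ^+ n)%:A := scalarX _ _; rewrite lam_scalar_coef.
Qed.

Lemma common_support (T : eqType) (A : T -> {fset nat} -> Prop) (s : seq T) U :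
  (forall k, exists V, A k V) -> (forall k V W, (V `<=` W)%fset -> A k V -> A k W) ->
  exists2 W, (U `<=` W)%fset & forall k, k \in s -> A k W.
Proof.
move=> hA mono; elim: s => [|k s [W UW hW]]; first by exists U.
have [V hV] := hA k; exists (V `|` W)%fset; first exact: fsubset_trans UW (fsubsetUr _ _).
move=> j; rewrite in_cons => /orP[/eqP ->|/hW]; first exact: mono (fsubsetUl _ _) hV.
exact/mono/fsubsetUr.
Qed.

(** On the first component, the ideal generated by phi+, phi- and the zeta_k with k in U. As a space
    cut out by coefficients it falls under [stab_eop], so its stability passes from a series to its
    inverse. *)
Definition ideal_space U : set (S * S) :=
  [set p | forall n J, [disjoint J & U]%fset -> c0 (p.1 n) J = 0].

Lemma coef_space_ideal U : coef_space (ideal_space U).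
Proof.
exists (fun l : S * S -> C => exists n J, [disjoint J & U]%fset /\ l = fun p : S * S => c0 (p.1 n) J); split.
  move=> _ [n [J [_ ->]]]; split=> //.
  by have [N h] := wt_local R n; exists N => f g hf hg; have [/= -> _] := h f g hf hg.
apply/seteqP; split=> [p h _ [n [J [JU ->]]]|p h n J JU]; first exact: h.
by apply: (h (fun p : S * S => c0 (p.1 n) J)); exists n, J.
Qed.

Lemma c0S_mul f g U : (forall n, in_ideal U (c0 (f n))) -> forall n, in_ideal U (c0 ((g * f) n)).
Proof.
move=> h n; rewrite sserME (big_morph (@c0 R) (id1 := 0) (op1 := +%R)) //.
by apply: in_ideal_sum => i; exact: in_idealMl.
Qed.

Lemma c0S_mulr f g U : (forall n, in_ideal U (c0 (f n))) -> forall n, in_ideal U (c0 ((f * g) n)).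
Proof.
move=> h n; rewrite sserME (big_morph (@c0 R) (id1 := 0) (op1 := +%R)) //.
by apply: in_ideal_sum => i; exact: in_idealMr.
Qed.

(** In f (T x, T phi+, T phi-) each term contains either a coefficient of f lying in the ideal or
    one of T phi+, T phi-. *)
Lemma stab_ideal U T : good T -> (forall n, in_ideal U (c0 (T pp n))) -> (forall n, in_ideal U (c0 (T pm n))) ->
  stab (ideal_space U) T.
Proof.
move=> gT hP hM [f g] hf n J; change ([disjoint J & U]%fset -> c0 (T f n) J = 0).
rewrite (scomp_good f gT).
rewrite (@scompE _ f (triple_of T) n.+2) //; last exact: (good_wt gT (wt_varx R)).
move: J; rewrite -/(in_ideal U _) (_ : (\sum_(k < n.+2) _) n = \sum_(k < n.+2) cterms f (triple_of T) k n); last first.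
  by rewrite (big_morph (fun h : S => h n) (id1 := 0) (op1 := +%R)).
rewrite (big_morph (@c0 R) (id1 := 0) (op1 := +%R)) //; apply: in_ideal_sum => k.
rewrite /cterms !sserDE; do !apply: in_idealD.
- by apply: c0S_mulr => -[|m]; [exact: hf|move=> K _; exact: lam0E].
- exact: c0S_mul.
- exact: c0S_mul.
- exact: c0S_mul.
Qed.

End Projections.

(** * Convergence is inherited by inverses *)

Section ConvergentGroup.
Variable R : realType.
Local Notation C := (R[i]).
Local Notation L := (Lam R).
Local Notation sg := (@lam_sign R).
Local Notation S := (sser R).
Local Notation sgS := (@sser_sign R).
Local Notation spoint := (spoint R).
Local Notation data := (data R).
Local Notation x := (varx R).
Local Notation pp := (phip R).
Local Notation pm := (phim R).
Local Opaque circ eop vf Etilde.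
Implicit Types (a b : L) (I J K U V W : {fset nat}) (e l t r s : R) (f g h : S) (p q : spoint) (G F : triple R).

Definition sums F := near0 [set p | exists q, has_sum3 F p q].

Lemma tri_wt_good (T : S -> S) : good T -> tri_wt (triple_of T).
Proof. by move=> gT; split; apply: (good_wt gT); [exact: wt_varx|exact: wt_phip|exact: wt_phim]. Qed.

Lemma has_sum3P r F p q : conv3 r F -> cnorm (body p.1.1) < r -> has_sum3 F p q <-> value3 F p q.
Proof.
move=> [c1 c2 c3] hp; have h f (cf : conv r f) := has_sumP _ (conv_regular cf hp).
by split=> -[k1 k2 k3]; split; apply/h.
Qed.

(** From left to right, summability at the real points of body r / 2 with arbitrary odd coordinates
    gives convergence in norm by [conv_of_sum], so r / 2 is the radius obtained. *)
Lemma sumsP F : sums F <-> exists r, [/\ 0 < r, conv3 r F & forall p, cnorm (body p.1.1) < r -> exists q, value3 F p q].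
Proof.
split=> [/near0P[r r0 h]|[r [r0 cF h]]]; last first.
  by apply/near0P; exists r => // p hp; have [q hq] := h p hp; exists q; apply/(has_sum3P _ cF hp).
have d0 : 0 < r / 2 by rewrite divr_gt0.
have d1 : r / 2 < r by rewrite ltr_pdivrMr // ltr_pMr // ltr1n.
have hr th ph : cnorm (body (rpoint (r / 2)%:C%C th ph).1.1) < r by rewrite body_scalar cnR ger0_norm // ltW.
exists (r / 2); split=> [//||p hp]; last first.
  have [q [h1 h2 h3]] := h p (lt_trans hp d1); exists q; split; exact: has_sum_value.
by split; apply: (conv_of_sum d0) => th ph; have [q [h1 h2 h3]] := h _ (hr th ph);
  [exists q.1.1|exists q.1.2|exists q.2].
Qed.

Lemma conv3W r r' F : 0 <= r' -> r' <= r -> conv3 r F -> conv3 r' F.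
Proof. by move=> r0 rr [c1 c2 c3]; split; exact: convW r0 rr _. Qed.

Lemma value_varx p : value x p p.1.1.
Proof.
move=> I; apply: (limL_eventually (u := fun=> p.1.1 : L) (N1 := 2)) (limL_const I 1 _) => -[//|[//|N]] _.
rewrite /partial_eval !big_ord_recl big1 => [|n _]; last by rewrite /odd_eval /= !mul0r !addr0 mul0r.
by rewrite /odd_eval /= !mul0r !addr0 mul0r add0r mul1r expr1.
Qed.

Lemma value_phi p : value pp p p.1.2 /\ value pm p p.2.
Proof.
split=> I; [apply: (limL_eventually (u := fun=> p.1.2 : L) (N1 := 1)) (limL_const I 1 _)
  |apply: (limL_eventually (u := fun=> p.2 : L) (N1 := 1)) (limL_const I 1 _)] => -[//|N] _;
rewrite /partial_eval big_ord_recl big1 => [|n _]; rewrite /odd_eval /= ?mul0r ?addr0 ?mul0r // ?add0r ?mul1r ?mulr1 //.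
Qed.

Lemma supports3 r F : 0 < r -> conv3 r F -> (forall p, cnorm (body p.1.1) < r -> exists q, value3 F p q) ->
  forall k : Lam1 R * Lam1 R, exists V, forall n, [/\ supported V (odd_eval (odd_point k.1 k.2) (F.1.1 n)),
    supported V (odd_eval (odd_point k.1 k.2) (F.1.2 n)) & supported V (odd_eval (odd_point k.1 k.2) (F.2 n))].
Proof.
move=> r0 [c1 c2 c3] h k.
have hz z th ph : 0 < z -> z < r -> exists q, value3 F (rpoint z%:C%C th ph) q.
  by move=> z0 zr; apply: h; rewrite body_scalar cnR ger0_norm // ltW.
have [|V1 h1] := support_uniform r0 c1 _ k.
  by move=> z z0 zr th ph; have [q [v1 _ _]] := hz z th ph z0 zr; exists (q.1.1 : L).
have [|V2 h2] := support_uniform r0 c2 _ k.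
  by move=> z z0 zr th ph; have [q [_ v2 _]] := hz z th ph z0 zr; exists (q.1.2 : L).
have [|V3 h3] := support_uniform r0 c3 _ k.
  by move=> z z0 zr th ph; have [q [_ _ v3]] := hz z th ph z0 zr; exists (q.2 : L).
exists (V1 `|` V2 `|` V3)%fset => n; split.
- by apply: supportedW (h1 n); rewrite -fsetUA fsubsetUl.
- by apply: supportedW (h2 n); rewrite fsetUAC fsubsetUr.
- by apply: supportedW (h3 n); exact: fsubsetUr.
Qed.

Lemma prT_value_parity W (T : S -> S) p (q1 q2 q3 : L) : good T -> value (proj_ser W (T x)) p q1 -> value (proj_ser W (T pp)) p q2 ->
  value (proj_ser W (T pm)) p q3 -> exists2 q : spoint, value3 (proj_triple W (triple_of T)) p q &
    [/\ (q.1.1 : L) = q1, (q.1.2 : L) = q2 & (q.2 : L) = q3].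
Proof.
move=> gT v1 v2 v3; have [e1 e2 e3] := even_odd_good gT.
have prSN f : proj_ser W (- f) = - proj_ser W f.
  by apply: sserP => n; apply: sextP; rewrite /= prLN.
have k1 : (to_even q1 : L) = q1 by apply: value_even v1; rewrite -prS_sg e1.
have k2 : (to_odd q2 : L) = q2 by apply: value_odd v2; rewrite -prS_sg e2 prSN.
have k3 : (to_odd q3 : L) = q3 by apply: value_odd v3; rewrite -prS_sg e3 prSN.
by exists (to_even q1, to_odd q2, to_odd q3); split; rewrite /= ?k1 ?k2 ?k3.
Qed.

(* The value of G at p, computed modulo the generators outside a large finite set W, is a point
   q with F (q) = p; the coefficients of F at q involve W only, hence G (p) = G (F (q)) = q. *)
Lemma sums_inverse (T U : S -> S) : good T -> good U -> (forall f, U (T f) = f) -> (forall f, T (U f) = f) ->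
  wt 3 (T x - x) -> wt 2 (T pp - pp) -> wt 2 (T pm - pm) ->
  (forall V, stab (ideal_space V) T -> stab (ideal_space V) U) -> sums (triple_of T) -> sums (triple_of U).
Proof.
move=> gT gU UT TU hX hP hM hstab.
have wT := tri_wt_good gT; have wU := tri_wt_good gU.
move=> /sumsP[r [r0 cF hF]].
have [r2 r20 cG] := conv_inverse r0 gU UT hX hP hM cF.
have [lF hsF] := conv_shrinks r0 cF wT r20.
have [lF0 lF1 _ _] := hsF.
(* Bounds the even coordinate of q: at most r, so that the series of T converge at q, and below lF^2
   r, so that T may be substituted at q into the series of U. *)
pose s := Num.min r (lF ^+ 2 * r / 2).
have lr0 : 0 < lF ^+ 2 * r by rewrite mulr_gt0 // exprn_gt0.
have s0 : 0 < s by rewrite lt_min r0 divr_gt0.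
have sr : s <= r by rewrite ge_min lexx.
have slr : s < lF ^+ 2 * r.
  by apply: (@le_lt_trans _ _ (lF ^+ 2 * r / 2)); [rewrite ge_min lexx orbT|rewrite ltr_pdivrMr // ltr_pMr // ltr1n].
have [lG hsG] := conv_shrinks r20 cG wU s0; have [lG0 lG1 _ _] := hsG.
have lG2 : lG ^+ 2 * r2 <= r2 by rewrite ler_piMl ?(ltW r20) // exprn_ile1 // ltW.
apply/sumsP; exists (lG ^+ 2 * r2); split.
- by rewrite mulr_gt0 // exprn_gt0.
- by apply: conv3W cG => //; rewrite mulr_ge0 ?exprn_ge0 // ltW.
move=> p hp.
have sup := supports3 r0 cF hF.
(* At zero odd coordinates only the coefficients without phi's are seen: [U1] supports all of
   them. *)
have [U1 hU1] := sup (0, 0).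
have [V1 p1] := supported_ex (p.1.1 : L); have [V2 p2] := supported_ex (p.1.2 : L).
have [V3 p3] := supported_ex (p.2 : L).
pose W1 := (U1 `|` (V1 `|` V2 `|` V3))%fset.
(* The finitely many odd test pairs of [supported_es]; W is taken to support the coefficients of T
   evaluated at each of them. *)
pose Z := [seq (th, ph) | th <- 0 :: [seq zeta R k | k <- W1], ph <- 0 :: [seq zeta R k | k <- W1]].
have [|W WW hW] := common_support Z W1 sup.
  by move=> k V V' VV hV n; have [m1 m2 m3] := hV n; split; exact: supportedW VV _.
have UW1 : (U1 `<=` W1)%fset by exact: fsubsetUl.
have VW1 : (V1 `|` V2 `|` V3 `<=` W1)%fset by exact: fsubsetUr.
have V1W1 : (V1 `<=` W1)%fset by apply: fsubset_trans VW1; rewrite -fsetUA fsubsetUl.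
have V2W1 : (V2 `<=` W1)%fset by apply: fsubset_trans VW1; rewrite fsetUAC fsubsetUr.
have V3W1 : (V3 `<=` W1)%fset by apply: fsubset_trans VW1; exact: fsubsetUr.
have sp : point_supported W p.
  split; [apply: supportedW p1|apply: supportedW p2|apply: supportedW p3]; exact: fsubset_trans WW.
have ideal (th : Lam1 R) V : (V `<=` W1)%fset -> supported V (th : L) -> in_ideal W1 (th : L).
  by move=> VW h; apply: in_idealW VW _; apply: in_ideal_odd h; exact: lam_sign1_odd.
have ip := ideal _ _ V2W1 p2; have im := ideal _ _ V3W1 p3.
have [e1 e2 e3] := even_odd_good gT.
(* T maps phi+ and phi- into the ideal because the parts free of phi's are odd and supported on
   [W1]; by hypothesis U does too. Therefore the odd coordinates of q will lie in the ideal of [W1],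
   as [supported_es] requires. *)
have sU : stab (ideal_space W1) U.
  apply/hstab/(stab_ideal gT) => n.
    have [_ h _] := hU1 n; apply: in_idealW UW1 _; apply: in_ideal_odd; first exact: odd_c0.
    by rewrite -odd_eval00.
  have [_ _ h] := hU1 n; apply: in_idealW UW1 _; apply: in_ideal_odd; first exact: odd_c0.
  by rewrite -odd_eval00.
have phi_ideal : ideal_space W1 (pp, pm) /\ ideal_space W1 (pm, pp).
  by split=> -[|n] J _.
have iP n : in_ideal W1 (c0 (U pp n)) := sU _ phi_ideal.1 n.
have iM n : in_ideal W1 (c0 (U pm n)) := sU _ phi_ideal.2 n.
have hp2 : cnorm (body p.1.1) < r2 := lt_le_trans hp lG2.
have pev_sup f N : supported W (partial_eval N (proj_ser W f) p).
  by apply: supported_pev => [|n]; [case: sp|exact: supported_prE].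
have [c1 c2 c3] := cG; have r2' := ltW r20.
have [q1 s1 v1] := value_ex (conv_prS W r2' c1) hp2 (pev_sup _).
have [q2 s2 v2] := value_ex (conv_prS W r2' c2) hp2 (pev_sup _).
have [q3 s3 v3] := value_ex (conv_prS W r2' c3) hp2 (pev_sup _).
have [q vq [k1 k2 k3]] := prT_value_parity gU v1 v2 v3.
have sq : point_supported W q by split; rewrite ?k1 ?k2 ?k3.
have iq2 : in_ideal W1 q.1.2.
  by rewrite k2; apply: in_ideal_value ip im v2 => n; apply: (@in_ideal_prL R); exact: iP.
have iq3 : in_ideal W1 q.2.
  by rewrite k3; apply: in_ideal_value ip im v3 => n; apply: (@in_ideal_prL R); exact: iM.
have wX : wt 2 (proj_triple W (triple_of U)).1.1 by apply: wt_prS; case: wU.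
have [bq hv] := value_scomp (shrinks_prT W hsG) wX s0 hp vq.
have FG f : scomp (proj_ser W (T f)) (proj_triple W (triple_of U)) = proj_ser W f.
  by rewrite -prS_scomp; [rewrite -(scomp_good _ gU) UT|case: wU].
(* So far T (q) = p is known only modulo the generators outside W. Since the coefficients of [T f]
   evaluated at q are supported on W, the projection changes none of the partial sums and can be
   removed. *)
have Fq f (v : L) : conv r (T f) -> (forall n, supported W (odd_eval q (T f n))) -> proj_ser W f = f -> value f p v ->
    value (T f) q v.
  move=> cf sf ef vf.
  have := (hv (proj_ser W (T f)) (conv_prS W (ltW s0) (convW (ltW s0) sr cf)) v).1.
  rewrite FG ef => /(_ vf) h I; apply: (limL_eventually (N1 := 0)) (h I) => N _.
  by rewrite -prL_pev // prL_id //; apply: supported_pev; case: sq.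
have es_sup (u : sext R) : (forall k, k \in Z -> supported W (odd_eval (odd_point k.1 k.2) u)) -> supported W (odd_eval q u).
  move=> h; apply: (supported_es sq iq2 iq3) => th ph hth hph; apply: (h (th, ph)).
  by apply/allpairsP; exists (th, ph).
have [d1 d2 d3] := cF; have [t2 t3] := value_phi p; have [b2 b3] := prS_phi R W.
have vF : value3 (triple_of T) q p.
  split; apply: Fq; [exact: d1| |exact: prS_varx|exact: value_varx|exact: d2| |exact: b2|exact: t2|exact: d3|
    |exact: b3|exact: t3].
  - by move=> n; apply: es_sup => k /hW/(_ n)[].
  - by move=> n; apply: es_sup => k /hW/(_ n)[].
  - by move=> n; apply: es_sup => k /hW/(_ n)[].
have wTX : wt 2 (triple_of T).1.1 by case: wT.
have [_ hv'] := value_scomp hsF wTX r20 (le_lt_trans bq slr) vF.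
(* The reverse substitution, now of T at the genuine point q, evaluates U at p without any
   projection. *)
have back f (v : L) : conv r2 (U f) -> value f q v -> value (U f) p v.
  by move=> cf vf; apply/(hv' (U f) cf v); rewrite -(scomp_good _ gT) TU.
have [m2 m3] := value_phi q.
exists q; split; apply: back; [exact: c1|exact: value_varx|exact: c2|exact: m2|exact: c3|exact: m3].
Qed.

(** The stability condition of [sums_inverse] holds because stability under e^w is stability under
    w, hence under -w, hence under e^(-w). *)
Lemma Hconv_opp (A : data) : Hconv A -> Hconv (- A).
Proof.
rewrite /Hconv /mkset -![near0 _]/(sums _) !EtildeE.
have first k f : wt k f -> wt k.+1 (eop (vf A) f - f) := eop_first (raises_vf A) (f := f).
apply: (sums_inverse (good_eop A) (good_eop (- A)) (eopNK A) (eopKN A)).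
- exact/first/wt_varx.
- exact/first/wt_phip.
- exact/first/wt_phim.
move=> V; have cI := coef_space_ideal R V; have [_ hN _] := coef_space_stab cI.
by move=> /(stab_eop A cI) h; apply/(stab_eop (- A) cI); exact: hN.
Qed.

End ConvergentGroup.

(** * Germs at zero *)

Section GermsAtZero.
Variable R : realType.
Local Notation C := (R[i]).
Local Notation L := (Lam R).
Local Notation L0 := (Lam0 R).
Local Notation S := (sser R).
Local Notation spoint := (spoint R).
Local Notation data := (data R).
Local Notation pdata := (pdata R).
Local Notation uone := (uone R).
Local Notation x := (varx R).
Local Notation pp := (phip R).
Local Notation pm := (phim R).
Local Opaque circ circoo eop vf Etilde Ehat rep sc.
Implicit Types (a b : L) (I J K U V W : {fset nat}) (e l t r s : R) (f g h : S) (p q : spoint) (G F : triple R)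
  (A B : data) (al be : pdata).

(** Made total by the value 0 where F does not converge; germs do not see this choice. *)
Definition tri_eval F p : spoint := xget 0 [set q | has_sum3 F p q].

Lemma has_sum3_unique F p q q' : has_sum3 F p q -> has_sum3 F p q' -> q = q'.
Proof.
case: q q' => [[z th] ph] [[z' th'] ph'] [/= h1 h2 h3] [/= k1 k2 k3].
by congr (_, _, _); apply: val_inj; [apply: (value_unique (has_sum_value h1) (has_sum_value k1))
  |apply: (value_unique (has_sum_value h2) (has_sum_value k2))
  |apply: (value_unique (has_sum_value h3) (has_sum_value k3))].
Qed.

Lemma evalE F p q : has_sum3 F p q -> tri_eval F p = q.
Proof.
move=> h; rewrite /tri_eval; case: xgetP => [_ -> h'|/(_ q)]; last by case.
exact: has_sum3_unique h' h.
Qed.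

Lemma near0_and (P Q : set spoint) : near0 P -> near0 Q -> near0 (P `&` Q).
Proof.
move=> /near0P[r r0 hP] /near0P[s s0 hQ]; apply/near0P; exists (Num.min r s); first by rewrite lt_min r0.
by move=> p; rewrite lt_min => /andP[h1 h2]; split; [exact: hP|exact: hQ].
Qed.

Lemma near0W (P Q : set spoint) : P `<=` Q -> near0 P -> near0 Q.
Proof. by move=> PQ /near0P[r r0 hP]; apply/near0P; exists r => // p /hP/PQ. Qed.

Lemma sums_eval F : sums F <-> near0 [set p | has_sum3 F p (tri_eval F p)].
Proof. by split; apply: near0W => p; [move=> [q h]; rewrite /mkset (evalE h)|exists (tri_eval F p)]. Qed.

Lemma eval_small F (P : set spoint) : tri_wt F -> sums F -> near0 P -> near0 [set p | P (tri_eval F p)].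
Proof.
move=> wF /sumsP[r [r0 cF hF]] /near0P[s s0 hP]; have d0 : 0 < s / 2 by rewrite divr_gt0.
have [l hl] := conv_shrinks r0 cF wF d0; have [l0 l1 _ _] := hl.
have lr : l ^+ 2 * r <= r by rewrite ler_piMl ?(ltW r0) // exprn_ile1 // ltW.
apply/near0P; exists (l ^+ 2 * r) => [|p hp]; first by rewrite mulr_gt0 ?exprn_gt0.
have hp' := lt_le_trans hp lr; have [q hq] := hF p hp'; have [wX _ _] := wF.
rewrite /mkset (evalE ((has_sum3P q cF hp').2 hq)); apply: hP.
have [h _] := value_scomp hl wX d0 hp hq.
by apply: le_lt_trans h _; rewrite ltr_pdivrMr // ltr_pMr // ltr1n.
Qed.

Lemma eval_tcomp F G : tri_wt G -> sums F -> sums G ->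
  near0 [set p | has_sum3 (tcomp F G) p (tri_eval F (tri_eval G p))].
Proof.
move=> wG sF sG; have := sF; move=> /sumsP[r [r0 cF hF]]; have := sG; move=> /sumsP[r' [r'0 cG hG]].
have d0 : 0 < r / 2 by rewrite divr_gt0.
have d1 : r / 2 < r by rewrite ltr_pdivrMr // ltr_pMr // ltr1n.
have [l hl] := conv_shrinks r'0 cG wG d0; have [l0 l1 _ _] := hl.
have lr : l ^+ 2 * r' <= r' by rewrite ler_piMl ?(ltW r'0) // exprn_ile1 // ltW.
have [k1 k2 k3] := cF; have [wX _ _] := wG.
have [s1 s10 c1] := conv_scomp r0 r'0 k1 cG wG; have [s2 s20 c2] := conv_scomp r0 r'0 k2 cG wG.
have [s3 s30 c3] := conv_scomp r0 r'0 k3 cG wG.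
have lr0 : 0 < l ^+ 2 * r' by rewrite mulr_gt0 ?exprn_gt0.
apply/near0P; exists (Num.min (l ^+ 2 * r') (Num.min s1 (Num.min s2 s3))).
  by rewrite !lt_min lr0 s10 s20 s30.
move=> p; rewrite !lt_min => /and4P[hp h1 h2 h3]; have hp' := lt_le_trans hp lr.
have [q hq] := hG p hp'; rewrite /mkset (evalE ((has_sum3P q cG hp').2 hq)).
have [hb hv] := value_scomp hl wX d0 hp hq; have hq' := le_lt_trans hb d1.
have [v hvv] := hF q hq'; rewrite (evalE ((has_sum3P v cF hq').2 hvv)).
have [v1 v2 v3] := hvv; have cW f : conv r f -> conv (r / 2) f by exact: convW (ltW d0) (ltW d1).
by split; apply: value_has_sum; [exact: conv_regular c1 h1|exact/(hv _ (cW _ k1))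
  |exact: conv_regular c2 h2|exact/(hv _ (cW _ k2))|exact: conv_regular c3 h3|exact/(hv _ (cW _ k3))].
Qed.

Lemma sums_tcomp F G : tri_wt G -> sums F -> sums G -> sums (tcomp F G).
Proof.
by move=> wG sF sG; apply: near0W (eval_tcomp wG sF sG) => p h; exists (tri_eval F (tri_eval G p)).
Qed.

Lemma pev_const N a f p : partial_eval N (constS a * f) p = a * partial_eval N f p.
Proof.
rewrite /partial_eval mulr_sumr; apply: eq_bigr => n _; rewrite constSE constS_mul_comp /odd_eval /= mulrA.
by rewrite !mulrDr !mulrA.
Qed.

Lemma value_const a f p v : value f p v -> value (constS a * f) p (a * v).
Proof.
move=> h I d d0; have p0 : 0 < nL I 1 a + 1 by rewrite ltr_wpDl ?nL_ge0.
have [|N0 hN] := h I (d / (nL I 1 a + 1)); first by rewrite divr_gt0.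
exists N0 => N /hN hN'; rewrite pev_const -mulrBr; apply: le_trans (nLM _ _ _ ler01) _.
apply: (@le_trans _ _ ((nL I 1 a + 1) * (d / (nL I 1 a + 1)))); last by rewrite mulrC divfK // gt_eqF.
by apply: ler_pM; rewrite ?nL_ge0 // lerDl.
Qed.

Lemma conv_const r a f : 0 <= r -> conv r f -> conv r (constS a * f).
Proof.
move=> r0 h I; have [B hB] := h I; exists (nL I 1 a * B) => M.
by apply: le_trans (Q_const I ler01 ler01 r0 M a f) _; apply: ler_wpM2l; rewrite ?nL_ge0.
Qed.

Lemma sums_id : sums (triple_of id : triple R).
Proof.
have [h1 h2] := @conv_phi R 1; apply/sumsP; exists 1; split=> //; first by split=> //; exact: conv_varx.
by move=> p _; exists p; have [] := value_phi p; split=> //; exact: value_varx.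
Qed.

Lemma sums_sc (u v : L0) : sums (triple_of (sc u v)).
Proof.
have [h1 h2] := @conv_phi R 1; rewrite /triple_of sc_varx sc_phip sc_phim; apply/sumsP; exists 1; split=> //.
  by split; apply: conv_const => //; exact: conv_varx.
move=> p _; exists ((u * v) * p.1.1, mul01 u p.1.2, mul01 v p.2); have [v1 v2] := value_phi p.
by split; apply: value_const; [exact: value_varx|..].
Qed.

Lemma dgroup_Hconv : dgroup (@Hconv R).
Proof.
have e A : Hconv A = sums (triple_of (eop (vf A))) by rewrite -EtildeE.
split.
- rewrite e (_ : triple_of _ = triple_of id); first exact: sums_id.
  by apply: eq_triple_of => f; exact: eop_data0.
- exact: Hconv_opp.
- move=> A B; rewrite !e => hA hB.
  rewrite (eq_triple_of (eop_dcirc A B)) -(tcomp_good (eop (vf B)) (good_eop A)).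
  exact: sums_tcomp (tri_wt_good (good_eop A)) hB hA.
Qed.

(** Scalings converge everywhere and are invertible, so composing with them does not affect
    convergence. *)
Lemma sums_rep al : Hconv al.2 <-> sums (triple_of (rep al)).
Proof.
have e A : Hconv A = sums (triple_of (eop (vf A))) by rewrite -EtildeE.
have [gE gR] := (good_eop al.2, good_rep al).
have repE f : rep al f = eop (vf al.2) (sc (qpart al.1) (rpart al.1) f) by [].
rewrite e; split=> h.
  by rewrite (eq_triple_of repE) -(tcomp_good _ gE); apply: sums_tcomp (tri_wt_good gE) (sums_sc _ _) h.
have inv f : eop (vf al.2) f = rep al (sc (qpart al.1)^-1 (rpart al.1)^-1 f).
  by rewrite repE sc_inv ?qpart_unit ?rpart_unit.
by rewrite (eq_triple_of inv) -(tcomp_good _ gR); apply: sums_tcomp (tri_wt_good gR) (sums_sc _ _) h.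
Qed.

Lemma Hconv_circ al be : Hconv al.2 -> Hconv be.2 -> Hconv (circ al be).2.
Proof.
move=> /sums_rep ha /sums_rep hb; apply/sums_rep.
rewrite (eq_triple_of (rep_circ al be)) -(tcomp_good _ (good_rep al)).
exact: sums_tcomp (tri_wt_good (good_rep al)) hb ha.
Qed.

Fact vinv_key al : {be | circ al be = (uone, 0) /\ circ be al = (uone, 0)}.
Proof. exact: cid (circ_inv al). Qed.
Definition circ_inverse al := sval (vinv_key al).

Lemma vinvP al : circ al (circ_inverse al) = (uone, 0) /\ circ (circ_inverse al) al = (uone, 0).
Proof. exact: svalP (vinv_key al). Qed.

Lemma vinv_unique al be : circ al be = (uone, 0) -> be = circ_inverse al.
Proof.
move=> h; have [_ k] := vinvP al.
by rewrite -[be](circ1 be).1 -k circA h (circ1 _).2.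
Qed.

Lemma vinvK : involutive circ_inverse.
Proof. by move=> al; apply/esym/vinv_unique; case: (vinvP al). Qed.

Lemma vinv_circ al be : circ_inverse (circ al be) = circ (circ_inverse be) (circ_inverse al).
Proof.
apply/esym/vinv_unique; rewrite circA -(circA be) (vinvP be).1 (circ1 _).1.
by case: (vinvP al).
Qed.

(** The inverse operator is e^(-w) followed by the inverse scaling, and the convergence of e^(-w) is
    [Hconv_opp]. *)
Lemma Hconv_vinv al : Hconv al.2 -> Hconv (circ_inverse al).2.
Proof.
have [_ HN _] := dgroup_Hconv; move=> /HN h; apply/sums_rep.
have repE f : rep al f = eop (vf al.2) (sc (qpart al.1) (rpart al.1) f) by [].
have e f : rep (circ_inverse al) f = sc (qpart al.1)^-1 (rpart al.1)^-1 (eop (vf (- al.2)) f).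
  have k : rep al (rep (circ_inverse al) f) = f by rewrite -[LHS](rep_circ al (circ_inverse al) f) (vinvP al).1 rep_id.
  by rewrite -[in RHS]k repE eopNK sc_invV ?qpart_unit ?rpart_unit.
have gs := good_sc (qpart al.1)^-1 (rpart al.1)^-1.
rewrite (eq_triple_of e) -(tcomp_good (eop (vf (- al.2))) gs).
by apply: sums_tcomp (tri_wt_good gs) _ (sums_sc _ _); rewrite -EtildeE.
Qed.

Lemma group_Hconv : group_on [set al | Hconv al.2] (graph2 (@circ R)).
Proof.
have [H0 _ _] := dgroup_Hconv.
apply: (group_on_graph (e := (uone, 0))); [exact: circA|exact: circ1|exact: H0| |].
- by move=> al be; exact: Hconv_circ.
- by move=> al h; exists (circ_inverse al); [exact: Hconv_vinv|exact: vinvP].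
Qed.

(** For fixed odd coordinates, each coefficient in the zeta's is a scalar power series vanishing on
    an interval, hence zero. Varying the odd coordinates then separates the coefficients of 1, phi+,
    phi- and phi+ phi-. *)
Lemma value_zero r f : 0 < r -> conv r f ->
  (forall z, 0 < z -> z < r -> forall th ph, value f (rpoint z%:C%C th ph) 0) -> f = 0.
Proof.
move=> r0 cf hv.
have es0 th ph n : odd_eval (odd_point th ph) (f n) = 0.
  apply: lamP => J; pose s := r / 5%:R; have s0 : 0 < s by rewrite divr_gt0.
  have sr : 5%:R * s <= r by rewrite /s mulrC divfK.
  have s1 : s < r by rewrite ltr_pdivrMr // ltr_pMr // ltr1n.
  have [|e [e0 e1 he]] := @small_point R J (odd_point th ph) r 1 _ ltr01; first by rewrite -[body _]/(0 : C) cn0.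
  have [_ hp hm] := he e e0 (lexx e); have [B hB] := cf J.
  apply: (@zeros_eq0 R (fun n => odd_eval (odd_point th ph) (f n) J) r s (B / e ^+ #|` J|) [set z | 0 < z <= s] s0 sr).
  - move=> N; rewrite ler_pdivlMr ?exprn_gt0 // mulr_suml; apply: le_trans (hB N).
    apply: (@le_trans _ _ (Q J e 1 r N f)); last by apply: Q_le => //; exact: ltW.
    apply: ler_sum => k _; rewrite mulrAC; apply: ler_wpM2r; first by rewrite exprn_ge0 // ltW.
    apply: le_trans (nL_coef _ (ltW e0) (fsubset_refl J)) _.
    exact: (nL_es (ltW e0) ler01 hp hm).
  - by move=> /finite_set_countable; exact: itv_not_countable.
  - move=> z /andP[z0 zs]; split=> // d d0.
    have [N0 hN] := hv z z0 (le_lt_trans zs s1) th ph J d d0; exists N0 => N /hN; apply: le_trans.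
    apply: le_trans (nL_coef1 J _); rewrite !subr0 /gsum /partial_eval lam_sumE.
    rewrite le_eqVlt; apply/orP; left; apply/eqP; congr cnorm; apply: eq_bigr => k _.
    have -> : ((rpoint z%:C%C th ph).1.1 : L) ^+ k = ((z%:C%C : C) ^+ k)%:A := scalarX _ _.
    by rewrite lam_scalar_coef.
(* This uses that there are infinitely many generators: for each coefficient of [a] some zeta_k is
   absent from its monomial. *)
have z0 a : (forall k, a * (zeta R k : L) = 0) -> a = 0.
  move=> h; apply: lamP => J; have [k kJ] := fresh J; apply: cn_eq0.
  by rewrite -(cn_mul_zeta a kJ) h cn0.
apply: sserP => n.
have c0E : c0 (f n) = 0 by rewrite -odd_eval00.
have cpE th : cp (f n) * (th : Lam1 R) = 0 by have := es0 th 0 n; rewrite odd_evalp c0E add0r.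
have cmE ph : cm (f n) * (ph : Lam1 R) = 0 by have := es0 0 ph n; rewrite odd_evalm c0E add0r.
apply: sextP; [exact: c0E|exact: z0|exact: z0|].
apply: (z0 (cpm (f n))) => k; apply: z0 => k'; have := es0 (zeta R k) (zeta R k') n.
change (c0 (f n) + cp (f n) * zeta R k + cm (f n) * zeta R k' + cpm (f n) * zeta R k * zeta R k' = 0 ->
  cpm (f n) * zeta R k * zeta R k' = 0).
by rewrite c0E cpE cmE !add0r.
Qed.

(** Agreement off body 0 is enough, as [value_zero] evaluates at positive reals only. Germs at
    infinity provide no more than this. *)
Lemma eval_inj F G : sums F -> sums G ->
  near0 [set p : spoint | body p.1.1 != 0 -> tri_eval F p = tri_eval G p] -> F = G.
Proof.
move=> /sumsP[r [r0 cF hF]] /sumsP[r' [r'0 cG hG]] /near0P[s s0 h].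
pose t := Num.min r (Num.min r' s); have t0 : 0 < t by rewrite !lt_min r0 r'0.
have wt_trunc : t <= r by rewrite ge_min lexx.
have tr' : t <= r' by rewrite !ge_min lexx orbT.
have ts : t <= s by rewrite !ge_min lexx !orbT.
have key z th ph : 0 < z -> z < t -> exists q, value3 F (rpoint z%:C%C th ph) q /\ value3 G (rpoint z%:C%C th ph) q.
  move=> z0 zt; set p := rpoint _ _ _; have hp : cnorm (body p.1.1) < t by rewrite body_scalar cnR ger0_norm // ltW.
  have hr := lt_le_trans hp wt_trunc; have hr' := lt_le_trans hp tr'.
  have [q hq] := hF p hr; have [q' hq'] := hG p hr'; exists q; split=> //.
  have p0 : body p.1.1 != 0 by rewrite body_scalar fmorph_eq0 gt_eqF.
  have := h p (lt_le_trans hp ts) p0; rewrite (evalE ((has_sum3P q cF hr).2 hq)).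
  by rewrite (evalE ((has_sum3P q' cG hr').2 hq')) => ->.
have eq0 f g : conv r f -> conv r' g -> (forall z th ph, 0 < z -> z < t -> exists v,
    value f (rpoint z%:C%C th ph) v /\ value g (rpoint z%:C%C th ph) v) -> f = g.
  move=> cf cg hfg; apply/eqP; rewrite -subr_eq0; apply/eqP; apply: (value_zero t0).
    by apply: convB; [exact: ltW|exact: convW (ltW t0) wt_trunc cf|exact: convW (ltW t0) tr' cg].
  move=> z z0 zt th ph; have [v [v1 v2]] := hfg z th ph z0 zt; rewrite -(subrr v) => I.
  apply: (limL_eventually (N1 := 0)) (limLD ler01 (v1 I) (valueN v2 I)) => N _.
  by rewrite pevD.
case: F G cF cG key {hF hG h} => [[X P] M] [[X' P'] M'] [/= a1 a2 a3] [/= b1 b2 b3] key.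
by congr (_, _, _); [apply: (eq0 _ _ a1 b1)|apply: (eq0 _ _ a2 b2)|apply: (eq0 _ _ a3 b3)] => z th ph z0 zt;
  have [q [[/= x1 x2 x3] [/= y1 y2 y3]]] := key z th ph z0 zt;
  [exists (q.1.1 : L)|exists (q.1.2 : L)|exists (q.2 : L)].
Qed.

Lemma germ_eq (near : set spoint -> Prop) (F G : spoint -> spoint) :
  (forall P Q, near P -> near Q -> near (P `&` Q)) -> (forall P Q : set spoint, P `<=` Q -> near P -> near Q) ->
  near [set p | F p = G p] -> germ near F = germ near G.
Proof.
move=> hI hW h; apply/seteqP; split=> [H hH|H hH].
  by apply: (hW _ _ _ (hI _ _ h hH)) => p [/= e ->].
by apply: (hW _ _ _ (hI _ _ h hH)) => p [/= e ->].
Qed.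

Definition germ0 al := germ (@near0 R) (tri_eval (Ehat al)).

Lemma near0T : near0 [set: spoint].
Proof. by apply/near0P; exists 1. Qed.

Lemma germ0_self (F : spoint -> spoint) : germ (@near0 R) F F.
Proof. by apply: near0W near0T => p _. Qed.

Lemma sums_Ehat al : Hconv al.2 -> sums (Ehat al).
Proof. by rewrite EhatE => /sums_rep. Qed.

Lemma tri_wt_Ehat al : tri_wt (Ehat al).
Proof. by rewrite EhatE; exact: tri_wt_good (good_rep al). Qed.

Lemma Ehat_circ al be : Ehat (circ al be) = tcomp (Ehat be) (Ehat al).
Proof. by rewrite !EhatE (tcomp_good _ (good_rep al)); exact: eq_triple_of (rep_circ al be). Qed.

Lemma germs0_mulE al be w : Hconv al.2 -> Hconv be.2 ->
  germs0_mul (germ0 al) (germ0 be) w <-> w = germ0 (circ be al).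
Proof.
move=> ha hb; have sa := sums_Ehat ha; have sb := sums_Ehat hb; have wb := tri_wt_Ehat be.
have key (F G : spoint -> spoint) : germ0 al F -> germ0 be G ->
    germ (@near0 R) (F \o G) = germ0 (circ be al).
  move=> hF hG; apply: (germ_eq near0_and near0W).
  have := near0_and hG (near0_and (eval_small wb sb hF) (eval_tcomp wb sa sb)).
  by apply: near0W => p [/= e1 [/= e2 e3]]; rewrite Ehat_circ (evalE e3) e1 e2.
split=> [[F [G [hF hG ->]]]|->]; first exact: key.
exists (tri_eval (Ehat al)), (tri_eval (Ehat be)); split; [exact: germ0_self|exact: germ0_self|].
by rewrite key //; exact: germ0_self.
Qed.

Lemma germs0E : @germs0 R = germ0 @` [set al | Hconv al.2].
Proof.
apply/seteqP; split=> [_ [F [H [h1 h2 h3 h4]] ->]|_ [al /= ha <-]].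
  have [al e] := Ehat_surj h1 h2 h3; exists al.
    by apply/sums_rep; rewrite -EhatE e; apply: near0W h4 => p hp; exists (F p).
  by apply: (germ_eq near0_and near0W); apply: near0W h4 => p hp; rewrite /mkset e (evalE hp).
exists (tri_eval (Ehat al)) => //; exists (Ehat al); split; last exact/sums_eval/sums_Ehat.
- rewrite EhatE; apply: (sconf_superconformal (sconf_rep al) (leading_rep al)).
    exact/lam_unit_neq0/lam0_unitL/qpart_unit.
  exact/lam_unit_neq0/lam0_unitL/rpart_unit.
- by rewrite EhatE; exact: good_vanishes (good_rep al).
- by rewrite EhatE; apply: (unit_coefs_leading (leading_rep al)); apply: lam0_unitL;
    [exact: qpart_unit|exact: rpart_unit].
Qed.

Lemma germ0_inj al be : Hconv al.2 -> Hconv be.2 -> germ0 al = germ0 be -> al = be.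
Proof.
move=> ha hb e; apply: Ehat_inj; apply: eval_inj; [exact: sums_Ehat|exact: sums_Ehat|].
have : germ0 be (tri_eval (Ehat al)) by rewrite -e; exact: germ0_self.
by apply: near0W => p h _.
Qed.

(** [circ] applies its first argument first, while germs multiply by composition of functions; the
    isomorphism sends [al] to the germ of its inverse. *)
Lemma isomorphic_germs0 : isomorphic_on (at_zero [set al | Hconv al.2]) (@sew R) (@germs0 R) (@germs0_mul R).
Proof.
rewrite at_zeroE germs0E.
apply: (@isomorphic_anti _ (@circ R) _ _ circ_inverse (fun al => (0, al)) snd germ0 (@sew R) (@germs0_mul R)
  [set al | Hconv al.2] group_Hconv Hconv_vinv vinvK vinv_circ).
- by [].
- by move=> al be w _ _; exact: sew_at_zero.
- by move=> al be w ha hb; exact: germs0_mulE.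
- by move=> al be ha hb; exact: germ0_inj.
Qed.

End GermsAtZero.

(** * Germs at infinity *)

Section SubstitutionAtInfinity.
Variable R : realType.
Local Notation C := (R[i]).
Local Notation L := (Lam R).
Local Notation sg := (@lam_sign R).
Local Notation S := (sser R).
Local Notation sgS := (@sser_sign R).
Local Notation x := (varx R).
Local Notation pp := (phip R).
Local Notation pm := (phim R).
Implicit Types (a b : L) (u v : nat -> L) (f g : S).

Definition cauchy u v : nat -> L := fun n => \sum_(i < n.+1) u i * v (n - i)%N.

Lemma cauchy_shift1r u v n : cauchy u (shiftn 1 v) n = shiftn 1 (cauchy u v) n.
Proof.
rewrite /cauchy big_ord_recr /= subnn /shiftn /= mulr0 addr0; case: n => [|n]; first by rewrite big_ord0.
rewrite subn1 /=; apply: eq_bigr => i _; have h : (0 < n.+1 - i)%N by rewrite subn_gt0.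
by rewrite h subn1 subSn // -ltnS.
Qed.

Lemma cauchy_shift1l u v n : cauchy (shiftn 1 u) v n = shiftn 1 (cauchy u v) n.
Proof.
rewrite /cauchy big_ord_recl /= /shiftn /= mul0r add0r; case: n => [|n]; first by rewrite big_ord0.
by rewrite subn1 /=; apply: eq_bigr => i _; rewrite /bump /= add1n subn1 subSS.
Qed.

Lemma shiftn_eq k u v n : (forall m, u m = v m) -> shiftn k u n = shiftn k v n.
Proof. by move=> h; rewrite /shiftn; case: ifP. Qed.

Lemma shiftnD k u v n : shiftn k u n + shiftn k v n = shiftn k (fun m => u m + v m) n.
Proof. by rewrite /shiftn; case: ifP => _; rewrite ?addr0. Qed.

Lemma shiftn2 u n : shiftn 2 u n = shiftn 1 (shiftn 1 u) n.
Proof. by rewrite /shiftn; case: n => [|[|n]] //=; rewrite ?subn1 ?subn2. Qed.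

Lemma shiftn_map k (h : L -> L) u n : h 0 = 0 -> h (shiftn k u n) = shiftn k (fun m => h (u m)) n.
Proof. by move=> h0; rewrite /shiftn; case: ifP. Qed.

(* f (x, i x phi+, i x phi-) *)
Definition Jop f : S := fun n => SExt (c0 (f n)) (shiftn 1 (fun k => 'i *: cp (f k)) n)
  (shiftn 1 (fun k => 'i *: cm (f k)) n) (shiftn 2 (fun k => - cpm (f k)) n).

Lemma c0_mul f g n : c0 ((f * g) n) = cauchy (fun k => c0 (f k)) (fun k => c0 (g k)) n.
Proof. by rewrite sserME (big_morph (@c0 R) (id1 := 0) (op1 := +%R)). Qed.

Lemma cp_mul f g n : cp ((f * g) n) = cauchy (fun k => c0 (f k)) (fun k => cp (g k)) n
  + cauchy (fun k => cp (f k)) (fun k => sg (c0 (g k))) n.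
Proof. by rewrite sserME (big_morph (@cp R) (id1 := 0) (op1 := +%R)) // -big_split. Qed.

Lemma cm_mul f g n : cm ((f * g) n) = cauchy (fun k => c0 (f k)) (fun k => cm (g k)) n
  + cauchy (fun k => cm (f k)) (fun k => sg (c0 (g k))) n.
Proof. by rewrite sserME (big_morph (@cm R) (id1 := 0) (op1 := +%R)) // -big_split. Qed.

Lemma cpm_mul f g n : cpm ((f * g) n) = cauchy (fun k => c0 (f k)) (fun k => cpm (g k)) n
  + cauchy (fun k => cp (f k)) (fun k => sg (cm (g k))) n
  - cauchy (fun k => cm (f k)) (fun k => sg (cp (g k))) n
  + cauchy (fun k => cpm (f k)) (fun k => c0 (g k)) n.
Proof.
rewrite sserME (big_morph (@cpm R) (id1 := 0) (op1 := +%R)) //.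
by rewrite -big_split -sumrB -big_split.
Qed.

Lemma cauchyZl (k : C) u v n : cauchy (fun m => k *: u m) v n = k *: cauchy u v n.
Proof. by rewrite /cauchy scaler_sumr; apply: eq_bigr => m _; rewrite scalerAl. Qed.
Lemma cauchyZr (k : C) u v n : cauchy u (fun m => k *: v m) n = k *: cauchy u v n.
Proof. by rewrite /cauchy scaler_sumr; apply: eq_bigr => m _; rewrite lam_scalerAr. Qed.

Lemma JopM f g : Jop (f * g) = Jop f * Jop g.
Proof.
have two u v : cauchy u (shiftn 1 (shiftn 1 v)) =1 shiftn 1 (shiftn 1 (cauchy u v)).
  by move=> m; rewrite cauchy_shift1r; apply: shiftn_eq => k; exact: cauchy_shift1r.
have two' u v : cauchy (shiftn 1 u) (shiftn 1 v) =1 shiftn 1 (shiftn 1 (cauchy u v)).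
  by move=> m; rewrite cauchy_shift1r; apply: shiftn_eq => k; exact: cauchy_shift1l.
have two'' u v : cauchy (shiftn 1 (shiftn 1 u)) v =1 shiftn 1 (shiftn 1 (cauchy u v)).
  by move=> m; rewrite cauchy_shift1l; apply: shiftn_eq => k; exact: cauchy_shift1l.
have sgi (h : nat -> L) : (fun k => sg (shiftn 1 (fun m => 'i *: h m) k)) = shiftn 1 (fun m => 'i *: sg (h m)).
  apply/funext => k; rewrite (shiftn_map _ _ _ (@lam_sign0 R)); apply: shiftn_eq => m; exact: lam_signZ.
have sh2 (h : nat -> L) : shiftn 2 (fun k => - h k) = shiftn 1 (shiftn 1 (fun k => (-1) *: h k)).
  by apply/funext => n; rewrite -shiftn2; apply: shiftn_eq => k; rewrite scaleN1r.
have ii : 'i * 'i = - 1 :> C by rewrite -expr2 sqrCi.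
apply: sserP => n; apply: sextP; rewrite [LHS]/=.
- by rewrite !c0_mul.
- rewrite [RHS]cp_mul -[RHS]/(cauchy (fun k => c0 (f k)) (shiftn 1 (fun k => 'i *: cp (g k))) n
    + cauchy (shiftn 1 (fun k => 'i *: cp (f k))) (fun k => sg (c0 (g k))) n).
  rewrite cauchy_shift1r cauchy_shift1l shiftnD; apply: shiftn_eq => m.
  by rewrite cauchyZl cauchyZr -scalerDr cp_mul.
- rewrite [RHS]cm_mul -[RHS]/(cauchy (fun k => c0 (f k)) (shiftn 1 (fun k => 'i *: cm (g k))) n
    + cauchy (shiftn 1 (fun k => 'i *: cm (f k))) (fun k => sg (c0 (g k))) n).
  rewrite cauchy_shift1r cauchy_shift1l shiftnD; apply: shiftn_eq => m.
  by rewrite cauchyZl cauchyZr -scalerDr cm_mul.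
rewrite [RHS]cpm_mul -[RHS]/(cauchy (fun k => c0 (f k)) (shiftn 2 (fun k => - cpm (g k))) n
  + cauchy (shiftn 1 (fun k => 'i *: cp (f k))) (fun k => sg (shiftn 1 (fun m => 'i *: cm (g m)) k)) n
  - cauchy (shiftn 1 (fun k => 'i *: cm (f k))) (fun k => sg (shiftn 1 (fun m => 'i *: cp (g m)) k)) n
  + cauchy (shiftn 2 (fun k => - cpm (f k))) (fun k => c0 (g k)) n).
rewrite !sgi !sh2 two !two' two'' -!shiftn2 (shiftn_map _ (h := -%R) _ _ (oppr0 _)) !shiftnD.
apply: shiftn_eq => m; rewrite cpm_mul !cauchyZl !cauchyZr !scalerA ii !scaleN1r.
by rewrite !opprD !opprK.
Qed.

Lemma good_Jop : good Jop.
Proof.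
split.
- move=> f g; apply: sserP => n; apply: sextP => //=; rewrite shiftnD; apply: shiftn_eq => m /=;
    by rewrite ?scalerDr ?opprD.
- move=> a f; apply: sserP => n; rewrite constSE constS_mul_comp.
  apply: sextP; rewrite /= ?constSE ?constS_mul_comp //; rewrite (shiftn_map _ (h := fun b => a * b) _ _ (mulr0 a));
    by apply: shiftn_eq => m; rewrite constSE constS_mul_comp /= ?lam_scalerAr ?mulrN.
- exact: JopM.
- have z m : [/\ cp ((1 : S) m) = 0, cm ((1 : S) m) = 0 & cpm ((1 : S) m) = 0] by rewrite sser1E; case: (m == 0)%N.
  apply: sserP => n; have [z1 z2 z3] := z n; apply: sextP; rewrite ?z1 ?z2 ?z3 //=; apply: shiftn_zero => m;
  by have [k1 k2 k3] := z m; rewrite ?k1 ?k2 ?k3 ?scaler0 ?oppr0.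
- move=> k f hf n; split=> hn /=.
  + by have [-> //] := hf n.
  + rewrite /shiftn; case: n hn => [|n] hn //=; rewrite subn1 /=.
    by have [_ h _ _] := hf n; rewrite h ?scaler0 //; clear -hn; lia.
  + rewrite /shiftn; case: n hn => [|n] hn //=; rewrite subn1 /=.
    by have [_ _ h _] := hf n; rewrite h ?scaler0 //; clear -hn; lia.
  + rewrite /shiftn; case: n hn => [|[|n]] hn //=; rewrite subn2 /=.
    by have [_ _ _ h] := hf n; rewrite h ?oppr0 //; clear -hn; lia.
- move=> f; apply: sserP => n; apply: sextP => //=.
  + rewrite (shiftn_map _ (h := fun b => - sg b)) ?lam_sign0 ?oppr0 //.
    by apply: shiftn_eq => m; rewrite lam_signZ scalerN.
  + rewrite (shiftn_map _ (h := fun b => - sg b)) ?lam_sign0 ?oppr0 //.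
    by apply: shiftn_eq => m; rewrite lam_signZ scalerN.
  + by rewrite (shiftn_map _ (h := sg)) ?lam_sign0 //; apply: shiftn_eq => m; rewrite lam_signN.
Qed.

Lemma triple_Jop : triple_of Jop = I_infty R.
Proof.
have xE (g : S) n : (constS 'i%:A * g * x) n = SExt 'i%:A 0 0 0 * (if (0 < n)%N then g (n - 1)%N else 0).
  by rewrite -mulrA -(sser_even_comm g (sser_sign_varx R)) -[x in x * g]expr1 constSE varxX_mulE.
congr (_, _, _); apply: sserP => n; rewrite ?xE ?constS_mul_comp.
- have z m : [/\ cp (x m) = 0, cm (x m) = 0 & cpm (x m) = 0] by rewrite /varx; case: (m == 1)%N.
  have [z1 z2 z3] := z n; apply: sextP; rewrite ?z1 ?z2 ?z3 //=; apply: shiftn_zero => m;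
  by have [k1 k2 k3] := z m; rewrite ?k1 ?k2 ?k3 ?scaler0 ?oppr0.
- rewrite !mulr_algl; case: n => [|n]; first by apply: sextP; rewrite /= ?scaler0.
  by case: n => [|[|n]]; apply: sextP; rewrite /= ?subn1 /shiftn /= ?subn1 ?subn2 /= ?scaler0 ?oppr0.
- rewrite !mulr_algl; case: n => [|n]; first by apply: sextP; rewrite /= ?scaler0.
  by case: n => [|[|n]]; apply: sextP; rewrite /= ?subn1 /shiftn /= ?subn1 ?subn2 /= ?scaler0 ?oppr0.
Qed.

Lemma Jop_inj : injective Jop.
Proof.
move=> f g e; apply: sserP => n.
have h m : Jop f m = Jop g m by rewrite e.
have i0 : ('i : C) != 0 := neq0Ci _.
have e1 : shiftn 1 (fun k => 'i *: cp (f k)) n.+1 = shiftn 1 (fun k => 'i *: cp (g k)) n.+1 :=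
  congr1 (@cp R) (h n.+1).
have e2 : shiftn 1 (fun k => 'i *: cm (f k)) n.+1 = shiftn 1 (fun k => 'i *: cm (g k)) n.+1 :=
  congr1 (@cm R) (h n.+1).
have e3 : shiftn 2 (fun k => - cpm (f k)) n.+2 = shiftn 2 (fun k => - cpm (g k)) n.+2 :=
  congr1 (@cpm R) (h n.+2).
apply: sextP; first exact: (congr1 (@c0 R) (h n)).
- by move: e1; rewrite !shiftnS !shiftn0 => /(scalerI i0).
- by move: e2; rewrite !shiftnS !shiftn0 => /(scalerI i0).
- by move: e3; rewrite !shiftnS !shiftn0 => /oppr_inj.
Qed.

Definition uinf (k : C) : S := constS ('i%:A) * (x ^+ 1 + constS (k%:A) * (x ^+ 2 * (pp * pm))).

Lemma uinfE k f n : (uinf k * f) n = SExt ('i *: shiftn 1 (fun m => c0 (f m)) n)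
  ('i *: shiftn 1 (fun m => cp (f m)) n) ('i *: shiftn 1 (fun m => cm (f m)) n)
  ('i *: (shiftn 1 (fun m => cpm (f m)) n + k *: shiftn 2 (fun m => c0 (f m)) n)).
Proof.
rewrite /uinf -mulrA constSE mulrDl sserDE varxX_mulE -[constS _ * _ * f]mulrA constSE.
rewrite -[x ^+ 2 * _ * f]mulrA varxX_mulE -[pp * pm * f]mulrA.
rewrite (_ : (if (2 <= n)%N then _ else _) = SExt 0 0 0 (shiftn 2 (fun m => c0 (f m)) n)); last first.
  rewrite /shiftn; case: ifP => // _; rewrite phip_mulE phim_mulE /=.
  by apply: sextP; rewrite /= ?lam_sign0 ?lam_signK.
rewrite !constS_mul_comp /shiftn; case: ifP => _; apply: sextP; rewrite /= ?mulr0 ?addr0 ?add0r -?scalerAl ?mul1r //.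
Qed.

Definition Dpoo f : S := dphip f + pm * dx_infty f.
Definition Dmoo f : S := dphim f + pp * dx_infty f.

Lemma dx_inftyE f n : dx_infty f n = - (if (2 <= n)%N then dx f (n - 2)%N else 0).
Proof. by rewrite /dx_infty -varxX_mulE. Qed.

Lemma Dpoo_Jop f : Dpoo (Jop f) = uinf 1 * Jop (Dp f).
Proof.
have i2 (a : L) : 'i *: ('i *: a) = - a by rewrite scalerA -expr2 sqrCi scaleN1r.
apply: sserP => n; rewrite uinfE /Dpoo sserDE phim_mulE dx_inftyE.
move: (Dp f) (DpE f) => g hg.
case: n => [|[|n]]; apply: sextP; rewrite /= /shiftn /= ?subn0 ?subn1 ?subn2 /= ?hg /= /dx ?c0Mn ?cpMn /= /shiftn /= ?subn0 ?subn1 /=.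
12: case: n => [|n]; rewrite /= ?subn2 /= ?hg /=.
all: rewrite !(lam_sign0, lam_signZ, lam_signN, lam_signMn, scaler0, oppr0, addr0, add0r, sub0r, i2, opprK, scale1r, mulr1n, opprD) //.
all: try by rewrite ?mulNrn ?opprK.
by rewrite mulNrn opprK -mulrSr scalerMnr.
Qed.

Lemma Dmoo_Jop f : Dmoo (Jop f) = uinf (- 1) * Jop (Dm f).
Proof.
have i2 (a : L) : 'i *: ('i *: a) = - a by rewrite scalerA -expr2 sqrCi scaleN1r.
apply: sserP => n; rewrite uinfE /Dmoo sserDE phip_mulE dx_inftyE.
move: (Dm f) (DmE f) => g hg.
case: n => [|[|n]]; apply: sextP; rewrite /= /shiftn /= ?subn0 ?subn1 ?subn2 /= ?hg /= /dx ?c0Mn ?cmMn /= /shiftn /= ?subn0 ?subn1 /=.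
12: case: n => [|n]; rewrite /= ?subn2 /= ?hg /=.
all: rewrite !(lam_sign0, lam_signZ, lam_signN, lam_signMn, scaler0, oppr0, addr0, add0r, sub0r, i2, opprK, scale1r, mulr1n, opprD) //.
all: try by rewrite ?mulNrn ?opprK.
all: rewrite ?scaleN1r ?scalerN //.
rewrite -[X in _ - X]/(('i *: sg (cm (f n.+1))) *+ n.+1) -!opprD scalerN -mulrS -mulrSr.
by rewrite scalerMnr.
Qed.

(** Up to the term in y^2 phi+ phi- the factor is i y, which merely shifts coefficients. That term
    brings in only the coefficients without phi's, already known to agree. *)
Lemma uinf_cancel k f g : uinf k * f = uinf k * g -> f = g.
Proof.
move=> e; have h n : (uinf k * f) n = (uinf k * g) n by rewrite e.
have i0 : ('i : C) != 0 := neq0Ci _.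
have S1 (u : nat -> L) n : shiftn 1 u n.+1 = u n by rewrite shiftnS shiftn0.
have e0 n : c0 (f n) = c0 (g n).
  by have := congr1 (@c0 R) (h n.+1); rewrite !uinfE [LHS]/= [RHS]/= !S1 => /(scalerI i0).
apply: sserP => n; apply: sextP; first exact: e0.
- by have := congr1 (@cp R) (h n.+1); rewrite !uinfE [LHS]/= [RHS]/= !S1 => /(scalerI i0).
- by have := congr1 (@cm R) (h n.+1); rewrite !uinfE [LHS]/= [RHS]/= !S1 => /(scalerI i0).
- have := congr1 (@cpm R) (h n.+1); rewrite !uinfE [LHS]/= [RHS]/= !S1 (shiftn_eq _ _ e0).
  by move=> /(scalerI i0)/addIr.
Qed.

Lemma uinf_comm k f : uinf k * f = f * uinf k.
Proof.
have ec (c : C) : sgS (constS c%:A) = constS c%:A by rewrite sser_sign_const lam_signZ lam_sign1.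
apply: sser_even_comm; rewrite /uinf !(sser_signM, sser_signD) ?expr1 ?expr2 ?sser_signM !ec.
by rewrite sser_sign_varx sser_sign_phip sser_sign_phim mulrNN.
Qed.

(** Substituting I is an injective morphism, and it intertwines the derivations up to even factors
    that commute and can be cancelled, so each equation holds before the substitution exactly when
    it holds after. *)
Lemma superconformal_infty K : superconformal (@dx_infty R) (tcomp K (I_infty R)) <-> superconformal (@dx R) K.
Proof.
have gJ := good_Jop; rewrite -triple_Jop /tcomp -!(scomp_good _ gJ).
have J0 : Jop 0 = 0 by apply: (addrI (Jop 0)); rewrite -(goodD gJ) !addr0.
have JN f : Jop (- f) = - Jop f by apply: (addrI (Jop f)); rewrite -(goodD gJ) !subrr.
have par (p : bool) f : series_parity p (Jop f) <-> series_parity p f.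
  rewrite !series_parityP (good_sign gJ); case: p; rewrite -?JN; split=> [/Jop_inj|->] //.
have eqp f g h : Dpoo (Jop f) = Jop g * Dpoo (Jop h) <-> Dp f = g * Dp h.
  rewrite !Dpoo_Jop mulrA -(uinf_comm _ (Jop g)) -mulrA -JopM.
  by split=> [/uinf_cancel/Jop_inj|->].
have eqm f g h : Dmoo (Jop f) = Jop g * Dmoo (Jop h) <-> Dm f = g * Dm h.
  rewrite !Dmoo_Jop mulrA -(uinf_comm _ (Jop g)) -mulrA -JopM.
  by split=> [/uinf_cancel/Jop_inj|->].
have zp f : Dpoo (Jop f) = 0 <-> Dp f = 0.
  rewrite Dpoo_Jop; split=> [h|->]; last by rewrite J0 mulr0.
  by apply/Jop_inj/(@uinf_cancel 1); rewrite h J0 mulr0.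
have zm f : Dmoo (Jop f) = 0 <-> Dm f = 0.
  rewrite Dmoo_Jop; split=> [h|->]; last by rewrite J0 mulr0.
  by apply/Jop_inj/(@uinf_cancel (- 1)); rewrite h J0 mulr0.
case: K => [[X P] M] /=.
change (([/\ series_parity false (Jop X), series_parity true (Jop P) & series_parity true (Jop M)] /\
  [/\ Dpoo (Jop M) = 0, Dmoo (Jop P) = 0, Dpoo (Jop X) = Jop M * Dpoo (Jop P) & Dmoo (Jop X) = Jop P * Dmoo (Jop M)] /\
  (Dpoo (Jop P) != 0 /\ Dmoo (Jop M) != 0)) <->
  ([/\ series_parity false X, series_parity true P & series_parity true M] /\
  [/\ Dp M = 0, Dm P = 0, Dp X = M * Dp P & Dm X = P * Dm M] /\ (Dp P != 0 /\ Dm M != 0))).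
have np f : Dpoo (Jop f) != 0 <-> Dp f != 0 by split; apply: contra_neq => /zp.
have nm f : Dmoo (Jop f) != 0 <-> Dm f != 0 by split; apply: contra_neq => /zm.
by split=> -[[h1 h2 h3] [[h4 h5 h6 h7] [h8 h9]]]; (split; [split; exact/par|split;
  [split; [exact/zp|exact/zm|exact/eqp|exact/eqm]|split; [exact/np|exact/nm]]]).
Qed.

End SubstitutionAtInfinity.

(** * Values and germs near infinity *)

Section GermsAtInfinity.
Variable R : realType.
Local Notation C := (R[i]).
Local Notation L := (Lam R).
Local Notation L0 := (Lam0 R).
Local Notation S := (sser R).
Local Notation sgS := (@sser_sign R).
Local Notation spoint := (spoint R).
Local Notation data := (data R).
Local Notation x := (varx R).
Local Notation pp := (phip R).
Local Notation pm := (phim R).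
Local Notation uone := (uone R).
Local Opaque circ circoo eop vf Etilde twist.
Implicit Types (a b : L) (I J : {fset nat}) (r s : R) (f g h : S) (p q : spoint) (F G K H : triple R)
  (A B : data) (z : L0).

Lemma cnV (w : C) : cnorm w^-1 = (cnorm w)^-1.
Proof.
have [->|w0] := eqVneq w 0; first by rewrite invr0 cn0 invr0.
have c0 : cnorm w != 0 by apply/eqP => /cn_eq0 /eqP; rewrite (negPf w0).
by apply: (mulfI c0); rewrite -cnM !divff ?cn1.
Qed.

Lemma body_inv z : body z != 0 -> body (z^-1 : L0) = (body z)^-1.
Proof.
move=> z0; apply: (mulfI z0); rewrite divff // -bodyM -[in RHS](body1 R); congr body.
by rewrite -[LHS]/((z * z^-1 : L0) : L) mulrV // lam0_unitP.
Qed.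

Definition point_infty p : spoint := let: (z, th, ph) := p in
  (z^-1, mul01 ('i *: z^-1) th, mul01 ('i *: z^-1) ph).

Lemma mul01A (u v : L0) (th : Lam1 R) : mul01 u (mul01 v th) = mul01 (u * v) th.
Proof. by apply: val_inj; rewrite /= mulrA. Qed.
Lemma mul01_1 (th : Lam1 R) : mul01 1 th = th.
Proof. by apply: val_inj; rewrite /= mul1r. Qed.

Lemma scale_invM z (k l : C) : body z != 0 -> k * l = 1 -> (k *: z^-1) * (l *: z) = 1.
Proof. by move=> z0 kl; rewrite lam0_scaleMM kl scale1r mulVr // lam0_unitP. Qed.

Lemma IevK p : body p.1.1 != 0 -> point_infty (I_inv p) = p.
Proof.
case: p => [[z th] ph] /= z0; rewrite invrK !mul01A.
have ii : - 'i * 'i = 1 :> C by rewrite mulNr -expr2 sqrCi opprK.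
by rewrite [('i *: z) * _]lam0C (scale_invM z0) // !mul01_1.
Qed.

Lemma body_I_inv p : (I_inv p).1.1 = p.1.1^-1. Proof. by case: p => [[z th] ph]. Qed.
Lemma body_Iev p : (point_infty p).1.1 = p.1.1^-1. Proof. by case: p => [[z th] ph]. Qed.
Lemma body_inv_x p : (inv_x p).1.1 = p.1.1^-1. Proof. by case: p => [[z th] ph]. Qed.

Lemma nearooP (P : set spoint) : nearoo P <-> exists2 r : R, 0 < r & forall p, r < cnorm (body p.1.1) -> P p.
Proof.
split=> [[r h]|[r _ h]]; last by exists r.
exists (Num.max r 1); first by rewrite lt_max ltr01 orbT.
by move=> p; rewrite gt_max => /andP[hr _]; exact: h.
Qed.

Lemma nearoo_and (P Q : set spoint) : nearoo P -> nearoo Q -> nearoo (P `&` Q).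
Proof.
move=> [r hP] [s hQ]; exists (Num.max r s) => p; rewrite gt_max => /andP[h1 h2].
by split; [exact: hP|exact: hQ].
Qed.

Lemma nearooW (P Q : set spoint) : P `<=` Q -> nearoo P -> nearoo Q.
Proof. by move=> PQ [r h]; exists r => p /h/PQ. Qed.

(** Neighbourhoods see only the body of the even coordinate. Quantifying over all q with that
    coordinate makes one statement serve [inv_x], [I_inv] and [point_infty], which differ in their
    odd coordinates. *)
Lemma nearoo_near0 (P : set spoint) : near0 P -> nearoo [set p : spoint | body p.1.1 != 0 /\
  forall q, q.1.1 = p.1.1^-1 -> P q].
Proof.
move=> /near0P[r r0 hP]; apply/nearooP; exists r^-1; first by rewrite invr_gt0.
move=> p hp; have p0 : 0 < cnorm (body p.1.1) by apply: lt_trans hp; rewrite invr_gt0.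
have b0 : body p.1.1 != 0 by apply: contraTneq p0 => ->; rewrite cn0 ltxx.
by split=> // q hq; apply: hP; rewrite hq body_inv // cnV -[r]invrK ltf_pV2 // posrE // invr_gt0.
Qed.

Lemma near0_nearoo (P : set spoint) : nearoo P -> near0 [set p : spoint | body p.1.1 != 0 ->
  forall q, q.1.1 = p.1.1^-1 -> P q].
Proof.
move=> /nearooP[r r0 hP]; apply/near0P; exists r^-1; first by rewrite invr_gt0.
move=> p hp b0 q hq; have p0 : 0 < cnorm (body p.1.1).
  by rewrite lt_def cn_ge0 andbT; apply: contra_neq b0; exact: cn_eq0.
by apply: hP; rewrite hq body_inv // cnV -[r]invrK ltf_pV2 // posrE invr_gt0.
Qed.

Lemma value_infty p : value3 (I_infty R) (inv_x p) (point_infty p).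
Proof.
have h g v q : (forall n, g n.+1 = 0) -> odd_eval q (g 0%N) = v ->
    value (constS 'i%:A * g * x) q ('i%:A * (v * (q.1.1 : L))).
  move=> g0 gv; have e : constS 'i%:A * g * x = constS 'i%:A * (x * g).
    by rewrite -mulrA (sser_even_comm g (sser_sign_varx R)).
  rewrite e -gv; apply: (@value_const R 'i%:A (x * g) q) => J.
  apply: (limL_eventually (u := fun=> odd_eval q (g 0%N) * (q.1.1 : L)) (N1 := 2)) (limL_const J 1 _) => -[//|[//|N]] _.
  have xg n : (x * g) n = if (0 < n)%N then g (n - 1)%N else 0 by rewrite -[x in x * g]expr1 varxX_mulE.
  have e0 : odd_eval q 0 = 0 by rewrite /odd_eval /= !mul0r !addr0.
  rewrite /partial_eval !big_ord_recl big1 => [|n _]; last by rewrite xg /= subn1 /= g0 e0 mul0r.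
  by rewrite !xg /= e0 mul0r add0r addr0 expr1.
case: p => [[z th] ph]; split; first exact: value_varx.
  have -> : ((point_infty (z, th, ph)).1.2 : L) = 'i%:A * ((th : L) * (z^-1 : L0)).
    by rewrite -lam0_commC mulr_algl scalerAl.
  by apply: h => //; rewrite /odd_eval /= !mul0r !addr0 add0r mul1r.
have -> : ((point_infty (z, th, ph)).2 : L) = 'i%:A * ((ph : L) * (z^-1 : L0)).
  by rewrite -lam0_commC mulr_algl scalerAl.
by apply: h => //; rewrite /odd_eval /= !mul0r !addr0 !add0r mul1r.
Qed.

Lemma convM r f g : 0 <= r -> conv r f -> conv r g -> conv r (f * g).
Proof.
move=> r0 cf cg I; have [B hB] := cf I; have [D hD] := cg I; exists (B * D) => M.
by apply: le_trans (QM I ler01 ler01 r0 M f g) _; apply: ler_pM; rewrite ?Q_ge0.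
Qed.

Lemma conv_I_infty : conv3 1 (I_infty R).
Proof.
have [c1 c2] := @conv_phi R 1; have cx := @conv_varx R 1 ler01.
by split; [exact: cx|apply: convM => //; exact: conv_const|apply: convM => //; exact: conv_const].
Qed.

Lemma tri_wt_I_infty : tri_wt (I_infty R).
Proof. by rewrite -triple_Jop; exact: tri_wt_good (@good_Jop R). Qed.

Lemma has_sum3_value F p q : has_sum3 F p q -> value3 F p q.
Proof. by move=> [h1 h2 h3]; split; exact: has_sum_value. Qed.

Lemma infty_value r K : 0 < r -> conv3 r K -> exists2 s : R, 0 < s &
  forall p, cnorm (body (inv_x p).1.1) < s -> forall v,
    value3 (tcomp K (I_infty R)) (inv_x p) v <-> value3 K (point_infty p) v.
Proof.
move=> r0 [c1 c2 c3]; have [l hl] := conv_shrinks ltr01 conv_I_infty tri_wt_I_infty r0.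
have [l0 l1 _ _] := hl; exists (l ^+ 2 * 1) => [|p hp v]; first by rewrite mulr1 exprn_gt0.
have [wX _ _] := tri_wt_I_infty; have [_ h] := value_scomp hl wX r0 hp (value_infty p).
split=> -[h1 h2 h3]; split.
- exact: (h _ c1 _).1 h1.
- exact: (h _ c2 _).1 h2.
- exact: (h _ c3 _).1 h3.
- exact: (h _ c1 _).2 h1.
- exact: (h _ c2 _).2 h2.
- exact: (h _ c3 _).2 h3.
Qed.

(** [Jop] shifts the coefficients by at most two powers of x and multiplies them by factors of
    modulus 1; undoing the shifts costs r^(-1) and r^(-2). *)
Lemma conv_Jop_inv r f : 0 < r -> conv r (Jop f) -> conv r f.
Proof.
move=> r0 h I; have [B hB] := h I.
have n0 a := @nL_ge0 R I 1 a ler01; have rn n : 0 <= r ^+ n by rewrite exprn_ge0 // ltW.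
have ni a : nL I 1 ('i *: a) = nL I 1 a.
  by apply: eq_bigr => J _; rewrite lamZE cnM (_ : cnorm 'i = 1) ?mul1r // /cnorm normCi.
have part (u : nat -> L) k : (forall n, nL I 1 (u n) <= nE I 1 1 (Jop f (n + k)%N)) ->
    forall M, \sum_(n < M) nL I 1 (u n) * r ^+ n <= B / r ^+ k.
  move=> hu M; rewrite ler_pdivlMr ?exprn_gt0 // mulr_suml; apply: le_trans (hB (M + k)%N).
  apply: (@le_trans _ _ (\sum_(n < M) nE I 1 1 (Jop f (n + k)%N) * r ^+ (n + k))).
    by apply: ler_sum => n _; rewrite exprD mulrA; do 2 apply: ler_wpM2r => //.
  rewrite /Q -!(big_mkord xpredT (fun n => nE I 1 1 (Jop f (n + k)%N) * r ^+ (n + k))).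
  rewrite -(big_mkord xpredT (fun n => nE I 1 1 (Jop f n) * r ^+ n)) (@big_cat_nat _ _ _ k 0 (M + k)) ?leq_addl //=.
  have e := @big_addn R 0 +%R 0 (M + k) k xpredT (fun n => nE I 1 1 (Jop f n) * r ^+ n).
  rewrite add0n addnK in e; rewrite e lerDr; apply: sumr_ge0 => n _.
  by rewrite mulr_ge0 // nE_ge0.
have S1 (u : nat -> L) n : shiftn 1 u (n + 1) = u n by rewrite addn1 shiftnS shiftn0.
have S2 (u : nat -> L) n : shiftn 2 u (n + 2) = u n by rewrite addn2 !shiftnS shiftn0.
exists (B / r ^+ 0 + (B / r ^+ 1 + B / r ^+ 1) + B / r ^+ 2) => M.
have -> : Q I 1 1 r M f = \sum_(n < M) nL I 1 (c0 (f n)) * r ^+ n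
    + (\sum_(n < M) nL I 1 (cp (f n)) * r ^+ n + \sum_(n < M) nL I 1 (cm (f n)) * r ^+ n)
    + \sum_(n < M) nL I 1 (cpm (f n)) * r ^+ n.
  rewrite -!big_split /=; apply: eq_bigr => n _.
  by rewrite /nE expr1n !mul1r !mulrDl.
have E n : nE I 1 1 (Jop f n) = nL I 1 (c0 (Jop f n)) + (nL I 1 (cp (Jop f n)) + nL I 1 (cm (Jop f n)))
    + nL I 1 (cpm (Jop f n)) by rewrite /nE expr1n !mul1r.
have all0 n : [/\ 0 <= nL I 1 (c0 (Jop f n)), 0 <= nL I 1 (cp (Jop f n)), 0 <= nL I 1 (cm (Jop f n))
  & 0 <= nL I 1 (cpm (Jop f n))] by [].
apply: lerD; [apply: lerD; [apply: (part (fun n => c0 (f n)) 0%N)|apply: lerD;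
  [apply: (part (fun n => cp (f n)) 1%N)|apply: (part (fun n => cm (f n)) 1%N)]]|
  apply: (part (fun n => cpm (f n)) 2%N)] => n; rewrite E.
- by rewrite addn0 -!addrA lerDl !addr_ge0.
- have [a1 a2 a3 a4] := all0 (n + 1)%N; rewrite -(ni (cp (f n))).
  have -> : 'i *: cp (f n) = cp (Jop f (n + 1)) by rewrite -[RHS]/(shiftn 1 (fun k => 'i *: cp (f k)) (n + 1)) S1.
  by move: a1 a2 a3 a4; clear; lra.
- have [a1 a2 a3 a4] := all0 (n + 1)%N; rewrite -(ni (cm (f n))).
  have -> : 'i *: cm (f n) = cm (Jop f (n + 1)) by rewrite -[RHS]/(shiftn 1 (fun k => 'i *: cm (f k)) (n + 1)) S1.
  by move: a1 a2 a3 a4; clear; lra.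
- have [a1 a2 a3 a4] := all0 (n + 2)%N; rewrite -(nLN _ _ (cpm (f n))).
  have -> : - cpm (f n) = cpm (Jop f (n + 2)) by rewrite -[RHS]/(shiftn 2 (fun k => - cpm (f k)) (n + 2)) S2.
  by move: a1 a2 a3 a4; clear; lra.
Qed.

(** High powers of the even coordinate vanish, so the sum is finite. This covers the points near
    zero that do not come from infinity. *)
Lemma nilpotent_value f p : body p.1.1 = 0 -> exists v, value f p v.
Proof.
move=> /soul_nilpotent[n zn]; exists (partial_eval n f p) => I.
apply: (limL_eventually (u := fun=> partial_eval n f p) (N1 := n)) (limL_const I 1 _) => N nN.
rewrite /partial_eval -!(big_mkord xpredT (fun k => odd_eval p (f k) * (p.1.1 : L) ^+ k)) (@big_cat_nat _ _ _ n 0 N) //=.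
rewrite [X in _ + X]big_nat_cond [X in _ + X]big1 ?addr0 // => k /andP[/andP[nk _] _].
by rewrite -(subnK nk) exprD zn !mulr0.
Qed.

Lemma even_odd_value K p (v1 v2 v3 : L) : even_odd K -> value K.1.1 p v1 -> value K.1.2 p v2 -> value K.2 p v3 ->
  value3 K p (to_even v1, to_odd v2, to_odd v3).
Proof.
move=> [e1 e2 e3] h1 h2 h3.
by split; rewrite ?(value_even e1 h1) ?(value_odd e2 h2) ?(value_odd e3 h3).
Qed.

(** Convergence of K comes from that of [Jop] applied to its components at one real point. Near
    zero, a point with nonzero body is I of a point near infinity, where F supplies the value; the
    others are handled by [nilpotent_value] and parity. *)
Lemma sums_of_infty K (F : spoint -> spoint) : even_odd K ->
  nearoo [set p | has_sum3 (tcomp K (I_infty R)) (inv_x p) (F p)] ->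
  sums K /\ nearoo [set p | tri_eval K (point_infty p) = F p].
Proof.
move=> eoK hF; have /near0P[r r0 h] := near0_nearoo hF.
pose t := r / 2; have t0 : 0 < t by rewrite divr_gt0.
have wt_trunc : t < r by rewrite ltr_pdivrMr // ltr_pMr // ltr1n.
have cK : conv3 t K.
  have key f th ph : (forall p, has_sum3 (tcomp K (I_infty R)) (inv_x p) (F p) -> exists v, has_sum f (inv_x p) v) ->
      exists v, has_sum f (rpoint t%:C%C th ph) v.
    move=> hf; pose z : L0 := (t%:C%C)%:A; have bz : body z = t%:C%C := body_scalar _.
    have z0 : body z != 0 by rewrite bz fmorph_eq0 gt_eqF.
    have hz : cnorm (body z) < r by rewrite bz cnR ger0_norm // ltW.
    have hq := h (z, th, ph) hz z0 (z^-1, th, ph) erefl.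
    by have [v] := hf _ hq; rewrite /inv_x invrK; exists v.
  rewrite /tcomp -triple_Jop -!(scomp_good _ (@good_Jop R)) in key.
  split.
  - by apply: (conv_Jop_inv t0); apply: (conv_of_sum t0) => th ph; apply: key => p [h1 _ _]; exists (F p).1.1.
  - by apply: (conv_Jop_inv t0); apply: (conv_of_sum t0) => th ph; apply: key => p [_ h2 _]; exists (F p).1.2.
  - by apply: (conv_Jop_inv t0); apply: (conv_of_sum t0) => th ph; apply: key => p [_ _ h3]; exists (F p).2.
have [s s0 hs] := infty_value t0 cK.
have val p : cnorm (body (inv_x p).1.1) < s -> has_sum3 (tcomp K (I_infty R)) (inv_x p) (F p) -> value3 K (point_infty p) (F p).
  by move=> hp hF'; exact: (hs p hp _).1 (has_sum3_value hF').
split.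
  apply/sumsP; exists (Num.min t s); split; first by rewrite lt_min t0.
    by apply: conv3W cK; [rewrite le_min (ltW t0) ltW|rewrite ge_min lexx].
  move=> p; rewrite lt_min => /andP[odd_point ps]; have [b0|b0] := eqVneq (body p.1.1) 0.
    have [v1 h1] := nilpotent_value K.1.1 b0; have [v2 h2] := nilpotent_value K.1.2 b0.
    have [v3 h3] := nilpotent_value K.2 b0.
    by exists (to_even v1, to_odd v2, to_odd v3); exact: even_odd_value.
  exists (F (I_inv p)); rewrite -[p in value3 K p](IevK b0); apply: val.
    by rewrite body_inv_x body_I_inv invrK.
  exact: (h p (lt_trans odd_point wt_trunc) b0 _ (body_I_inv p)).
have /nearoo_near0 : near0 [set q : spoint | cnorm (body q.1.1) < Num.min t s].
  by apply/near0P; exists (Num.min t s) => //; rewrite lt_min t0.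
move=> /(nearoo_and hF); apply: nearooW => p [hp [_ hq]].
have := hq _ (body_inv_x p); rewrite /mkset lt_min => /andP[h1 h2].
apply: evalE; apply/(has_sum3P _ cK); first by rewrite body_Iev -body_inv_x.
exact: val h2 hp.
Qed.

Lemma infty_of_sums K : tri_wt K -> sums K ->
  nearoo [set p | has_sum3 (tcomp K (I_infty R)) (inv_x p) (tri_eval K (point_infty p))].
Proof.
move=> wK /sumsP[r [r0 cK hK]]; have [s s0 hs] := infty_value r0 cK; have [k1 k2 k3] := cK.
have [s1 s10 c1] := conv_scomp r0 ltr01 k1 conv_I_infty tri_wt_I_infty.
have [s2 s20 c2] := conv_scomp r0 ltr01 k2 conv_I_infty tri_wt_I_infty.
have [s3 s30 c3] := conv_scomp r0 ltr01 k3 conv_I_infty tri_wt_I_infty.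
pose m := Num.min (Num.min r s) (Num.min s1 (Num.min s2 s3)).
have /nearoo_near0 : near0 [set q : spoint | cnorm (body q.1.1) < m].
  by apply/near0P; exists m => //; rewrite /m !lt_min r0 s0 s10 s20 s30.
apply: nearooW => p [_ hq]; have := hq _ (body_inv_x p); rewrite /mkset /m !lt_min.
move=> /andP[/andP[hr hs'] /and3P[h1 h2 h3]].
have hp : cnorm (body (point_infty p).1.1) < r by rewrite body_Iev -body_inv_x.
have [v hv] := hK _ hp; rewrite (evalE ((has_sum3P v cK hp).2 hv)).
have [v1 v2 v3] := (hs p hs' v).2 hv.
split; apply: value_has_sum; [exact: conv_regular c1 h1|exact: v1|exact: conv_regular c2 h2|exact: v2
  |exact: conv_regular c3 h3|exact: v3].
Qed.

Lemma body_value f p v : at0 f = 0 -> body p.1.1 = 0 -> value f p v -> body v = 0.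
Proof.
move=> f0 b0 hv; apply/cn_eq0/eqP; rewrite eq_le cn_ge0 andbT; apply/ler_addgt0Pr => d d0.
have [N0 hN] := hv fset0 d d0; have := le_trans (nL_coef1 fset0 _) (hN N0.+1 (leqnSn _)).
rewrite -[(_ - v) fset0]/(body (partial_eval N0.+1 f p) - body v) (_ : body (partial_eval N0.+1 f p) = 0) ?sub0r ?cnN ?add0r //.
have bD : {morph (fun a : L => body a) : a b / a + b >-> a + b} by [].
rewrite /partial_eval (big_morph _ bD (id1 := 0)) // big_ord_recl big1 => [|n _]; last first.
  by rewrite exprS !bodyM b0 mul0r mulr0.
have bDE a b : body (a + b) = body a + body b by [].
rewrite addr0 [_ ^+ _]expr0 mulr1 /odd_eval !bDE !bodyM !body_odd !mulr0 !addr0.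
by rewrite -[c0 _]/(at0 f) f0.
Qed.

Definition eval_twist A := tri_eval (Etilde (twist A)).
Definition germ_infty A := germ (@nearoo R) (eval_twist A \o point_infty).

Lemma sums_twist A : Hconv (twist A) -> sums (Etilde (twist A)). Proof. by []. Qed.

Lemma tri_wt_Etilde A : tri_wt (Etilde A).
Proof. by rewrite EtildeE; exact: tri_wt_good (good_eop A). Qed.

Lemma tcomp_Etilde A B : tcomp (Etilde B) (Etilde A) = Etilde (dcirc A B).
Proof.
rewrite [Etilde B]EtildeE [Etilde A]EtildeE (tcomp_good _ (good_eop A)) EtildeE.
exact/esym/eq_triple_of/eop_dcirc.
Qed.

Lemma eval_Etilde A B : Hconv A -> Hconv B ->
  near0 [set p | tri_eval (Etilde (dcirc A B)) p = tri_eval (Etilde B) (tri_eval (Etilde A) p)].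
Proof.
move=> hA hB; apply: near0W (eval_tcomp (tri_wt_Etilde A) hB hA) => p; rewrite /mkset.
rewrite tcomp_Etilde; exact: evalE.
Qed.

(** If the value had body 0, applying the series of - A to it would give back p with body 0. The
    germ product needs this in order to pass through [I_inv]. *)
Lemma eval_body_neq0 A : Hconv A -> near0 [set p : spoint | body p.1.1 != 0 -> body (tri_eval (Etilde A) p).1.1 != 0].
Proof.
move=> hA; have [H0 HN _] := dgroup_Hconv R; have hN := HN _ hA.
have sE (B : data) : Hconv B -> sums (Etilde B) by [].
have van : near0 [set q : spoint | body q.1.1 = 0 -> body (tri_eval (Etilde (- A)) q).1.1 = 0].
  apply: near0W ((sums_eval _).1 (sE _ hN)) => q [h _ _] b0.
  apply: body_value b0 (has_sum_value h); rewrite EtildeE.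
  by have [] := good_vanishes (good_eop (- A)).
have id0 : near0 [set p | tri_eval (Etilde (0 : data)) p = p].
  have e0 : Etilde (0 : data) = triple_of id.
    by rewrite EtildeE; apply: eq_triple_of => f; exact: eop_data0.
  have [h1 h2] := @conv_phi R 1; apply/near0P; exists 1 => // p hp; apply: evalE; rewrite e0.
  have c : conv3 1 (triple_of id : triple R) by split=> //; exact: conv_varx.
  by apply/(has_sum3P _ c hp); have [] := value_phi p; split=> //; exact: value_varx.
have := near0_and (eval_small (tri_wt_Etilde A) (sE _ hA) van) (near0_and id0 (eval_Etilde hA hN)).
apply: near0W => p [/= k1 [k2 k3]]; apply: contra_neq => b0.
by move: k3; rewrite (dcircN A).1 k2 => ->; exact: k1.
Qed.

Lemma near_pull (P : set spoint) : near0 P -> nearoo [set p | P (point_infty p)].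
Proof. by move=> /nearoo_near0; apply: nearooW => p [_]; apply; exact: body_Iev. Qed.

Lemma nearoo_neq0 : nearoo [set p : spoint | body p.1.1 != 0].
Proof. by have /nearoo_near0 := near0T R; apply: nearooW => p []. Qed.

Lemma germ_infty_self (F : spoint -> spoint) : germ (@nearoo R) F F.
Proof. by exists 0 => p _. Qed.

Lemma germsoo_mulE A B w : Hconv_infty A -> Hconv_infty B ->
  germsoo_mul (germ_infty A) (germ_infty B) w <-> w = germ_infty (circoo A B).
Proof.
move=> hA hB.
have key (F G : spoint -> spoint) : germ_infty A F -> germ_infty B G -> germ (@nearoo R) (F \o I_inv (R := R) \o G) = germ_infty (circoo A B).
  move=> hF hG; apply: (germ_eq nearoo_and nearooW).
  have k1 := near_pull (eval_small (tri_wt_Etilde (twist B)) (sums_twist hB) (near0_nearoo hF)).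
  have k2 := near_pull (eval_body_neq0 hB); have k3 := near_pull (eval_Etilde hB hA).
  have := nearoo_and (nearoo_and k1 nearoo_neq0) (nearoo_and hG (nearoo_and k2 k3)).
  apply: nearooW => p [[e1 b0] [e2 [e3 e4]]]; move: e1 e2 e3 e4; rewrite /mkset /= -/(eval_twist B) => e1 e2 e3 e4.
  have bI : body (point_infty p).1.1 != 0 by rewrite body_Iev body_inv // invr_eq0.
  have bq := e3 bI; rewrite e2 (e1 bq _ (body_I_inv _)) IevK // /eval_twist twist_circoo.
  by rewrite e4.
split=> [[F [G [hF hG ->]]]|->]; first exact: key.
exists (eval_twist A \o point_infty), (eval_twist B \o point_infty); split; [exact: germ_infty_self|exact: germ_infty_self|].
by rewrite key //; exact: germ_infty_self.
Qed.

Lemma germ_infty_inj A B : Hconv_infty A -> Hconv_infty B -> germ_infty A = germ_infty B -> A = B.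
Proof.
move=> hA hB e; apply: (can_inj (@twistK R)); apply: Etilde_inj.
apply: (eval_inj (sums_twist hA) (sums_twist hB)).
have : germ_infty B (eval_twist A \o point_infty) by rewrite -e; exact: germ_infty_self.
move=> /near0_nearoo; apply: near0W => p h b0; have := h b0 _ (body_I_inv p).
by rewrite /mkset /= (IevK b0).
Qed.

Lemma germsooE : @germsoo R = germ_infty @` (@Hconv_infty R).
Proof.
apply/seteqP; split=> [_ [F [H [K [eH sH vK oK hF]]] ->]|_ [A /= hA <-]].
  have sK : superconformal (@dx R) K by apply/superconformal_infty; rewrite -eH.
  have [B eB] := Etilde_surj sK vK oK; rewrite eH in hF.
  have eo : even_odd K by rewrite -eB EtildeE; exact: even_odd_good (good_eop B).
  have [cK nF] := sums_of_infty eo hF; exists (untwist B).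
    by rewrite /Hconv_infty /mkset untwistK /Hconv /mkset eB; exact: cK.
  apply: (germ_eq nearoo_and nearooW); apply: nearooW nF => p; rewrite /mkset /eval_twist /= untwistK eB.
  by [].
exists (eval_twist A \o point_infty) => //; exists (tcomp (Etilde (twist A)) (I_infty R)), (Etilde (twist A)).
split=> //.
- exact/superconformal_infty/superconformal_Etilde.
- by rewrite EtildeE; exact: good_vanishes (good_eop (twist A)).
- by rewrite EtildeE; exact: one_coefs_eop.
- exact: infty_of_sums (tri_wt_Etilde _) (sums_twist hA).
Qed.

(** Germs multiply like [circoo], whereas sewing at infinity exchanges its arguments; negation, the
    inverse for [circoo], mediates between the two orders. *)
Lemma isomorphic_germsoo :
  isomorphic_on (at_infty (@Hconv_infty R)) (@sew R) (@germsoo R) (@germsoo_mul R).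
Proof.
have gH := group_circoo (dgroup_Hconv R); have [_ HN _] := dgroup_Hconv R.
have hN A : Hconv_infty A -> Hconv_infty (- A) by rewrite /Hconv_infty /mkset (twistN A); exact: HN.
rewrite at_inftyE germsooE.
apply: (@isomorphic_anti _ (fun A B => circoo B A) _ _ -%R (fun A => (A, (uone, 0))) fst germ_infty (@sew R)
  (@germsoo_mul R) (@Hconv_infty R) (group_on_flip gH) hN).
- exact: opprK.
- by move=> A B; exact: oppr_circoo.
- by [].
- by move=> A B w _ _; exact: sew_at_infty.
- by move=> A B w hA hB; exact: germsoo_mulE.
- by move=> A B hA hB; exact: germ_infty_inj.
Qed.

End GermsAtInfinity.

(** * Even multiples of a single datum *)

Section Lines.
Variable R : realType.
Local Notation L0 := (Lam0 R).
Local Notation data := (data R).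
Local Notation uone := (uone R).
Local Opaque circ circoo eop vf Etilde twist Hconv.
Implicit Types (A B : data) (s t : L0) (P : set L0).

Definition line P A : set data := [set B | exists2 t, P t & B = dscale t A].

Definition additive_set P := [/\ P 0, forall t, P t -> P (- t) & forall s t, P s -> P t -> P (s + t)].

Lemma dscaleNl t A : - dscale t A = dscale (- t) A.
Proof. by rewrite -dscaleN dscaleA mulN1r. Qed.

Lemma dgroup_line P A : additive_set P -> dgroup (line P A).
Proof.
move=> [P0 PN PD]; split.
- by exists 0; rewrite ?dscale0.
- by move=> _ [t ht ->]; exists (- t); [exact: PN|exact: dscaleNl].
- by move=> _ _ [s hs ->] [t ht ->]; exists (s + t); [exact: PD|exact: dcirc_dscale].
Qed.

Lemma Hconv_dscaleD s t A : Hconv (dscale s A) -> Hconv (dscale t A) -> Hconv (dscale (s + t) A).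
Proof. by have [_ _ h] := dgroup_Hconv R; rewrite -dcirc_dscale; exact: h. Qed.

Lemma additive_Hconv A : additive_set [set t | Hconv (dscale t A)].
Proof.
have [H0 HN _] := dgroup_Hconv R; split.
- by rewrite /mkset dscale0.
- by move=> t /HN; rewrite dscaleNl.
- by move=> s t; exact: Hconv_dscaleD.
Qed.

Lemma Hconv_inftyE t A : Hconv_infty (dscale t A) = Hconv (dscale t (twist A)).
Proof. by rewrite /Hconv_infty /mkset twist_dscale. Qed.

Lemma line_twist P A : line P A = [set B | line P (twist A) (twist B)].
Proof.
apply/seteqP; split=> [_ [t ht ->]|B [t ht e]]; first by exists t; rewrite ?twist_dscale.
by exists t => //; apply: (can_inj (@twistK R)); rewrite twist_dscale.
Qed.

(** Multiples of one A add under [circ] and under [circoo] alike, so a line of multiples is a group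
    as soon as its set of scalars is additive. Hence the scalars with t A in [Hconv] also give a
    group at infinity, although [Hconv] itself is not closed under [circoo]. *)
Lemma sums_of_lines :
  (forall (A : data) (t1 t2 : L0),
      Hconv (dscale t1 A) -> Hconv (dscale t2 A) ->
      [/\ Hconv (dscale (t1 + t2) A),
          sew (0, (uone, dscale t1 A)) (0, (uone, dscale t2 A)) (0, (uone, dscale (t1 + t2) A))
        & sew (dscale t1 A, (uone, 0)) (dscale t2 A, (uone, 0)) (dscale (t1 + t2) A, (uone, 0))])
   /\
   (forall (A : data) (t1 t2 : L0),
      Hconv_infty (dscale t1 A) -> Hconv_infty (dscale t2 A) -> Hconv_infty (dscale (t1 + t2) A))
   /\
   (forall A : data, Hconv A ->
      subgroup_on (at_zero (with_one (line [set t | Hconv (dscale t A)] A)))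
        (at_zero [set al | Hconv al.2]) (@sew R) /\
      subgroup_on (at_infty (line [set t | Hconv (dscale t A)] A)) (at_infty setT) (@sew R))
   /\
   (forall A : data, Hconv_infty A ->
      subgroup_on (at_infty (line [set t | Hconv_infty (dscale t A)] A))
        (at_infty (@Hconv_infty R)) (@sew R)).
Proof.
split; [|split; [|split]].
- move=> A t1 t2 h1 h2; split; first exact: Hconv_dscaleD.
    by apply/sew_at_zero; rewrite circ_data dcirc_dscale.
  by apply/sew_at_infty; rewrite circoo_dscale addrC.
- by move=> A t1 t2; rewrite !Hconv_inftyE; exact: Hconv_dscaleD.
- move=> A hA; have aH := additive_Hconv A; split.
    apply: subgroup_at_zero; split; [exact: group_Hconv| |exact/group_with_one/dgroup_line].
    by move=> [u B] [/= _ [t ht ->]].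
  apply: subgroup_at_infty; rewrite line_twist.
  exact: (subgroup_circoo (dgroup_line (twist A) aH) (@dgroupT R)).
- move=> A hA; have eH : [set t | Hconv_infty (dscale t A)] = [set t | Hconv (dscale t (twist A))].
    by apply/funext => t; exact: Hconv_inftyE.
  rewrite eH; apply: subgroup_at_infty; rewrite line_twist.
  apply: (subgroup_circoo (dgroup_line (twist A) (additive_Hconv (twist A))) (dgroup_Hconv R)).
  by move=> _ [t ht ->].
Qed.

End Lines.

Theorem proposition9p1 (R : realType) :
  (* (1) *)
  ((exists phi : SK1 R -> pdata R,
     [/\ group_on (at_zero setT) (@sew R),
         group_on setT (graph2 (@circ R)),
         iso_on (at_zero setT) (@sew R) setT (graph2 (@circ R)) phi,
         subgroup_on (at_zero (with_one setT)) (at_zero setT) (@sew R) /\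
         subgroup_on (with_one setT) setT (graph2 (@circ R)) /\
         iso_on (at_zero (with_one setT)) (@sew R)
           (with_one setT) (graph2 (@circ R)) phi
       & forall b, b \in families ->
         [/\ subgroup_on (with_one (@vanishing_family R b)) (with_one setT) (graph2 (@circ R)),
             subgroup_on (at_zero (with_one (@vanishing_family R b)))
               (at_zero (with_one setT)) (@sew R)
           & phi @` at_zero (with_one (@vanishing_family R b)) = with_one (@vanishing_family R b)]])
   /\
   (exists psi : SK1 R -> data R,
     [/\ group_on (at_infty setT) (@sew R),
         group_on setT (graph2 (@circoo R)),
         iso_on (at_infty setT) (@sew R) setT (graph2 (@circoo R)) psi
       & forall b, b \in families ->
         [/\ subgroup_on (@vanishing_family R b) setT (graph2 (@circoo R)),
             subgroup_on (at_infty (@vanishing_family R b)) (at_infty setT) (@sew R)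
           & psi @` at_infty (@vanishing_family R b) = @vanishing_family R b]]))
  /\
  (* (2) *)
  [/\ subgroup_on (at_zero [set al | @Hconv R al.2]) (at_zero setT) (@sew R),
      isomorphic_on (at_zero [set al | @Hconv R al.2]) (@sew R)
        (@germs0 R) (@germs0_mul R),
      subgroup_on (at_infty (@Hconv_infty R)) (at_infty setT) (@sew R)
    & isomorphic_on (at_infty (@Hconv_infty R)) (@sew R)
        (@germsoo R) (@germsoo_mul R)]
  /\
  (* (3) *)
  (forall (A : data R) (ap am lp lm : Lam0 R),
     body ap != 0 -> body am != 0 -> expL lp = ap -> expL lm = am ->
     [/\ hom_from_additive (fun t : Lam0 R => (0, (uclass (expL (t * lp)) 1, 0)))
           (at_zero setT) (@sew R),
         hom_from_additive (fun t : Lam0 R => (0, (uclass 1 (expL (t * lm)), 0)))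
           (at_zero setT) (@sew R),
         hom_from_additive (fun t : Lam0 R => (0, (uone R, dscale t A)))
           (at_zero setT) (@sew R)
       & hom_from_additive (fun t : Lam0 R => (dscale t A, (uone R, 0)))
           (at_infty setT) (@sew R)])
  /\
  (* (4) *)
  ((forall (A : data R) (t1 t2 : Lam0 R),
      Hconv (dscale t1 A) -> Hconv (dscale t2 A) ->
      [/\ Hconv (dscale (t1 + t2) A),
          sew (0, (uone R, dscale t1 A)) (0, (uone R, dscale t2 A))
              (0, (uone R, dscale (t1 + t2) A))
        & sew (dscale t1 A, (uone R, 0)) (dscale t2 A, (uone R, 0))
              (dscale (t1 + t2) A, (uone R, 0))])
   /\
   (forall (A : data R) (t1 t2 : Lam0 R),
      Hconv_infty (dscale t1 A) -> Hconv_infty (dscale t2 A) ->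
      Hconv_infty (dscale (t1 + t2) A))
   /\
   (forall A : data R, Hconv A ->
      subgroup_on
        (at_zero (with_one [set B | exists2 t, Hconv (dscale t A) & B = dscale t A]))
        (at_zero [set al | Hconv al.2]) (@sew R) /\
      subgroup_on
        (at_infty [set B | exists2 t, Hconv (dscale t A) & B = dscale t A])
        (at_infty setT) (@sew R))
   /\
   (forall A : data R, Hconv_infty A ->
      subgroup_on
        (at_infty [set B | exists2 t, Hconv_infty (dscale t A) & B = dscale t A])
        (at_infty (@Hconv_infty R)) (@sew R))).
Proof.
split; first by split; [exact: groups_at_zero|exact: groups_at_infty].
split.
  split; last exact: isomorphic_germsoo.
  - apply: subgroup_at_zero; split; [exact: group_circ|by []|exact: group_Hconv].
  - exact: isomorphic_germs0.
  - apply: subgroup_at_infty; exact: (subgroup_circoo (dgroup_Hconv R) (@dgroupT R)).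
split; last exact: sums_of_lines.
by move=> A ap am lp lm _ _ _ _; exact: homs_from_additive.
Qed.
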